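(* Let $\epsilon>0$ be a fixed constant and let $g=g(n)$. Then the random graphs $G(n)$ and $S_g(n)$ are contiguous if $g(n)\ge(1+\epsilon)\frac{n^2}{24}$, and are not contiguous if $g(n)\le(1-\epsilon)\frac{n^2}{24}$.
   Context: $G(n)$ denotes a graph chosen uniformly at random from all labelled graphs on $[n]$ (equivalently, each edge present independently with probability $1/2$). $S_g(n)$ denotes a graph chosen uniformly at random from all labelled graphs on $[n]$ with genus at most $g=g(n)$, where the genus of a graph is the minimum number of handles attached to a sphere needed to embed it without crossings. Two random graph models $A(n)$ and $B(n)$ are called contiguous if, for every property $P(n)$, $A(n)$ has $P(n)$ with high probability if and only if $B(n)$ has $P(n)$ with high probability; ''with high probability'' means with probability tending to $1$ as $n\to\infty$. *)

(* Defs.v *)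
From HB Require Import structures.
From mathcomp Require Import all_boot all_order all_algebra.
From mathcomp Require Import all_classical all_reals all_analysis.

Set Implicit Arguments.
Unset Strict Implicit.
Unset Printing Implicit Defensive.

Import Order.TTheory GRing.Theory Num.Theory.
Import numFieldNormedType.Exports.

Local Open Scope classical_set_scope.
Local Open Scope ring_scope.

(* Labelled simple graphs; the vertex set [n] is 'I_n. *)
Definition sgraph (n : nat) : finType :=
  {E : {set {set 'I_n}} | [forall e in E, #|e| == 2%N]}.

Definition edges (n : nat) (G : sgraph n) : {set {set 'I_n}} := val G.

Definition frontier (T : topologicalType) (A : set T) : set T :=
  closure A `\` interior A.

(* The solid 1-handle number i (out of h) glued to the ball below: an arch in
   the slab 0 <= y <= 1 made of two vertical legs, over 4i <= x <= 4i + 1 and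
   4i + 2 <= x <= 4i + 3, joined by a bridge at height 4h + 2 <= z <= 4h + 3.
   Both legs start inside the ball, leave it once, through its upper
   hemisphere, and the bridge lies entirely above the ball. *)
Definition solid_handle (R : realType) (h i : nat) : set (R * R * R) :=
  [set p | let: (x, y, z) := p in
    [/\ (4 * i)%:R <= x <= (4 * i + 3)%:R,
        0 <= y <= 1,
        0 <= z <= (4 * h + 3)%:R &
        [\/ x <= (4 * i + 1)%:R, (4 * i + 2)%:R <= x | (4 * h + 2)%:R <= z]]].

Definition solid_ball (R : realType) (h : nat) : set (R * R * R) :=
  [set p | let: (x, y, z) := p in
    x ^+ 2 + y ^+ 2 + z ^+ 2 <= (4 * h + 1)%:R ^+ 2].

(* The sphere with h handles, as a subspace of R^3: the frontier of a round
   ball with h pairwise disjoint solid handles.  Adding a solid handle cuts two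
   disjoint discs out of the sphere and puts a tube between the two resulting
   circles; since the surface bounds a solid in R^3 it is orientable.  For
   h = 0 it is the unit sphere. *)
Definition sphere_with_handles (R : realType) (h : nat) : set (R * R * R) :=
  frontier (solid_ball h `|` \bigcup_(i in `I_h) @solid_handle R h i).

(* G can be drawn on S without crossings: distinct vertices are distinct points
   of S, each edge is a simple arc in S between its two ends that avoids all
   vertices in its interior, and the interiors of distinct edges are
   disjoint. *)
Definition embeds_in (R : realType) (T : topologicalType) (S : set T)
    (n : nat) (G : sgraph n) : Prop :=
  exists (v : 'I_n -> T) (c : {set 'I_n} -> R -> T),
    [/\ injective v,
        forall i, S (v i),
        forall e, e \in edges G ->
          [/\ {within `[0, 1], continuous (c e)},
              {in `[0, 1] &, injective (c e)},
              c e @` `[0, 1] `<=` S,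
              [set c e 0; c e 1] = v @` [set i | i \in e] &
              forall (t : R) i, t \in `]0, 1[ -> c e t <> v i] &
        forall e f, e \in edges G -> f \in edges G -> e <> f ->
          forall s t : R, s \in `]0, 1[ -> t \in `]0, 1[ -> c e s <> c f t].

Definition is_genus (R : realType) (n : nat) (G : sgraph n) (k : nat) : Prop :=
  embeds_in R (@sphere_with_handles R k) G /\
  forall h, embeds_in R (@sphere_with_handles R h) G -> (k <= h)%N.

Definition genus_at_most (R : realType) (n : nat) (G : sgraph n) (m : nat) :
  Prop := exists2 k, is_genus R G k & (k <= m)%N.

Definition random_graph (R : realType) := forall n, {ffun sgraph n -> R}.

Definition uniform_on (R : realType) (C : forall n, {set sgraph n}) :
    random_graph R :=
  fun n => [ffun G => (G \in C n)%:R / #|C n|%:R].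

Definition prob (R : realType) (n : nat) (mu : {ffun sgraph n -> R})
  (P : {set sgraph n}) : R := \sum_(G in P) mu G.

Definition whp (R : realType) (A : random_graph R)
    (P : forall n, {set sgraph n}) : Prop :=
  (fun n => prob (A n) (P n)) @ \oo --> (1 : R).

Definition contiguous (R : realType) (A B : random_graph R) : Prop :=
  forall P : forall n, {set sgraph n}, whp A P <-> whp B P.

(* G(n) *)
Definition Grand (R : realType) : random_graph R :=
  uniform_on R (fun n => [set: sgraph n]%SET).

(* S_g(n) *)
Definition Srand (R : realType) (g : nat -> nat) : random_graph R :=
  uniform_on R (fun n => [set G : sgraph n | `[< genus_at_most R G (g n) >]]%SET).

(* Main.v *)
Require Import Defs.
From HB Require Import structures.
From mathcomp Require Import all_boot all_order all_algebra.
From mathcomp Require Import all_classical all_reals all_analysis.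
From mathcomp Require Import ring lra zify.

(** A graph with [e] edges that embeds in the sphere with [h] handles has
    [e <= 3 n + 6 h], and at least half of all graphs have at least
    [n (n - 1) / 4] edges; this gives the second half.  The edge bound is proved
    without surface classification: the surface is covered by small closed
    pieces whose incidences are those of a plane grid with [2 h] holes glued in
    pairs, so the drawing exhibits the graph as a minor of a graph carrying a
    complex with at most [2 ^ (2 h)] classes of cycles modulo boundaries, and a
    count of chains over the field with two elements replaces Euler's formula.

    For the first half, write the darts (half edges) in one word, grouped by
    vertex.  One handle reverses three consecutive blocks of the word, and this
    can be made to lower the rank of the interlace matrix over the field with
    two elements by two; when no two edges cross in the word, the drawing can be
    completed.  So half the rank of the interlace matrix bounds the genus.  A
    copy of the complete tripartite graph on three sets of size [m] can be given
    rotations with almost [2 m ^ 2] triangular faces, each an element of the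
    kernel, so its [3 m ^ 2] edges contribute only [m ^ 2 + O(m)] to the rank.
    Finally almost all edges of a random graph are covered by edge-disjoint such
    copies: in one round of an algebraic design a fixed edge survives
    with probability [p - p ^ (3 m ^ 2)] if it survived the earlier rounds with
    probability [p], and this iteration tends to [0].  With about [n ^ 2 / 4]
    edges the genus is then at most [(1 + o(1)) n ^ 2 / 24]. *)

Set Implicit Arguments.
Unset Strict Implicit.
Unset Printing Implicit Defensive.

Import Order.TTheory GRing.Theory Num.Theory.
Import numFieldNormedType.Exports.

(** Both halves reduce to one question: does [G(n)] have genus at most [g(n)] with high probability?
    If so, conditioning on that event moves no probability by more than the probability of its
    failure; conversely the event is certain for [S_g(n)], so contiguity would carry it over to
    [G(n)]. The constant [1 / 24] is common to both halves: a typical graph has about [n ^ 2 / 4]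
    edges, a handle pays for at most six of them, and nearly triangulated drawings attain this.

    The obstacle is that genus is defined by continuous arcs on a concrete subset of [R ^ 3]. In the
    edge bound a drawing is seen only through positive distances between disjoint compact pieces,
    which a fine enough grid respects, so no Jordan curve theorem enters. In the other half every
    arc is explicit: polygonal lines lifted to the upper hemisphere and generators of tubes, swept
    from left to right past one handle after another. The packing is followed through expectations
    alone: the algebraic design makes the needed events exactly independent, and Markov's inequality
    replaces any concentration argument. *)

Module Chains.
Local Open Scope ring_scope.

Lemma bool_addxx (b : bool) : b + b = 0 :> bool.
Proof. by case: b. Qed.

(** The witness is a point whose fibre is largest. Passing to a large fibre stands in for the rank
    of a linear map: each use costs the factor [#|K|], that is, a known number of bits. *)
Lemma pigeonhole_fiber (T K : finType) (f : T -> K) (A : {set T}) x0 :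
  x0 \in A -> exists2 x, x \in A & (#|A| <= #|K| * #|[set y in A | f y == f x]|)%N.
Proof.
move=> x0A; pose x := [arg max_(x > x0 | x \in A) #|[set y in A | f y == f x]|].
have [xA xmax] : x \in A /\ forall y, y \in A ->
    (#|[set z in A | f z == f y]| <= #|[set z in A | f z == f x]|)%N.
  by rewrite /x; case: arg_maxnP => // i iA imax; split => // y /imax.
exists x => //.
have -> : #|A| = (\sum_(k : K) #|[set y in A | f y == k]|)%N.
  rewrite -sum1_card (partition_big f predT) //=; apply: eq_bigr => k _.
  by rewrite -sum1_card; apply: eq_bigl => y; rewrite inE.
rewrite -sum_nat_const; apply: leq_sum => k _.
have [->|[y]] := set_0Vmem [set y in A | f y == k]; first by rewrite cards0.
by rewrite inE => /andP[yA /eqP <-]; exact: xmax.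
Qed.

(** * Chains and boundaries modulo two on a finite graph *)

Section Chains.
Variables (N L : finType) (s t : L -> N).

(** Addition on [bool] is exclusive or, so a link with equal ends has no boundary. *)
Definition inc (l : L) (n : N) : bool := (s l == n) + (t l == n).
Definition bnd (d : {ffun L -> bool}) (n : N) : bool := \sum_l d l * inc l n.

Lemma bndD d d' n : bnd (d + d') n = bnd d n + bnd d' n.
Proof.
by rewrite /bnd -big_split /=; apply: eq_bigr => l _; rewrite ffunE mulrDl.
Qed.

Lemma bnd0 n : bnd 0 n = 0.
Proof. by rewrite /bnd big1 // => l _; rewrite ffunE mul0r. Qed.

Lemma bnd_sum (I : finType) (P : pred I) (F : I -> {ffun L -> bool}) n :
  bnd (\sum_(i | P i) F i) n = \sum_(i | P i) bnd (F i) n.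
Proof. by elim/big_rec2: _ => [|i y x _ <-]; [exact: bnd0 | exact: bndD]. Qed.

Definition link1 (l : L) : {ffun L -> bool} := [ffun l' => l' == l].

Lemma bnd_link1 l n : bnd (link1 l) n = inc l n.
Proof.
rewrite /bnd (bigD1 l) //= ffunE eqxx mul1r big1 ?addr0 // => l' l'l.
by rewrite ffunE (negPf l'l) mul0r.
Qed.

Definition linked (Y : pred L) : rel N :=
  fun u v => [exists l, Y l && (((s l == u) && (t l == v)) || ((s l == v) && (t l == u)))].

(** The links of a path are summed modulo two: a link used twice cancels, and so do the inner nodes
    in the boundary. *)
Lemma path_chain (Y : pred L) u v : connect (linked Y) u v ->
  exists d : {ffun L -> bool}, (forall l, d l -> Y l) /\
    forall n, bnd d n = (u == n) + (v == n).
Proof.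
case/connectP => p; elim: p u => [|w p IHp] u /=.
  move=> _ ->; exists 0; split=> [l|n]; first by rewrite ffunE.
  by rewrite bnd0 bool_addxx.
case/andP => /existsP[l /andP[Yl uw]] /IHp IH /IH[d [dY dB]].
exists (link1 l + d); split=> [l'|n].
  rewrite !ffunE; have [-> _ //|_ /=] := eqVneq l' l.
  by rewrite add0r; exact: dY.
rewrite bndD dB bnd_link1 /inc.
case/orP: uw => /andP[/eqP-> /eqP->].
  by rewrite addrA -(addrA (u == n)) bool_addxx addr0.
by rewrite addrA (addrC (w == n)) -(addrA (u == n)) bool_addxx addr0.
Qed.

(* A 0-chain which is even on every connected class is a boundary: join the
   points of each class to a base point of that class. *)
Lemma even_chain (Y : pred L) (J : finType) (cl : N -> option J) (b : N -> bool) :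
  (forall u v, cl u = cl v -> cl u != None -> connect (linked Y) u v) ->
  (forall u, cl u = None -> b u = false) ->
  (forall j, \sum_(u | cl u == Some j) b u = 0) ->
  exists d : {ffun L -> bool}, (forall l, d l -> Y l) /\ forall n, bnd d n = b n.
Proof.
move=> con bN bE.
pose bs (j : option J) : option N := [pick u | cl u == j].
have pathc (u : N) : exists d : {ffun L -> bool}, (forall l, d l -> Y l) /\
    (b u -> forall n, bnd d n = (odflt u (bs (cl u)) == n) + (u == n)).
  case bu: (b u); last by exists 0; split=> // l; rewrite ffunE.
  have clu : cl u != None by apply/eqP => /bN; rewrite bu.
  rewrite /bs; case: pickP => [v /eqP vu|/(_ u)]; last by rewrite eqxx.
  have /path_chain[d [dY dB]] : connect (linked Y) v u by apply: con; rewrite ?vu.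
  by exists d.
have /fin_all_exists[d dP] := pathc.
exists (\sum_(u | b u) d u); split=> [l|n].
  rewrite /comp sum_ffunE => h; apply/negPn/negP => Yl; move: h.
  rewrite big1 // => u _; apply/negbTE/negP => /(proj1 (dP u)).
  by rewrite (negPf Yl).
rewrite bnd_sum.
transitivity (\sum_(u | b u) ((odflt u (bs (cl u)) == n) + (u == n))).
  by apply: eq_bigr => u bu; rewrite (proj2 (dP u)).
rewrite big_split /= addrC.
have -> : \sum_(u | b u) (u == n) = b n :> bool.
  have [bn|bn] := boolP (b n).
    rewrite (bigD1 n) //= eqxx big1 ?addr0 // => u /andP[_ /negPf->//].
  by rewrite big1 ?(negPf bn) // => u bu; case: eqVneq => // un; rewrite -un bu in bn.
rewrite -[RHS]addr0; congr (_ + _).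
rewrite (partition_big cl predT) //= big1 // => -[j|] _; last first.
  by rewrite big1 // => u /andP[bu /eqP /bN]; rewrite bu.
transitivity (\sum_(u | b u && (cl u == Some j)) (bs (Some j) == Some n)).
  apply: eq_bigr => u /andP[bu /eqP clu]; rewrite clu.
  rewrite /bs; case: pickP => [v _|/(_ u)]; first by [].
  by rewrite clu eqxx.
have := bE j; rewrite (bigID b) /= [X in _ + X]big1 ?addr0; last first.
  by move=> u /andP[_ /negPf].
move=> h; have [_|_] := eqVneq (bs (Some j)) (Some n); last by rewrite big1.
by rewrite -[RHS]h; apply: eq_big => [u|u /andP[-> _]//]; rewrite andbC.
Qed.

End Chains.

(** * Edge bound for a minor of a graph that carries a two-dimensional complex *)

Section MinorBound.
Variables (N L F : finType) (s t : L -> N) (bd : F -> {ffun L -> bool}).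
Variables (K : finType) (cls : {ffun L -> bool} -> K) (ok : pred L).
Variables (n : nat) (E : {set {set 'I_n}}) (br : N -> option 'I_n)
  (lk : {set 'I_n} -> L).

(** The abstract surface: no link borders more than two faces, and the cycles on admissible links
    fall into [#|K|] classes, two cycles of one class differing by a boundary. The graph [E] is a
    minor: [br] sends nodes to branch sets and [lk] picks the link that represents an edge. *)
Hypothesis bd_le2 : forall l, (#|[set f | bd f l]| <= 2)%N.
Hypothesis bd_cycle : forall f u, bnd s t (bd f) u = 0.
Hypothesis cls_bd : forall z1 z2 : {ffun L -> bool},
  (forall l, z1 l -> ok l) -> (forall l, z2 l -> ok l) ->
  (forall u, bnd s t z1 u = 0) -> (forall u, bnd s t z2 u = 0) ->
  cls z1 = cls z2 -> exists A : {ffun F -> bool}, z1 + z2 = \sum_(f | A f) bd f.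
Hypothesis E2 : forall e, e \in E -> #|e| = 2.
Hypothesis br_conn : forall u v i, br u = Some i -> br v = Some i ->
  connect (linked s t (fun l => [&& ok l, br (s l) == Some i & br (t l) == Some i])) u v.
Hypothesis lk_ok : forall e, e \in E -> ok (lk e).
Hypothesis lkP : forall e, e \in E -> exists i j,
  [/\ br (s (lk e)) = Some i, br (t (lk e)) = Some j & e = [set i; j]].

Let inner (l : L) := [&& ok l, br (s l) != None & br (s l) == br (t l)].

Lemma lk_inj : {in E &, injective lk}.
Proof.
move=> e e' eE e'E ee'; have [i [j [si tj ->]]] := lkP eE.
have [i' [j' [si' tj' ->]]] := lkP e'E.
by move: si tj; rewrite ee' si' tj' => -[->] [->].
Qed.

Lemma lk_not_inner e : e \in E -> ~~ inner (lk e).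
Proof.
move=> eE; have [i [j [si tj eij]]] := lkP eE.
rewrite /inner si tj lk_ok //=; apply/negP => /eqP[ij].
by have := E2 eE; rewrite eij ij finset.setUid cards1.
Qed.

(** The links of the minor model, which play the part of the drawn graph: those inside one branch
    set and those that represent edges. *)
Let X (l : L) := inner l || [exists e in E, l == lk e].

Lemma X_ok l : X l -> ok l.
Proof. by case/orP => [/and3P[]//|/exists_inP[e eE /eqP->]]; exact: lk_ok. Qed.

Lemma inc_lk e i : e \in E ->
  \sum_(u | br u == Some i) inc s t (lk e) u = (i \in e) :> bool.
Proof.
move=> eE; have [a [b [sa tb eab]]] := lkP eE.
have ab : a != b.
  by apply/eqP => ab; have := E2 eE; rewrite eab ab finset.setUid cards1.
have pt (x : N) : \sum_(u | br u == Some i) (x == u) = (br x == Some i) :> bool.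
  have [bx|bx] := boolP (br x == Some i).
    by rewrite (bigD1 x) //= eqxx big1 ?addr0 // => u /andP[_]; rewrite eq_sym => /negPf.
  by rewrite big1 // => u bu; case: eqVneq => // xu; rewrite xu bu in bx.
rewrite /inc big_split /= !pt sa tb eab !inE !(inj_eq Some_inj) (eq_sym i a) (eq_sym i b).
have [ia|ia] := eqVneq a i; have [ib|ib] := eqVneq b i => //.
by rewrite ib ia eqxx in ab.
Qed.

Lemma inc_inner l i : inner l ->
  \sum_(u | br u == Some i) inc s t l u = 0 :> bool.
Proof.
move=> /and3P[_ sN /eqP st].
have pt (x : N) : \sum_(u | br u == Some i) (x == u) = (br x == Some i) :> bool.
  have [bx|bx] := boolP (br x == Some i).
    by rewrite (bigD1 x) //= eqxx big1 ?addr0 // => u /andP[_]; rewrite eq_sym => /negPf.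
  by rewrite big1 // => u bu; case: eqVneq => // xu; rewrite xu bu in bx.
by rewrite /inc big_split /= !pt st bool_addxx.
Qed.

(** Summing a boundary over a branch set contracts the set: an inner link meets it twice or not at
    all and cancels, and only links that represent edges are left. *)
Lemma bnd_branch (c : {ffun L -> bool}) i : (forall l, c l -> X l) ->
  \sum_(u | br u == Some i) bnd s t c u =
  \sum_(e in E | c (lk e)) (i \in e) :> bool.
Proof.
move=> cX; rewrite /bnd exchange_big /=.
transitivity (\sum_(l | c l) \sum_(u | br u == Some i) inc s t l u).
  rewrite (bigID (fun l => c l)) /= [X in _ + X]big1 ?addr0; last first.
    by move=> l /negPf cl; rewrite big1 // => u _; rewrite cl mul0r.
  by apply: eq_bigr => l cl; apply: eq_bigr => u _; rewrite cl mul1r.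
rewrite (bigID inner) /= big1 ?add0r; last by move=> l /andP[_ /inc_inner].
rewrite -[RHS]big_filter_cond.
transitivity (\sum_(l in [set lk e | e in E & c (lk e)])
   \sum_(u | br u == Some i) inc s t l u).
  apply: eq_bigl => l; apply/andP/imsetP => [[cl il]|[e]].
    have := cX l cl; rewrite /X (negPf il) /= => /exists_inP[e eE /eqP le].
    by exists e => //; rewrite inE eE -le.
  by rewrite inE => /andP[eE ce] ->; split=> //; exact: lk_not_inner.
rewrite big_imset /=; last first.
  by move=> e e'; rewrite !inE => /andP[eE _] /andP[e'E _]; exact: lk_inj.
rewrite big_filter_cond; apply: eq_big => [e|e]; first by rewrite inE.
by rewrite inE => /andP[eE _]; exact: inc_lk.
Qed.

Definition gcycle (Z : {set {set 'I_n}}) :=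
  (Z \subset E) /\ forall i, \sum_(e in Z) (i \in e) = 0 :> bool.

(** The links of the edges of [Z] have a boundary that is even on every branch set, because [Z] has
    even degrees; as branch sets are connected, [even_chain] cancels it by inner links. *)
Lemma lift_cycle Z : gcycle Z -> exists z : {ffun L -> bool},
  [/\ forall l, z l -> X l, forall u, bnd s t z u = 0 &
      forall e, e \in E -> z (lk e) = (e \in Z)].
Proof.
move=> [ZE Zc].
pose c : {ffun L -> bool} := [ffun l => [exists e in Z, l == lk e]].
have cX l : c l -> X l.
  rewrite ffunE /X => /exists_inP[e eZ /eqP->]; apply/orP; right.
  by apply/exists_inP; exists e => //; exact: (fintype.subsetP ZE).
have clk e : e \in E -> c (lk e) = (e \in Z).
  move=> eE; rewrite ffunE; apply/exists_inP/idP => [[e' e'Z /eqP]|eZ].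
    by move/(lk_inj eE (fintype.subsetP ZE _ e'Z)) => ->.
  by exists e.
have [//|||d [dI dB]] := @even_chain N L s t inner 'I_n br (bnd s t c).
- move=> u v; case bu: (br u) => [i|] // /esym bv _.
  have := br_conn bu bv; apply: connect_sub => x y /existsP[l /andP[/and3P[okl /eqP sl /eqP tl] h]].
  by apply: connect1; apply/existsP; exists l; rewrite h andbT /inner sl tl okl eqxx.
- move=> u bu; rewrite /bnd big1 // => l _; case cl: (c l); last by rewrite mul0r.
  rewrite mul1r /inc; have := cX _ cl; rewrite /X => /orP[/and3P[_ sN /eqP st]|].
    case: eqVneq => [su|_]; first by rewrite su bu in sN.
    by case: eqVneq => [tu|//]; rewrite st tu bu in sN.
  case/exists_inP => e /lkP[i [j [si tj _]]] /eqP le; rewrite le.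
  case: eqVneq => [su|_]; first by rewrite su bu in si.
  by case: eqVneq => [tu|//]; rewrite tu bu in tj.
- move=> j; rewrite bnd_branch // -[RHS](Zc j); apply: eq_bigl => e.
  have [eE|eE] := boolP (e \in E); first by rewrite clk.
  by apply/esym/negbTE; apply: contra eE => /(fintype.subsetP ZE).
exists (c + d); split.
- move=> l; rewrite ffunE; have [/cX//|_] := boolP (c l).
  by rewrite add0r => /dI il; rewrite /X il.
- by move=> u; rewrite bndD dB bool_addxx.
- move=> e eE; rewrite ffunE clk //.
  by have := lk_not_inner eE; case dl: (d (lk e)); [rewrite dI | rewrite addr0].
Qed.

(** The graph is simple: a second edge is needed at each end of [e], and the two are distinct since
    an edge through both ends would be [e] itself. *)
Lemma gcycle_card Z : gcycle Z -> Z != finset.set0 -> (3 <= #|Z|)%N.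
Proof.
move=> [ZE Zc] /set0Pn[e eZ].
have other i : i \in e -> exists2 e', (e' \in Z) && (e' != e) & i \in e'.
  move=> ie; have := Zc i; rewrite (bigD1 e) //= ie => h.
  case: (pickP (fun e' => (e' \in Z) && (e' != e) && (i \in e'))) => [e' /andP[h1 h2]|no].
    by exists e'.
  move: h; rewrite big1 // => e' h'.
  by have := no e'; rewrite h'.
have /eqP/cards2P[a [b [ab eab]]] := E2 (fintype.subsetP ZE _ eZ).
have [|e1 /andP[e1Z e1e] ae1] := other a; first by rewrite eab !inE eqxx.
have [|e2 /andP[e2Z e2e] be2] := other b; first by rewrite eab !inE eqxx orbT.
have e12 : e1 != e2.
  apply: contra e1e => /eqP e12; rewrite -e12 in be2.
  rewrite eq_sym eqEcard (E2 (fintype.subsetP ZE _ eZ)) (E2 (fintype.subsetP ZE _ e1Z)) leqnn andbT.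
  by rewrite eab; apply/fintype.subsetP => x; rewrite !inE => /orP[/eqP->|/eqP->].
have /card_uniqP e3 : uniq [:: e; e1; e2].
  by rewrite /= !inE !negb_or eq_sym e1e eq_sym e2e e12.
have : (#|[:: e; e1; e2]| <= #|Z|)%N; last by rewrite e3.
apply: subset_leq_card; apply/fintype.subsetP => x; rewrite !inE.
by case/or3P => /eqP->.
Qed.

(** Faces are merged across links outside [X]. The classes, represented by their roots, are the
    regions into which the drawing cuts the surface. *)
Let adj (f g : F) := [exists l, [&& ~~ X l, bd f l & bd g l]].

Let rt := fingraph.root adj.

Lemma adj_sym : connect_sym adj.
Proof.
apply: sym_connect_sym => f g; apply/existsP/existsP => -[l /and3P[a b c]];
  by exists l; apply/and3P.
Qed.

Let comp (r : F) : {ffun L -> bool} := \sum_(f | rt f == r) bd f.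

Let trace (r : F) : {set {set 'I_n}} := [set e in E | comp r (lk e)].

(** Regions whose boundary belongs to the drawing and contains an edge of the graph; only these
    contribute to cycles of the graph. *)
Let live : {set F} := [set r | [forall l, comp r l ==> X l] && (trace r != finset.set0)].

Lemma trace_cycle r : r \in live -> gcycle (trace r).
Proof.
rewrite inE => /andP[/forallP cX _]; split=> [|i].
  by apply/fintype.subsetP => e; rewrite inE => /andP[].
have cX' l : comp r l -> X l by move=> h; exact: (implyP (cX l)).
transitivity (\sum_(u | br u == Some i) bnd s t (comp r) u).
  by rewrite bnd_branch //; apply: eq_bigl => e; rewrite inE.
by rewrite big1 // => u _; rewrite /comp bnd_sum big1.
Qed.

Lemma comp_odd r l : comp r l -> exists2 f, rt f == r & bd f l.
Proof.
rewrite /comp sum_ffunE => h; apply/exists_inP; apply: contraT => /exists_inPn no.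
by move: h; rewrite big1 // => f /no /negbTE.
Qed.

(** Double counting: a live region has at least three edges on its boundary, and an edge borders at
    most two regions. *)
Lemma live_card : (3 * #|live| <= 2 * #|E|)%N.
Proof.
have h1 : (\sum_(r in live) 3 <= \sum_(r in live) #|trace r|)%N.
  apply: leq_sum => r rl; apply: gcycle_card; first exact: trace_cycle.
  by move: rl; rewrite inE => /andP[].
rewrite mulnC -sum_nat_const; apply: leq_trans h1 _; rewrite mulnC -sum_nat_const.
have -> : (\sum_(r in live) #|trace r| =
    \sum_(e in E) \sum_(r in live | comp r (lk e)) 1)%N.
  under eq_bigr => r _ do rewrite -sum1_card.
  rewrite (exchange_big_dep (mem E)) /= => [|r e _]; last by rewrite inE => /andP[].
  by apply: eq_bigr => e eE; apply: eq_bigl => r; rewrite [e \in trace r]inE eE.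
apply: leq_sum => e eE; rewrite sum1_card.
apply: leq_trans (bd_le2 (lk e)).
apply: leq_trans (leq_imset_card rt _); apply: subset_leq_card.
apply/fintype.subsetP => r; rewrite unfold_in => /andP[_ /comp_odd[f /eqP <- bf]].
by apply/imsetP; exists f; rewrite ?inE.
Qed.

(** A set of faces whose total boundary stays in [X] cannot separate two faces sharing a link
    outside [X], so it is a union of regions. If one of them had a boundary link outside [X], that
    link would survive in the sum; so the regions with a nonempty trace are live. *)
Lemma boundary_trace (A : {ffun F -> bool}) e :
  (forall l, (\sum_(f | A f) bd f) l -> X l) -> e \in E ->
  (\sum_(f | A f) bd f) (lk e) = \sum_(r in live | A r) (e \in trace r).
Proof.
move=> AX eE.
have Aadj f g : adj f g -> A f = A g.
  case/existsP => l /and3P[Xl fl gl]; apply: contraNeq Xl => Afg; apply: AX.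
  have fg : f != g by apply: contra Afg => /eqP->.
  have sub : [set f | bd f l] = [set f; g].
    apply/esym/eqP; rewrite eqEcard cards2 fg bd_le2 andbT.
    by apply/fintype.subsetP => x; rewrite !inE => /orP[]/eqP->.
  rewrite sum_ffunE (bigID (fun f => bd f l)) /= [X in _ + X]big1 ?addr0; last first.
    by move=> x /andP[_ /negPf].
  transitivity (A f + A g); last by move: Afg; case: (A f); case: (A g).
  rewrite big_mkcondl /=.
  transitivity (\sum_(x in [set f; g]) A x).
    rewrite -sub; apply: eq_big => [x|x bx]; first by rewrite inE.
    by rewrite bx; case: (A x).
  by rewrite big_setU1 ?inE //= big_set1.
have Art f : A f = A (rt f).
  have /connectP[p pth ->] : connect adj f (rt f) by exact: connect_root.
  elim: p f pth => [|g p IHp] f //= /andP[/Aadj -> pg]; exact: IHp.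
have split l : (\sum_(f | A f) bd f) l = \sum_(r | A r) comp r l.
  rewrite sum_ffunE (partition_big rt predT) //= [RHS]big_mkcond /=.
  apply: eq_bigr => r _; rewrite /comp; case Ar: (A r).
    rewrite sum_ffunE; apply: eq_bigl => f.
    by case: eqP => [fr|]; rewrite ?andbF // Art fr Ar.
  rewrite big1 // => f /andP[Af /eqP fr]; by rewrite Art fr Ar in Af.
rewrite split big_mkcond [RHS]big_mkcond /=.
apply: eq_bigr => r _.
have tr : (e \in trace r) = comp r (lk e) by rewrite inE eE.
case Ar: (A r); last by rewrite andbF.
rewrite andbT tr; case: ifP => // /negbT; rewrite inE negb_and.
have [cX /=|] := boolP [forall l, comp r l ==> X l].
  by rewrite negbK => /eqP t0; rewrite -tr t0 inE.
move=> /forallPn[l]; rewrite negb_imply => /andP[cl Xl] _.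
exfalso; move/negP: (Xl); apply; apply: AX; rewrite split.
rewrite (bigD1 r) //= cl big1 // => r' /andP[_ r'r].
apply/negbTE/negP => /comp_odd[f' /eqP f'r f'l].
have [f /eqP fr fl] := comp_odd cl.
have ff' : adj f f' by apply/existsP; exists l; rewrite Xl fl f'l.
by move/negP: r'r; apply; rewrite -fr -f'r; apply/eqP/esym/(fingraph.rootP adj_sym)/connect1.
Qed.

(** Euler's inequality by counting the [2 ^ #|E|] edge sets: fixing the degree parities costs [n]
    bits, fixing the class of the lifted cycle costs [2 * h] bits, and a set of live regions
    determines the rest. Hence [#|E| <= n + 2 * h + #|live|], to be combined with
    [3 * #|live| <= 2 * #|E|]. *)
Theorem minor_edge_bound h : #|K| = (2 ^ (2 * h))%N -> (#|E| <= 3 * n + 6 * h)%N.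
Proof.
move=> cardK.
pose D (Z : {set {set 'I_n}}) : {ffun 'I_n -> bool} :=
  [ffun i => \sum_(e in Z) (i \in e)].
have [|Z0 Z0E card1] := @pigeonhole_fiber _ _ D (powerset E) finset.set0.
  by rewrite inE finset.sub0set.
set S1 := [set y in _ | _] in card1.
have symm (Z Z' : {set {set 'I_n}}) : Z \in S1 -> Z' \in S1 -> gcycle (Z :\: Z' :|: Z' :\: Z).
  rewrite !inE => /andP[ZE /eqP DZ] /andP[Z'E /eqP DZ'].
  split=> [|i].
    rewrite finset.subUset; apply/andP; split; apply: fintype.subset_trans (finset.subsetDl _ _) _ => //.
  have := congr1 (fun d : {ffun _ -> bool} => d i) (etrans DZ (esym DZ')).
  rewrite /D !ffunE (big_setID Z') /= [in RHS](big_setID Z) /= finset.setIC => /addrI h'.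
  have -> : \sum_(e in Z :\: Z' :|: Z' :\: Z) (i \in e) =
    \sum_(e in Z :\: Z') (i \in e) + \sum_(e in Z' :\: Z) (i \in e) :> bool.
    rewrite (bigID (mem Z)) /=; congr (_ + _); apply: eq_bigl => e; rewrite !inE;
    by case: (e \in Z); case: (e \in Z').
  by rewrite h' bool_addxx.
have Z0S1 : Z0 \in S1 by rewrite inE Z0E eqxx.
(* Edge sets with the degree parities of [Z0] form a coset of the cycle space; adding [Z0] turns
   each of them into a cycle, which can be lifted. *)
have ex_lift (Z : {set {set 'I_n}}) : exists z : {ffun L -> bool}, Z \in S1 ->
  [/\ forall l, z l -> X l, forall u, bnd s t z u = 0 &
      forall e, e \in E -> z (lk e) = (e \in Z) + (e \in Z0)].
  case ZS: (Z \in S1); last by exists 0.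
  have [z [zX zc zE]] := lift_cycle (symm _ _ ZS Z0S1); exists z => _; split=> // e eE.
  by rewrite zE // !inE; case: (e \in Z); case: (e \in Z0).
have [lft lftP] := fin_all_exists ex_lift.
have [Z1 Z1S1 card2] := pigeonhole_fiber (fun Z => cls (lft Z)) Z0S1.
set S2 := [set y in _ | _] in card2.
have S2A (Z : {set {set 'I_n}}) : exists A : {set F}, Z \in S2 -> A \subset live /\
    forall e, e \in E -> (e \in Z) = (e \in Z1) + \sum_(r in A) (e \in trace r).
  case ZS: (Z \in S2); last by exists finset.set0.
  move: ZS; rewrite inE => /andP[ZS /eqP eqc].
  have [zX zc zE] := lftP _ ZS; have [z1X z1c z1E] := lftP _ Z1S1.
  have [A AE] : exists A : {ffun F -> bool}, lft Z + lft Z1 = \sum_(f | A f) bd f.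
    by apply: cls_bd => // l; [move/zX | move/z1X]; exact: X_ok.
  exists [set r in live | A r] => _; split=> [|e eE].
    by apply/fintype.subsetP => r; rewrite inE => /andP[].
  have AX l : (\sum_(f | A f) bd f) l -> X l.
    rewrite -AE ffunE; have [/zX//|_] := boolP (lft Z l).
    by rewrite add0r; exact: z1X.
  have := boundary_trace AX eE; rewrite -AE ffunE zE // z1E //.
  have -> : \sum_(r in [set r in live | A r]) (e \in trace r) =
           \sum_(r in live | A r) (e \in trace r) :> bool.
    by apply: eq_bigl => r; rewrite inE.
  by move=> <-; case: (e \in Z); case: (e \in Z0); case: (e \in Z1).
have [AA AAP] := fin_all_exists S2A.
have card3 : (#|S2| <= 2 ^ #|live|)%N.
  rewrite -card_powerset -(card_in_imset (f := AA)).
    apply: subset_leq_card; apply/fintype.subsetP => _ /imsetP[Z ZS ->].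
    by rewrite inE; case: (AAP _ ZS).
  move=> Z Z' ZS Z'S eqA; have [_ h1] := AAP _ ZS; have [_ h2] := AAP _ Z'S.
  have sub Z2 : Z2 \in S2 -> Z2 \subset E by rewrite !inE => /andP[/andP[]].
  apply/setP => e; have [eE|eE] := boolP (e \in E); first by rewrite h1 // h2 // eqA.
  have notin Z2 : Z2 \in S2 -> e \in Z2 = false.
    by move=> /sub Z2E; apply/negbTE; apply: contra eE => /(fintype.subsetP Z2E).
  by rewrite !notin.
have card4 : (#|E| <= n + (2 * h + #|live|))%N.
  rewrite -(leq_exp2l (m := 2)) // -card_powerset.
  apply: leq_trans card1 _; rewrite card_ffun card_bool card_ord expnD leq_mul2l.
  apply/orP; right; apply: leq_trans card2 _.
  by rewrite cardK expnD leq_mul2l card3 orbT.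
have := live_card; lia.
Qed.

End MinorBound.

End Chains.

(** * First homology of a plane grid with holes glued in pairs *)

Module GridHomology.
Import Chains.
Local Open Scope ring_scope.

Lemma ffun_addE (L : finType) (f g : {ffun L -> bool}) l : (f + g) l = f l + g l.
Proof. by rewrite ffunE. Qed.

Lemma link4E (L : finType) (l1 l2 l3 l4 l : L) :
  (link1 l1 + link1 l2 + (link1 l3 + link1 l4)) l =
  (l == l1) + (l == l2) + ((l == l3) + (l == l4)) :> bool.
Proof. by rewrite !ffunE. Qed.

Lemma bnd_link4 (N L : finType) (s t : L -> N) (l1 l2 l3 l4 : L) u :
  bnd s t (link1 l1 + link1 l2 + (link1 l3 + link1 l4)) u =
  inc s t l1 u + inc s t l2 u + (inc s t l3 u + inc s t l4 u).
Proof. by rewrite !bndD !bnd_link1. Qed.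

Lemma link2E (L : finType) (l1 l2 l : L) (r : {ffun L -> bool}) :
  (link1 l1 + link1 l2 + r) l = (l == l1) + (l == l2) + r l :> bool.
Proof. by rewrite !ffunE. Qed.

Lemma bool_add_or (x y : bool) : is_true (x + y)%R -> x || y.
Proof. by case: x; case: y. Qed.

Section Spans.
Variables (L F : finType) (bd : F -> {ffun L -> bool}).

Definition spanned (z : {ffun L -> bool}) :=
  exists A : {ffun F -> bool}, z = \sum_(f | A f) bd f.

Lemma spannedD z1 z2 : spanned z1 -> spanned z2 -> spanned (z1 + z2).
Proof.
move=> [A1 ->] [A2 ->]; exists (A1 + A2).
apply/ffunP => l; rewrite ffunE !sum_ffunE [X in X + _]big_mkcond [X in _ + X]big_mkcond.
rewrite [RHS]big_mkcond -big_split /=.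
by apply: eq_bigr => f _; rewrite ffunE; case: (A1 f); case: (A2 f); rewrite /= ?addr0 ?add0r ?bool_addxx.
Qed.

Lemma spanned0 : spanned 0.
Proof. by exists 0; rewrite big_pred0 // => f; rewrite ffunE. Qed.

Lemma spanned_sum (I : finType) (P : pred I) (z : I -> {ffun L -> bool}) :
  (forall i, P i -> spanned (z i)) -> spanned (\sum_(i | P i) z i).
Proof.
by move=> h; elim/big_rec: _ => [|i x /h si sx]; [exact: spanned0 | exact: spannedD].
Qed.

Lemma spanned_face f : spanned (bd f).
Proof.
exists [ffun g => g == f]; rewrite (bigD1 f) ?ffunE ?eqxx //= big1 ?addr0 // => g.
by rewrite ffunE andbN.
Qed.

End Spans.

Lemma ffun_addxx (L : finType) (z : {ffun L -> bool}) : z + z = 0.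
Proof. by apply/ffunP => l; rewrite !ffunE bool_addxx. Qed.

(* On the plane grid, a cycle is the boundary of the set of squares lying above
   an odd number of its horizontal edges. *)
Section PlaneGrid.
Variables (W : nat) (H V : nat -> nat -> bool).
Hypothesis H_out : forall i j, (W <= i)%N || (W < j)%N -> H i j = 0.
Hypothesis V_out : forall i j, (W < i)%N || (W <= j)%N -> V i j = 0.
Hypothesis cyc : forall i j, H i j + (if i is i'.+1 then H i' j else 0) +
  (V i j + (if j is j'.+1 then V i j' else 0)) = 0.

Definition fill i j : bool := \sum_(k < j.+1) H i k.

Lemma fill_H i j : H i j = fill i j + (if j is j'.+1 then fill i j' else 0).
Proof.
rewrite /fill; case: j => [|j]; first by rewrite big_ord_recl big_ord0 !addr0.
by rewrite big_ord_recr /= addrAC bool_addxx add0r.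
Qed.

Lemma fill_V i j : V i j = fill i j + (if i is i'.+1 then fill i' j else 0).
Proof.
elim: j => [|j IHj].
  have := cyc i 0; rewrite /fill addr0.
  case: i => [|i]; rewrite ?big_ord_recl ?big_ord0 /= ?addr0.
    by case: (H 0 0); case: (V 0 0).
  by case: (H i.+1 0); case: (H i 0); case: (V i.+1 0).
have := cyc i j.+1; move: IHj; rewrite /fill; case: i => [|i].
  rewrite !big_ord_recr /=; move: (\sum_(i < j) _) => x.
  by case: (H 0 j.+1); case: (H 0 j); case: (V 0 j.+1); case: (V 0 j); case: x.
rewrite ![\sum_(k < j.+2) _]big_ord_recr /=.
move: (\sum_(i < j.+1) _) (\sum_(i < j.+1) _) => x y.
by case: (H i.+1 j.+1); case: (H i j.+1); case: (V i.+1 j.+1); case: (V i.+1 j); case: x; case: y.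
Qed.

(** From one column to the next the parity changes by a vertical edge at height [W], and there is
    none. So every column of horizontal edges is even and [fill] has bounded support. *)
Lemma fill_top i : fill i W = 0.
Proof.
elim: i => [|i IHi].
  by have := fill_V 0 W; rewrite V_out ?leqnn ?orbT // addr0 => <-.
by have := fill_V i.+1 W; rewrite V_out ?leqnn ?orbT // IHi addr0 => <-.
Qed.

Lemma fill_out i j : (W <= i)%N || (W <= j)%N -> fill i j = 0.
Proof.
case/orP => h; first by rewrite /fill big1 // => k _; rewrite H_out ?h.
rewrite -(fill_top i) /fill -(subnKC h) -addSn big_split_ord /= [X in _ + X]big1 ?addr0 //.
by move=> k _; rewrite H_out // addSn ltnS leq_addr orbT.
Qed.

End PlaneGrid.

Section HoledGrid.
(** The holes are squares of side [N] at row [b]; those of pair [k] start at the columns [a k] and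
    [a k + 6 * N]. The numbers [6 * N] and [12 * N] come from the solid handles, [N] being a third
    of a unit: the two feet of a handle are two units apart, consecutive handles four. *)
Variables (h W N b : nat) (a : 'I_h -> nat).
Hypothesis N_gt0 : (0 < N)%N.
Hypothesis b_gt0 : (0 < b)%N.
Hypothesis b_W : (b + N < W)%N.
Hypothesis a_gt0 : forall k, (0 < a k)%N.
Hypothesis a_W : forall k, (a k + 7 * N < W)%N.
Hypothesis a_sep : forall k k', k != k' ->
  (a k + 12 * N <= a k')%N || (a k' + 12 * N <= a k)%N.

Definition node := ('I_W.+1 * 'I_W.+1)%type.
Definition pt (i j : nat) : node := (inord i, inord j).

Lemma ptE (p : node) i j : (i <= W)%N -> (j <= W)%N ->
  (p == pt i j) = (p.1 == i :> nat) && (p.2 == j :> nat).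
Proof.
case: p => x y iW jW; rewrite xpair_eqE /=.
by rewrite -!(inj_eq val_inj) /= !inordK.
Qed.

Lemma ptK (p : node) : pt p.1 p.2 = p.
Proof. by case: p => x y; rewrite /pt !inord_val. Qed.

Lemma node1_le (p : node) : (p.1 <= W)%N.
Proof. exact: (ltn_ord p.1). Qed.
Lemma node2_le (p : node) : (p.2 <= W)%N.
Proof. exact: (ltn_ord p.2). Qed.

Lemma pt1 i j : (i <= W)%N -> (pt i j).1 = i :> nat.
Proof. by move=> iW; rewrite /= inordK. Qed.
Lemma pt2 i j : (j <= W)%N -> (pt i j).2 = j :> nat.
Proof. by move=> iW; rewrite /= inordK. Qed.

(* The hole number k of the first (resp. second) kind, as a set of unit squares
   named by their lower left corner. *)
Definition hole1 k i j := [&& a k <= i, i < a k + N, b <= j & j < b + N]%N.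
Definition hole2 k i j := hole1 k (i - 6 * N) j && (6 * N <= i)%N.
Definition hole i j := [exists k, hole1 k i j || hole2 k i j].

(** The reflection that exchanges the two holes of pair [k], which span the columns from [a k] to
    [a k + N] and from [a k + 6 * N] to [a k + 7 * N]. *)
Definition mir (k : 'I_h) i := (2 * a k + 7 * N - i)%N.

Definition onH k i j := [&& a k <= i, i < a k + N & (j == b) || (j == b + N)]%N.
Definition onV k i j := [&& b <= j, j < b + N & (i == a k) || (i == a k + N)]%N.
Definition rim k i j :=
  [&& a k <= i, i <= a k + N, b <= j, j <= b + N &
      [|| i == a k, i == a k + N, j == b | j == b + N]]%N.

(** Grid edges, named by their lower or left end and horizontal for [true], and rungs: the rung
    [(k, p)] joins a point on the rim of a first hole to its mirror image on the second. *)
Definition link := (bool * node + 'I_h * node)%type.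
Definition lH i j : link := inl (true, pt i j).
Definition lV i j : link := inl (false, pt i j).
Definition lR k i j : link := inr (k, pt i j).

Definition lsrc (l : link) : node :=
  match l with inl (_, p) => p | inr (_, p) => p end.
Definition ltgt (l : link) : node :=
  match l with
  | inl (true, p) => pt p.1.+1 p.2
  | inl (false, p) => pt p.1 p.2.+1
  | inr (k, p) => pt (mir k p.1) p.2
  end.
(** Edges with hole squares on both sides are discarded. The truncated predecessors on the border
    are harmless, since holes have positive coordinates. *)
Definition lok (l : link) : bool :=
  match l with
  | inl (true, p) => (p.1 < W)%N && ~~ (hole p.1 p.2 && hole p.1 p.2.-1)
  | inl (false, p) => (p.2 < W)%N && ~~ (hole p.1 p.2 && hole p.1.-1 p.2)
  | inr (k, p) => rim k p.1 p.2
  end.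

Definition onrim k (l : link) : bool :=
  match l with
  | inl (true, p) => onH k p.1 p.2
  | inl (false, p) => onV k p.1 p.2
  | inr _ => false
  end.

Definition lmir k (l : link) : link :=
  match l with
  | inl (true, p) => lH (mir k p.1.+1) p.2
  | inl (false, p) => lV (mir k p.1) p.2
  | inr _ => l
  end.

Definition rungs k (l : link) : {ffun link -> bool} :=
  [ffun l' => if l' is inr (k', p) then (k == k') && inc lsrc ltgt l p else false].

(** Besides the squares, a quadrilateral for each rim edge, spanned by the edge, its mirror image
    and the rungs at its ends. Those of one [k] form the tube between two holes. Indices that name
    no such face get boundary zero in [fbd]. *)
Definition face := (node + 'I_h * link)%type.

Definition sq i j : {ffun link -> bool} :=
  link1 (lH i j) + link1 (lH i j.+1) + (link1 (lV i j) + link1 (lV i.+1 j)).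

Definition fbd (f : face) : {ffun link -> bool} :=
  match f with
  | inl p => if [&& p.1 < W, p.2 < W & ~~ hole p.1 p.2]%N then sq p.1 p.2 else 0
  | inr (k, l) => if onrim k l then link1 l + link1 (lmir k l) + rungs k l else 0
  end.

Lemma lH_inj i j i' j' : (i <= W)%N -> (j <= W)%N -> (i' <= W)%N -> (j' <= W)%N ->
  (lH i j == lH i' j') = (i == i') && (j == j').
Proof.
move=> ? ? ? ?; rewrite (inj_eq inl_inj) xpair_eqE eqxx /= ptE //.
by rewrite pt1 // pt2.
Qed.

Lemma lV_inj i j i' j' : (i <= W)%N -> (j <= W)%N -> (i' <= W)%N -> (j' <= W)%N ->
  (lV i j == lV i' j') = (i == i') && (j == j').
Proof.
move=> ? ? ? ?; rewrite (inj_eq inl_inj) xpair_eqE eqxx /= ptE //.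
by rewrite pt1 // pt2.
Qed.

Lemma lHV i j i' j' : (lH i j == lV i' j') = false.
Proof. by rewrite (inj_eq inl_inj) xpair_eqE. Qed.

Lemma lVH i j i' j' : (lV i j == lH i' j') = false.
Proof. by rewrite (inj_eq inl_inj) xpair_eqE. Qed.

Lemma ltgt_H i j : (i <= W)%N -> (j <= W)%N -> ltgt (lH i j) = pt i.+1 j.
Proof. by move=> ? ?; rewrite /ltgt /lH pt1 // pt2. Qed.

Lemma ltgt_V i j : (i <= W)%N -> (j <= W)%N -> ltgt (lV i j) = pt i j.+1.
Proof. by move=> ? ?; rewrite /ltgt /lV pt1 // pt2. Qed.

Lemma sq_H x y i j : (i <= W)%N -> (j <= W)%N -> (x < W)%N -> (y < W)%N ->
  sq x y (lH i j) = (i == x) && (j == y) + (i == x) && (j == y.+1) :> bool.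
Proof.
move=> iW jW xW yW; rewrite /sq link4E 2!lHV 2?lH_inj //; [exact: addr0 | exact: ltnW..].
Qed.

Lemma sq_V x y i j : (i <= W)%N -> (j <= W)%N -> (x < W)%N -> (y < W)%N ->
  sq x y (lV i j) = (i == x) && (j == y) + (i == x.+1) && (j == y) :> bool.
Proof.
move=> iW jW xW yW; rewrite /sq link4E 2!lVH addr0 add0r 2?lV_inj //; exact: ltnW.
Qed.

Lemma sq_R x y k p : sq x y (inr (k, p)) = 0.
Proof. by rewrite /sq link4E. Qed.

Lemma hole_sep k k' i j : hole1 k i j || hole2 k i j ->
  hole1 k' i j || hole2 k' i j -> k = k'.
Proof.
move=> h1 h2; apply/eqP; apply: contraT => /a_sep.
move: h1 h2; rewrite /hole2 /hole1; lia.
Qed.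

Lemma bnd_sq i j u : (i < W)%N -> (j < W)%N -> bnd lsrc ltgt (sq i j) u = 0.
Proof.
move=> iW jW; have [iW' jW'] := (ltnW iW, ltnW jW).
rewrite /sq bnd_link4 /inc 2?ltgt_H // 2?ltgt_V // /lsrc /=.
move: (pt i j == u) (pt i.+1 j == u) (pt i j.+1 == u) (pt i.+1 j.+1 == u).
by do 4 case.
Qed.

Lemma bnd_rungs k l u :
  bnd lsrc ltgt (rungs k l) u = \sum_n inc lsrc ltgt l n * inc lsrc ltgt (inr (k, n)) u.
Proof.
rewrite /bnd big_sumType /= big1 ?add0r; last by move=> p _; rewrite ffunE mul0r.
transitivity (\sum_k' \sum_n rungs k l (inr (k', n)) * inc lsrc ltgt (inr (k', n)) u).
  by rewrite pair_bigA; apply: eq_bigr => -[].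
rewrite (bigD1 k) //= [X in _ + X]big1 ?addr0.
  by apply: eq_bigr => n _; rewrite ffunE eqxx.
by move=> k' k'k; rewrite big1 // => n _; rewrite ffunE eq_sym (negPf k'k) mul0r.
Qed.

Lemma sum_inc l (f : node -> bool) :
  \sum_n inc lsrc ltgt l n * f n = f (lsrc l) + f (ltgt l).
Proof.
have pick x : \sum_n (x == n) * f n = f x :> bool.
  rewrite (bigD1 x) //= eqxx mul1r big1 ?addr0 // => n.
  by rewrite eq_sym => /negPf->; rewrite mul0r.
by rewrite -(pick (lsrc l)) -(pick (ltgt l)) -big_split; apply: eq_bigr => n _; rewrite mulrDl.
Qed.

Lemma fbd_cycle f u : bnd lsrc ltgt (fbd f) u = 0.
Proof.
case: f => [p|[k l]] /=.
  by case: ifP => [/and3P[? ? _]|_]; rewrite ?bnd0 ?bnd_sq.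
case: ifP => [onl|_]; last by rewrite bnd0.
rewrite !bndD !bnd_link1 bnd_rungs sum_inc /inc.
have aW := a_W k.
case: l onl => [[[] p]|//] /=; rewrite /onH /onV => /and3P[h1 h2 h3].
- have e1 : (mir k p.1.+1).+1 = mir k p.1 by rewrite /mir; lia.
  rewrite !inordK ?ltnS ?e1; try (rewrite /mir; lia).
  move: (p == u) (pt p.1.+1 p.2 == u) (pt (mir k p.1) p.2 == u) (pt (mir k p.1.+1) p.2 == u).
  by do 4 case.
- rewrite !inordK ?ltnS; try (rewrite /mir; lia).
  move: (p == u) (pt p.1 p.2.+1 == u) (pt (mir k p.1) p.2 == u) (pt (mir k p.1) p.2.+1 == u).
  by do 4 case.
Qed.

Lemma card_le_seq (T : finType) (P : pred T) (s : seq T) :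
  (forall x, P x -> x \in s) -> (#|[set x | P x]| <= size s)%N.
Proof.
move=> Ps; apply: leq_trans (card_size s); apply: subset_leq_card.
by apply/fintype.subsetP => x; rewrite inE => /Ps.
Qed.


Lemma onH_W k i j : onH k i j -> (i < W)%N && (j <= W)%N.
Proof. by have := a_W k; rewrite /onH; lia. Qed.

Lemma onV_W k i j : onV k i j -> (i <= W)%N && (j < W)%N.
Proof. by have := a_W k; rewrite /onV; lia. Qed.

Lemma fbd_H f i j : (i <= W)%N -> (j <= W)%N -> fbd f (lH i j) ->
  match f with
  | inl p => [&& p.1 == i :> nat, ~~ hole i p.2 & (p.2 == j :> nat) || (p.2.+1 == j)]
  | inr (k, l) => (l == lH i j) && onH k i j ||
      (l == lH (mir k i.+1) j) && onH k (mir k i.+1) j && (i < mir k 0)%N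
  end.
Proof.
move=> iW jW; case: f => [p|[k l]] /=.
  case: ifP => [/and3P[p1 p2 hp]|_]; last by rewrite ffunE.
  rewrite sq_H // => /bool_add_or; rewrite -andb_orr => /andP[/eqP-> hj].
  by rewrite hp eqxx (eq_sym _ j) (eq_sym _ j).
case: ifP => [onl|_]; last by rewrite ffunE.
rewrite link2E ffunE addr0; case: eqVneq => [lE _|_].
  have onl' : onH k i j by move: onl; rewrite -lE /= pt1 ?pt2.
  by rewrite onl'.
case: l onl => [[[] p]|//] /=; last by rewrite add0r.
move=> onl; have aW := a_W k; rewrite add0r lH_inj ?node2_le //; last by move: onl; rewrite /onH /mir; lia.
move=> /andP[/eqP iE /eqP jE].
have e1 : mir k i.+1 = p.1 by rewrite iE /mir; move: onl; rewrite /onH; lia.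
rewrite e1 jE /lH ptK eqxx onl /= iE; move: onl; rewrite /onH /mir; lia.
Qed.

Lemma fbd_V f i j : (i <= W)%N -> (j <= W)%N -> fbd f (lV i j) ->
  match f with
  | inl p => [&& p.2 == j :> nat, ~~ hole p.1 j & (p.1 == i :> nat) || (p.1.+1 == i)]
  | inr (k, l) => (l == lV i j) && onV k i j ||
      (l == lV (mir k i) j) && onV k (mir k i) j && (i < mir k 0)%N
  end.
Proof.
move=> iW jW; case: f => [p|[k l]] /=.
  case: ifP => [/and3P[p1 p2 hp]|_]; last by rewrite ffunE.
  rewrite sq_V // => /bool_add_or; rewrite -andb_orl => /andP[hi /eqP->].
  by rewrite hp eqxx (eq_sym _ i) (eq_sym _ i).
case: ifP => [onl|_]; last by rewrite ffunE.
rewrite link2E ffunE addr0; case: eqVneq => [lE _|_].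
  have onl' : onV k i j by move: onl; rewrite -lE /= pt1 ?pt2.
  by rewrite onl'.
case: l onl => [[[] p]|//] /=; first by rewrite add0r.
move=> onl; have aW := a_W k; have ag := a_gt0 k.
rewrite add0r lV_inj ?node2_le //; last by move: onl; rewrite /onV /mir; lia.
move=> /andP[/eqP iE /eqP jE].
have e1 : mir k i = p.1 by rewrite iE /mir; move: onl; rewrite /onV; lia.
rewrite e1 jE /lV ptK eqxx onl /= iE; move: onl; rewrite /onV /mir; lia.
Qed.

Lemma onH_hole k i j : onH k i j -> hole i (if j == b then b else j.-1).
Proof.
by rewrite /onH => hh; apply/existsP; exists k; apply/orP; left; rewrite /hole1; case: eqP hh; lia.
Qed.

Lemma onH_mir_hole k i j : onH k (mir k i.+1) j -> (i < mir k 0)%N ->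
  hole i (if j == b then b else j.-1).
Proof.
rewrite /onH /mir => hh im; apply/existsP; exists k; apply/orP; right.
by rewrite /hole2 /hole1; case: eqP hh; lia.
Qed.

Lemma onV_hole k i j : onV k i j -> hole (if i == a k then i else i.-1) j.
Proof.
by rewrite /onV => hh; apply/existsP; exists k; apply/orP; left; rewrite /hole1; case: eqP hh; lia.
Qed.

Lemma onV_mir_hole k i j : onV k (mir k i) j -> (i < mir k 0)%N ->
  hole (if i == (a k + 6 * N)%N then i else i.-1) j.
Proof.
rewrite /onV /mir => hh im; apply/existsP; exists k; apply/orP; right.
by rewrite /hole2 /hole1; case: (eqVneq i (a k + 6 * N)%N); move: hh; lia.
Qed.

Lemma onH_uniq k k' i j : onH k i j || onH k (mir k i.+1) j && (i < mir k 0)%N ->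
  onH k' i j || onH k' (mir k' i.+1) j && (i < mir k' 0)%N ->
  k = k' /\ onH k i j = onH k' i j.
Proof.
move=> h1 h2; have kk : k = k'; last by rewrite kk.
apply/eqP; apply: contraT => /a_sep; move: h1 h2; rewrite /onH /mir; lia.
Qed.

Lemma onV_uniq k k' i j : onV k i j || onV k (mir k i) j && (i < mir k 0)%N ->
  onV k' i j || onV k' (mir k' i) j && (i < mir k' 0)%N ->
  k = k' /\ onV k i j = onV k' i j.
Proof.
move=> h1 h2; have kk : k = k'; last by rewrite kk.
apply/eqP; apply: contraT => /a_sep; move: h1 h2; rewrite /onV /mir; lia.
Qed.

(** At a rim edge, or its mirror image, the square inside the hole is missing and one quadrilateral
    takes its place; any other edge has only its two squares. A rung at [p] lies on the
    quadrilaterals of the rim edges at [p], and at most two of the four grid edges there are on the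
    rim. *)
Lemma fbd_le2 l : (#|[set f | fbd f l]| <= 2)%N.
Proof.
case: l => [[[] p]|[k p]].
- rewrite -(ptK p); set i := nat_of_ord p.1; set j := nat_of_ord p.2.
  have iW : (i <= W)%N by rewrite -ltnS ltn_ord.
  have jW : (j <= W)%N by rewrite -ltnS ltn_ord.
  pose at1 k := onH k i j; pose at2 k := onH k (mir k i.+1) j && (i < mir k 0)%N.
  have [k /orP atk|no] := pickP (fun k => at1 k || at2 k).
    pose l0 := if at1 k then lH i j else lH (mir k i.+1) j.
    pose q := if j == b then (pt i j.-1) else pt i j.
    apply: (card_le_seq (s := [:: inl q; inr (k, l0)])) => -[x|[k' l']].
      move/(fbd_H iW jW) => /and3P[/eqP xi hx xj]; rewrite !inE /= orbF.
      have hh : hole i (if j == b then b else j.-1).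
        by case: atk => [/onH_hole//|/andP[]]; exact: onH_mir_hole.
      have jb : (j == b) || (j == b + N)%N.
        by case: atk => [|/andP[+ _]]; rewrite /at1 /onH => /and3P[].
      rewrite (inj_eq inl_inj) /q; move: hh hx xj; case: eqVneq => [jb' hh hx xj|jb' hh hx xj].
        rewrite ptE; [|lia..]; rewrite xi eqxx /=; case/orP: xj => /eqP xj; last by lia.
        by rewrite xj jb' hh in hx.
      rewrite ptE //; rewrite xi eqxx /=; case/orP: xj => /eqP xj; first by rewrite xj.
      have e : nat_of_ord x.2 = j.-1 by rewrite -xj.
      by rewrite e hh in hx.
    move/(fbd_H iW jW) => hf; rewrite !inE /=; apply/eqP; congr (inr _).
    have [kk e1] : k = k' /\ at1 k = at1 k'.
      by apply: onH_uniq; [apply/orP | case/orP: hf => [/andP[_ ->]|/andP[/andP[_ ->] ->]]; rewrite ?orbT].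
    subst k'; congr (_, _); rewrite /l0; case/orP: hf => [/andP[/eqP-> h1]|/andP[/andP[/eqP -> h1] h2]].
      by rewrite /at1 h1.
    have -> // : at1 k = false.
    by apply/negbTE/negP; move: h1 h2; rewrite /at1 /onH /mir; lia.
  apply: (card_le_seq (s := [:: inl (pt i j); inl (pt i j.-1)])) => -[x|[k' l']].
    move/(fbd_H iW jW) => /and3P[/eqP xi hx xj]; rewrite !inE !(inj_eq inl_inj).
    rewrite !ptE //; last lia; rewrite xi eqxx /=; case/orP: xj => [->//|/eqP <-].
    by rewrite /= eqxx orbT.
  move/(fbd_H iW jW) => hf; have := no k'; rewrite /at1 /at2.
  by case/orP: hf => [/andP[_ ->]|/andP[/andP[_ ->] ->]]; rewrite ?orbT.
- rewrite -(ptK p); set i := nat_of_ord p.1; set j := nat_of_ord p.2.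
  have iW : (i <= W)%N by rewrite -ltnS ltn_ord.
  have jW : (j <= W)%N by rewrite -ltnS ltn_ord.
  pose at1 k := onV k i j; pose at2 k := onV k (mir k i) j && (i < mir k 0)%N.
  have [k /orP atk|no] := pickP (fun k => at1 k || at2 k).
    pose l0 := if at1 k then lV i j else lV (mir k i) j.
    pose lft := (i == a k) || (i == a k + 6 * N)%N.
    pose q := if lft then pt i.-1 j else pt i j.
    apply: (card_le_seq (s := [:: inl q; inr (k, l0)])) => -[x|[k' l']].
      move/(fbd_V iW jW) => /and3P[/eqP xj hx xi]; rewrite !inE /= orbF.
      have hh : hole (if lft then i else i.-1) j.
        rewrite /lft; case: atk => [h1|/andP[h1 h2]].
          have := onV_hole h1; case: eqP => // ia.
          have -> // : (i == a k + 6 * N)%N = false by move: h1; rewrite /at1 /onV; lia.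
        have := onV_mir_hole h1 h2; rewrite orbC; case: eqP => // ia.
        have -> // : (i == a k)%N = false by move: h1 h2; rewrite /onV /mir; lia.
      have igt : (0 < i)%N.
        have ag := a_gt0 k; case: atk => [|/andP[]]; rewrite /at1 /onV /mir; lia.
      rewrite (inj_eq inl_inj) /q; move: hh hx xi; case: ifP => [_ hh hx xi|_ hh hx xi].
        rewrite ptE; [|lia..]; rewrite xj eqxx andbT; case/orP: xi => /eqP xi; last by lia.
        by rewrite xi hh in hx.
      rewrite ptE // xj eqxx andbT; case/orP: xi => /eqP xi; first by rewrite xi.
      have e : nat_of_ord x.1 = i.-1 by rewrite -xi.
      by rewrite e hh in hx.
    move/(fbd_V iW jW) => hf; rewrite !inE /=; apply/eqP; congr (inr _).
    have [kk e1] : k = k' /\ at1 k = at1 k'.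
      by apply: onV_uniq; [apply/orP | case/orP: hf => [/andP[_ ->]|/andP[/andP[_ ->] ->]]; rewrite ?orbT].
    subst k'; congr (_, _); rewrite /l0; case/orP: hf => [/andP[/eqP-> h1]|/andP[/andP[/eqP -> h1] h2]].
      by rewrite /at1 h1.
    have -> // : at1 k = false.
    by apply/negbTE/negP; move: h1 h2; rewrite /at1 /onV /mir; lia.
  apply: (card_le_seq (s := [:: inl (pt i j); inl (pt i.-1 j)])) => -[x|[k' l']].
    move/(fbd_V iW jW) => /and3P[/eqP xj hx xi]; rewrite !inE !(inj_eq inl_inj).
    rewrite !ptE //; last lia; rewrite xj eqxx !andbT; case/orP: xi => [->//|/eqP <-].
    by rewrite /= eqxx orbT.
  move/(fbd_V iW jW) => hf; have := no k'; rewrite /at1 /at2.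
  by case/orP: hf => [/andP[_ ->]|/andP[/andP[_ ->] ->]]; rewrite ?orbT.
- set i := nat_of_ord p.1; set j := nat_of_ord p.2.
  have iW : (i <= W)%N by rewrite -ltnS ltn_ord.
  have jW : (j <= W)%N by rewrite -ltnS ltn_ord.
  pose cand := [:: lH i j; lH i.-1 j; lV i j; lV i j.-1].
  pose cnd := [:: onH k i j; (0 < i)%N && onH k i.-1 j; onV k i j; (0 < j)%N && onV k i j.-1].
  apply: (@leq_trans (size (mask cnd [seq inr (k, l) | l <- cand : seq link] : seq face))).
    apply: card_le_seq => -[x|[k' l']] /=.
      by case: ifP => _; rewrite ?sq_R ?ffunE.
    case: ifP => [onl|]; last by rewrite ffunE.
    move=> hb; have kk : k' = k; last subst k'.
      move: hb; rewrite link2E ffunE; case: l' onl => [[[] ?]|//] _ /=; rewrite !add0r => /andP[/eqP->//].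
    have : inc lsrc ltgt l' p.
      by move: hb; rewrite link2E ffunE eqxx; case: l' onl => [[[] ?]|//] _; rewrite !add0r.
    rewrite /inc => hinc; clear hb.
    have {hinc} : (lsrc l' == p) || (ltgt l' == p) by move: hinc; do 2 case: eqP.
    case: l' onl => [[[] y]|//] /= onl /orP[/eqP yp|/eqP py].
    + subst y; have {}onl : onH k i j := onl.
      have -> : inl (true, p) = lH i j by rewrite /lH ptK.
      by rewrite onl inE eqxx.
    + have yi : i = y.1.+1 by rewrite /i -py pt1 //; have := onH_W onl; lia.
      have yj : j = y.2 by rewrite /j -py pt2 //; have := onH_W onl; lia.
      rewrite yi yj /= onl /lH ptK.
      by case: (onH k _.+1 _); rewrite !inE eqxx ?orbT.
    + subst y; have {}onl : onV k i j := onl.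
      have -> : inl (false, p) = lV i j by rewrite /lV ptK.
      rewrite onl.
      by case: (onH _ _ _); case: (_ && _); rewrite !inE eqxx ?orbT.
    + have yi : i = y.1 by rewrite /i -py pt1 //; have := onV_W onl; lia.
      have yj : j = y.2.+1 by rewrite /j -py pt2 //; have := onV_W onl; lia.
      rewrite yi yj /= onl /lV ptK.
      by case: (onH _ _ _); case: (_ && _); case: (onV _ _ _); rewrite !inE eqxx ?orbT.
  rewrite size_mask //= !addn0; have aW := a_W k.
  rewrite /onH /onV; lia.
Qed.


Lemma sum_pick (T : finType) (f c : T -> bool) x :
  (forall p, f p -> c p = (p == x)) -> \sum_p f p * c p = f x.
Proof.
move=> fc; transitivity (\sum_p f p * (p == x)).
  by apply: eq_bigr => p _; case fp: (f p); rewrite ?mul0r // fc.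
rewrite (bigD1 x) //= eqxx mulr1 big1 ?addr0 // => p /negPf->; exact: mulr0.
Qed.

Lemma sum_none (T : finType) (f c : T -> bool) :
  (forall p, f p -> c p = false) -> \sum_p f p * c p = 0.
Proof. by move=> fc; rewrite big1 // => p _; case fp: (f p); rewrite ?mul0r // fc. Qed.

Section Flat.
Variable z : {ffun link -> bool}.
Hypothesis z_ok : forall l, z l -> lok l.
Hypothesis z_flat : forall k p, z (inr (k, p)) = 0.

Definition zH i j : bool := [&& i <= W, j <= W & z (lH i j)]%N.
Definition zV i j : bool := [&& i <= W, j <= W & z (lV i j)]%N.

Lemma zH_out i j : (W <= i)%N || (W < j)%N -> zH i j = 0.
Proof.
move=> out; apply/negbTE/negP => /and3P[iW jW /z_ok]; rewrite /lok /lH pt1 // => /andP[+ _].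
by move: out; lia.
Qed.

Lemma zV_out i j : (W < i)%N || (W <= j)%N -> zV i j = 0.
Proof.
move=> out; apply/negbTE/negP => /and3P[iW jW /z_ok]; rewrite /lok /lV pt2 // => /andP[+ _].
by move: out; lia.
Qed.

Lemma bnd_flat i j : (i <= W)%N -> (j <= W)%N -> bnd lsrc ltgt z (pt i j) =
  zH i j + (if i is i'.+1 then zH i' j else 0) + (zV i j + (if j is j'.+1 then zV i j' else 0)).
Proof.
move=> iW jW; rewrite /bnd big_sumType /= [X in _ + X]big1 ?addr0; last first.
  by move=> [k p] _; rewrite z_flat mul0r.
transitivity (\sum_(c : bool) \sum_(p : node) z (inl (c, p)) * inc lsrc ltgt (inl (c, p)) (pt i j)).
  by rewrite pair_bigA; apply: eq_bigr => -[].
rewrite big_bool /=; congr (_ + _); rewrite /inc.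
  under eq_bigr => p _ do rewrite mulrDr.
  rewrite big_split /=; congr (_ + _).
    by rewrite (sum_pick (x := pt i j)) // /zH iW jW.
  case: i iW => [|i] iW.
    apply: sum_none => p /z_ok /= /andP[pW _].
    by rewrite ptE // pt1 // -[nat_of_ord p.1]/(nat_of_ord p.1); lia.
  rewrite (sum_pick (x := pt i j)) /zH ?(ltnW iW) ?jW // => p /z_ok /= /andP[pW _].
  have p2W : (p.2 <= W)%N by rewrite -ltnS ltn_ord.
  by rewrite !ptE ?(ltnW iW) // pt1 // pt2.
under eq_bigr => p _ do rewrite mulrDr.
rewrite big_split /=; congr (_ + _).
  by rewrite (sum_pick (x := pt i j)) // /zV iW jW.
case: j jW => [|j] jW.
  apply: sum_none => p /z_ok /= /andP[pW _].
  by rewrite ptE // pt2 // andbF.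
rewrite (sum_pick (x := pt i j)) /zV ?(ltnW jW) ?iW // => p /z_ok /= /andP[pW _].
have p1W : (p.1 <= W)%N by rewrite -ltnS ltn_ord.
by rewrite !ptE ?(ltnW jW) // pt1 // pt2.
Qed.

End Flat.

Definition sqs (A : nat -> nat -> bool) : {ffun link -> bool} :=
  \sum_(p : node | A p.1 p.2) sq p.1 p.2.

Section Sqs.
Variable A : nat -> nat -> bool.
Hypothesis A_out : forall i j, (W <= i)%N || (W <= j)%N -> A i j = 0.

Lemma A_in i j : A i j -> (i < W)%N && (j < W)%N.
Proof. by move=> Aij; rewrite !ltnNge -negb_or; apply/negP => /A_out; rewrite Aij. Qed.

Lemma sqs_H i j : (i <= W)%N -> (j <= W)%N ->
  sqs A (lH i j) = A i j + (if j is j'.+1 then A i j' else 0).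
Proof.
move=> iW jW; rewrite /sqs sum_ffunE big_mkcond /=.
transitivity (\sum_(p : node) (A p.1 p.2 * (p == pt i j) +
    A p.1 p.2 * ((p.1 == i :> nat) && (p.2.+1 == j)))).
  apply: eq_bigr => p _; case Ap: (A p.1 p.2); last by rewrite !mul0r.
  have /andP[p1 p2] := A_in Ap.
  by rewrite sq_H // !mul1r ptE // !(eq_sym i) !(eq_sym j).
rewrite big_split /= (sum_pick (x := pt i j)) // pt1 // pt2 //; congr (_ + _).
case: j jW => [|j] jW; first by apply: sum_none => p _; rewrite andbF.
rewrite (sum_pick (x := pt i j)) ?pt1 ?pt2 // ?(ltnW jW) // => p _.
by rewrite ptE // ltnW.
Qed.

Lemma sqs_V i j : (i <= W)%N -> (j <= W)%N ->
  sqs A (lV i j) = A i j + (if i is i'.+1 then A i' j else 0).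
Proof.
move=> iW jW; rewrite /sqs sum_ffunE big_mkcond /=.
transitivity (\sum_(p : node) (A p.1 p.2 * (p == pt i j) +
    A p.1 p.2 * ((p.1.+1 == i) && (p.2 == j :> nat)))).
  apply: eq_bigr => p _; case Ap: (A p.1 p.2); last by rewrite !mul0r.
  have /andP[p1 p2] := A_in Ap.
  by rewrite sq_V // !mul1r ptE // !(eq_sym i) !(eq_sym j).
rewrite big_split /= (sum_pick (x := pt i j)) // pt1 // pt2 //; congr (_ + _).
case: i iW => [|i] iW; first by apply: sum_none.
rewrite (sum_pick (x := pt i j)) ?pt1 ?pt2 // ?(ltnW iW) // => p _.
by rewrite ptE // ltnW.
Qed.

Lemma sqs_R k p : sqs A (inr (k, p)) = 0.
Proof. by rewrite /sqs sum_ffunE big1 // => q _; rewrite sq_R. Qed.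

Lemma bnd_sqs u : bnd lsrc ltgt (sqs A) u = 0.
Proof.
rewrite /sqs bnd_sum big1 // => p /A_in /andP[? ?]; exact: bnd_sq.
Qed.

End Sqs.

Lemma link_eqP (z z' : {ffun link -> bool}) :
  (forall i j, (i <= W)%N -> (j <= W)%N -> z (lH i j) = z' (lH i j)) ->
  (forall i j, (i <= W)%N -> (j <= W)%N -> z (lV i j) = z' (lV i j)) ->
  (forall k p, z (inr (k, p)) = z' (inr (k, p))) -> z = z'.
Proof.
move=> hH hV hR; apply/ffunP => -[[[] p]|[k p]] //; rewrite -(ptK p).
  by apply: hH; rewrite -ltnS ltn_ord.
by apply: hV; rewrite -ltnS ltn_ord.
Qed.

Lemma hole1_out k i j : (W <= i)%N || (W <= j)%N -> hole1 k i j = 0.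
Proof. by have := a_W k; rewrite /hole1 => ? ?; apply/negbTE; lia. Qed.

Lemma hole2_out k i j : (W <= i)%N || (W <= j)%N -> hole2 k i j = 0.
Proof. by have := a_W k; rewrite /hole2 /hole1 => ? ?; apply/negbTE; lia. Qed.

Lemma bool_addP (x y c : bool) : (x && ~~ y || ~~ x && y) = c -> x + y = c.
Proof. by case: x; case: y. Qed.

Lemma hole1_rim k l : sqs (hole1 k) l = onrim k l.
Proof.
case: l => [[[] p]|[k' p]]; last by rewrite sqs_R.
  have [iW jW] := (node1_le p, node2_le p).
  have -> : inl (true, p) = lH p.1 p.2 by rewrite /lH ptK.
  rewrite sqs_H //; last exact: hole1_out.
  rewrite /lH /onrim pt1 // pt2 // /hole1 /onH.
  case: (nat_of_ord p.2) => [|j]; [rewrite addr0 | apply: bool_addP];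
  by apply/idP/idP; lia.
have [iW jW] := (node1_le p, node2_le p).
have -> : inl (false, p) = lV p.1 p.2 by rewrite /lV ptK.
rewrite sqs_V //; last exact: hole1_out.
rewrite /lV /onrim pt1 // pt2 // /hole1 /onV; have ag := a_gt0 k.
case: (nat_of_ord p.1) => [|i]; [rewrite addr0 | apply: bool_addP];
by apply/idP/idP; lia.
Qed.

Definition rims k : {ffun link -> bool} := sqs (hole1 k).

(** The tube is a cobordism between the two rims: over a whole closed rim every rung occurs an even
    number of times and cancels. *)
Lemma rims_mirror k :
  rims k + sqs (hole2 k) = \sum_(l | onrim k l) fbd (inr (k, l)).
Proof.
have aW := a_W k.
have lhs l : (\sum_(l0 | onrim k l0) fbd (inr (k, l0))) l =
   onrim k l + (\sum_(l0 | onrim k l0) (l == lmir k l0) + \sum_(l0 | onrim k l0) rungs k l0 l).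
  rewrite sum_ffunE.
  transitivity (\sum_(l0 | onrim k l0) ((l == l0) + ((l == lmir k l0) + rungs k l0 l))).
    by apply: eq_bigr => l0 hl; rewrite /fbd hl link2E addrA.
  rewrite !big_split /=; congr (_ + _).
  rewrite big_mkcond /= (bigD1 l) //= eqxx big1 ?addr0; first by case: ifP.
  by move=> l' /negPf; rewrite eq_sym => ->; case: ifP.
apply: link_eqP => [i j iW jW|i j iW jW|k' p]; rewrite ffun_addE lhs [rims _ _]hole1_rim.
- rewrite [X in _ = _ + (_ + X)]big1; last by move=> l0 _; rewrite ffunE.
  rewrite addr0 sqs_H //; last exact: hole2_out.
  congr (_ + _); transitivity (onH k (mir k i.+1) j && (i < mir k 0)%N).
    rewrite /hole2 /hole1 /onH /mir; case: j jW => [|j] jW;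
    [rewrite addr0 | apply: bool_addP]; by apply/idP/idP; lia.
  rewrite big_mkcond /=; case h1: (_ && _).
    have /andP[h2 h3] := h1; have mW : (mir k i.+1 <= W)%N by move: h2; rewrite /onH; lia.
    rewrite (bigD1 (lH (mir k i.+1) j)) //= pt1 // pt2 //.
    rewrite h2 lH_inj //; try (rewrite /mir; move: h2; rewrite /onH /mir; lia).
    rewrite eqxx andbT; have -> : i == mir k (mir k i.+1).+1.
      by move: h2 h3; rewrite /onH /mir; lia.
    rewrite big1 ?addr0 // => -[[[] p]|[? ?]] //= ne; case: ifP => // onp.
    rewrite lH_inj //; try (rewrite /mir; move: onp; rewrite /onH; lia).
    apply/negbTE/negP => /andP[/eqP iE /eqP jE]; move/negP: ne; apply; apply/eqP.
    by rewrite /lH -(ptK p) -jE; congr (inl (_, pt _ _)); move: onp; rewrite iE /onH /mir; lia.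
  rewrite big1 // => -[[[] p]|[? ?]] //= _; case: ifP => // onp.
  rewrite lH_inj //; try (rewrite /mir; move: onp; rewrite /onH; lia).
  apply/negbTE/negP => /andP[/eqP iE /eqP jE]; move: h1; rewrite iE jE.
  move: onp; rewrite /onH /mir; lia.
- rewrite [X in _ = _ + (_ + X)]big1; last by move=> l0 _; rewrite ffunE.
  rewrite addr0 sqs_V //; last exact: hole2_out.
  congr (_ + _); transitivity (onV k (mir k i) j && (i < mir k 0)%N).
    rewrite /hole2 /hole1 /onV /mir; have ag := a_gt0 k.
    case: i iW => [|i] iW; [rewrite addr0 | apply: bool_addP]; by apply/idP/idP; lia.
  rewrite big_mkcond /=; case h1: (_ && _).
    have /andP[h2 h3] := h1; have mW : (mir k i <= W)%N by move: h2; rewrite /onV; lia.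
    rewrite (bigD1 (lV (mir k i) j)) //= pt1 // pt2 //.
    rewrite h2 lV_inj //; try (rewrite /mir; move: h2; rewrite /onV /mir; lia).
    rewrite eqxx andbT; have -> : i == mir k (mir k i).
      by move: h2 h3; rewrite /onV /mir; lia.
    rewrite big1 ?addr0 // => -[[[] p]|[? ?]] //= ne; case: ifP => // onp.
    rewrite lV_inj //; try (rewrite /mir; move: onp; rewrite /onV; lia).
    apply/negbTE/negP => /andP[/eqP iE /eqP jE]; move/negP: ne; apply; apply/eqP.
    by rewrite /lV -(ptK p) -jE; congr (inl (_, pt _ _)); move: onp; rewrite iE /onV /mir; lia.
  rewrite big1 // => -[[[] p]|[? ?]] //= _; case: ifP => // onp.
  rewrite lV_inj //; try (rewrite /mir; move: onp; rewrite /onV; lia).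
  apply/negbTE/negP => /andP[/eqP iE /eqP jE]; move: h1; rewrite iE jE.
  have ag := a_gt0 k; move: onp; rewrite /onV /mir; lia.
- rewrite sqs_R [X in _ + (X + _)]big1 ?add0r; last by move=> [[[] ?]|[? ?]].
  have := bnd_sqs (@hole1_out k) p; rewrite /bnd => {1}<-.
  case: (eqVneq k k') => [<-|kk].
    rewrite [RHS]big_mkcond; apply: eq_bigr => l _; rewrite hole1_rim ffunE eqxx.
    by case: ifP => _; rewrite ?mul1r ?mul0r.
  rewrite [RHS]big1; last by move=> l _; rewrite ffunE (negPf kk).
  exact: (bnd_sqs (@hole1_out k) p).
Qed.

Lemma hole_const (A : nat -> nat -> bool) (x : nat) :
  (forall i j, x <= i < x + N -> b < j < b + N -> A i j = A i j.-1)%N ->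
  (forall i j, x < i < x + N -> b <= j < b + N -> A i j = A i.-1 j)%N ->
  (forall i j, x <= i < x + N -> b <= j < b + N -> A i j = A x b)%N.
Proof.
move=> hj hi i j /andP[xi iN] /andP[bj jN].
transitivity (A i b).
  rewrite -(subnKC bj); have : (j - b < N)%N by lia.
  elim: (j - b)%N => [|d IHd] dN; first by rewrite addn0.
  by rewrite hj; [rewrite addnS /= IHd //; lia | lia..].
rewrite -(subnKC xi); have : (i - x < N)%N by lia.
elim: (i - x)%N => [|d IHd] dN; first by rewrite addn0.
by rewrite hi; [rewrite addnS /= IHd //; lia | lia..].
Qed.

(** By the plane case the cycle bounds a set of squares. This set contains or avoids each hole
    entirely, as no edge inside a hole is admissible. Squares outside the holes are faces; a filled
    first hole contributes its rim, a filled second hole the same rim up to the tube. *)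
Lemma flat_spanned (z : {ffun link -> bool}) :
  (forall l, z l -> lok l) -> (forall k p, z (inr (k, p)) = 0) ->
  (forall u, bnd lsrc ltgt z u = 0) ->
  exists c : {ffun 'I_h -> bool}, spanned fbd (z + \sum_(k | c k) rims k).
Proof.
move=> z_ok z_flat z_cyc.
have cyc i j : zH z i j + (if i is i'.+1 then zH z i' j else 0) +
   (zV z i j + (if j is j'.+1 then zV z i j' else 0)) = 0.
  have [/andP[iW jW]|out] := boolP ((i <= W) && (j <= W))%N.
    by rewrite -(bnd_flat z_ok z_flat).
  have e1 : zH z i j = 0 by apply: (zH_out z_ok); lia.
  have e2 : zV z i j = 0 by apply: (zV_out z_ok); lia.
  have e3 : (if i is i'.+1 then zH z i' j else 0) = 0.
    by case: i out {e1 e2} => [//|i'] out; apply: (zH_out z_ok); lia.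
  have e4 : (if j is j'.+1 then zV z i j' else 0) = 0.
    by case: j out {e1 e2 e3} => [//|j'] out; apply: (zV_out z_ok); lia.
  by rewrite e1 e2 e3 e4.
pose A := fill (zH z).
have A_out : forall i j, (W <= i)%N || (W <= j)%N -> A i j = 0.
  exact: fill_out (zH_out z_ok) (zV_out z_ok) cyc.
have zE : z = sqs A.
  apply: link_eqP => [i j iW jW|i j iW jW|k p]; last by rewrite sqs_R z_flat.
    by rewrite sqs_H // -[RHS](fill_H (zH z)) /zH iW jW.
  by rewrite sqs_V // -[RHS](fill_V cyc) /zV iW jW.
have cst1 k i j : hole1 k i j -> A i j = A (a k) b.
  move=> /and4P[h1 h2 h3 h4]; apply: (hole_const (x := a k)) => [i' j' h5 h6|i' j' h5 h6||]; last 2 first.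
  - by rewrite h1.
  - by rewrite h3.
  - have : zH z i' j' = 0.
      apply/negbTE/negP => /and3P[iW jW /z_ok]; rewrite /lok /lH pt1 // pt2 // => /andP[_ /negP[]].
      by apply/andP; split; apply/existsP; exists k; apply/orP; left; rewrite /hole1; lia.
    rewrite (fill_H (zH z)); case: j' h6 => [|j'] h6; first by lia.
    by rewrite /= -/A; case: (A i' j'.+1); case: (A i' j').
  - have : zV z i' j' = 0.
      apply/negbTE/negP => /and3P[iW jW /z_ok]; rewrite /lok /lV pt1 // pt2 // => /andP[_ /negP[]].
      by apply/andP; split; apply/existsP; exists k; apply/orP; left; rewrite /hole1; lia.
    rewrite (fill_V cyc); case: i' h5 => [|i'] h5; first by lia.
    by rewrite /= -/A; case: (A i'.+1 j'); case: (A i' j').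
have cst2 k i j : hole2 k i j -> A i j = A (a k + 6 * N)%N b.
  rewrite /hole2 /hole1 => hh; apply: (hole_const (x := (a k + 6 * N)%N)) => [i' j' h5 h6|i' j' h5 h6||]; last 2 first.
  - by lia.
  - by lia.
  - have : zH z i' j' = 0.
      apply/negbTE/negP => /and3P[iW jW /z_ok]; rewrite /lok /lH pt1 // pt2 // => /andP[_ /negP[]].
      by apply/andP; split; apply/existsP; exists k; apply/orP; right; rewrite /hole2 /hole1; lia.
    rewrite (fill_H (zH z)); case: j' h6 => [|j'] h6; first by lia.
    by rewrite /= -/A; case: (A i' j'.+1); case: (A i' j').
  - have : zV z i' j' = 0.
      apply/negbTE/negP => /and3P[iW jW /z_ok]; rewrite /lok /lV pt1 // pt2 // => /andP[_ /negP[]].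
      by apply/andP; split; apply/existsP; exists k; apply/orP; right; rewrite /hole2 /hole1; lia.
    rewrite (fill_V cyc); case: i' h5 => [|i'] h5; first by lia.
    by rewrite /= -/A; case: (A i'.+1 j'); case: (A i' j').
(* One rim for each filled hole of the pair; two of them cancel. *)
exists [ffun k => A (a k) b + A (a k + 6 * N)%N b].
have -> : z + \sum_(k | [ffun k => A (a k) b + A (a k + 6 * N)%N b] k) rims k =
  \sum_(p : node | A p.1 p.2 && ~~ hole p.1 p.2) fbd (inl p) +
  \sum_(k | A (a k + 6 * N)%N b) (rims k + sqs (hole2 k)).
  have eq1 : z = \sum_(p : node | A p.1 p.2 && ~~ hole p.1 p.2) fbd (inl p) +
     \sum_(p : node | A p.1 p.2 && hole p.1 p.2) sq p.1 p.2.
    rewrite {1}zE /sqs (bigID (fun p : node => hole p.1 p.2)) /= addrC; congr (_ + _).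
    apply: eq_bigr => p /andP[Ap hp]; have /andP[p1 p2] := A_in A_out Ap.
    by rewrite /fbd p1 p2 hp.
  have eq2 : \sum_(p : node | A p.1 p.2 && hole p.1 p.2) sq p.1 p.2 =
     \sum_(k | A (a k) b) rims k + \sum_(k | A (a k + 6 * N)%N b) sqs (hole2 k).
    rewrite [X in X + _]big_mkcond [X in _ + X]big_mkcond -big_split /=.
    transitivity (\sum_(k : 'I_h) \sum_(p : node | A p.1 p.2 && (hole1 k p.1 p.2 || hole2 k p.1 p.2)) sq p.1 p.2).
      rewrite (exchange_big_dep (fun p : node => A p.1 p.2 && hole p.1 p.2)) /=; last first.
        by move=> k p _ /andP[-> hk]; apply/existsP; exists k.
      apply: eq_bigr => p /andP[Ap /existsP[k hk]].
      rewrite (bigD1 k) ?Ap //= big1 ?addr0 // => k' /andP[hk' /negP[]].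
      by apply/eqP; exact: hole_sep hk' hk.
    apply: eq_bigr => k _; rewrite (bigID (fun p : node => hole1 k p.1 p.2)) /=; congr (_ + _).
      transitivity (\sum_(p : node | A (a k) b && hole1 k p.1 p.2) sq p.1 p.2).
        apply: eq_bigl => p; case h1: (hole1 k _ _); rewrite ?andbF ?andbT //=.
        by rewrite (cst1 k).
      by case: (A (a k) b) => //=; rewrite big_pred0.
    transitivity (\sum_(p : node | A (a k + 6 * N)%N b && hole2 k p.1 p.2) sq p.1 p.2).
      apply: eq_bigl => p; case h2: (hole2 k _ _); rewrite ?andbF ?orbF ?orbT ?andbT //=.
        rewrite (cst2 k) //; case h1: (hole1 _ _ _); rewrite ?andbT //.
        by move: h1 h2; rewrite /hole2 /hole1; lia.
      by case: (hole1 _ _ _); rewrite ?andbF.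
    by case: (A _ b) => //=; rewrite big_pred0.
  rewrite {1}eq1 -!addrA; congr (_ + _); rewrite eq2 big_split /=.
  rewrite addrAC; congr (_ + _).
  rewrite ![\sum_(k | _) rims k]big_mkcond -big_split /=; apply: eq_bigr => k _.
  by rewrite ffunE; case: (A (a k) b); case: (A _ b); rewrite /= ?addr0 ?add0r ?ffun_addxx.
apply: spannedD; first by apply: spanned_sum => p _; exact: spanned_face.
apply: spanned_sum => k _; rewrite rims_mirror; apply: spanned_sum => l _; exact: spanned_face.
Qed.


Lemma lok_rim k l : onrim k l -> lok l && lok (lmir k l).
Proof.
have aW := a_W k; have ag := a_gt0 k.
case: l => [[[] p]|//]; rewrite /onrim /lok /lmir /lH /lV => onp.
- have m1 : (mir k p.1.+1 <= W)%N by move: onp; rewrite /onH /mir; lia.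
  rewrite pt1 // pt2 ?node2_le //.
  have nh i j : (j == b) || (j == b + N)%N -> ~~ (hole i j && hole i j.-1).
    move=> jb; apply/negP => /andP[/existsP[k1 h1] /existsP[k2 h2]].
    by move: jb h1 h2; rewrite /hole2 /hole1; lia.
  move: onp; rewrite /onH => /and3P[h1 h2 h3]; rewrite !nh // !andbT.
  by rewrite /mir; lia.
- have m1 : (mir k p.1 <= W)%N by move: onp; rewrite /onV /mir; lia.
  rewrite pt1 // pt2 ?node2_le //.
  have nh i j : [|| i == a k, i == a k + N, i == a k + 6 * N | i == a k + 7 * N]%N ->
     ~~ (hole i j && hole i.-1 j).
    move=> ik; apply/negP => /andP[/existsP[k1 h1] /existsP[k2 h2]].
    have e1 : k1 = k.
      apply/eqP; apply: contraT => /a_sep; move: ik h1; rewrite /hole2 /hole1; lia.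
    have e2 : k2 = k.
      apply/eqP; apply: contraT => /a_sep; move: ik h2; rewrite /hole2 /hole1; lia.
    by subst; move: ik h1 h2; rewrite /hole2 /hole1; lia.
  move: onp; rewrite /onV => /and3P[h1 h2 h3].
  rewrite !nh; last 2 first.
  - by move: h3; rewrite /mir; lia.
  - by lia.
  by lia.
Qed.

Lemma rim_inc k l (u : node) : onrim k l -> inc lsrc ltgt l u -> rim k u.1 u.2.
Proof.
have aW := a_W k; rewrite /inc => onl /bool_add_or.
case: l onl => [[[] p]|//] /= onp /orP[/eqP <-|/eqP <-]; move: onp.
- by rewrite /onH /rim; lia.
- move=> onp; have /andP[pW _] := onH_W onp; rewrite pt1 // pt2 ?node2_le //.
  by move: onp; rewrite /onH /rim; lia.
- by rewrite /onV /rim; lia.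
- move=> onp; have /andP[_ pW] := onV_W onp; rewrite pt2 // pt1 ?node1_le //.
  by move: onp; rewrite /onV /rim; lia.
Qed.

Lemma fbd_ok f l : fbd f l -> lok l.
Proof.
case: f => [p|[k l']]; rewrite /fbd.
  case: ifP => [/and3P[p1 p2 hp]|_]; last by rewrite ffunE.
  have [p1' p2'] := (ltnW p1, ltnW p2).
  rewrite /sq link4E.
  have h1 (x : link) : (l == x) -> lok x -> lok l by move/eqP->.
  have e1 : lok (lH p.1 p.2) by rewrite /= pt1 // pt2 // p1 (negPf hp).
  have e2 : lok (lH p.1 p.2.+1) by rewrite /= pt1 // pt2 // p1 /= (negPf hp) andbF.
  have e3 : lok (lV p.1 p.2) by rewrite /= pt1 // pt2 // p2 (negPf hp).
  have e4 : lok (lV p.1.+1 p.2) by rewrite /= pt1 // pt2 // p2 /= (negPf hp) andbF.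
  by move/bool_add_or => /orP[/bool_add_or/orP[]|/bool_add_or/orP[]] /h1; apply.
case: ifP => [onl|_]; last by rewrite ffunE.
case/andP: (lok_rim onl) => o1 o2.
rewrite link2E => /bool_add_or/orP[/bool_add_or/orP[/eqP->|/eqP->]|] //.
by rewrite ffunE; case: l => // -[k' u] /andP[/eqP <- /(rim_inc onl)].
Qed.

Lemma rim_connect k (u : node) : rim k u.1 u.2 ->
  connect (linked lsrc ltgt (onrim k)) (pt (a k) b) u.
Proof.
have aW := a_W k.
have stepH i j : onH k i j -> connect (linked lsrc ltgt (onrim k)) (pt i j) (pt i.+1 j).
  move=> h1; have /andP[iW jW] := onH_W h1; apply: connect1; apply/existsP; exists (lH i j).
  by rewrite ltgt_H ?(ltnW iW) // /lsrc !eqxx andbT /= pt1 ?(ltnW iW) // pt2 // h1.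
have stepV i j : onV k i j -> connect (linked lsrc ltgt (onrim k)) (pt i j) (pt i j.+1).
  move=> h1; have /andP[iW jW] := onV_W h1; apply: connect1; apply/existsP; exists (lV i j).
  by rewrite ltgt_V ?(ltnW jW) // /lsrc !eqxx andbT /= pt1 // pt2 ?(ltnW jW) // h1.
have row j d : (j == b) || (j == b + N)%N -> (d <= N)%N ->
    connect (linked lsrc ltgt (onrim k)) (pt (a k) j) (pt (a k + d) j).
  move=> jb; elim: d => [|d IHd] dN; first by rewrite addn0.
  apply: connect_trans (IHd _) _; first lia.
  by rewrite addnS; apply: stepH; rewrite /onH; lia.
have col i d : (i == a k) || (i == a k + N)%N -> (d <= N)%N ->
    connect (linked lsrc ltgt (onrim k)) (pt i b) (pt i (b + d)).
  move=> jb; elim: d => [|d IHd] dN; first by rewrite addn0.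
  apply: connect_trans (IHd _) _; first lia.
  by rewrite addnS; apply: stepV; rewrite /onV; lia.
rewrite /rim => hu; rewrite -(ptK u).
have e1 : nat_of_ord u.1 = (a k + (u.1 - a k))%N by lia.
have e2 : nat_of_ord u.2 = (b + (u.2 - b))%N by lia.
have [ua|ua] := eqVneq (nat_of_ord u.1) (a k); first by rewrite ua e2; apply: col; lia.
have [uN|uN] := eqVneq (nat_of_ord u.1) (a k + N)%N.
  apply: (connect_trans (y := pt (a k + N) b)); first by apply: row; lia.
  by rewrite uN e2; apply: col; lia.
have [ub|ub] := eqVneq (nat_of_ord u.2) b; first by rewrite ub e1; apply: row; lia.
apply: (connect_trans (y := pt (a k) (b + N))); first by apply: col; lia.
have -> : nat_of_ord u.2 = (b + N)%N by lia.
by rewrite e1; apply: row; lia.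
Qed.

(** The intersection number with the belt of tube [k]: how often, modulo two, a cycle runs through
    the tube. *)
Definition rung_parity (z : {ffun link -> bool}) : {ffun 'I_h -> bool} :=
  [ffun k => \sum_(p : node) z (inr (k, p))].

(** An even number of feet on a rim bounds a chain [d k] of rim edges. The quadrilaterals over this
    chain carry exactly the rungs of [z], so adding them leaves a cycle of the plane grid. *)
Lemma even_spanned (z : {ffun link -> bool}) :
  (forall l, z l -> lok l) -> (forall u, bnd lsrc ltgt z u = 0) ->
  rung_parity z = 0 ->
  exists c : {ffun 'I_h -> bool}, spanned fbd (z + \sum_(k | c k) rims k).
Proof.
move=> z_ok z_cyc z_even.
have ex_d (k : 'I_h) : exists d : {ffun link -> bool}, (forall l, d l -> onrim k l) /\
    forall u, bnd lsrc ltgt d u = z (inr (k, u)).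
  pose cl (u : node) := if rim k u.1 u.2 then Some tt else None.
  apply: (@even_chain _ _ lsrc ltgt (onrim k) unit cl (fun u => z (inr (k, u)))).
  - move=> u v; rewrite /cl; case: ifP => // ru; case: ifP => // rv _ _.
    apply: (connect_trans (y := pt (a k) b)); last exact: rim_connect.
    rewrite (sym_connect_sym (e := linked lsrc ltgt (onrim k))); first exact: rim_connect.
    by move=> x y; apply: eq_existsb => l; rewrite orbC.
  - move=> u; rewrite /cl; case: ifP => // ru _; apply/negbTE/negP => /z_ok /=.
    by rewrite ru.
  - move=> []; have := congr1 (fun f : {ffun 'I_h -> bool} => f k) z_even.
    rewrite !ffunE => e; rewrite -[RHS]e [RHS](bigID (fun u => cl u == Some tt)) /=.
    rewrite [X in _ + X]big1 ?addr0 // => u; rewrite /cl; case: ifP => // ru _.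
    by apply/negbTE/negP => /z_ok /=; rewrite ru.
have [d dP] := fin_all_exists ex_d.
pose y := \sum_(k : 'I_h) \sum_(l | d k l) fbd (inr (k, l)).
have y_sp : spanned fbd y.
  by apply: spanned_sum => k _; apply: spanned_sum => l _; exact: spanned_face.
have [||| c csp] := @flat_spanned (z + y).
- move=> l; rewrite ffun_addE => /bool_add_or/orP[/z_ok//|].
  rewrite /y sum_ffunE => yl; apply: contraT => nl; move: yl.
  rewrite big1 // => k _; rewrite sum_ffunE big1 // => l' _.
  by apply/negbTE/negP => /fbd_ok; rewrite (negPf nl).
- move=> k p; rewrite ffun_addE /y sum_ffunE (bigD1 k) //= [X in _ + (_ + X)]big1 ?addr0.
    rewrite -(proj2 (dP k)) sum_ffunE [X in _ + X]big_mkcond /bnd -big_split /= big1 // => l _.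
    case dl: (d k l); last by rewrite mul0r.
    have onl := proj1 (dP k) _ dl; rewrite mul1r /fbd onl link2E ffunE eqxx /=.
    by case: l onl {dl} => [[[] q]|//] _; rewrite !add0r bool_addxx.
  move=> k' kk'; rewrite sum_ffunE big1 // => l dl.
  have onl := proj1 (dP k') _ dl; rewrite /fbd onl link2E ffunE (negPf kk') /=.
  by case: l onl {dl} => [[[] q]|//].
- move=> u; rewrite bndD z_cyc add0r /y bnd_sum big1 // => k _.
  by rewrite bnd_sum big1 // => l _; rewrite fbd_cycle.
exists c; have -> : z + \sum_(k | c k) rims k = z + y + \sum_(k | c k) rims k + y.
  by rewrite [RHS]addrAC -[z + y + y]addrA ffun_addxx addr0.
exact: spannedD.
Qed.

(** Two bits for each tube: the rung parity, and the coefficient of the rim after a standard cycle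
    of the same parity has been added. The coefficients are chosen cycle by cycle; equal values give
    homologous cycles, and that is all the counting asks for. *)
Theorem grid_classes : exists cls : {ffun link -> bool} ->
    ({ffun 'I_h -> bool} * {ffun 'I_h -> bool})%type,
  forall z1 z2 : {ffun link -> bool},
  (forall l, z1 l -> lok l) -> (forall l, z2 l -> lok l) ->
  (forall u, bnd lsrc ltgt z1 u = 0) -> (forall u, bnd lsrc ltgt z2 u = 0) ->
  cls z1 = cls z2 -> exists A : {ffun face -> bool}, z1 + z2 = \sum_(f | A f) fbd f.
Proof.
pose good (z : {ffun link -> bool}) :=
  [forall l, z l ==> lok l] && [forall u, bnd lsrc ltgt z u == 0].
have goodP (z : {ffun link -> bool}) : (forall l, z l -> lok l) ->
    (forall u, bnd lsrc ltgt z u = 0) -> good z.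
  move=> h1 h2; apply/andP; split; first by apply/forallP => l; apply/implyP/h1.
  by apply/forallP => u; rewrite h2.
have goodD (z z' : {ffun link -> bool}) : good z -> good z' -> good (z + z').
  move=> /andP[/forallP h1 /forallP h2] /andP[/forallP h3 /forallP h4]; apply: goodP.
    by move=> l; rewrite ffun_addE => /bool_add_or/orP[/(implyP (h1 l))|/(implyP (h3 l))].
  by move=> u; rewrite bndD (eqP (h2 u)) (eqP (h4 u)).
have parD (z z' : {ffun link -> bool}) : rung_parity (z + z') = rung_parity z + rung_parity z'.
  by apply/ffunP => k; rewrite !ffunE -big_split /=; apply: eq_bigr => p _; rewrite ffun_addE.
(* A fixed cycle for each parity that occurs. The default [0] is not reached from a cycle, which
   realises its own parity. *)
pose rep (e : {ffun 'I_h -> bool}) : {ffun link -> bool} :=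
  odflt 0 [pick z | good z && (rung_parity z == e)].
have repP z : good z -> good (z + rep (rung_parity z)) /\ rung_parity (z + rep (rung_parity z)) = 0.
  move=> gz; rewrite /rep; case: pickP => [z' /andP[gz' /eqP pz']|/(_ z)] /=; last by rewrite gz eqxx.
  by split; [exact: goodD | rewrite parD pz' ffun_addxx].
have ex_c (z : {ffun link -> bool}) : exists c : {ffun 'I_h -> bool}, good z ->
    spanned fbd (z + rep (rung_parity z) + \sum_(k | c k) rims k).
  case gz: (good z); last by exists 0.
  have [/andP[/forallP h1 /forallP h2] h3] := repP z gz.
  have [|||c cP] := @even_spanned (z + rep (rung_parity z)) => //.
  - by move=> l; exact: (implyP (h1 l)).
  - by move=> u; exact: (eqP (h2 u)).
  by exists c.
have [c cP] := fin_all_exists ex_c.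
exists (fun z => (rung_parity z, c z)) => z1 z2 ok1 ok2 cy1 cy2 [e1 e2].
have s1 := cP z1 (goodP _ ok1 cy1); have s2 := cP z2 (goodP _ ok2 cy2).
have := spannedD s1 s2; rewrite e1 e2; move: (rep _) (\sum_(k | _) _) => x y.
have -> // : z1 + x + y + (z2 + x + y) = z1 + z2.
apply/ffunP => l; rewrite !ffun_addE; move: (z1 l) (z2 l) (x l) (y l).
by do 4 case.
Qed.

End HoledGrid.

End GridHomology.

(** * From drawings to minors through fine closed covers *)

Module FineCovers.
Import Chains.

Section BranchSets.
Variables (N L : finType) (l0 : L) (s t : L -> N) (ok : pred L).
Variables (n : nat) (E : {set {set 'I_n}}) (Br : 'I_n -> {set N}) (P : {set 'I_n} -> {set N}).

Definition linkin (A : {set N}) : rel N :=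
  fun x y => [&& x \in A, y \in A & linked s t ok x y].

Hypothesis E2 : forall e, e \in E -> #|e| = 2.
Hypothesis Br_conn : forall i x y, x \in Br i -> y \in Br i -> connect (linkin (Br i)) x y.
Hypothesis P_conn : forall e x y, e \in E -> x \in P e -> y \in P e -> connect (linkin (P e)) x y.
Hypothesis Br_disj : forall i j x, x \in Br i -> x \in Br j -> i = j.
Hypothesis P_disj : forall e f x, e \in E -> f \in E -> x \in P e -> x \in P f -> e = f.
Hypothesis P_Br : forall e i x, e \in E -> x \in P e -> x \in Br i -> i \in e.
Hypothesis P_meet : forall e i, e \in E -> i \in e -> exists x, (x \in P e) && (x \in Br i).

Lemma linked_sym (Y : pred L) x y : linked s t Y x y = linked s t Y y x.
Proof. by apply: eq_existsb => l; rewrite orbC. Qed.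

(** For an edge [e] with ends [a] and [b], the part of [P e] that is reached from [Br a] without
    entering [Br b] is annexed to the branch set of [a]. A link by which [P e] leaves this part must
    enter [Br b], and it represents [e]. *)
Lemma minor_of_sets : exists (br : N -> option 'I_n) (lk : {set 'I_n} -> L),
  [/\ forall u v i, br u = Some i -> br v = Some i ->
        connect (linked s t (fun l => [&& ok l, br (s l) == Some i & br (t l) == Some i])) u v,
      forall e, e \in E -> ok (lk e) &
      forall e, e \in E -> exists i j,
        [/\ br (s (lk e)) = Some i, br (t (lk e)) = Some j & e = [set i; j]%SET]].
Proof.
have ends (e : {set 'I_n}) : exists p : option ('I_n * 'I_n), e \in E ->
    exists a b, p = Some (a, b) /\ e = [set a; b]%SET /\ a != b.
  case eE: (e \in E); last by exists None.
  have /eqP/cards2P[a [b [ab ->]]] := E2 eE.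
  by exists (Some (a, b)) => _; exists a, b.
have [p pP] := fin_all_exists ends.
have base (e : {set 'I_n}) : exists x : option N, forall a b, e \in E -> p e = Some (a, b) ->
    exists y, x = Some y /\ (y \in P e) && (y \in Br a).
  case eE: (e \in E); last by exists None.
  have [a [b [pe [eab ab]]]] := pP _ eE.
  have [|x xP] := @P_meet e a eE; first by rewrite eab !inE eqxx.
  by exists (Some x) => a' b' _; rewrite pe => -[<- _]; exists x.
have [n0 n0P] := fin_all_exists base.
pose A e : {set N} := if (p e, n0 e) is (Some (a, b), Some x)
  then [set y | connect (linkin (P e :\: Br b)) x y] else finset.set0.
have AE e a b x : p e = Some (a, b) -> n0 e = Some x ->
    A e = [set y | connect (linkin (P e :\: Br b)) x y].
  by rewrite /A => -> ->.
have A_sub e a b x : e \in E -> p e = Some (a, b) -> x \in A e -> x \in P e :\: Br b.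
  move=> eE pe; have [y [ny /andP[yP yB]]] := n0P _ _ _ eE pe.
  rewrite (AE _ _ _ _ pe ny) inE => /connectP[q qp ->].
  have [a' [b' [pe' [eab ab]]]] := pP _ eE; move: pe'; rewrite pe => -[? ?]; subst a' b'.
  have : y \in P e :\: Br b.
    by rewrite inE yP andbT; apply: contra ab => /(Br_disj yB) ->.
  by elim: q y qp {ny yP yB} => [|z q IHq] y //= /andP[/and3P[_ zP _]] /IHq h _; exact: h.
pose br (x : N) : option 'I_n :=
  if [pick i | x \in Br i] is Some i then Some i else
  if [pick e | (e \in E) && (x \in A e)] is Some e then omap fst (p e) else None.
have br_Br i x : x \in Br i -> br x = Some i.
  move=> xi; rewrite /br; case: pickP => [j xj|/(_ i)]; last by rewrite xi.
  by rewrite (Br_disj xi xj).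
have br_A e a b x : e \in E -> p e = Some (a, b) -> x \in A e -> br x = Some a.
  move=> eE pe xA; have := A_sub _ _ _ _ eE pe xA; rewrite inE => /andP[xb xP].
  have [a' [b' [pe' [eab ab]]]] := pP _ eE; move: pe'; rewrite pe => -[? ?]; subst a' b'.
  rewrite /br; case: pickP => [j xj|_].
    have := P_Br eE xP xj; rewrite eab !inE => /orP[/eqP->//|/eqP jb].
    by rewrite jb in xj; rewrite xj in xb.
  case: pickP => [f /andP[fE xf]|/(_ e)]; last by rewrite eE xA.
  have [a' [b' [pf _]]] := pP _ fE.
  have := A_sub _ _ _ _ fE pf xf; rewrite inE => /andP[_ xPf].
  by rewrite -(P_disj eE fE xP xPf) pe.
have br_inv x i : br x = Some i -> x \in Br i \/ exists e a b,
    [/\ e \in E, p e = Some (a, b), x \in A e & i = a].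
  rewrite /br; case: pickP => [j xj [<-]|_]; first by left.
  case: pickP => [e /andP[eE xe]|//]; have [a [b [pe _]]] := pP _ eE.
  by rewrite pe /= => -[<-]; right; exists e, a, b.
pose Rel i := linked s t (fun l => [&& ok l, br (s l) == Some i & br (t l) == Some i]).
have RelS i : connect_sym (Rel i) by apply: sym_connect_sym => x y; exact: linked_sym.
have Rel1 i x y : br x = Some i -> br y = Some i -> linked s t ok x y -> Rel i x y.
  move=> bx ry /existsP[l /andP[okl xy]]; apply/existsP; exists l; rewrite xy okl andbT /=.
  by case/orP: xy => /andP[/eqP-> /eqP->]; rewrite bx ry !eqxx.
have connBr i x y : x \in Br i -> y \in Br i -> connect (Rel i) x y.
  move=> xi yi; have := Br_conn xi yi; apply: connect_sub => u v /and3P[ui vi uv].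
  by apply: connect1; apply: Rel1 => //; exact: br_Br.
have connA e a b x : e \in E -> p e = Some (a, b) -> x \in A e ->
    exists2 y, y \in Br a & connect (Rel a) y x.
  move=> eE pe xA; have [y [ny /andP[yP yB]]] := n0P _ _ _ eE pe; exists y => //.
  move: xA; rewrite (AE _ _ _ _ pe ny) inE => /connectP[q qp ->].
  have yA : y \in A e by rewrite (AE _ _ _ _ pe ny) inE.
  elim: q (y) yA qp => [|z q IHq] u uA //= /andP[uz] qp.
  have zA : z \in A e.
    by move: uA; rewrite !(AE _ _ _ _ pe ny) !inE => uA; apply: connect_trans uA (connect1 uz).
  apply: connect_trans (IHq _ zA qp); apply: connect1.
  by apply: Rel1; [exact: (br_A _ _ _ _ eE pe uA) | exact: (br_A _ _ _ _ eE pe zA) | case/and3P: uz].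
have toBr i x : br x = Some i -> exists2 y, y \in Br i & connect (Rel i) y x.
  case/br_inv => [xi|[e [a [b [eE pe xA ->]]]]]; first by exists x.
  exact: connA pe xA.
have lkex (e : {set 'I_n}) : exists l : option L, e \in E -> exists l', l = Some l' /\ ok l' /\
   exists i j, [/\ br (s l') = Some i, br (t l') = Some j & e = [set i; j]%SET].
  case eE: (e \in E); last by exists None.
  have [a [b [pe [eab ab]]]] := pP _ eE.
  have [y [ny /andP[yP yB]]] := n0P _ _ _ eE pe.
  have [|w /andP[wP wB]] := @P_meet e b eE; first by rewrite eab !inE eqxx orbT.
  have yA : y \in A e by rewrite (AE _ _ _ _ pe ny) inE.
  have wA : w \notin A e.
    by apply/negP => /(A_sub _ _ _ _ eE pe); rewrite inE wB.
  have /connectP[q qp wq] := P_conn eE yP wP.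
  have [u [v [uA vA uv]]] : exists u v, [/\ u \in A e, v \notin A e & linkin (P e) u v].
    elim: q y {ny yP yB} yA qp wq => [|z q IHq] u uA /=.
      by move=> _ wu; rewrite wu uA in wA.
    case/andP => uz qp wz; case zA: (z \in A e); first exact: IHq zA qp wz.
    by exists u, z; rewrite zA.
  have vb : v \in Br b.
    case/and3P: uv => uP vP uv; apply: contraT => vB.
    move: vA; rewrite (AE _ _ _ _ pe ny) inE => /negP[]; move: (uA).
    rewrite (AE _ _ _ _ pe ny) inE => h; apply: connect_trans h (connect1 _).
    by apply/and3P; split => //; [exact: (A_sub _ _ _ _ eE pe uA) | rewrite inE vB].
  have bu := br_A _ _ _ _ eE pe uA; have bv := br_Br _ _ vb.
  case/and3P: uv => _ _ /existsP[l /andP[okl /orP[/andP[/eqP sl /eqP tl]|/andP[/eqP sl /eqP tl]]]].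
    by exists (Some l) => _; exists l; do 2 split => //; exists a, b; rewrite sl tl.
  exists (Some l) => _; exists l; do 2 split => //; exists b, a; rewrite sl tl; split => //.
  by rewrite finset.setUC.
have [lk lkP] := fin_all_exists lkex.
exists br, (fun e => odflt l0 (lk e)); split=> [u v i bu bv|e eE|e eE].
- have [x xi xu] := toBr _ _ bu; have [y yi yv] := toBr _ _ bv.
  by apply: connect_trans (connect_trans _ (connBr _ _ _ xi yi)) yv; rewrite RelS.
- by have [l' [-> [okl _]]] := lkP _ eE.
- by have [l' [-> [_ h]]] := lkP _ eE.
Qed.

End BranchSets.

Local Open Scope classical_set_scope.
Local Open Scope ring_scope.

(** The nerve argument: the pieces reached from [q] and the remaining ones have closed unions that
    are disjoint on [K], and [K], being connected, lies in the first union. *)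
Lemma closed_cover_connected (T : topologicalType) (K : set T) (Q : finType) (F : Q -> set T) :
  connected K -> (forall q, closed (F q)) -> (forall x, K x -> exists q, F q x) ->
  forall q q', (F q `&` K) !=set0 -> (F q' `&` K) !=set0 ->
  connect (fun p p' => `[< (F p `&` K) !=set0 >] && `[< (F p' `&` K) !=set0 >] &&
     `[< (F p `&` F p') !=set0 >]) q q'.
Proof.
move=> Kc Fc Kcov q q' [x [Fx Kx]] [x' [Fx' Kx']].
set e := (fun p p' : Q => _).
pose U := \bigcup_(p in [set p | connect e q p]) F p.
pose V := \bigcup_(p in [set p | ~~ connect e q p]) F p.
have Uc : closed U by apply: closed_bigcup => //; exact: finite_finset.
have Vc : closed V by apply: closed_bigcup => //; exact: finite_finset.
have KUV y : K y -> ~ (U y /\ V y).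
  move=> Ky [[p /= qp Fp] [p' /= /negP qp' Fp']]; apply: qp'.
  apply: connect_trans qp (connect1 _); rewrite /e.
  by apply/andP; split; [apply/andP; split|]; apply/asboolP; exists y.
have KU : K `&` U = K.
  apply: Kc.
  - by exists x; split => //; exists q => //=; exact: connect0.
  - exists (~` V); first by rewrite openC.
    apply/seteqP; split=> y /= [Ky].
      by move=> Uy; split=> // Vy; exact: (KUV y Ky).
    move=> nV; split=> //; have [p Fp] := Kcov _ Ky; exists p => //=.
    by apply: contrapT => /negP np; apply: nV; exists p.
  - by exists U.
have [_ [p /= qp Fp]] : (K `&` U) x' by rewrite KU.
apply: connect_trans qp (connect1 _).
by rewrite /e; apply/andP; split; [apply/andP; split|]; apply/asboolP; exists x'.
Qed.

(** Each point of [K] has a ball avoiding [K'], and compactness makes the radius uniform. The filter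
    on [d] allows finitely many gaps to be combined into one. *)
Lemma compact_gap (R : realType) (T : pseudoMetricType R) (K K' : set T) :
  compact K -> closed K' -> (forall x, K x -> ~ K' x) ->
  \forall d \near (0 : R)^'+, forall x y, K x -> K' y -> ~ ball x d y.
Proof.
move=> /compact_near_coveringP cK cK' dis.
have := cK R (0 : R)^'+ (fun d x => forall y, K' y -> ~ ball x d y) _.
move=> /(_ _) h; apply: filterS (h _) => [d Kd x y Kx K'y|x Kx]; first exact: Kd.
have : nbhs x (~` K') by apply: open_nbhs_nbhs; split; [rewrite openC | exact: dis].
rewrite -nbhs_ballE => -[r /= r0 rK].
exists (ball x (r / 2), [set d | d < r / 2]) => /=.
  split; first by apply: nbhsx_ballx; rewrite divr_gt0.
  by apply: nbhs_right_lt; rewrite divr_gt0.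
move=> [x' d] /= [xx' dr] y K'y x'y; apply: (rK y) K'y.
by apply: ball_split xx' _; apply: le_ball x'y; exact: ltW.
Qed.

Section EmbeddedSets.
Variables (R : realType) (T : pseudoMetricType R) (S : set T) (n : nat) (G : sgraph n).
Variables (v : 'I_n -> T) (c : {set 'I_n} -> R -> T).
Hypothesis T_haus : hausdorff_space T.
Hypothesis v_inj : injective v.
Hypothesis vS : forall i, S (v i).
Hypothesis c_arc : forall e, e \in edges G ->
  [/\ {within `[0, 1], continuous (c e)}, {in `[0, 1] &, injective (c e)},
      c e @` `[0, 1] `<=` S, [set c e 0; c e 1] = v @` [set i | i \in e] &
      forall (t : R) i, t \in `]0, 1[ -> c e t <> v i].
Hypothesis c_dis : forall e f, e \in edges G -> f \in edges G -> e <> f ->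
  forall s t : R, s \in `]0, 1[ -> t \in `]0, 1[ -> c e s <> c f t.

(** [None] gives the vertex itself, [Some (e, b)] the third of [e] next to its parameter [0] if [b]
    holds and next to [1] otherwise. *)
Let arc (o : option ({set 'I_n} * bool)) (i : 'I_n) : set T :=
  if o is Some (e, b) then c e @` (if b then `[0, 1/3]%classic else `[2/3, 1]%classic)
  else [set v i].
Let own (i : 'I_n) (o : option ({set 'I_n} * bool)) : Prop :=
  if o is Some (e, b) then e \in edges G /\ v i = c e (if b then 0 else 1) else True.

(** Edges with a common vertex touch, so they have no positive distance. Cut into thirds, the
    drawing becomes a family of compact connected sets: stars are pairwise disjoint, middles are
    pairwise disjoint, and a middle meets only the stars of its two ends. This pattern survives a
    small thickening. *)
Definition star i : set T := \bigcup_(o in own i) arc o i.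
Definition middle e : set T := c e @` `[1/3, 2/3].

Lemma sub_continuous e (a b : R) : e \in edges G -> 0 <= a -> b <= 1 ->
  {within `[a, b], continuous (c e)}.
Proof.
move=> /c_arc[ce _ _ _ _] a0 b1; apply: continuous_subspaceW ce => x /=.
by rewrite !in_itv /= => /andP[ax xb]; rewrite (le_trans a0 ax) (le_trans xb b1).
Qed.

Lemma third_lt : (1/3 : R) < 2/3.
Proof. by rewrite ltr_pM2r ?invr_gt0 ?ltr0n // ltr1n. Qed.

Lemma third_gt0 : (0 : R) < 1/3.
Proof. by rewrite divr_gt0. Qed.

Lemma twothird_lt1 : (2/3 : R) < 1.
Proof. by rewrite ltr_pdivrMr ?ltr0n // mul1r ltr_nat. Qed.

Lemma third_contra (x : R) : x <= 1/3 -> 2/3 <= x -> False.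
Proof. by move=> h1 h2; have := third_lt; lra. Qed.

Lemma one_third_contra : (1 : R) <= 1/3 -> False.
Proof. by move=> h1; have := third_lt; have := twothird_lt1; lra. Qed.

Lemma twothird_contra : (2/3 : R) <= 0 -> False.
Proof. by move=> h1; have := third_lt; have := third_gt0; lra. Qed.

Lemma arc_connected i o : own i o -> connected (arc o i).
Proof.
case: o => [[e [|]]|] /=.
- move=> [eE _]; apply: connected_continuous_connected; first exact: segment_connected.
  by apply: sub_continuous => //; rewrite (le_trans (ltW third_lt)) ?ltW ?twothird_lt1.
- move=> [eE _]; apply: connected_continuous_connected; first exact: segment_connected.
  by apply: sub_continuous => //; rewrite divr_ge0.
- by move=> _; exact: connected1.
Qed.

Lemma arc_compact i o : own i o -> compact (arc o i).
Proof.
case: o => [[e [|]]|] /=.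
- move=> [eE _]; apply: continuous_compact; last exact: segment_compact.
  by apply: sub_continuous => //; rewrite (le_trans (ltW third_lt)) ?ltW ?twothird_lt1.
- move=> [eE _]; apply: continuous_compact; last exact: segment_compact.
  by apply: sub_continuous => //; rewrite divr_ge0.
- by move=> _; exact: compact_set1.
Qed.

Lemma arc_base i o : own i o -> arc o i (v i).
Proof.
case: o => [[e [|]]|//] /= [_ ->]; [exists 0 | exists 1] => //=; rewrite in_itv /= lexx ?andbT /=.
  exact: ltW third_gt0.
exact: ltW twothird_lt1.
Qed.

Lemma star_connected i : connected (star i).
Proof.
apply: bigcup_connected => [|o]; last exact: arc_connected.
by exists (v i) => o; exact: arc_base.
Qed.

Lemma star_compact i : compact (star i).
Proof.
rewrite /star.
have -> : \bigcup_(o in own i) arc o i =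
   \big[setU/set0]_(o : option ({set 'I_n} * bool)) (if `[< own i o >] then arc o i else set0).
  rewrite -bigcup_seq; apply/seteqP; split=> x [w wi xw].
    by exists w => /=; [rewrite mem_index_enum | rewrite asboolT].
  by move: xw; case: asboolP => // wi' xw; exists w.
elim/big_rec: _ => [|o X _ cX]; first exact: compact0.
apply: compactU => //; case: asboolP => [/arc_compact//|_]; exact: compact0.
Qed.

Lemma middle_connected e : e \in edges G -> connected (middle e).
Proof.
move=> eE; apply: connected_continuous_connected; first exact: segment_connected.
by apply: sub_continuous => //; exact: ltW twothird_lt1.
Qed.

Lemma middle_compact e : e \in edges G -> compact (middle e).
Proof.
move=> eE; apply: continuous_compact; last exact: segment_compact.
by apply: sub_continuous => //; exact: ltW twothird_lt1.
Qed.

Lemma star_sub i : star i `<=` S.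
Proof.
move=> x [[[e b]|] /= oi]; last by move=> ->; exact: vS.
move=> [t tI <-]; have [_ _ cS _ _] := c_arc oi.1; apply: cS; exists t => //=.
move: b tI {oi} => [] /=; rewrite !in_itv /= => /andP[h1 h2]; apply/andP; split => //.
  by rewrite (le_trans h2) // (le_trans (ltW third_lt)) ?ltW ?twothird_lt1.
by rewrite (le_trans _ h1) // divr_ge0.
Qed.

Lemma middle_sub e : e \in edges G -> middle e `<=` S.
Proof.
move=> /c_arc[_ _ cS _ _] x [t tI <-]; apply: cS; exists t => //=.
move: tI => /=; rewrite !in_itv /= => /andP[h1 h2]; apply/andP; split.
  exact: le_trans (ltW third_gt0) h1.
exact: le_trans h2 (ltW twothird_lt1).
Qed.

Lemma meet_cases e f (s t : R) : e \in edges G -> f \in edges G ->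
  s \in `[0, 1] -> t \in `[0, 1] -> c e s = c f t ->
  (e = f /\ s = t) \/ ((s = 0 \/ s = 1) /\ (t = 0 \/ t = 1)).
Proof.
move=> eE fE sI tI cst.
have [_ cinj _ cends cv] := c_arc eE; have [_ _ _ fends fv] := c_arc fE.
have endv e' (r : R) : e' \in edges G -> r = 0 \/ r = 1 -> exists i, c e' r = v i.
  move=> /c_arc[_ _ _ ends _] h; have : [set c e' 0; c e' 1] (c e' r) by case: h => ->; [left|right].
  by rewrite ends => -[i _ <-]; exists i.
have split01 (r : R) : r \in `[0, 1] -> (r \in `]0, 1[) \/ (r = 0 \/ r = 1).
  rewrite !in_itv /= => /andP[r0 r1].
  have [->|r0'] := eqVneq r 0; first by right; left.
  have [->|r1'] := eqVneq r 1; first by right; right.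
  by left; rewrite !lt_neqAle r0 r1 r1' eq_sym r0'.
have [ef|ef] := pselect (e = f).
  by left; split => //; subst f; exact: (cinj _ _ sI tI cst).
case: (split01 _ sI) => hs; case: (split01 _ tI) => ht.
- by have := c_dis eE fE ef hs ht.
- by have [i ci] := endv _ _ fE ht; have := cv _ i hs; rewrite cst ci.
- by have [i ci] := endv _ _ eE hs; have := fv _ i ht; rewrite -cst ci.
- by right.
Qed.


Lemma star_inv i x : star i x -> x = v i \/ exists e (s : R) b,
  [/\ e \in edges G, v i = c e (if b then 0 else 1), x = c e s &
      s \in (if b then `[0, 1/3]%R else `[2/3, 1]%R)].
Proof.
move=> [[[e b]|] /= oi]; last by left.
move=> [s sI <-]; right; exists e, s, b; split; [exact: oi.1 | exact: oi.2 | by []|].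
by move: sI; case: (b).
Qed.

Lemma unit_of_third (b : bool) (s : R) : s \in (if b then `[0, 1/3]%R else `[2/3, 1]%R) ->
  s \in `[0, 1]%R.
Proof.
have h1 := third_lt; have h2 := third_gt0; have h3 := twothird_lt1.
by case: b; rewrite !in_itv /= => /andP[? ?]; apply/andP; split; lra.
Qed.

Lemma unit_of_middle (s : R) : s \in `[1/3, 2/3]%R -> (s \in `]0, 1[%R) && (s \in `[0, 1]%R).
Proof.
have h1 := third_lt; have h2 := third_gt0; have h3 := twothird_lt1.
by rewrite !in_itv /= => /andP[? ?]; apply/andP; split; apply/andP; split; lra.
Qed.

Lemma vertex_param e i (s : R) : e \in edges G -> s \in `[0, 1]%R -> c e s = v i -> s = 0 \/ s = 1.
Proof.
move=> eE sI csv; have [_ _ _ _ cv] := c_arc eE.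
have [s0|s0] := eqVneq s 0; first by left.
have [s1|s1] := eqVneq s 1; first by right.
exfalso; apply: (cv s i) => //; move: sI; rewrite !in_itv /= => /andP[h0 h1].
by rewrite !lt_neqAle h0 h1 s1 eq_sym s0.
Qed.

Lemma star_disjoint i j x : i != j -> star i x -> ~ star j x.
Proof.
move=> ij /star_inv si /star_inv sj.
have main k e (s : R) b : e \in edges G -> v k = c e (if b then 0 else 1) ->
    s \in (if b then `[0, 1/3]%R else `[2/3, 1]%R) -> (s = 0 \/ s = 1) -> c e s = v k.
  case: b => _ ->; rewrite !in_itv /= => /andP[h4 h5] [] s01; subst s => //; exfalso.
    exact: one_third_contra h5.
  exact: twothird_contra h4.
case: si => [xi|[e [s [b [eE ie xs sI]]]]]; case: sj => [xj|[f [t [b' [fE jf xt tI]]]]].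
- by move/eqP: ij; apply; apply: v_inj; rewrite -xi -xj.
- have cft : c f t = v i by rewrite -xt.
  have := vertex_param fE (unit_of_third tI) cft => h.
  by move/eqP: ij; apply; apply: v_inj; rewrite -cft (main _ _ _ _ fE jf tI h).
- have cft : c e s = v j by rewrite -xs.
  have := vertex_param eE (unit_of_third sI) cft => h.
  by move/eqP: ij; apply; apply: v_inj; rewrite -cft (main _ _ _ _ eE ie sI h).
- have cc : c e s = c f t by rewrite -xs -xt.
  case: (meet_cases eE fE (unit_of_third sI) (unit_of_third tI) cc) => [[ef st]|[hs ht]].
    have bb : b = b'.
      move: sI tI; rewrite st.
      case: (b); case: (b'); rewrite !in_itv /= => // /andP[h1 h2] /andP[h3 h4]; exfalso.
        exact: third_contra h2 h3.
      exact: third_contra h4 h1.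
    by move/eqP: ij; apply; apply: v_inj; rewrite ie jf ef bb.
  by move/eqP: ij; apply; apply: v_inj; rewrite -(main _ _ _ _ eE ie sI hs) cc (main _ _ _ _ fE jf tI ht).
Qed.

Lemma middle_disjoint e f x : e \in edges G -> f \in edges G -> e != f ->
  middle e x -> ~ middle f x.
Proof.
move=> eE fE /eqP ef [s /= sI xs] [t /= tI xt].
have /andP[s1 _] := unit_of_middle sI; have /andP[t1 _] := unit_of_middle tI.
by apply: (c_dis eE fE ef s1 t1); rewrite xs xt.
Qed.

Lemma middle_star e i x : e \in edges G -> middle e x -> star i x -> i \in e.
Proof.
move=> eE [s /= sI xs] /star_inv si; have /andP[s1 s2] := unit_of_middle sI.
have [_ _ _ ends cv] := c_arc eE.
case: si => [xi|[f [t [b [fE ifv xt tI]]]]]; first by case: (cv s i s1); rewrite xs xi.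
have cc : c e s = c f t by rewrite xs xt.
case: (meet_cases eE fE s2 (unit_of_third tI) cc) => [[ef st]|[hs _]].
  have : (v @` [set k | k \in e]) (v i).
    by rewrite -ends ifv -ef; case: (b); [left | right].
  by case=> k /= ke /v_inj <-.
by exfalso; move: s1; rewrite in_itv /= => /andP[]; case: hs => ->; rewrite ?ltxx.
Qed.

Lemma middle_meets e i : e \in edges G -> i \in e -> exists x, middle e x /\ star i x.
Proof.
move=> eE ie; have [_ _ _ ends _] := c_arc eE.
have h1 := third_lt; have h2 := third_gt0; have h3 := twothird_lt1.
have : [set c e 0; c e 1] (v i) by rewrite ends; exists i.
case=> [vi|vi].
  exists (c e (1/3)); split; first by exists (1/3) => //=; rewrite in_itv /= lexx ltW.
  by exists (Some (e, true)) => //=; exists (1/3) => //=; rewrite in_itv /= lexx ltW.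
exists (c e (2/3)); split; first by exists (2/3) => //=; rewrite in_itv /= lexx ltW.
by exists (Some (e, false)) => //=; exists (2/3) => //=; rewrite in_itv /= lexx ltW.
Qed.

Lemma embed_gap : exists2 d : R, 0 < d &
  [/\ forall i j x y, i != j -> star i x -> star j y -> ~ ball x d y,
      forall e f x y, e \in edges G -> f \in edges G -> e != f ->
        middle e x -> middle f y -> ~ ball x d y &
      forall e i x y, e \in edges G -> i \notin e -> middle e x -> star i y -> ~ ball x d y].
Proof.
have clo (K : set T) : compact K -> closed K := compact_closed T_haus.
have g1 (p : 'I_n * 'I_n) : \forall d \near (0 : R)^'+,
    p.1 != p.2 -> forall x y, star p.1 x -> star p.2 y -> ~ ball x d y.
  case: (boolP (p.1 != p.2)) => [ne|_]; last exact: nearW.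
  have := compact_gap (@star_compact p.1) (clo _ (@star_compact p.2)) (fun x => star_disjoint ne).
  by apply: filterS => d h _.
have g2 (p : {set 'I_n} * {set 'I_n}) : \forall d \near (0 : R)^'+,
    p.1 \in edges G -> p.2 \in edges G -> p.1 != p.2 ->
    forall x y, middle p.1 x -> middle p.2 y -> ~ ball x d y.
  case: (boolP (p.1 \in edges G)) => [e1|_]; last exact: nearW.
  case: (boolP (p.2 \in edges G)) => [e2|_]; last exact: nearW.
  case: (boolP (p.1 != p.2)) => [ne|_]; last exact: nearW.
  have := compact_gap (middle_compact e1) (clo _ (middle_compact e2)) (fun x => middle_disjoint e1 e2 ne).
  by apply: filterS => d h _.
have g3 (p : {set 'I_n} * 'I_n) : \forall d \near (0 : R)^'+,
    p.1 \in edges G -> p.2 \notin p.1 ->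
    forall x y, middle p.1 x -> star p.2 y -> ~ ball x d y.
  case: (boolP (p.1 \in edges G)) => [e1|_]; last exact: nearW.
  case: (boolP (p.2 \notin p.1)) => [ne|_]; last exact: nearW.
  have := compact_gap (middle_compact e1) (clo _ (@star_compact p.2))
    (fun x mx sx => negP ne (middle_star e1 mx sx)).
  by apply: filterS => d h _.
have G1 := filter_forall _ g1; have G2 := filter_forall _ g2; have G3 := filter_forall _ g3.
near (0 : R)^'+ => d.
have h1 : forall p : 'I_n * 'I_n, p.1 != p.2 -> forall x y, star p.1 x -> star p.2 y -> ~ ball x d y.
  by near: d; apply: G1.
have h2 : forall p : {set 'I_n} * {set 'I_n}, p.1 \in edges G -> p.2 \in edges G -> p.1 != p.2 ->
    forall x y, middle p.1 x -> middle p.2 y -> ~ ball x d y by near: d; apply: G2.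
have h3 : forall p : {set 'I_n} * 'I_n, p.1 \in edges G -> p.2 \notin p.1 ->
    forall x y, middle p.1 x -> star p.2 y -> ~ ball x d y by near: d; apply: G3.
exists d; first by near: d; exact: nbhs_right_gt.
split=> [i j x y ij|e f x y eE fE ef|e i x y eE ie].
- exact: (h1 (i, j)).
- exact: (h2 (e, f)).
- exact: (h3 (e, i)).
Unshelve. all: by end_near. Qed.

End EmbeddedSets.

(* A cover of S by finitely many closed pieces of diameter less than d, each
   labelled by a connected set of nodes of a graph which carries a
   two-dimensional complex with at most 2 ^ (2 * h) homology classes, so that
   pieces meet only if their labels are joined. *)
Definition fine_cover (R : realType) (T : pseudoMetricType R) (S : set T) (h : nat) (d : R) :=
  exists (N L F K Q : finType) (l0 : L) (s t : L -> N) (bd : F -> {ffun L -> bool})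
    (cls : {ffun L -> bool} -> K) (ok : pred L) (pc : Q -> set T) (nd : Q -> {set N}),
  [/\ [/\ #|K| = (2 ^ (2 * h))%N,
      forall l, (#|[set f | bd f l]%SET| <= 2)%N,
      forall f u, bnd s t (bd f) u = 0 &
      forall z1 z2 : {ffun L -> bool},
        (forall l, z1 l -> ok l) -> (forall l, z2 l -> ok l) ->
        (forall u, bnd s t z1 u = 0) -> (forall u, bnd s t z2 u = 0) ->
        cls z1 = cls z2 -> exists A : {ffun F -> bool}, z1 + z2 = \sum_(f | A f) bd f],
      [/\ forall q, closed (pc q), forall x, S x -> exists q, pc q x &
          forall q x y, pc q x -> pc q y -> ball x d y] &
      [/\ forall q, exists x, x \in nd q,
          forall q q', pc q `&` pc q' !=set0 -> forall x y, x \in nd q -> y \in nd q' ->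
            connect (linkin s t ok (nd q :|: nd q')) x y &
          forall q q' x, x \in nd q -> x \in nd q' -> pc q `&` pc q' !=set0]].

(** Each star and middle is replaced by the nodes of the pieces it hits. Diameter [d / 2] suffices
    for a gap [d]: pieces with a common node meet, and two pieces in a row cannot bridge the gap.
    Connected sets give connected node sets by the nerve argument. *)
Theorem fine_cover_edge_bound (R : realType) (T : pseudoMetricType R) (S : set T)
    (n : nat) (G : sgraph n) (h : nat) :
  hausdorff_space T -> (forall d : R, 0 < d -> fine_cover S h d) -> embeds_in R S G ->
  (#|edges G| <= 3 * n + 6 * h)%N.
Proof.
move=> T_haus cov [v [c [v_inj vS c_arc c_dis]]].
have [d d0 [gap1 gap2 gap3]] := embed_gap T_haus v_inj c_arc c_dis.
have [|N [L [F [K [Q [l0 [s [t [bd [cls [ok [pc [nd [hom [pcc pcS pcd] [ndn nda nds]]]]]]]]]]]]]]] :=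
  cov (d / 2); first by rewrite divr_gt0.
have [cardK bd2 bdc clsP] := hom.
have E2 e : e \in edges G -> #|e| = 2%N.
  by move=> eG; have := valP G; rewrite -/(edges G) => /forall_inP /(_ e eG) /eqP.
pose hit (X : set T) : {set N} := [set x | `[< exists q, (pc q `&` X) !=set0 /\ x \in nd q >]]%SET.
have hitP (X : set T) x : x \in hit X -> exists q, (pc q `&` X) !=set0 /\ x \in nd q.
  by rewrite inE => /asboolP.
have hit_in (X : set T) q x : (pc q `&` X) !=set0 -> x \in nd q -> x \in hit X.
  by move=> qX xq; rewrite inE; apply/asboolP; exists q.
have hit_gap (X Y : set T) x : (forall a b, X a -> Y b -> ~ ball a d b) ->
    x \in hit X -> x \in hit Y -> False.
  move=> gap /hitP[q [[a [qa Xa]] xq]] /hitP[q' [[b [qb Yb]] xq']].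
  have [w [qw q'w]] := nds _ _ _ xq xq'.
  by apply: (gap a b Xa Yb); apply: ball_split (pcd _ _ _ qa qw) (pcd _ _ _ q'w qb).
have hit_conn (X : set T) : connected X -> X `<=` S ->
    forall x y, x \in hit X -> y \in hit X -> connect (linkin s t ok (hit X)) x y.
  move=> Xc XS x y /hitP[q [qX xq]] /hitP[q' [q'X yq']].
  have Xcov z : X z -> exists p, pc p z by move=> /XS /pcS.
  have /connectP[p pp q'p] := closed_cover_connected Xc pcc Xcov qX q'X.
  have stepc q1 q2 : (pc q1 `&` X) !=set0 -> (pc q2 `&` X) !=set0 -> (pc q1 `&` pc q2) !=set0 ->
      forall x y, x \in nd q1 -> y \in nd q2 -> connect (linkin s t ok (hit X)) x y.
    move=> h1 h2 h12 a b a1 b2; have := nda _ _ h12 _ _ a1 b2.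
    apply: connect_sub => a' b' /and3P[a'q b'q ab']; apply: connect1; apply/and3P; split => //.
      by move: a'q; rewrite inE => /orP[]; exact: hit_in.
    by move: b'q; rewrite inE => /orP[]; exact: hit_in.
  elim: p q qX x xq pp q'p => [|q1 p IHp] q qX x xq /=.
    move=> _ q'q; subst q'; apply: (stepc q q) => //.
    by case: qX => w [qw _]; exists w.
  case/andP => /andP[/andP[_ /asboolP q1X] /asboolP qq1] pp q'p.
  have [w wq1] := ndn q1.
  by apply: connect_trans (stepc _ _ qX q1X qq1 _ _ xq wq1) (IHp q1 q1X w wq1 pp q'p).
pose Br i := hit (star G v c i); pose P e := hit (middle c e).
have [br [lk [br_conn lk_ok lkP]]] : exists (br : N -> option 'I_n) (lk : {set 'I_n} -> L),
  [/\ forall u v i, br u = Some i -> br v = Some i ->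
        connect (linked s t (fun l => [&& ok l, br (s l) == Some i & br (t l) == Some i])) u v,
      forall e, e \in edges G -> ok (lk e) &
      forall e, e \in edges G -> exists i j,
        [/\ br (s (lk e)) = Some i, br (t (lk e)) = Some j & e = [set i; j]%SET]].
  apply: (@minor_of_sets N L l0 s t ok n (edges G) Br P) => //.
  - move=> i; apply: hit_conn; first exact: (star_connected c_arc).
    exact: (star_sub vS c_arc).
  - move=> e x y eE; apply: hit_conn; first exact: (middle_connected c_arc).
    exact: (middle_sub c_arc).
  - move=> i j x xi xj; apply/eqP; apply: contraT => ij.
    by case: (hit_gap _ _ _ _ xi xj) => a b; exact: gap1.
  - move=> e f x eE fE xe xf; apply/eqP; apply: contraT => ef.
    by case: (hit_gap _ _ _ _ xe xf) => a b; exact: gap2.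
  - move=> e i x eE xe xi; apply: contraT => ie.
    by case: (hit_gap _ _ _ _ xe xi) => a b; exact: gap3.
  - move=> e i eE ie; have [w [mw sw]] := middle_meets c_arc eE ie.
    have [q qw] := pcS _ (middle_sub c_arc eE mw); have [x xq] := ndn q.
    by exists x; apply/andP; split; apply: (hit_in _ q) => //; exists w.
exact: (minor_edge_bound bd2 bdc clsP E2 br_conn lk_ok lkP cardK).
Qed.

End FineCovers.

(** * Coordinates on the ball with solid handles *)

Module SolidHandles.
Local Open Scope classical_set_scope.
Local Open Scope ring_scope.

Section Surface.
Variables (R : realType) (h : nat).
Notation point := (R * R * R)%type.

Definition rad : R := (4 * h + 1)%:R.
(** [mid] and [roof] are the centre of the arch: a solid handle is the product of [0 <= y <= 1] with
    the region [z >= 0], [1 / 2 <= max(|x - mid k|, z - roof) <= 3 / 2]. That maximum is the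
    parameter [xi] used below. *)
Definition mid (k : nat) : R := 4 * k%:R + 3 / 2.
Definition roof : R := 4 * h%:R + 3 / 2.
Definition solid : set point := @solid_ball R h `|` \bigcup_(i in `I_h) @solid_handle R h i.

Lemma radE : rad = 4 * h%:R + 1.
Proof. by rewrite /rad natrD natrM. Qed.

Lemma handleE k (x y z : R) : @solid_handle R h k (x, y, z) <->
  [/\ `|x - mid k| <= 3 / 2, 0 <= y <= 1, 0 <= z <= roof + 3 / 2 &
      1 / 2 <= `|x - mid k| \/ roof + 1 / 2 <= z].
Proof.
rewrite /solid_handle /mid /roof /=.
have e1 : ((4 * k)%:R = 4 * k%:R :> R) by rewrite natrM.
have e2 : ((4 * k + 1)%:R = 4 * k%:R + 1 :> R) by rewrite natrD natrM.
have e3 : ((4 * k + 2)%:R = 4 * k%:R + 2 :> R) by rewrite natrD natrM.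
have e4 : ((4 * k + 3)%:R = 4 * k%:R + 3 :> R) by rewrite natrD natrM.
have e5 : ((4 * h + 2)%:R = 4 * h%:R + 2 :> R) by rewrite natrD natrM.
have e6 : ((4 * h + 3)%:R = 4 * h%:R + 3 :> R) by rewrite natrD natrM.
rewrite e1 e2 e3 e4 e5 e6; move: (k%:R) (h%:R) => K H.
split=> -[].
  move=> /andP[x1 x2] /andP[y1 y2] /andP[z1 z2] d; split.
  - by rewrite ler_norml; apply/andP; split; lra.
  - by rewrite y1.
  - by apply/andP; split; lra.
  - case: d => d; [left|left|right]; rewrite ?ler_normr; try (apply/orP; (by left; lra) || (right; lra)); lra.
rewrite ler_norml => /andP[x1 x2] /andP[y1 y2] /andP[z1 z2] d; split.
- by apply/andP; split; lra.
- by rewrite y1.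
- by apply/andP; split; lra.
- case: d; last by move=> d; apply: Or33; lra.
  by rewrite ler_normr => /orP[d|d]; [apply: Or32 | apply: Or31]; lra.
Qed.

Lemma px_cont : continuous (fun p : point => p.1.1).
Proof. by move=> p; apply: (@continuous_comp _ _ _ fst fst); exact: cvg_fst. Qed.
Lemma py_cont : continuous (fun p : point => p.1.2).
Proof. by move=> p; apply: (@continuous_comp _ _ _ fst snd); [exact: cvg_fst | exact: cvg_snd]. Qed.
Lemma pz_cont : continuous (fun p : point => p.2).
Proof. by move=> p; exact: cvg_snd. Qed.

Lemma pn_cont : continuous (fun p : point => p.1.1 ^+ 2 + p.1.2 ^+ 2 + p.2 ^+ 2).
Proof.
move=> p; apply: cvgD; first apply: cvgD.
- by apply: (@cvgM R _ _ _ (fun p : point => p.1.1) (fun p : point => p.1.1)); exact: px_cont.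
- by apply: (@cvgM R _ _ _ (fun p : point => p.1.2) (fun p : point => p.1.2)); exact: py_cont.
- by apply: (@cvgM R _ _ _ (fun p : point => p.2) (fun p : point => p.2)); exact: pz_cont.
Qed.

Lemma pabs_cont (c : R) : continuous (fun p : point => `|p.1.1 - c|).
Proof.
move=> p; apply: (@continuous_comp _ _ _ (fun p : point => p.1.1 - c) (fun x => `|x|)).
  by apply: cvgB; [exact: px_cont | exact: cvg_cst].
exact: norm_continuous.
Qed.

Lemma closed_le_fun (f : point -> R) (c : R) : continuous f -> closed [set p | f p <= c].
Proof.
by move=> fc; apply: (@closed_comp _ _ f [set x | x <= c]) => [p _|]; [exact: fc | exact: closed_le].
Qed.

Lemma closed_ge_fun (f : point -> R) (c : R) : continuous f -> closed [set p | c <= f p].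
Proof.
by move=> fc; apply: (@closed_comp _ _ f [set x | c <= x]) => [p _|]; [exact: fc | exact: closed_ge].
Qed.

Lemma open_lt_fun (f : point -> R) (c : R) : continuous f -> open [set p | f p < c].
Proof. by move=> fc; apply: (@open_comp _ _ f [set x | x < c]) => [p _|]; [exact: fc | exact: open_lt]. Qed.

Lemma open_gt_fun (f : point -> R) (c : R) : continuous f -> open [set p | c < f p].
Proof. by move=> fc; apply: (@open_comp _ _ f [set x | c < x]) => [p _|]; [exact: fc | exact: open_gt]. Qed.

Lemma solid_closed : closed solid.
Proof.
apply: closedU.
  have -> : @solid_ball R h = [set p : point | p.1.1 ^+ 2 + p.1.2 ^+ 2 + p.2 ^+ 2 <= rad ^+ 2].
    by apply/seteqP; split=> -[[x y] z].
  by apply: closed_le_fun; exact: pn_cont.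
apply: closed_bigcup => [|k _]; first exact: finite_II.
have -> : @solid_handle R h k =
   [set p : point | `|p.1.1 - mid k| <= 3 / 2] `&` ([set p : point | 0 <= p.1.2] `&` [set p : point | p.1.2 <= 1]) `&`
   ([set p : point | 0 <= p.2] `&` [set p : point | p.2 <= roof + 3 / 2]) `&`
   ([set p : point | 1 / 2 <= `|p.1.1 - mid k|] `|` [set p : point | roof + 1 / 2 <= p.2]).
  apply/seteqP; split=> -[[x y] z].
    by move=> /handleE[? /andP[? ?] /andP[? ?] ?].
  by move=> [[[/= ? [? ?]] [? ?]] ?]; apply/handleE; split=> //; apply/andP.
apply: closedI; last apply: closedU.
- apply: closedI; first apply: closedI; first by apply: closed_le_fun; exact: pabs_cont.
  + by apply: closedI; [apply: closed_ge_fun | apply: closed_le_fun]; exact: py_cont.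
  + by apply: closedI; [apply: closed_ge_fun | apply: closed_le_fun]; exact: pz_cont.
- by apply: closed_ge_fun; exact: pabs_cont.
- by apply: closed_ge_fun; exact: pz_cont.
Qed.

Lemma surfaceE p : @sphere_with_handles R h p <-> solid p /\ ~ interior solid p.
Proof.
rewrite /sphere_with_handles /frontier -/solid.
by have /closure_id <- := solid_closed.
Qed.

(* A point of tube number k: [xi] and [y] locate its foot, the part of the
   tube over the mirror images [mid k - xi] and [mid k + xi]. *)
Definition ontube (k : nat) (xi : R) (p : point) : Prop :=
  [/\ 1 / 2 <= xi <= 3 / 2, 0 <= p.1.2 <= 1,
      [\/ xi = 1 / 2, xi = 3 / 2, p.1.2 = 0 | p.1.2 = 1],
      rad ^+ 2 <= p.1.1 ^+ 2 + p.1.2 ^+ 2 + p.2 ^+ 2 /\ 0 < p.2 &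
      (`|p.1.1 - mid k| = xi /\ p.2 <= roof + xi) \/
      (`|p.1.1 - mid k| <= xi /\ p.2 = roof + xi)].

Definition onsphere (p : point) : Prop :=
  p.1.1 ^+ 2 + p.1.2 ^+ 2 + p.2 ^+ 2 = rad ^+ 2 /\
  forall k, (k < h)%N -> 0 < p.2 -> 0 < p.1.2 < 1 ->
    ~ (1 / 2 < `|p.1.1 - mid k| < 3 / 2).

Lemma mid_bound k : (k < h)%N -> 3 / 2 <= mid k <= 4 * h%:R - 5 / 2.
Proof.
move=> kh; have : (k%:R + 1 <= h%:R :> R) by rewrite natr1 ler_nat.
have : 0 <= k%:R :> R by [].
by rewrite /mid => ? ?; apply/andP; split; lra.
Qed.

(** All feet lie strictly inside the equatorial disc: the farthest ones have [x <= 4 * h - 1] and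
    [y <= 1], against the radius [4 * h + 1]. *)
Lemma foot_in_ball k (x y : R) : (k < h)%N -> `|x - mid k| <= 3 / 2 -> 0 <= y <= 1 ->
  0 <= x /\ x ^+ 2 + y ^+ 2 < rad ^+ 2.
Proof.
move=> kh; have /andP[m1 m2] := mid_bound kh.
rewrite ler_norml => /andP[x1 x2] /andP[y1 y2]; rewrite radE.
have h1 : 1 <= h%:R :> R by rewrite ler1n; apply: leq_ltn_trans kh.
by move: (h%:R) (mid k) h1 m1 m2 x1 x2 => H M h1 m1 m2 x1 x2; split; nra.
Qed.

(** A frontier point lies in no open subset of the solid. Outside the ball this confines it to the
    border of the cross-section of a handle; on the sphere it excludes the open feet, above which
    the leg continues the solid. *)
Lemma surface_cases p : @sphere_with_handles R h p ->
  onsphere p \/ exists k xi, (k < h)%N /\ ontube k xi p.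
Proof.
case: p => [[x y] z] /surfaceE[sp nint].
have interior_of (U : set point) : open U -> U `<=` solid -> U (x, y, z) -> False.
  move=> oU US Up; apply: nint; rewrite /interior; apply: filterS US _.
  exact: open_nbhs_nbhs.
pose nrm := x ^+ 2 + y ^+ 2 + z ^+ 2.
have n1 : rad ^+ 2 <= nrm.
  rewrite leNgt; apply/negP => lt.
  apply: (interior_of [set p : point | p.1.1 ^+ 2 + p.1.2 ^+ 2 + p.2 ^+ 2 < rad ^+ 2]) => //.
    by apply: open_lt_fun; exact: pn_cont.
  by move=> [[x' y'] z'] /= /ltW lt'; left.
have inside k : (k < h)%N -> 0 < y < 1 -> 0 < z < roof + 3 / 2 -> `|x - mid k| < 3 / 2 ->
    1 / 2 < `|x - mid k| \/ roof + 1 / 2 < z -> False.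
  move=> kh /andP[y1 y2] /andP[z1 z2] x1 dd.
  apply: (interior_of ([set p : point | `|p.1.1 - mid k| < 3 / 2] `&`
    ([set p : point | 0 < p.1.2] `&` [set p : point | p.1.2 < 1]) `&`
    ([set p : point | 0 < p.2] `&` [set p : point | p.2 < roof + 3 / 2]) `&`
    ([set p : point | 1 / 2 < `|p.1.1 - mid k|] `|` [set p : point | roof + 1 / 2 < p.2]))).
  - apply: openI; last apply: openU.
    + apply: openI; first apply: openI; first by apply: open_lt_fun; exact: pabs_cont.
      * by apply: openI; [apply: open_gt_fun | apply: open_lt_fun]; exact: py_cont.
      * by apply: openI; [apply: open_gt_fun | apply: open_lt_fun]; exact: pz_cont.
    + by apply: open_gt_fun; exact: pabs_cont.
    + by apply: open_gt_fun; exact: pz_cont.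
  - move=> [[x' y'] z'] [[[/= ? [? ?]] [? ?]] dd']; right; exists k => //.
    apply/handleE; split; [exact: ltW | by apply/andP; split; exact: ltW..|].
    by case: dd' => dd'; [left|right]; exact: ltW.
  - by do !split.
have [n2|n2] := eqVneq nrm (rad ^+ 2).
  left; split=> //= k kh z0 y01 /andP[x1 x2]; apply: (inside k) => //; last by left.
  have /andP[y0 y1] := y01.
  have zr : z <= rad.
    have r0 : 0 <= rad by [].
    rewrite -(@ler_sqr R) ?nnegrE ?(ltW z0) //.
    by rewrite -n2 /nrm; nra.
  by rewrite z0 /= (le_lt_trans zr) // radE /roof; lra.
have {n2}n2 : rad ^+ 2 < nrm by rewrite lt_neqAle eq_sym n2.
case: sp => [/= sb|[k /= kh /handleE[x1 /andP[y1 y2] /andP[z1 z2] dd]]].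
  by move: n2; rewrite ltNge sb.
right; have y12 : 0 <= y <= 1 by rewrite y1.
have [x0 fb] := foot_in_ball kh x1 y12.
have z0 : 0 < z by move: n2; rewrite /nrm => n2; rewrite lt_neqAle z1 andbT; apply/eqP => z0; rewrite -z0 in n2; nra.
exists k, (Num.max `|x - mid k| (z - roof)); split=> //; split=> //=.
- apply/andP; split; last by rewrite ge_max x1 /=; lra.
  by rewrite le_max; case: dd => dd; apply/orP; [left | right; lra].
- have [->|y0'] := eqVneq y 0; first by apply: Or43.
  have [->|y1'] := eqVneq y 1; first by apply: Or44.
  have [e1|e1] := eqVneq (Num.max `|x - mid k| (z - roof)) (1 / 2); first exact: Or41.
  have [e2|e2] := eqVneq (Num.max `|x - mid k| (z - roof)) (3 / 2); first exact: Or42.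
  exfalso; apply: (inside k) => //.
  + by rewrite !lt_neqAle y1 y2 y1' eq_sym y0'.
  + rewrite z0 /= lt_neqAle z2 andbT; apply/eqP => zE; move/eqP: e2; apply.
    by rewrite zE addrAC subrr add0r; apply/max_idPr.
  + rewrite lt_neqAle x1 andbT; apply/eqP => xE; move/eqP: e2; apply.
    by rewrite xE; apply/max_idPl; lra.
  + have : 1 / 2 < Num.max `|x - mid k| (z - roof).
      rewrite lt_neqAle eq_sym e1 le_max; case: dd => dd; apply/orP; [left | right; lra] => //.
    by rewrite lt_max => /orP[|zz]; [left | right; lra].
- have [le1|le1] := leP (z - roof) `|x - mid k|; first by left; split=> //; lra.
  by right; split; [exact: ltW | lra].
Qed.


(* The point at height s (0 at the foot, 1 half way over the arch) on the
   generator of tube number k which starts at (mid k + sg * xi, y), for sg = -1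
   (first foot) or 1 (second foot). *)
Definition foot_z (x y : R) : R := Num.sqrt (rad ^+ 2 - x ^+ 2 - y ^+ 2).

Definition tubept (k : nat) (sg xi y s : R) : point :=
  (mid k + sg * (xi * (1 - Num.max 0 (2 * s - 1))), y,
   foot_z (mid k + sg * xi) y +
     Num.min 1 (2 * s) * (roof + xi - foot_z (mid k + sg * xi) y)).

Section TubePoint.
Variables (k : nat) (sg xi y s : R).
Hypotheses (kh : (k < h)%N) (sg1 : `|sg| = 1).
Hypotheses (xi1 : 1 / 2 <= xi <= 3 / 2) (y1 : 0 <= y <= 1) (s1 : 0 <= s <= 1).

Lemma foot_near : `|mid k + sg * xi - mid k| <= 3 / 2.
Proof.
rewrite addrAC subrr add0r normrM sg1 mul1r ger0_norm; first by case/andP: xi1.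
by case/andP: xi1 => ? _; lra.
Qed.

Lemma foot_z_gt0 : 0 < foot_z (mid k + sg * xi) y.
Proof.
have [_ fb] := foot_in_ball kh foot_near y1.
by rewrite sqrtr_gt0 -addrA -opprD subr_gt0.
Qed.

Lemma foot_z_sqr : (mid k + sg * xi) ^+ 2 + y ^+ 2 + foot_z (mid k + sg * xi) y ^+ 2 = rad ^+ 2.
Proof.
have [_ fb] := foot_in_ball kh foot_near y1.
rewrite sqr_sqrtr; last by rewrite -addrA -opprD subr_ge0 ltW.
ring.
Qed.

Lemma foot_z_le : foot_z (mid k + sg * xi) y <= rad.
Proof.
rewrite -(@ler_sqr R) ?nnegrE ?(ltW foot_z_gt0) // -foot_z_sqr lerDr addr_ge0 ?sqr_ge0 //.
Qed.

Lemma foot_z_top : foot_z (mid k + sg * xi) y < roof + xi.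
Proof. by apply: le_lt_trans foot_z_le _; rewrite radE /roof; case/andP: xi1; lra. Qed.

Lemma tubept_x : `|(tubept k sg xi y s).1.1 - mid k| = xi * (1 - Num.max 0 (2 * s - 1)).
Proof.
rewrite /tubept /= addrAC subrr add0r normrM sg1 mul1r ger0_norm // mulr_ge0 //.
  by case/andP: xi1; lra.
by rewrite subr_ge0 ge_max ler01 /=; case/andP: s1; lra.
Qed.

Lemma tubept_z : foot_z (mid k + sg * xi) y <= (tubept k sg xi y s).2 <= roof + xi.
Proof.
have ft := foot_z_top; rewrite /tubept /= -subr_ge0 addrAC subrr add0r.
have m0 : 0 <= Num.min 1 (2 * s) by rewrite le_min ler01 /=; case/andP: s1; lra.
have m1 : Num.min 1 (2 * s) <= 1 by rewrite ge_min lexx.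
by move: (Num.min 1 (2 * s)) m0 m1 => m m0 m1; apply/andP; split; nra.
Qed.

(** Along the leg the first term attains the maximum, along the bridge the second one. So the point
    alone determines [xi], which starts the proof of injectivity. *)
Lemma tubept_xi : xi = Num.max `|(tubept k sg xi y s).1.1 - mid k| ((tubept k sg xi y s).2 - roof).
Proof.
have /andP[x1 x2] := xi1; have /andP[s0 s2] := s1; have /andP[_ zt] := tubept_z.
apply/le_anti/andP; split.
  have [le|lt] := leP (2 * s) 1.
    rewrite le_max tubept_x; apply/orP; left.
    by rewrite (max_idPl _) ?subr_le0 // subr0 mulr1.
  rewrite le_max; apply/orP; right; rewrite /tubept /=.
  by rewrite (min_idPl (ltW lt)) mul1r; lra.
rewrite ge_max tubept_x; apply/andP; split; last by lra.
rewrite -[leRHS]mulr1 ler_pM2l ?gerBl ?le_max ?lexx //; lra.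
Qed.

Lemma tubept_norm : 0 < s -> rad ^+ 2 < (tubept k sg xi y s).1.1 ^+ 2 +
   (tubept k sg xi y s).1.2 ^+ 2 + (tubept k sg xi y s).2 ^+ 2.
Proof.
move=> s0; have fz := foot_z_sqr; have fg := foot_z_gt0; have ft := foot_z_top.
have [le|lt] := leP (2 * s) 1.
  rewrite /tubept /= (max_idPl _) ?subr_le0 // subr0 mulr1 (min_idPr le) -fz ltrD2l.
  have : 0 < 2 * s * (roof + xi - foot_z (mid k + sg * xi) y) by rewrite mulr_gt0 ?subr_gt0 //; lra.
  by move: (2 * s * _) fg; move: (foot_z _ _) => a b a0 b0; nra.
rewrite /tubept /= (min_idPl (ltW lt)) mul1r addrCA subrr addr0.
have rr : rad < roof + xi by rewrite radE /roof; case/andP: xi1; lra.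
have r0 : 0 <= rad by [].
apply: (@lt_le_trans _ _ ((roof + xi) ^+ 2)); first by rewrite ltr_sqr ?nnegrE //; lra.
by rewrite lerDr addr_ge0 ?sqr_ge0.
Qed.

Lemma tubept_z_gt0 : 0 < (tubept k sg xi y s).2.
Proof. by have /andP[+ _] := tubept_z; apply: lt_le_trans foot_z_gt0. Qed.

Lemma tubept_ball : rad ^+ 2 <= (tubept k sg xi y s).1.1 ^+ 2 +
   (tubept k sg xi y s).1.2 ^+ 2 + (tubept k sg xi y s).2 ^+ 2.
Proof.
have /andP[s0 _] := s1; move: s0; rewrite le_eqVlt => /orP[/eqP s0|/tubept_norm/ltW//].
rewrite /tubept -s0 /= mulr0 (max_idPl _) ?subr_le0 // subr0 mulr1 (min_idPr _) // mul0r addr0.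
by rewrite foot_z_sqr.
Qed.

End TubePoint.

Lemma tubept0 k sg xi y : tubept k sg xi y 0 = (mid k + sg * xi, y, foot_z (mid k + sg * xi) y).
Proof.
by rewrite /tubept mulr0 (max_idPl _) ?subr_le0 // subr0 mulr1 (min_idPr _) // mul0r addr0.
Qed.

Lemma mid_sep k k' (x : R) : `|x - mid k| <= 3 / 2 -> `|x - mid k'| <= 3 / 2 -> k = k'.
Proof.
wlog le : k k' / (k <= k')%N.
  by move=> wl h1 h2; case/orP: (leq_total k k') => le; [|apply/esym]; exact: wl.
move=> h1 h2; apply/eqP; rewrite eqn_leq le /= leqNgt; apply/negP => lt.
have : k%:R + 1 <= k'%:R :> R by rewrite natr1 ler_nat.
by move: h1 h2; rewrite !ler_norml /mid => /andP[? ?] /andP[? ?] ?; lra.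
Qed.

(** The generators that rise from the two feet with the same [xi] and [y] meet at the top [s = 1]
    only; there the sign is lost. *)
Lemma tubept_inj k sg xi y s k' sg' xi' y' s' :
  (k < h)%N -> (k' < h)%N -> `|sg| = 1 -> `|sg'| = 1 ->
  1 / 2 <= xi <= 3 / 2 -> 1 / 2 <= xi' <= 3 / 2 -> 0 <= y <= 1 -> 0 <= y' <= 1 ->
  0 <= s <= 1 -> 0 <= s' <= 1 -> tubept k sg xi y s = tubept k' sg' xi' y' s' ->
  [/\ k = k', xi = xi', y = y', s = s' & sg = sg' \/ s = 1].
Proof.
move=> kh kh' sg1 sg1' x1 x1' y1 y1' s1 s1' eqp.
have near a b c d : `|b| = 1 -> 1 / 2 <= c <= 3 / 2 -> 0 <= d <= 1 ->
    forall e, `|(tubept a b c e d).1.1 - mid a| <= 3 / 2.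
  move=> b1 c1 d1 e; rewrite tubept_x //; have /andP[c2 c3] := c1; apply: le_trans c3.
  by rewrite -[leRHS]mulr1 ler_pM2l ?gerBl ?le_max ?lexx //; lra.
have kk : k = k'.
  apply: (@mid_sep k k' (tubept k sg xi y s).1.1); first exact: near.
  by rewrite eqp; exact: near.
subst k'.
have xx : xi = xi' by rewrite (tubept_xi kh sg1 x1 y1 s1) (tubept_xi kh sg1' x1' y1' s1') eqp.
subst xi'.
have yy : y = y' by have := congr1 (fun p : point => p.1.2) eqp.
subst y'.
have mm : Num.max 0 (2 * s - 1) = Num.max 0 (2 * s' - 1).
  have e1 : `|(tubept k sg xi y s).1.1 - mid k| = xi * (1 - Num.max 0 (2 * s - 1)) by apply: tubept_x.
  have e2 : `|(tubept k sg' xi y s').1.1 - mid k| = xi * (1 - Num.max 0 (2 * s' - 1)) by apply: tubept_x.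
  move: e1; rewrite eqp e2.
  have xi0 : xi != 0 by apply: lt0r_neq0; case/andP: x1; lra.
  by move/(mulfI xi0)/addrI/oppr_inj => ->.
have /andP[s2 s3] := s1; have /andP[s4 s5] := s1'.
have [lt|le] := ltP 1 (2 * s).
  move: mm; rewrite (max_idPr _) ?subr_ge0 ?(ltW lt) // => mm.
  have ss : s = s'.
    by move: mm; have [?|?] := leP (2 * s' - 1) 0 => ?; lra.
  subst s'; split=> //; have [->|sn1] := eqVneq s 1; first by right.
  left; have := congr1 (fun p : point => p.1.1) eqp; rewrite /tubept /= => /addrI.
  apply: mulIf; rewrite mulf_neq0 //; first by apply: lt0r_neq0; case/andP: x1; lra.
  rewrite (max_idPr _) ?subr_ge0 ?(ltW lt) // subr_eq0; apply/eqP => e; move/eqP: sn1; lra.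
have le' : 2 * s' <= 1.
  rewrite leNgt; apply/negP => lt; move: mm.
  by rewrite (max_idPl _) ?subr_le0 // (max_idPr _) ?subr_ge0 ?(ltW lt) // => ?; lra.
have gg : sg = sg'.
  have := congr1 (fun p : point => p.1.1) eqp; rewrite /tubept /=.
  rewrite !(max_idPl _) ?subr_le0 // subr0 mulr1 => /addrI; apply: mulIf.
  by apply: lt0r_neq0; case/andP: x1; lra.
subst sg'; split=> //; last by left.
have := congr1 (fun p : point => p.2) eqp; rewrite /tubept /= => /addrI.
have ft := foot_z_top kh sg1 x1 y1.
move/mulIf; rewrite !(min_idPr _) // => /(_ _) e.
have : 2 * s = 2 * s' by apply: e; rewrite subr_eq0 gt_eqF.
lra.
Qed.

Lemma tubept_cover k xi p : (k < h)%N -> ontube k xi p ->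
  exists sg s, [/\ `|sg| = 1, 0 <= s <= 1 & p = tubept k sg xi p.1.2 s].
Proof.
case: p => [[x y] z] kh [/= x1 y1 bd [nrm z0] tb].
have /andP[x2 x3] := x1.
pose sg : R := if x <= mid k then - 1 else 1.
have sg1 : `|sg| = 1 by rewrite /sg; case: ifP; rewrite ?normrN normr1.
have xE : x = mid k + sg * `|x - mid k|.
  rewrite /sg; case: leP => le; first by rewrite ler0_norm ?subr_le0 //; ring.
  by rewrite gtr0_norm ?subr_gt0 //; ring.
have ft := foot_z_top kh sg1 x1 y1.
case: tb => [[xd zt]|[xd zt]].
  exists sg, ((z - foot_z (mid k + sg * xi) y) / (roof + xi - foot_z (mid k + sg * xi) y) / 2).
  have fz : foot_z (mid k + sg * xi) y <= z.
    have fg := foot_z_gt0 kh sg1 x1 y1.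
    rewrite -(@ler_sqr R) ?nnegrE ?(ltW fg) ?(ltW z0) //; have := foot_z_sqr kh sg1 x1 y1.
    by move: nrm; rewrite {1}xE xd => nrm e; rewrite -(lerD2l ((mid k + sg * xi) ^+ 2 + y ^+ 2)) e.
  have dd : 0 < roof + xi - foot_z (mid k + sg * xi) y by rewrite subr_gt0.
  have q0 : 0 <= (z - foot_z (mid k + sg * xi) y) / (roof + xi - foot_z (mid k + sg * xi) y).
    by rewrite divr_ge0 ?subr_ge0 // ltW.
  have q1 : (z - foot_z (mid k + sg * xi) y) / (roof + xi - foot_z (mid k + sg * xi) y) <= 1.
    by rewrite ler_pdivrMr // mul1r lerD2r.
  split=> //; first by apply/andP; split; lra.
  rewrite /tubept; set q := _ / _ in q0 q1 *; have -> : 2 * (q / 2) = q by field.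
  rewrite (max_idPl _) ?subr_le0 // subr0 mulr1 (min_idPr q1) /q mulfVK ?gt_eqF //.
  by congr (_, _, _); [rewrite {1}xE xd | ring].
(* On the bridge the second half of the parameter measures the way to the plane [x = mid k]. *)
exists sg, ((1 + (1 - `|x - mid k| / xi)) / 2).
have xi0 : 0 < xi by lra.
have q1 : `|x - mid k| / xi <= 1 by rewrite ler_pdivrMr // mul1r.
have q0 : 0 <= `|x - mid k| / xi by rewrite divr_ge0 // ltW.
split=> //; first by apply/andP; split; lra.
rewrite /tubept; set q := _ / _ in q0 q1 *; have -> : 2 * ((1 + (1 - q)) / 2) = 1 + (1 - q) by field.
rewrite (max_idPr _); last by lra.
rewrite (min_idPl _); last by lra.
have -> : 1 - (1 + (1 - q) - 1) = q by ring.
rewrite /q [xi * _]mulrC mulfVK ?gt_eqF // -xE zt; congr (_, _, _); ring.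
Qed.

End Surface.

End SolidHandles.

(** * Charts of the sphere and of the tubes on a plane square *)

Module SphereChart.
Import Chains GridHomology FineCovers SolidHandles.
Local Open Scope classical_set_scope.
Local Open Scope ring_scope.

Section SphereMap.
Variables (R : realType) (h : nat).
Notation point := (R * R * R)%type.
Notation rad := (rad R h).

(** An integer, so that the corners of the feet become grid points, and large enough for the
    equatorial disc to lie well inside the square. *)
Definition boxn : nat := (8 * h + 4)%N.
Definition box : R := boxn%:R.
Definition supn (P : R * R) : R := Num.max `|P.1| `|P.2|.
Definition rho (P : R * R) : R := Num.sqrt (P.1 ^+ 2 + P.2 ^+ 2).
(** Outside the disc this is the distance of the image from the axis: it falls from [rad] on the
    equator to [0] on the border of the square. Inside the disc it stays equal to [rad]. *)
Definition shrink (P : R * R) : R :=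
  rad * (box - supn P) / (box - supn P + Num.max 0 (rho P - rad)).

(* The disc of radius rad is lifted to the upper hemisphere; the rest of the
   square of half side box is wrapped around the lower hemisphere, with the
   boundary of the square sent to the south pole. *)
Definition psis (P : R * R) : point :=
  (P.1 * (shrink P / Num.max (rho P) (shrink P)),
   P.2 * (shrink P / Num.max (rho P) (shrink P)),
   Num.sqrt (rad ^+ 2 - Num.min (rho P) rad ^+ 2) - Num.sqrt (rad ^+ 2 - shrink P ^+ 2)).

Lemma boxE : box = 8 * h%:R + 4.
Proof. by rewrite /box /boxn natrD natrM. Qed.

Lemma rad_ge1 : 1 <= rad.
Proof. by rewrite radE; have : 0 <= h%:R :> R by []; lra. Qed.

Lemma box_rad : 2 * rad < box.
Proof. by rewrite radE boxE; lra. Qed.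

Lemma rho_ge0 P : 0 <= rho P.
Proof. exact: sqrtr_ge0. Qed.

Lemma rho_sqr P : rho P ^+ 2 = P.1 ^+ 2 + P.2 ^+ 2.
Proof. by rewrite sqr_sqrtr // addr_ge0 ?sqr_ge0. Qed.

Lemma rho_scale P (s : R) : 0 < rho P ->
  (P.1 * (s / rho P)) ^+ 2 + (P.2 * (s / rho P)) ^+ 2 = s ^+ 2.
Proof.
move=> q0; have -> : (P.1 * (s / rho P)) ^+ 2 + (P.2 * (s / rho P)) ^+ 2 =
  (P.1 ^+ 2 + P.2 ^+ 2) * (s / rho P) ^+ 2 by ring.
by rewrite -rho_sqr -exprMn mulrCA mulfV ?mulr1 // gt_eqF.
Qed.

Lemma supn_ge0 P : 0 <= supn P.
Proof. by rewrite le_max normr_ge0. Qed.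

Lemma supn_rho P : supn P <= rho P.
Proof.
rewrite ge_max; apply/andP; split.
  rewrite -(@ler_sqr R) ?nnegrE ?normr_ge0 ?rho_ge0 // rho_sqr real_normK ?num_real //.
  by rewrite lerDl sqr_ge0.
rewrite -(@ler_sqr R) ?nnegrE ?normr_ge0 ?rho_ge0 // rho_sqr real_normK ?num_real //.
by rewrite lerDr sqr_ge0.
Qed.

Lemma rho_supn P : rho P <= 2 * supn P.
Proof.
have s0 := supn_ge0 P.
rewrite -(@ler_sqr R) ?nnegrE ?rho_ge0 ?mulr_ge0 // rho_sqr.
have h1 : P.1 ^+ 2 <= supn P ^+ 2.
  by rewrite -real_normK ?num_real // ler_sqr ?nnegrE ?normr_ge0 // le_max lexx.
have h2 : P.2 ^+ 2 <= supn P ^+ 2.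
  by rewrite -(@real_normK _ P.2) ?num_real // ler_sqr ?nnegrE ?normr_ge0 // le_max lexx orbT.
by move: h1 h2; rewrite exprMn; have := sqr_ge0 (supn P); nra.
Qed.

Lemma shrink_den P : supn P <= box -> 0 < box - supn P + Num.max 0 (rho P - rad).
Proof.
move=> nB; have rB := box_rad; have r1 := rad_ge1; have nr := supn_rho P.
rewrite le_eqVlt in nB; case/orP: nB => [/eqP nB|nB].
  by rewrite nB subrr add0r lt_max subr_gt0; apply/orP; right; lra.
by rewrite ltr_pwDl ?subr_gt0 // le_max lexx.
Qed.

Lemma shrink_ge0 P : supn P <= box -> 0 <= shrink P.
Proof.
move=> nB; rewrite /shrink divr_ge0 ?(ltW (shrink_den nB)) // mulr_ge0 ?subr_ge0 //.
Qed.

Lemma shrink_in P : rho P <= rad -> shrink P = rad.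
Proof.
move=> Pr; have rB := box_rad; have r1 := rad_ge1; have nr := supn_rho P.
rewrite /shrink (_ : Num.max 0 _ = 0); last by apply/max_idPl; rewrite subr_le0.
by rewrite addr0 mulfK // subr_eq0; apply/eqP; lra.
Qed.

Lemma shrinkM P : supn P <= box -> rad <= rho P ->
  shrink P * (box - supn P + (rho P - rad)) = rad * (box - supn P).
Proof.
move=> nB rP; have := shrink_den nB.
rewrite /shrink (_ : Num.max 0 _ = rho P - rad); last by apply/max_idPr; rewrite subr_ge0.
by move=> d0; rewrite mulfVK // gt_eqF.
Qed.

Lemma shrink_out P : supn P <= box -> rad < rho P -> shrink P < rad.
Proof.
move=> nB rP; have sM := shrinkM nB (ltW rP); have := shrink_den nB.
rewrite (_ : Num.max 0 _ = rho P - rad); last by apply/max_idPr; rewrite subr_ge0 ltW.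
have r1 := rad_ge1 => d0; rewrite -(ltr_pM2r d0) sM; nra.
Qed.

Lemma shrink_le P : supn P <= box -> shrink P <= rad.
Proof. by move=> nB; have [/shrink_in->//|/(shrink_out nB)/ltW] := leP (rho P) rad. Qed.

Lemma shrink_eq0 P : supn P <= box -> shrink P = 0 -> supn P = box.
Proof.
move=> nB s0; have r1 := rad_ge1.
have rP : rad <= rho P by rewrite leNgt; apply/negP => /ltW/shrink_in; rewrite s0; lra.
have := shrinkM nB rP; rewrite s0 mul0r => /esym/eqP.
by rewrite mulf_eq0 subr_eq0 => /orP[/eqP|/eqP->//]; lra.
Qed.

Lemma psis_in P : rho P <= rad -> psis P = (P.1, P.2, Num.sqrt (rad ^+ 2 - rho P ^+ 2)).
Proof.
move=> Pr; have r1 := rad_ge1; rewrite /psis shrink_in // (max_idPr Pr) (min_idPl Pr).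
by rewrite divff ?gt_eqF ?(lt_le_trans _ r1) // !mulr1 subrr sqrtr0 subr0.
Qed.

Lemma psis_out P : supn P <= box -> rad <= rho P ->
  psis P = (P.1 * (shrink P / rho P), P.2 * (shrink P / rho P), - Num.sqrt (rad ^+ 2 - shrink P ^+ 2)).
Proof.
move=> nB Pr; have sr := shrink_le nB; rewrite /psis (min_idPr Pr) subrr sqrtr0 add0r.
by rewrite (max_idPl (le_trans sr Pr)).
Qed.

Lemma psis_norm P : supn P <= box ->
  (psis P).1.1 ^+ 2 + (psis P).1.2 ^+ 2 + (psis P).2 ^+ 2 = rad ^+ 2.
Proof.
move=> nB; have r1 := rad_ge1; have [Pr|Pr] := leP (rho P) rad.
  rewrite psis_in //= (rho_sqr P) sqr_sqrtr; first by rewrite addrC subrK.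
  by rewrite subr_ge0 -(rho_sqr P) ler_sqr ?nnegrE ?rho_ge0.
have s0 := shrink_ge0 nB; have sr := shrink_le nB.
rewrite psis_out ?(ltW Pr) //= sqrrN sqr_sqrtr ?subr_ge0 ?ler_sqr ?nnegrE //.
by rewrite rho_scale; [rewrite addrC subrK | lra].
Qed.

Lemma psis_z_ge0 P : rho P <= rad -> 0 <= (psis P).2.
Proof. by move=> Pr; rewrite psis_in //= sqrtr_ge0. Qed.

Lemma psis_z_lt0 P : supn P <= box -> rad < rho P -> (psis P).2 < 0.
Proof.
move=> nB Pr; rewrite psis_out ?(ltW Pr) //= oppr_lt0 sqrtr_gt0 subr_gt0.
have s0 := shrink_ge0 nB; have sr := shrink_out nB Pr.
by rewrite ltr_sqr ?nnegrE //; have := rad_ge1; lra.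
Qed.

Lemma supn_scale P P' (t : R) : 0 <= t -> P.1 = t * P'.1 -> P.2 = t * P'.2 -> supn P = t * supn P'.
Proof. by move=> t0 e1 e2; rewrite /supn e1 e2 !normrM ger0_norm // maxr_pMr. Qed.

Lemma psis_pole P : supn P = box -> psis P = (0, 0, - rad).
Proof.
move=> sB; have rB := box_rad; have r1 := rad_ge1; have := supn_rho P; rewrite sB => Pr.
have sh : shrink P = 0 by rewrite /shrink sB subrr mulr0 mul0r.
rewrite psis_out ?sB //; last lra.
by rewrite sh mul0r !mulr0 expr0n subr0 sqrtr_sqr ger0_norm.
Qed.

Lemma psis_inj P P' : supn P <= box -> supn P' <= box -> psis P = psis P' ->
  P = P' \/ (supn P = box /\ supn P' = box).
Proof.
wlog le : P P' / rho P <= rho P'.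
  move=> wl nB nB' eq; have [le|/ltW le] := leP (rho P) (rho P'); first exact: wl.
  by have [->|[-> ->]] := wl P' P le nB' nB (esym eq); [left|right].
move=> nB nB' eq; have r1 := rad_ge1; have [Pr|Pr] := leP (rho P) rad.
  have Pr' : rho P' <= rad.
    by rewrite leNgt; apply/negP => /(psis_z_lt0 nB'); rewrite -eq ltNge psis_z_ge0.
  move: eq; rewrite !psis_in //; case: (P) (P') => [u v] [u' v'] /= [-> -> _].
  by left.
have Pr' := lt_le_trans Pr le.
have [s0 s0'] := (shrink_ge0 nB, shrink_ge0 nB').
move: (eq); rewrite !psis_out ?(ltW Pr) ?(ltW Pr') // => -[e1 e2 e3].
have [p0 p0'] : 0 < rho P /\ 0 < rho P' by split; lra.
have ss : shrink P = shrink P'.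
  have : shrink P ^+ 2 = shrink P' ^+ 2.
    by rewrite -(rho_scale (shrink P) p0) -(rho_scale (shrink P') p0') e1 e2.
  by move/eqP; rewrite eqrXn2 // => /eqP.
have [z0|z0] := eqVneq (shrink P) 0.
  by right; split; apply: shrink_eq0; rewrite -?ss.
(* On the lower hemisphere, points with equal images lie on one ray and have equal [shrink], which
   decreases strictly along a ray. *)
left; pose t := rho P / rho P'.
have t0 : 0 < t by rewrite divr_gt0.
have t1 : t <= 1 by rewrite ler_pdivrMr // mul1r.
have sc (x x' : R) : x * (shrink P / rho P) = x' * (shrink P' / rho P') -> x = t * x'.
  rewrite -ss => e; have : x * (shrink P / rho P) * (rho P / shrink P) = x' * (shrink P / rho P') * (rho P / shrink P).
    by rewrite e.
  rewrite /t; have -> : x * (shrink P / rho P) * (rho P / shrink P) = x.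
    by field; rewrite z0 gt_eqF.
  by move=> ->; field; rewrite z0 !gt_eqF.
have [E1 E2] := (sc _ _ e1, sc _ _ e2).
have nn := supn_scale (ltW t0) E1 E2.
have rr : rho P = t * rho P' by rewrite /t mulfVK // gt_eqF.
have m1 := shrinkM nB (ltW Pr); have m2 := shrinkM nB' (ltW Pr'); rewrite -ss in m2.
have np' : 0 < supn P' by have := rho_supn P'; lra.
have tt : t = 1.
  apply/eqP; rewrite eq_le t1 /= leNgt; apply/negP => tlt.
  have a1 : supn P < supn P' by rewrite nn -[ltRHS]mul1r ltr_pM2r.
  have a2 : rho P < rho P' by rewrite rr -[ltRHS]mul1r ltr_pM2r.
  have sr := shrink_out nB Pr.
  have s1 : 0 < shrink P by rewrite lt_neqAle eq_sym z0.
  by move: m1 m2 a1 a2; move: (shrink P) (supn P) (supn P') (rho P) (rho P') sr s1 nB nB' Pr Pr' => *; nra.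
by rewrite [P]surjective_pairing [P']surjective_pairing E1 E2 tt !mul1r.
Qed.

Lemma psis_cover (p : point) : p.1.1 ^+ 2 + p.1.2 ^+ 2 + p.2 ^+ 2 = rad ^+ 2 ->
  exists P, [/\ supn P <= box, psis P = p & 0 <= p.2 -> P = p.1].
Proof.
case: p => [[x y] z] /= nrm; have r1 := rad_ge1; have rB := box_rad.
have [z0|z0] := leP 0 z.
  have Pr : rho (x, y) <= rad.
    rewrite -(@ler_sqr R) ?nnegrE ?rho_ge0 //.
    by rewrite rho_sqr /= -nrm; have := sqr_ge0 z; lra.
  exists (x, y); split=> //; first by have := supn_rho (x, y); lra.
  rewrite psis_in //= rho_sqr /= -nrm addrAC subrr add0r sqrtr_sqr ger0_norm //.
pose d := rho (x, y).
have dr : d < rad.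
  rewrite -(@ltr_sqr R) ?nnegrE ?rho_ge0 //.
  by rewrite rho_sqr /= -nrm ltrDl exprn_even_gt0 //= lt_eqF.
have [d0|d0] := eqVneq d 0.
  have [x0 y0] : x = 0 /\ y = 0.
    have : x ^+ 2 + y ^+ 2 = 0 by have := rho_sqr (x, y); rewrite -/d d0 expr0n /= => <-.
    by move=> /eqP; rewrite paddr_eq0 ?sqr_ge0 // !sqrf_eq0 => /andP[/eqP-> /eqP->].
  have B0 : 0 <= box by lra.
  have sB : supn (box, 0) = box by rewrite /supn /= normr0 ger0_norm //; apply/max_idPl.
  have rb : rho (box, 0) = box by rewrite /rho /= expr0n addr0 sqrtr_sqr ger0_norm.
  exists (box, 0); split; [by rewrite sB | | by []].
  have sh : shrink (box, 0) = 0 by rewrite /shrink sB subrr mulr0 mul0r.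
  rewrite psis_out ?sB ?rb //; last lra.
  rewrite sh mul0r !mulr0 expr0n subr0 sqrtr_sqr ger0_norm; last lra.
  rewrite x0 y0; congr (_, _, _); move: nrm; rewrite x0 y0 expr0n !add0r => /eqP.
  by rewrite eqf_sqr => /orP[/eqP|/eqP->//]; lra.
have {}d0 : 0 < d by rewrite lt_neqAle eq_sym d0 rho_ge0.
pose m := supn (x, y).
have md : m <= d := supn_rho _.
have m0 : 0 < m by have := rho_supn (x, y); rewrite -/d -/m; lra.
(* Cleared of denominators, the equation [shrink (t * x, t * y) = d] is linear in [t]; this is its
   solution. *)
pose t := (box * (rad - d) + rad * d) / (d ^+ 2 + (rad - d) * m).
have den : 0 < d ^+ 2 + (rad - d) * m by nra.
have num : 0 < box * (rad - d) + rad * d by nra.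
have t0 : 0 < t by rewrite divr_gt0.
have tE : t * (d ^+ 2 + (rad - d) * m) = box * (rad - d) + rad * d by rewrite mulfVK ?gt_eqF.
clearbody t; have sP : supn (t * x, t * y) = t * m by rewrite (supn_scale (P' := (x, y)) (ltW t0)).
have rP : rho (t * x, t * y) = t * d.
  by rewrite /rho /= !exprMn -mulrDr sqrtrM ?sqr_ge0 // sqrtr_sqr gtr0_norm.
have k1 : rad * m <= box * d by nra.
have k2 : d * (rad * m) <= d * (box * d) by rewrite ler_pM2l.
have k3 : 0 <= (rad - d) * (box * d - rad * m) by rewrite mulr_ge0 ?subr_ge0 // ltW.
have tmB : t * m <= box.
  by rewrite -(ler_pM2r den) mulrAC tE; lra.
have tdr : rad <= t * d.
  by rewrite -(ler_pM2r den) [leRHS]mulrAC tE; lra.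
have sh : shrink (t * x, t * y) = d.
  have nB : supn (t * x, t * y) <= box by rewrite sP.
  have := shrinkM nB; rewrite rP => /(_ tdr); rewrite sP => E.
  have dd : 0 < box - t * m + (t * d - rad) by have := shrink_den nB; rewrite sP rP (max_idPr _) ?subr_ge0.
  apply: (mulIf (lt0r_neq0 dd)); rewrite E.
  by lra.
exists (t * x, t * y); split; [by rewrite sP | | by []].
rewrite psis_out ?sP ?rP // sh /=.
have e (w : R) : t * w * (d / (t * d)) = w by field; rewrite !gt_eqF.
rewrite !e; congr (_, _, _).
rewrite rho_sqr /= -nrm addrAC subrr add0r sqrtr_sqr ltr0_norm ?opprK //.
Qed.

End SphereMap.

Section ContinuityTools.
Variables (R : realType) (T : topologicalType) (x : T).
Implicit Types f g : T -> R.

Lemma cont_cst (c : R) : {for x, continuous (fun _ : T => c)}.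
Proof. exact: cvg_cst. Qed.

Lemma cont_add f g : {for x, continuous f} -> {for x, continuous g} ->
  {for x, continuous (fun t => f t + g t)}.
Proof. by move=> cf cg; apply: cvgD. Qed.

Lemma cont_sub f g : {for x, continuous f} -> {for x, continuous g} ->
  {for x, continuous (fun t => f t - g t)}.
Proof. by move=> cf cg; apply: cvgB. Qed.

Lemma cont_mul f g : {for x, continuous f} -> {for x, continuous g} ->
  {for x, continuous (fun t => f t * g t)}.
Proof. by move=> cf cg; apply: cvgM. Qed.

Lemma cont_div f g : g x != 0 -> {for x, continuous f} -> {for x, continuous g} ->
  {for x, continuous (fun t => f t / g t)}.
Proof. by move=> g0 cf cg; apply: cvgM => //; apply: cvgV. Qed.

Lemma cont_sqr f : {for x, continuous f} -> {for x, continuous (fun t => f t ^+ 2)}.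
Proof. by move=> cf; apply: (@cont_mul f f). Qed.

Lemma cont_max f g : {for x, continuous f} -> {for x, continuous g} ->
  {for x, continuous (fun t => Num.max (f t) (g t))}.
Proof. by move=> cf cg; apply: (@continuous_max R T f g). Qed.

Lemma cont_min f g : {for x, continuous f} -> {for x, continuous g} ->
  {for x, continuous (fun t => Num.min (f t) (g t))}.
Proof. by move=> cf cg; apply: (@continuous_min R T f g). Qed.

Lemma cont_abs f : {for x, continuous f} -> {for x, continuous (fun t => `|f t|)}.
Proof. by move=> cf; apply: (@continuous_comp _ _ _ f (fun y => `|y|)) => //; exact: norm_continuous. Qed.

Lemma cont_sqrt f : {for x, continuous f} -> {for x, continuous (fun t => Num.sqrt (f t))}.
Proof. by move=> cf; apply: (@continuous_comp _ _ _ f Num.sqrt) => //; exact: sqrt_continuous. Qed.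

Lemma cont_pair (U V : topologicalType) (f : T -> U) (g : T -> V) :
  {for x, continuous f} -> {for x, continuous g} -> {for x, continuous (fun t => (f t, g t))}.
Proof. by move=> cf cg; exact: (cvg_pair cf cg). Qed.

Lemma cont_triple f g (k : T -> R) : {for x, continuous f} -> {for x, continuous g} ->
  {for x, continuous k} -> {for x, continuous (fun t => (f t, g t, k t))}.
Proof. by move=> cf cg ck; apply: cont_pair => //; exact: cont_pair. Qed.

End ContinuityTools.

Section Charts.
Variables (R : realType) (h : nat).
Notation point := (R * R * R)%type.
Notation rad := (rad R h).
Notation mid := (mid R).
Notation roof := (roof R h).
Notation psis := (@psis R h).
Notation box := (box R h).

Lemma fst_cont (P : R * R) : {for P, continuous (fun P : R * R => P.1)}.
Proof. exact: cvg_fst. Qed.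
Lemma snd_cont (P : R * R) : {for P, continuous (fun P : R * R => P.2)}.
Proof. exact: cvg_snd. Qed.

(** With [max] and [min] the chart is a single formula, so nothing has to be glued along the
    equator; only the denominators must not vanish. *)
Lemma psis_cont P : supn P <= box -> {for P, continuous psis}.
Proof.
move=> nB; have r1 := rad_ge1 R h.
have cs : {for P, continuous (@supn R)}.
  by apply: cont_max; apply: cont_abs; [exact: fst_cont | exact: snd_cont].
have cr : {for P, continuous (@rho R)}.
  by apply: cont_sqrt; apply: cont_add; apply: cont_sqr; [exact: fst_cont | exact: snd_cont].
have csh : {for P, continuous (@shrink R h)}.
  apply: cont_div; first by rewrite gt_eqF // shrink_den.
    by apply: cont_mul; [exact: cont_cst | apply: cont_sub => //; exact: cont_cst].
  apply: cont_add; first by apply: cont_sub => //; exact: cont_cst.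
  by apply: cont_max; [exact: cont_cst | apply: cont_sub => //; exact: cont_cst].
have m0 : Num.max (rho P) (shrink h P) != 0.
  apply: lt0r_neq0; rewrite lt_max; have [le|lt] := leP (rho P) rad.
    by rewrite (shrink_in le); apply/orP; right; lra.
  by apply/orP; left; lra.
apply: cont_triple.
- by apply: cont_mul; [exact: fst_cont | apply: cont_div => //; apply: cont_max].
- by apply: cont_mul; [exact: snd_cont | apply: cont_div => //; apply: cont_max].
- apply: cont_sub; apply: cont_sqrt; apply: cont_sub; try exact: cont_cst; apply: cont_sqr => //.
  by apply: cont_min => //; exact: cont_cst.
Qed.

Section Tube.
Variables (k : nat) (sg : R).
Hypotheses (kh : (k < h)%N) (sg1 : sg = -1 \/ sg = 1).

(** The supremum distance from the centre of a foot, which is a unit square. The annulus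
    [1 / 6 <= tq <= 1 / 2] parametrises half of a tube: radial projection to the border of the foot,
    at [(mid k + sg * txi, ty)], selects the generator, and the height [3 / 2 - 3 * tq] grows from
    [0] on that border to [1] at the central hole. *)
Definition tq (P : R * R) : R := Num.max `|P.1 - (mid k + sg)| `|P.2 - 1 / 2|.
Definition txi (P : R * R) : R := 1 + sg * ((P.1 - (mid k + sg)) / (2 * tq P)).
Definition ty (P : R * R) : R := 1 / 2 + (P.2 - 1 / 2) / (2 * tq P).
Definition psit (P : R * R) : point := tubept h k sg (txi P) (ty P) (3 / 2 - 3 * tq P).

Lemma sg_norm : `|sg| = 1.
Proof. by case: sg1 => ->; rewrite ?normrN normr1. Qed.

Lemma sg_sqr : sg * sg = 1.
Proof. by case: sg1 => ->; rewrite ?mulrNN mulr1. Qed.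

Lemma half_ratio (a b : R) : 0 < b -> `|a| <= b -> - (1 / 2) <= a / (2 * b) <= 1 / 2.
Proof.
move=> b0; rewrite ler_norml => /andP[h1 h2].
by rewrite ler_pdivlMr ?ler_pdivrMr ?mulr_gt0 //; apply/andP; split; lra.
Qed.

Section Annulus.
Variable P : R * R.
Hypothesis annP : 1 / 6 <= tq P <= 1 / 2.

Lemma tq_gt0 : 0 < tq P.
Proof. by case/andP: annP; lra. Qed.

Lemma txi_bound : 1 / 2 <= txi P <= 3 / 2.
Proof.
have := @half_ratio (P.1 - (mid k + sg)) (tq P) tq_gt0; rewrite le_max lexx => /(_ isT) /andP[a b].
by rewrite /txi; case: sg1 => sgE; rewrite {1 3}sgE ?mulN1r ?mul1r; apply/andP; split; lra.
Qed.

Lemma ty_bound : 0 <= ty P <= 1.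
Proof.
have := @half_ratio (P.2 - 1 / 2) (tq P) tq_gt0; rewrite le_max lexx orbT => /(_ isT) /andP[a b].
by rewrite /ty; apply/andP; split; lra.
Qed.

Lemma ts_bound : 0 <= 3 / 2 - 3 * tq P <= 1.
Proof. by case/andP: annP => ? ?; apply/andP; split; lra. Qed.

Lemma txiK : P.1 = mid k + sg + 2 * tq P * (sg * (txi P - 1)).
Proof.
have q0 := lt0r_neq0 tq_gt0.
have -> : 2 * tq P * (sg * (txi P - 1)) = (sg * sg) * (P.1 - (mid k + sg)) by rewrite /txi; field.
by rewrite sg_sqr mul1r addrC subrK.
Qed.

Lemma tyK : P.2 = 1 / 2 + 2 * tq P * (ty P - 1 / 2).
Proof. by have q0 := lt0r_neq0 tq_gt0; rewrite /ty; field. Qed.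

Lemma psit_cont : {for P, continuous psit}.
Proof.
have cq : {for P, continuous tq}.
  by apply: cont_max; apply: cont_abs; apply: cont_sub; try exact: cont_cst; [exact: fst_cont | exact: snd_cont].
have q0 : 2 * tq P != 0 by rewrite mulf_neq0 // gt_eqF // tq_gt0.
have c2q : {for P, continuous (fun P => 2 * tq P)} by apply: cont_mul => //; exact: cont_cst.
have cx : {for P, continuous txi}.
  apply: cont_add; first exact: cont_cst.
  apply: cont_mul; first exact: cont_cst.
  by apply: cont_div => //; apply: cont_sub; [exact: fst_cont | exact: cont_cst].
have cy : {for P, continuous ty}.
  apply: cont_add; first exact: cont_cst.
  by apply: cont_div => //; apply: cont_sub; [exact: snd_cont | exact: cont_cst].
have cs : {for P, continuous (fun P => 2 * (3 / 2 - 3 * tq P))}.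
  apply: cont_mul; first exact: cont_cst.
  apply: cont_sub; first exact: cont_cst.
  by apply: cont_mul => //; exact: cont_cst.
have cb : {for P, continuous (fun P => mid k + sg * txi P)}.
  by apply: cont_add; [exact: cont_cst | apply: cont_mul => //; exact: cont_cst].
have cf : {for P, continuous (fun P => foot_z h (mid k + sg * txi P) (ty P))}.
  apply: cont_sqrt; apply: cont_sub; last exact: cont_sqr.
  by apply: cont_sub; [exact: cont_cst | exact: cont_sqr].
apply: cont_triple => //.
- apply: cont_add; first exact: cont_cst.
  apply: cont_mul; first exact: cont_cst.
  apply: cont_mul => //; apply: cont_sub; first exact: cont_cst.
  by apply: cont_max; [exact: cont_cst | apply: cont_sub => //; exact: cont_cst].
- apply: cont_add => //; apply: cont_mul; first by apply: cont_min => //; exact: cont_cst.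
  by apply: cont_sub => //; apply: cont_add => //; exact: cont_cst.
Qed.

(** At height [0] a tube point is the lift of its foot to the upper hemisphere, just as in the
    sphere chart; so the charts agree along the border of a foot. *)
Lemma psit_edge : tq P = 1 / 2 -> psit P = psis P.
Proof.
move=> qE; have [xb yb] := (txi_bound, ty_bound).
have e1 : mid k + sg * txi P = P.1 by rewrite [RHS]txiK qE; have := sg_sqr; nra.
have e2 : ty P = P.2 by rewrite [RHS]tyK qE; lra.
have Pr : rho P <= rad.
  have [_ fb] := foot_in_ball kh (foot_near k sg_norm xb) yb.
  rewrite -(@ler_sqr R) ?nnegrE ?rho_ge0 // rho_sqr -e1 -e2; exact: ltW.
rewrite /psit psis_in // qE (_ : 3 / 2 - 3 * (1 / 2) = 0); last by field.
by rewrite tubept0 e1 e2 /foot_z rho_sqr; congr (_, _, Num.sqrt _); ring.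
Qed.

Lemma psit_psis P' : supn P' <= box -> psit P = psis P' -> P' = P /\ tq P = 1 / 2.
Proof.
move=> nB eqp; have [xb yb] := (txi_bound, ty_bound); have sb := ts_bound.
have nr := psis_norm nB; have /andP[t1 t2] := annP.
have qE : tq P = 1 / 2.
  apply/eqP; rewrite eq_le t2 /= leNgt; apply/negP => lt.
  have sb0 : 0 < 3 / 2 - 3 * tq P by lra.
  have sb1 : 3 / 2 - 3 * tq P <= 1 by lra.
  by have := tubept_norm kh sg_norm xb yb sb0; rewrite -/(psit P) eqp nr ltxx.
split=> //; have pe := psit_edge qE.
have z0 : 0 < (psis P).2 by rewrite -pe; exact: (tubept_z_gt0 kh sg_norm xb yb sb).
have Pr : rho P <= rad.
  have [_ fb] := foot_in_ball kh (foot_near k sg_norm xb) yb.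
  have e1 : mid k + sg * txi P = P.1 by rewrite [RHS]txiK qE; have := sg_sqr; nra.
  have e2 : ty P = P.2 by rewrite [RHS]tyK qE; lra.
  rewrite -(@ler_sqr R) ?nnegrE ?rho_ge0 // rho_sqr -e1 -e2; exact: ltW.
have Pr' : rho P' <= rad.
  by rewrite leNgt; apply/negP => /(psis_z_lt0 nB); rewrite -eqp pe ltNge (ltW z0).
move: eqp; rewrite pe !psis_in //; case: (P) (P') => [u v] [u' v'] /= [-> -> _].
by [].
Qed.

End Annulus.

Lemma psit_cover xi y (s : R) : 1 / 2 <= xi <= 3 / 2 -> 0 <= y <= 1 -> 0 <= s <= 1 ->
  [\/ xi = 1 / 2, xi = 3 / 2, y = 0 | y = 1] ->
  exists P, 1 / 6 <= tq P <= 1 / 2 /\ psit P = tubept h k sg xi y s.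
Proof.
move=> /andP[x1 x2] /andP[y1 y2] /andP[s1 s2] bd; pose q : R := 1 / 2 - s / 3.
have q0 : 0 < q by rewrite /q; lra.
pose P : R * R := (mid k + sg + 2 * q * (sg * (xi - 1)), 1 / 2 + 2 * q * (y - 1 / 2)).
have a1 : `|P.1 - (mid k + sg)| = 2 * q * `|xi - 1|.
  rewrite /P /= [X in `|X|](_ : _ = 2 * q * (sg * (xi - 1))); last by ring.
  by rewrite !normrM sg_norm mul1r (gtr0_norm q0) ger0_norm.
have a2 : `|P.2 - 1 / 2| = 2 * q * `|y - 1 / 2|.
  rewrite /P /= [X in `|X|](_ : _ = 2 * q * (y - 1 / 2)); last by ring.
  by rewrite !normrM (gtr0_norm q0) ger0_norm.
have b1 : `|xi - 1| <= 1 / 2 by rewrite ler_norml; apply/andP; split; lra.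
have b2 : `|y - 1 / 2| <= 1 / 2 by rewrite ler_norml; apply/andP; split; lra.
have qE : tq P = q.
  rewrite /tq a1 a2; apply/le_anti/andP; split.
    by rewrite ge_max; apply/andP; split; nra.
  rewrite le_max; case: bd => bd; apply/orP.
  - left; rewrite bd (_ : 1 / 2 - 1 = - (1 / 2)); last by field.
    by rewrite normrN ger0_norm; lra.
  - left; rewrite bd (_ : 3 / 2 - 1 = 1 / 2); last by field.
    by rewrite ger0_norm; lra.
  - by right; rewrite bd sub0r normrN ger0_norm; lra.
  - right; rewrite bd (_ : 1 - 1 / 2 = 1 / 2); last by field.
    by rewrite ger0_norm; lra.
exists P; rewrite qE; split; first by rewrite /q; apply/andP; split; lra.
have q2 : 2 * q != 0 by rewrite mulf_neq0 // gt_eqF.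
rewrite /psit; congr (tubept _ _ _ _ _ _).
- rewrite /txi qE /P /= [X in _ * (X / _)](_ : _ = 2 * q * (sg * (xi - 1))); last by ring.
  by rewrite [_ / _]mulrC mulKf // mulrA sg_sqr mul1r addrC subrK.
- rewrite /ty qE /P /= [X in _ + X / _](_ : _ = 2 * q * (y - 1 / 2)); last by ring.
  by rewrite [2 * q * _]mulrC mulfK // addrC subrK.
- by rewrite qE /q; field.
Qed.

End Tube.

(** The two halves of a tube are joined at their tops, where a parameter is identified with its
    mirror image in [mid k]. This is the gluing of paired holes in the grid. *)
Lemma psit_inj k sg k' sg' P P' : (k < h)%N -> (k' < h)%N ->
  sg = -1 \/ sg = 1 -> sg' = -1 \/ sg' = 1 ->
  1 / 6 <= tq k sg P <= 1 / 2 -> 1 / 6 <= tq k' sg' P' <= 1 / 2 ->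
  psit k sg P = psit k' sg' P' ->
  k = k' /\ (sg = sg' /\ P = P' \/
    [/\ sg = - sg', tq k sg P = 1 / 6, P.1 + P'.1 = 2 * mid k & P.2 = P'.2]).
Proof.
move=> kh kh' s1 s1' a1 a1' eqp.
have [kk xx yy ss gg] := tubept_inj kh kh' (sg_norm s1) (sg_norm s1') (txi_bound s1 a1)
   (txi_bound s1' a1') (ty_bound a1) (ty_bound a1') (ts_bound a1) (ts_bound a1') eqp.
subst k'; split=> //.
have qq : tq k sg P = tq k sg' P' by lra.
have p1 := txiK s1 a1; have p2 := tyK a1; have p1' := txiK s1' a1'; have p2' := tyK a1'.
have [sgE|sgN] := eqVneq sg sg'.
  left; split=> //; rewrite [P]surjective_pairing [P']surjective_pairing.
  by rewrite p1 p2 p1' p2' -qq -xx -yy -sgE.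
have sg_opp : sg = - sg'.
  by case: s1 sgN => ->; case: s1' => -> //; rewrite ?opprK ?eqxx.
right; split=> //.
- by case: gg => [gg|gg]; [rewrite gg eqxx in sgN | lra].
- by rewrite p1 p1' -qq -xx sg_opp; ring.
- by rewrite p2 p2' -qq -yy.
Qed.

End Charts.

End SphereChart.

(** * Fine covers of the sphere with handles, and the edge bound *)

Module EdgeBound.
Import Chains GridHomology FineCovers SolidHandles SphereChart.
Local Open Scope classical_set_scope.
Local Open Scope ring_scope.

(** Compactness in its covering form; the second point [P'] may lie outside [K]. *)
Lemma unif_small (R : realType) (T : pseudoMetricType R) (f : R * R -> T) (K : set (R * R)) (d : R) :
  compact K -> (forall P, K P -> {for P, continuous f}) -> 0 < d ->
  \forall n \near \oo, forall P, K P -> forall P', `|P.1 - P'.1| <= n.+1%:R^-1 ->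
    `|P.2 - P'.2| <= n.+1%:R^-1 -> ball (f P) d (f P').
Proof.
move=> /compact_near_coveringP cK fc d0.
apply: (cK nat \oo (fun n P => forall P', `|P.1 - P'.1| <= n.+1%:R^-1 ->
    `|P.2 - P'.2| <= n.+1%:R^-1 -> ball (f P) d (f P'))) => P KP.
have d20 : 0 < d / 2 by rewrite divr_gt0.
have := fc P KP _ (nbhsx_ballx (f P) _ d20); rewrite nbhs_simpl => /nbhs_ballP[e /= e0 eP].
have e20 : 0 < e / 2 by rewrite divr_gt0.
exists (ball P (e / 2), [set n : nat | n.+1%:R^-1 < e / 2]).
  by split; [exact: nbhsx_ballx | exact: (near_infty_natSinv_lt (PosNum e20))].
move=> [P1 n] /= [[b1 b2] lt] P' h1 h2; apply: (ball_splitr (z := f P)); apply: eP.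
  by split; [apply: le_ball b1 | apply: le_ball b2]; lra.
move: b1 b2; rewrite /ball /= => b1 b2; split; rewrite /ball /=.
  by apply: le_lt_trans (ler_distD P1.1 _ _) _; rewrite [ltRHS]splitr; apply: ltrD => //; exact: le_lt_trans lt.
by apply: le_lt_trans (ler_distD P1.2 _ _) _; rewrite [ltRHS]splitr; apply: ltrD => //; exact: le_lt_trans lt.
Qed.

Ltac clear_real R := repeat match goal with H : ?T |- _ => lazymatch T with context [R] => clear H end end.

Lemma adjacent_pick (lo hi c d : nat) : (c <= d.+1)%N -> (d <= c.+1)%N -> (lo <= c.+1)%N ->
  (lo <= d.+1)%N -> (c <= hi)%N -> (d <= hi)%N -> (lo <= hi)%N ->
  exists y, [/\ (lo <= y <= hi)%N, (c <= y <= c.+1)%N & (d <= y <= d.+1)%N].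
Proof.
move=> *; case: (ltngtP c d) => cd.
- by exists d; split; lia.
- by exists c; split; lia.
- by case: (leqP lo c) => lc; [exists c | exists c.+1]; split; lia.
Qed.

Section Mesh.
Variables (R : realType) (h n : nat).
Notation point := (R * R * R)%type.
Notation N := n.+1.
Notation rad := (rad R h).
Notation mid := (mid R).
Notation psis := (@psis R h).
Notation psit := (@psit R h).
Notation box := (box R h).
Notation boxn := (boxn h).

(** Grid lines at distance [1 / (3 * N)], starting at [- box]: a foot has [3 * N] squares on a side,
    and its middle third is the hole of side [N]. *)
Definition cx (i : nat) : R := i%:R / (3 * N%:R) - box.
Definition wid := (6 * N * boxn)%N.
Definition fo (k : nat) (s : bool) := (3 * N * (boxn + (4 * k + s.*2)))%N.
Definition fo0 := (3 * N * boxn)%N.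
Definition ha (k : 'I_h) := (fo k false + N)%N.
Definition hb := (fo0 + N)%N.
Definition sgn (s : bool) : R := if s then 1 else -1.
Definition infoot (k : 'I_h) s i j :=
  [&& fo k s <= i, i < fo k s + 3 * N, fo0 <= j & j < fo0 + 3 * N]%N.
Definition inner (k : 'I_h) s i j :=
  [&& fo k s + N <= i, i < fo k s + 2 * N, fo0 + N <= j & j < fo0 + 2 * N]%N.
Definition sqr i j : set (R * R) := `[cx i, cx i.+1]%classic `*` `[cx j, cx j.+1]%classic.
(** One formula for each grid square, defined on the whole plane, so that continuity on a square is
    that of [psis] or of one [psit]. *)
Definition chart i j : R * R -> point :=
  if [pick ks : 'I_h * bool | infoot ks.1 ks.2 i j] is Some ks then psit ks.1 (sgn ks.2)
  else psis.
Notation hole := (hole N hb ha).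

Lemma sgnP s : sgn s = -1 \/ sgn s = 1.
Proof. by case: s; [right | left]. Qed.

Lemma mesh_gt0 : 0 < 3 * N%:R :> R.
Proof. by rewrite mulr_gt0. Qed.

Lemma cx_le i j : (cx i <= cx j) = (i <= j)%N.
Proof. by rewrite lerD2r ler_pM2r ?invr_gt0 ?mesh_gt0 // ler_nat. Qed.

Lemma cx_lt i j : (cx i < cx j) = (i < j)%N.
Proof. by rewrite ltrD2r ltr_pM2r ?invr_gt0 ?mesh_gt0 // ltr_nat. Qed.

Lemma cx_step i : cx i.+1 - cx i <= N%:R^-1.
Proof.
rewrite /cx -natr1 mulrDl; have -> (x y z : R) : x + y - z - (x - z) = y by ring.
rewrite mul1r lef_pV2 ?posrE ?mesh_gt0 //; have : 0 <= N%:R :> R by []; lra.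
Qed.

Lemma cx_nat m r : cx (3 * N * (boxn + m) + r * N) = m%:R + r%:R / 3.
Proof.
have N0 : N%:R != 0 :> R by rewrite pnatr_eq0.
rewrite /cx natrD natrM (natrM _ r) (natrM _ 3) natrD /SphereChart.box.
move: N%:R boxn%:R N0 => x y N0; by field.
Qed.

Lemma midE k (s : bool) : (4 * k + s.*2)%:R = mid k + sgn s - 1 / 2.
Proof.
rewrite natrD natrM /SolidHandles.mid (_ : s.*2%:R = 1 + sgn s); first by lra.
by case: s; rewrite /sgn ?subrr.
Qed.

Lemma cx_foN k s r : cx (fo k s + r * N) = mid k + sgn s - 1 / 2 + r%:R / 3.
Proof. by rewrite cx_nat midE. Qed.

Lemma cx_fo0 r : cx (fo0 + r * N) = r%:R / 3.
Proof. by have := cx_nat 0 r; rewrite addn0 => ->; rewrite add0r. Qed.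

Lemma cx0 : cx 0 = - box.
Proof. by rewrite /cx mul0r add0r. Qed.

Lemma cxW : cx wid = box.
Proof.
have := cx_nat boxn 0; rewrite mul0n addn0 mul0r addr0 /box => <-; congr cx.
by rewrite /wid; lia.
Qed.

Lemma sqrP i j P : sqr i j P <->
  [/\ cx i <= P.1, P.1 <= cx i.+1, cx j <= P.2 & P.2 <= cx j.+1].
Proof.
rewrite /sqr /= !in_itv /=; split; first by case=> /andP[-> ->] /andP[-> ->].
by case=> -> -> -> ->.
Qed.

Lemma locate lo r x : (0 < r)%N -> cx lo <= x <= cx (lo + r) ->
  exists i, [/\ (lo <= i)%N, (i < lo + r)%N & cx i <= x <= cx i.+1].
Proof.
elim: r => // r IHr _ /andP[x1 x2]; have [le|lt] := leP (cx (lo + r)) x.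
  by exists (lo + r)%N; rewrite -addnS le x2; split=> //; lia.
case: r IHr lt x2 => [|r] IHr lt x2; first by move: lt; rewrite addn0; lra.
have [|i [i1 i2 i3]] := IHr isT; first by rewrite x1 ltW.
by exists i; split=> //; lia.
Qed.

Lemma fo_bound (k : 'I_h) s : (0 < fo k s)%N /\ (fo k s + 3 * N < wid)%N.
Proof.
have := ltn_ord k; rewrite /fo /wid /SphereChart.boxn; move: (nat_of_ord k) => m mh; split; first by lia.
have : (4 * m + s.*2 <= 4 * h)%N by case: s => /=; lia.
move: (4 * m + s.*2)%N => c ch.
have -> : (6 * N * (8 * h + 4) = 3 * N * (16 * h + 8))%N by lia.
by rewrite -mulnSr ltn_pmul2l //; lia.
Qed.

Lemma fo0_bound : (0 < fo0)%N /\ (fo0 + 3 * N < wid)%N.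
Proof. by rewrite /fo0 /wid /SphereChart.boxn; split; nia. Qed.

Lemma fo_uniq (k k' : 'I_h) s s' i : (fo k s <= i < fo k s + 3 * N)%N ->
  (fo k' s' <= i < fo k' s' + 3 * N)%N -> k = k' /\ s = s'.
Proof.
move=> /andP[h1 h2] /andP[h3 h4].
have e1 : (boxn + (4 * k + s.*2) < (boxn + (4 * k' + s'.*2)).+1)%N.
  by rewrite -(@ltn_pmul2l (3 * N)) // (mulnSr (3 * N)); apply: (leq_ltn_trans h1 h4).
have e2 : (boxn + (4 * k' + s'.*2) < (boxn + (4 * k + s.*2)).+1)%N.
  by rewrite -(@ltn_pmul2l (3 * N)) // (mulnSr (3 * N)); apply: (leq_ltn_trans h3 h2).
have [kk ss] : (k : nat) = k' /\ s = s' by case: s s' e1 e2 {h1 h2 h3 h4} => -[] /=; lia.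
by split=> //; exact: val_inj.
Qed.

Lemma inner_foot k s i j : inner k s i j -> infoot k s i j.
Proof. by rewrite /inner /infoot; lia. Qed.

Lemma infoot_uniq k s k' s' i j : infoot k s i j -> infoot k' s' i j -> k = k' /\ s = s'.
Proof. by move=> /and4P[? ? _ _] /and4P[? ? _ _]; apply: (@fo_uniq k k' s s' i); lia. Qed.

Lemma foE (k : 'I_h) : fo k true = (fo k false + 6 * N)%N.
Proof. by rewrite /fo /= doubleE; lia. Qed.

Lemma holeP i j : reflect (exists k s, inner k s i j) (hole i j).
Proof.
apply: (iffP existsP) => [[k hk]|[k [s hk]]].
  move: hk; rewrite /hole2 /hole1 /ha /hb => /orP[hk|hk].
    by exists k, false; rewrite /inner; lia.
  by exists k, true; rewrite /inner foE; lia.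
exists k; rewrite /hole2 /hole1 /ha /hb; case: s hk; rewrite /inner ?foE; lia.
Qed.

Lemma chartP i j : (exists k s, infoot k s i j /\ chart i j = psit k (sgn s)) \/
  ((forall k s, ~~ infoot k s i j) /\ chart i j = psis).
Proof.
rewrite /chart; case: pickP => [[k s] /= f|f]; first by left; exists k, s.
by right; split=> // k s; have /negbT := f (k, s).
Qed.

Lemma foot_tq k s i j P : infoot k s i j -> sqr i j P -> tq k (sgn s) P <= 1 / 2.
Proof.
move=> /and4P[f1 f2 f3 f4] /sqrP[p1 p2 p3 p4].
have := cx_foN k s 0; rewrite mul0n addn0 => e0; have e3 := cx_foN k s 3.
have := cx_fo0 0; rewrite mul0n addn0 => e0'; have e3' := cx_fo0 3.
move: f1 f2 f3 f4; rewrite -(cx_le (fo k s)) -(cx_le i.+1) -(cx_le fo0) -(cx_le j.+1) e0 e3 e0' e3' => *.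
by rewrite ge_max !ler_norml; apply/andP; split; apply/andP; split; lra.
Qed.

Lemma foot_tq_ge k s i j P : infoot k s i j -> ~~ hole i j -> sqr i j P -> 1 / 6 <= tq k (sgn s) P.
Proof.
move=> /and4P[f1 f2 f3 f4] nh /sqrP[p1 p2 p3 p4].
have e1 := cx_foN k s 1; have e2 := cx_foN k s 2; have e1' := cx_fo0 1; have e2' := cx_fo0 2.
have : [|| i.+1 <= fo k s + 1 * N, fo k s + 2 * N <= i, j.+1 <= fo0 + 1 * N | fo0 + 2 * N <= j]%N.
  apply: contraNT nh; rewrite !negb_or => nh; apply/holeP; exists k, s; move: nh; rewrite /inner; lia.
rewrite -!cx_le e1 e2 e1' e2' !le_max !ler_normr.
case/or4P => le; apply/orP; [left|left|right|right]; apply/orP; [right|left|right|left]; lra.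
Qed.

Lemma inner_tq k s i j P : inner k s i j -> sqr i j P -> tq k (sgn s) P <= 1 / 6.
Proof.
move=> /and4P[f1 f2 f3 f4] /sqrP[p1 p2 p3 p4].
have e1 := cx_foN k s 1; have e2 := cx_foN k s 2; have e1' := cx_fo0 1; have e2' := cx_fo0 2.
rewrite mul1n in e1 e1'.
move: f1 f2 f3 f4; rewrite -(cx_le (fo k s + N)) -(cx_le i.+1) -(cx_le (fo0 + N)) -(cx_le j.+1) e1 e2 e1' e2' => *.
by rewrite ge_max !ler_norml; apply/andP; split; apply/andP; split; lra.
Qed.

Lemma foot_strict (k : 'I_h) s i j P : sqr i j P -> tq k (sgn s) P < 1 / 2 -> infoot k s i j.
Proof.
move=> /sqrP[p1 p2 p3 p4]; rewrite gt_max !ltr_norml => /andP[/andP[q1 q2] /andP[q3 q4]].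
have := cx_foN k s 0; rewrite mul0n addn0 => e0; have e3 := cx_foN k s 3.
have := cx_fo0 0; rewrite mul0n addn0 => e0'; have e3' := cx_fo0 3.
have : cx (fo k s) < cx i.+1 by lra.
have : cx i < cx (fo k s + 3 * N) by lra.
have : cx fo0 < cx j.+1 by lra.
have : cx j < cx (fo0 + 3 * N) by lra.
by rewrite !cx_lt /infoot; lia.
Qed.

Lemma sqr_box i j P : (i < wid)%N -> (j < wid)%N -> sqr i j P -> supn P <= box.
Proof.
move=> iW jW /sqrP[p1 p2 p3 p4].
have := leq0n i; have := leq0n j; move: iW jW; rewrite -!cx_le cx0 cxW => *.
by rewrite ge_max !ler_norml; apply/andP; split; apply/andP; split; lra.
Qed.

(** Distinct feet are far apart, so different charts can only meet on the border of a foot, and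
    there [psit_edge] applies. *)
Lemma chart_eq i j i' j' P : ~~ hole i j -> ~~ hole i' j' -> sqr i j P -> sqr i' j' P ->
  chart i j P = chart i' j' P.
Proof.
wlog: i j i' j' / exists k s, infoot k s i j /\ chart i j = psit k (sgn s).
  move=> wl nh nh' sP sP'; have [ex|[n1 c1]] := chartP i j; first exact: wl.
  have [ex'|[n2 c2]] := chartP i' j'; last by rewrite c1 c2.
  by apply/esym; exact: wl.
move=> [k [s [f c]]] nh nh' sP sP'.
have ann : 1 / 6 <= tq k (sgn s) P <= 1 / 2 by rewrite (foot_tq_ge f nh sP) (foot_tq f sP).
have [[k' [s' [f' c']]]|[n' c']] := chartP i' j'.
  have [kk ss] : k = k' /\ s = s'.
    have /orP[/eqP t1|t1] : (tq k (sgn s) P == 1 / 2) || (tq k (sgn s) P < 1 / 2).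
    - by rewrite -le_eqVlt (foot_tq f sP).
    - have t' := foot_tq f' sP'.
      have : `|P.1 - (mid k + sgn s)| <= 1 / 2 by rewrite -t1 /tq le_max lexx.
      have : `|P.1 - (mid k' + sgn s')| <= 1 / 2 by apply: le_trans t'; rewrite /tq le_max lexx.
      have e := midE k s; have e' := midE k' s'.
      have -> : mid k + sgn s = (4 * k + s.*2)%:R + 1 / 2 by lra.
      have -> : mid k' + sgn s' = (4 * k' + s'.*2)%:R + 1 / 2 by lra.
      rewrite !ler_norml => /andP[a1 a2] /andP[a3 a4].
      have b1 : ((4 * k + s.*2)%:R <= (4 * k' + s'.*2 + 1)%:R :> R) by rewrite natrD; lra.
      have b2 : ((4 * k' + s'.*2)%:R <= (4 * k + s.*2 + 1)%:R :> R) by rewrite natrD; lra.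
      move: b1 b2; rewrite !ler_nat => b1 b2.
      have [kk ss] : (k : nat) = k' /\ s = s' by case: s s' b1 b2 {f c f' c' sP ann t1 t' e e' a1 a2 a3 a4} => -[] /=; lia.
      by split=> //; exact: val_inj.
    - exact: infoot_uniq (foot_strict sP' t1) f'.
  by rewrite c c' kk ss.
rewrite c c'; apply: (psit_edge (ltn_ord k) (sgnP s) ann).
apply/eqP; rewrite eq_le (foot_tq f sP) /= leNgt; apply/negP => lt.
by have := n' k s; rewrite (foot_strict sP' lt).
Qed.

Lemma chart_cont i j P : (i < wid)%N -> (j < wid)%N -> ~~ hole i j -> sqr i j P ->
  {for P, continuous (chart i j)}.
Proof.
move=> iW jW nh sP; have [[k [s [f ->]]]|[_ ->]] := chartP i j.
  by apply: psit_cont; rewrite (foot_tq_ge f nh sP) (foot_tq f sP).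
by apply: psis_cont; exact: sqr_box sP.
Qed.

Lemma sqr_compact i j : compact (sqr i j).
Proof. by apply: compact_setX; exact: segment_compact. Qed.

Lemma chart_closed i j : (i < wid)%N -> (j < wid)%N -> ~~ hole i j ->
  closed (chart i j @` sqr i j).
Proof.
move=> iW jW nh; apply: compact_closed; first exact: (@norm_hausdorff R (R * R * R)%type).
apply: continuous_compact; last exact: sqr_compact.
by apply: continuous_in_subspaceT => P; rewrite inE; exact: chart_cont.
Qed.

Lemma chart_cover p : @sphere_with_handles R h p ->
  exists i j, [/\ (i < wid)%N, (j < wid)%N, ~~ hole i j & (chart i j @` sqr i j) p].
Proof.
have [fo1 fo2] := fo0_bound.
move=> /surface_cases[[nrm out]|[k [xi [kh tub]]]].
  have [P [PB Pp Pz]] := psis_cover nrm.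
  have /andP[/andP[q1 q2] /andP[q3 q4]] : (- box <= P.1 <= box) && (- box <= P.2 <= box).
    by rewrite -!ler_norml -ge_max.
  have W0 : (0 < wid)%N by lia.
  have [|i [_ iW iP]] := @locate 0 wid P.1 W0; first by rewrite add0n cx0 cxW q1 q2.
  have [|j [_ jW jP]] := @locate 0 wid P.2 W0; first by rewrite add0n cx0 cxW q3 q4.
  have sP : sqr i j P by case/andP: iP jP => ? ? /andP[? ?]; apply/sqrP.
  exists i, j; have [[k [s [f c]]]|[n' c]] := chartP i j; last first.
    split=> //; last by exists P => //; rewrite c.
    by apply/negP => /holeP[k [s /inner_foot ff]]; have := n' k s; rewrite ff.
  (* [onsphere] excludes points above an open foot, so the parameter is on the border of the foot,
     where the tube chart takes the same value. *)
  have tqE : tq k (sgn s) P = 1 / 2.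
    apply/eqP; rewrite eq_le (foot_tq f sP) /= leNgt; apply/negP => lt.
    move: lt; rewrite gt_max !ltr_norml => /andP[/andP[a1 a2] /andP[a3 a4]].
    have md : 1 / 2 < `|P.1 - mid k| < 3 / 2.
      rewrite ltr_norml ltr_normr /sgn in a1 a2 *; case: s {f c} a1 a2 => a1 a2;
      apply/andP; split; try (apply/andP; split; lra); apply/orP; by [left; lra | right; lra].
    have [_ ib] := @foot_in_ball R h k P.1 P.2 (ltn_ord k) (ltW (proj2 (andP md))) ltac:(apply/andP; split; lra).
    have Pr : rho P < rad by rewrite -(@ltr_sqr R) ?nnegrE ?rho_ge0 // rho_sqr.
    have z0 : 0 < p.2.
      by rewrite -Pp psis_in ?(ltW Pr) //= sqrtr_gt0 subr_gt0 ltr_sqr ?nnegrE ?rho_ge0.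
    have PE := Pz (ltW z0); apply: (out k (ltn_ord k) z0); rewrite -PE //.
    by apply/andP; split; lra.
  have nh : ~~ hole i j.
    apply/negP => /holeP[k' [s' inn]].
    have [kk ss] := infoot_uniq f (inner_foot inn); subst k' s'.
    by have := inner_tq inn sP; rewrite tqE; lra.
  have ann : 1 / 6 <= tq k (sgn s) P <= 1 / 2 by rewrite tqE; apply/andP; split; lra.
  by split=> //; exists P => //; rewrite c (psit_edge (ltn_ord k) (sgnP s) ann tqE).
have [sg [s [sg1 s1 pE]]] := tubept_cover kh tub.
have [xb yb bd _ _] := tub.
have sgE : exists s : bool, sg = sgn s.
  move/eqP: sg1; rewrite eqr_norml ler01 andbT.
  by case/orP => /eqP->; [exists true | exists false].
case: sgE => b bE; rewrite bE in pE.
have [P [/andP[q1 q2] Pp]] := @psit_cover R h k _ (sgnP b) _ _ _ xb yb s1 bd; rewrite -pE in Pp.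
pose kk := Ordinal kh.
have [g1 g2] := fo_bound kk b.
have e0 := cx_foN k b 0; have e1 := cx_foN k b 1; have e2 := cx_foN k b 2; have e3 := cx_foN k b 3.
have e0' := cx_fo0 0; have e1' := cx_fo0 1; have e2' := cx_fo0 2; have e3' := cx_fo0 3.
rewrite mul0n addn0 in e0; rewrite mul0n addn0 in e0'; rewrite mul1n in e1 e1'.
have N0 : (0 < N)%N by [].
have fin i j : infoot kk b i j -> ~~ inner kk b i j -> cx i <= P.1 <= cx i.+1 ->
    cx j <= P.2 <= cx j.+1 ->
  exists i j : nat, [/\ (i < wid)%N, (j < wid)%N, ~~ hole i j & (chart i j @` sqr i j) p].
  move=> ff ni /andP[? ?] /andP[? ?]; exists i, j; split.
  - by case/and4P: ff; clear_real R; lia.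
  - by case/and4P: ff; clear_real R; lia.
  - apply/negP => /holeP[k' [s' inn]]; have [kE sE] := infoot_uniq ff (inner_foot inn).
    by move: ni; rewrite kE sE inn.
  - exists P; first by apply/sqrP.
    have [[k' [s' [f' c']]]|[n' c']] := chartP i j; last by have := n' kk b; rewrite ff.
    by have [kE sE] := infoot_uniq ff f'; rewrite c' -kE -sE.
move: q2; rewrite ge_max !ler_norml => /andP[/andP[a1 a2] /andP[a3 a4]].
have [|i [i1 i2 iP]] := @locate (fo k b) (3 * N) P.1 isT; first by rewrite e0 e3; clear -a1 a2 a3 a4; lra.
have [|j [j1 j2 jP]] := @locate fo0 (3 * N) P.2 isT; first by rewrite e0' e3'; clear -a1 a2 a3 a4; lra.
move: q1; rewrite le_max !ler_normr => /orP[/orP[d|d]|/orP[d|d]].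
- have [|i' [i1' i2' iP']] := @locate (fo k b + 2 * N) N P.1 isT.
    by rewrite (_ : fo k b + 2 * N + N = fo k b + 3 * N)%N; [rewrite e2 e3; clear -a1 a2 a3 a4 d; lra | by rewrite -addnA -(mulSnr 2)].
  by apply: (fin i' j) => //; rewrite /infoot /inner /=; clear_real R; lia.
- have [|i' [i1' i2' iP']] := @locate (fo k b) N P.1 isT; first by rewrite e0 e1; clear -a1 a2 a3 a4 d; lra.
  by apply: (fin i' j) => //; rewrite /infoot /inner /=; clear_real R; lia.
- have [|j' [j1' j2' jP']] := @locate (fo0 + 2 * N) N P.2 isT.
    by rewrite (_ : fo0 + 2 * N + N = fo0 + 3 * N)%N; [rewrite e2' e3'; clear -a1 a2 a3 a4 d; lra | by rewrite -addnA -(mulSnr 2)].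
  by apply: (fin i j') => //; rewrite /infoot /inner /=; clear_real R; lia.
- have [|j' [j1' j2' jP']] := @locate fo0 N P.2 isT; first by rewrite e0' e1'; clear -a1 a2 a3 a4 d; lra.
  by apply: (fin i j') => //; rewrite /infoot /inner /=; clear_real R; lia.
Qed.

Notation W := wid.
Notation linkA := (linkin (lsrc (h:=h) (W:=W)) (ltgt (W:=W) N ha) (lok (W:=W) N hb ha)).
Notation pt := (pt W).

Lemma hole_bound i j : hole i j -> [&& 0 < i, i.+1 < W, 0 < j & j.+1 < W]%N.
Proof.
move=> /holeP[k [s /and4P[? ? ? ?]]]; have [? ?] := fo_bound k s; have [? ?] := fo0_bound.
by apply/and4P; split; lia.
Qed.

Lemma linkA_sym A : connect_sym (linkA A).
Proof.
apply: sym_connect_sym => x y; rewrite /linkin andbCA; congr [&& _, _ & _].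
by apply: eq_existsb => l; rewrite orbC.
Qed.

Lemma stepH (A : {set node W}) i j : (i < W)%N -> (j <= W)%N -> ~~ (hole i j && hole i j.-1) ->
  pt i j \in A -> pt i.+1 j \in A -> linkA A (pt i j) (pt i.+1 j).
Proof.
move=> iW jW nh a1 a2; apply/and3P; split=> //; apply/existsP; exists (lH h W i j).
by rewrite ltgt_H ?(ltnW iW) // /lsrc /lH !eqxx /= andbT !inordK ?ltnS ?(ltnW iW) // iW.
Qed.

Lemma stepV (A : {set node W}) i j : (i <= W)%N -> (j < W)%N -> ~~ (hole i j && hole i.-1 j) ->
  pt i j \in A -> pt i j.+1 \in A -> linkA A (pt i j) (pt i j.+1).
Proof.
move=> iW jW nh a1 a2; apply/and3P; split=> //; apply/existsP; exists (lV h W i j).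
by rewrite ltgt_V ?(ltnW jW) // /lsrc /lV !eqxx /= andbT !inordK ?ltnS ?(ltnW jW) // jW.
Qed.

Definition corner i j (x : node W) :=
  ((x.1 == i :> nat) || (x.1 == i.+1 :> nat)) && ((x.2 == j :> nat) || (x.2 == j.+1 :> nat)).
Definition onring (x : node W) :=
  [|| x.1 == 0%N :> nat, x.1 == W :> nat, x.2 == 0%N :> nat | x.2 == W :> nat].
Definition touch i j := [exists x, corner i j x && onring x].
(** The border of the square is collapsed to the south pole, so all grid squares that touch it meet
    there. Each of them is given the whole ring of border nodes, which is connected; thus common
    points and common nodes correspond. *)
Definition nd i j : {set node W} := [set x | corner i j x || touch i j && onring x]%SET.

Lemma ptP i j : (i <= W)%N -> (j <= W)%N -> (pt i j).1 = i :> nat /\ (pt i j).2 = j :> nat.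
Proof. by move=> iW jW; rewrite pt1 ?pt2. Qed.

Lemma corner_pt i j i' j' : (i < W)%N -> (j < W)%N -> (i <= i' <= i.+1)%N -> (j <= j' <= j.+1)%N ->
  corner i j (pt i' j').
Proof. by move=> iW jW ii jj; have [||e1 e2] := @ptP i' j'; rewrite /corner ?e1 ?e2; lia. Qed.

Lemma corner_conn i j (A : {set node W}) : (i < W)%N -> (j < W)%N -> ~~ hole i j ->
  (forall x, corner i j x -> x \in A) ->
  forall x, corner i j x -> connect (linkA A) (pt i j) x.
Proof.
move=> iW jW nh cA x xc.
have inA i' j' : (i <= i' <= i.+1)%N -> (j <= j' <= j.+1)%N -> pt i' j' \in A.
  by move=> ii jj; apply: cA; exact: corner_pt.
have ii1 : (i <= i <= i.+1)%N by lia. have ii2 : (i <= i.+1 <= i.+1)%N by lia.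
have jj1 : (j <= j <= j.+1)%N by lia. have jj2 : (j <= j.+1 <= j.+1)%N by lia.
have s1 : connect (linkA A) (pt i j) (pt i.+1 j).
  by apply/connect1/stepH; rewrite ?(negbTE nh) ?inA // ltnW.
have s2 : connect (linkA A) (pt i j) (pt i j.+1).
  by apply/connect1/stepV; rewrite ?(negbTE nh) ?inA // ltnW.
have s3 : connect (linkA A) (pt i j) (pt i.+1 j.+1).
  apply: connect_trans s2 _; apply/connect1/stepH; rewrite ?inA //=.
  by rewrite (negbTE nh) andbF.
rewrite -(ptK x); case/andP: xc => /orP[/eqP->|/eqP->] /orP[/eqP->|/eqP->] //.
Qed.

Lemma ring_conn (A : {set node W}) : (forall x, onring x -> x \in A) ->
  forall x, onring x -> connect (linkA A) (pt 0 0) x.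
Proof.
move=> rA; have inA i j : (i <= W)%N -> (j <= W)%N -> [|| i == 0, i == W, j == 0 | j == W]%N -> pt i j \in A.
  by move=> iW jW r; apply: rA; rewrite /onring !pt1 ?pt2.
have W0 : (0 < W)%N by have := fo0_bound; lia.
have b1 i : (i <= W)%N -> connect (linkA A) (pt 0 0) (pt i 0).
  elim: i => // i IHi iW; apply: connect_trans (IHi (ltnW iW)) _; apply/connect1/stepH => //.
  - by apply/negP => /andP[/hole_bound]; lia.
  - by apply: inA; lia.
  - by apply: inA; lia.
have b2 j : (j <= W)%N -> connect (linkA A) (pt 0 0) (pt 0 j).
  elim: j => // j IHj jW; apply: connect_trans (IHj (ltnW jW)) _; apply/connect1/stepV => //.
  - by apply/negP => /andP[/hole_bound]; lia.
  - by apply: inA; lia.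
  - by apply: inA; lia.
have b3 i : (i <= W)%N -> connect (linkA A) (pt 0 0) (pt i W).
  elim: i => [|i IHi] iW; first exact: b2.
  apply: connect_trans (IHi (ltnW iW)) _; apply/connect1/stepH => //.
  - by apply/negP => /andP[/hole_bound]; lia.
  - by apply: inA; lia.
  - by apply: inA; lia.
have b4 j : (j <= W)%N -> connect (linkA A) (pt 0 0) (pt W j).
  elim: j => [|j IHj] jW; first exact: b1.
  apply: connect_trans (IHj (ltnW jW)) _; apply/connect1/stepV => //.
  - by apply/negP => /andP[/hole_bound]; lia.
  - by apply: inA; lia.
  - by apply: inA; lia.
move=> x; have := node1_le x; have := node2_le x; rewrite /onring => ? ?; rewrite -{5}(ptK x).
by case/or4P => /eqP->; [exact: b2 | exact: b4 | exact: b1 | exact: b3].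
Qed.

Lemma nd_conn i j (A : {set node W}) : (i < W)%N -> (j < W)%N -> ~~ hole i j ->
  nd i j \subset A -> forall x y, x \in nd i j -> y \in nd i j -> connect (linkA A) x y.
Proof.
move=> iW jW nh /fintype.subsetP sA.
have cA x : corner i j x -> x \in A by move=> xc; apply: sA; rewrite inE xc.
suff base x : x \in nd i j -> connect (linkA A) (pt i j) x.
  by move=> x y xn yn; apply: connect_trans (base y yn); rewrite linkA_sym base.
rewrite inE => /orP[xc|/andP[t xr]]; first exact: corner_conn.
have rA z : onring z -> z \in A by move=> zr; apply: sA; rewrite inE t zr orbT.
have /existsP[y /andP[yc yr]] := t.
apply: connect_trans (corner_conn iW jW nh cA yc) _.
by apply: connect_trans (ring_conn rA xr); rewrite linkA_sym ring_conn.
Qed.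

Lemma common_corner i j i' j' P : (i < W)%N -> (j < W)%N -> (i' < W)%N -> (j' < W)%N ->
  sqr i j P -> sqr i' j' P -> exists x, corner i j x && corner i' j' x.
Proof.
move=> iW jW iW' jW' /sqrP[p1 p2 p3 p4] /sqrP[q1 q2 q3 q4].
have := le_trans p1 q2; have := le_trans q1 p2; have := le_trans p3 q4; have := le_trans q3 p4.
rewrite !cx_le => ? ? ? ?; exists (pt (maxn i i') (maxn j j')).
by apply/andP; split; apply: corner_pt => //; lia.
Qed.

Lemma touch_box i j P : (i < W)%N -> (j < W)%N -> sqr i j P -> supn P = box -> touch i j.
Proof.
move=> iW jW /sqrP[p1 p2 p3 p4] sB.
have W0 : (0 < W)%N by have := fo0_bound; lia.
have e : [|| cx i <= cx 0, cx W <= cx i.+1, cx j <= cx 0 | cx W <= cx j.+1].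
  rewrite cx0 cxW; move: sB; rewrite /supn => sB.
  have : box <= Num.max `|P.1| `|P.2| by rewrite sB.
  by rewrite le_max !ler_normr => /orP[/orP[?|?]|/orP[?|?]]; apply/or4P; [constructor 2|constructor 1|constructor 4|constructor 3]; lra.
move: e; rewrite !cx_le => /or4P[e|e|e|e]; apply/existsP.
- exists (pt i j); rewrite corner_pt ?leqnn ?leqnSn //= /onring; have [||-> ->] := @ptP (i) (j); lia.
- exists (pt i.+1 j); rewrite corner_pt ?leqnn ?leqnSn //= /onring; have [||-> ->] := @ptP (i.+1) (j); lia.
- exists (pt i j); rewrite corner_pt ?leqnn ?leqnSn //= /onring; have [||-> ->] := @ptP (i) (j); lia.
- exists (pt i j.+1); rewrite corner_pt ?leqnn ?leqnSn //= /onring; have [||-> ->] := @ptP (i) (j.+1); lia.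
Qed.

Lemma cx_mir (k : 'I_h) c : (c <= 2 * ha k + 7 * N)%N -> cx (mir N ha k c) = 2 * mid k - cx c.
Proof.
move=> cle; have N0 : N%:R != 0 :> R by rewrite pnatr_eq0.
rewrite /cx /mir natrB // natrD (natrM _ 2) (natrM _ 7) /ha natrD /fo (natrM _ (3 * N)) (natrM _ 3).
rewrite natrD /= addn0 natrM /SolidHandles.mid /SphereChart.box.
move: N%:R boxn%:R N0 (k%:R) (c%:R) => x y N0 z w; by field.
Qed.

Lemma mirD (k : 'I_h) x : (x <= 2 * fo k false + 9 * N)%N ->
  (mir N ha k x + x = 2 * fo k false + 9 * N)%N.
Proof. by rewrite /mir /ha; move: (fo k false) => A; lia. Qed.

(** Reflecting the second grid square turns the gluing into equality: the two squares then share a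
    point of the rim, and being cells of one grid they also share a node of it. [adjacent_pick]
    finds that node along the side of the hole. *)
Lemma rim_meet (k : 'I_h) i j i' j' P P' : infoot k false i j -> infoot k true i' j' ->
  sqr i j P -> sqr i' j' P' -> tq k (-1) P = 1 / 6 -> P.1 + P'.1 = 2 * mid k -> P.2 = P'.2 ->
  exists x y, [/\ rim N hb ha k x y, (i <= x <= i.+1)%N, (j <= y <= j.+1)%N,
    (i' <= mir N ha k x <= i'.+1)%N & (j' <= y <= j'.+1)%N].
Proof.
move=> /and4P[f1 f2 f3 f4] /and4P[f1' f2' f3' f4'] /sqrP[p1 p2 p3 p4] /sqrP[q1 q2 q3 q4] tE xE yE.
rewrite foE in f1' f2'.
have c1 : (i' <= 2 * ha k + 7 * N)%N by rewrite /ha; lia.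
have c2 : (i'.+1 <= 2 * ha k + 7 * N)%N by rewrite /ha; lia.
have := cx_mir c1; have := cx_mir c2.
set m1 := mir N ha k i'; set m2 := mir N ha k i'.+1 => e2 e1.
have u1 : cx m2 <= P.1 by lra.
have u2 : P.1 <= cx m1 by lra.
have m1E : m1 = (2 * fo k false + 9 * N - i')%N by have := @mirD k i'; rewrite -/m1; clear_real R; lia.
have m2E : m2.+1 = m1 by have := @mirD k i'.+1; rewrite -/m2; clear_real R; lia.
have g1 := cx_foN k false 1; have g2 := cx_foN k false 2; have g1' := cx_fo0 1; have g2' := cx_fo0 2.
rewrite !mul1n in g1 g1'; rewrite /sgn in g1 g2.
set A := fo k false in g1 g2 f1 f2 f1' f2' m1E.
have yl : cx j' <= P.2 by rewrite yE. have yr : P.2 <= cx j'.+1 by rewrite yE.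
have j1 := le_trans p3 yr; have j2 := le_trans yl p4.
have i1 := le_trans p1 u2; have i2 := le_trans u1 p2.
rewrite !cx_le in j1 j2 i1 i2.
have tt : (P.1 = cx (A + N) \/ P.1 = cx (A + 2 * N)) /\ cx (fo0 + N) <= P.2 <= cx (fo0 + 2 * N) \/
    (P.2 = cx (fo0 + N) \/ P.2 = cx (fo0 + 2 * N)) /\ cx (A + N) <= P.1 <= cx (A + 2 * N).
  rewrite g1 g2 g1' g2'; move: tE; rewrite /tq.
  have [le e|lt e] := leP `|P.1 - (mid k + -1)| `|P.2 - 1 / 2|; [right|left].
    rewrite e ler_norml in le; case/andP: le => l1 l2; split; last by apply/andP; split; lra.
    by have [a|a] := leP 0 (P.2 - 1 / 2); [rewrite ger0_norm // in e; right | rewrite ltr0_norm // in e; left]; lra.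
  move: lt; rewrite e ltr_norml => /andP[l1 l2]; split; last by apply/andP; split; lra.
  by have [a|a] := leP 0 (P.1 - (mid k + -1)); [rewrite ger0_norm // in e; right | rewrite ltr0_norm // in e; left]; lra.
have mirE x : (x <= 2 * A + 9 * N)%N -> (mir N ha k x + x = 2 * A + 9 * N)%N.
  exact: mirD.
have fin (x y : nat) : (A + N <= x <= A + 2 * N)%N -> (fo0 + N <= y <= fo0 + 2 * N)%N ->
   [|| x == A + N, x == A + 2 * N, y == fo0 + N | y == fo0 + 2 * N]%N ->
   (i <= x <= i.+1)%N -> (j <= y <= j.+1)%N -> (m2 <= x <= m1)%N -> (j' <= y <= j'.+1)%N ->
   exists x y, [/\ rim N hb ha k x y, (i <= x <= i.+1)%N, (j <= y <= j.+1)%N,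
    (i' <= mir N ha k x <= i'.+1)%N & (j' <= y <= j'.+1)%N].
  move=> xb yb xy ix jy mx jy'; exists x, y; split=> //.
    by move: xb yb xy; rewrite /rim /ha /hb -/A; clear -A; clearbody A; lia.
  by have := mirE x; clear_real R; lia.
have N0 : (0 < N)%N by [].
case: tt => -[ee /andP[l1 l2]].
  have [x [xE' xb]] : exists x, P.1 = cx x /\ (x = A + N \/ x = A + 2 * N)%N.
    by case: ee => ->; [exists (A + N)%N; split=> //; left | exists (A + 2 * N)%N; split=> //; right].
  rewrite xE' !cx_le in p1 p2 u1 u2.
  have := le_trans l1 p4; have := le_trans l1 yr; have := le_trans p3 l2; have := le_trans yl l2.
  rewrite !cx_le => ? ? ? ?.
  have [|||||||y [y1 y2 y3]] := @adjacent_pick (fo0 + N)%N (fo0 + 2 * N)%N j j'; try (clear_real R; lia).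
  by apply: (fin x y) => //; clear_real R; lia.
have [y [yE' yb]] : exists y, P.2 = cx y /\ (y = fo0 + N \/ y = fo0 + 2 * N)%N.
  by case: ee => ->; [exists (fo0 + N)%N; split=> //; left | exists (fo0 + 2 * N)%N; split=> //; right].
rewrite yE' !cx_le in p3 p4 yl yr.
have := le_trans l1 p2; have := le_trans l1 u2; have := le_trans p1 l2; have := le_trans u1 l2.
rewrite !cx_le => ? ? ? ?.
have [|||||||x [x1 x2 x3]] := @adjacent_pick (A + N)%N (A + 2 * N)%N i m2; try (clear_real R; lia).
by apply: (fin x y) => //; clear_real R; lia.
Qed.

(** Images agree in three ways: equal parameters, mirror images at the top of a tube, or the south
    pole. They give a common corner, a rung and the common ring respectively. *)
Lemma chart_meet i j i' j' P P' : (i < W)%N -> (j < W)%N -> ~~ hole i j ->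
  (i' < W)%N -> (j' < W)%N -> ~~ hole i' j' -> sqr i j P -> sqr i' j' P' ->
  chart i j P = chart i' j' P' ->
  exists x y, [/\ x \in nd i j, y \in nd i' j' &
    x = y \/ linked (lsrc (h:=h) (W:=W)) (ltgt (W:=W) N ha) (lok (W:=W) N hb ha) x y].
Proof.
move=> iW jW nh iW' jW' nh' sP sP' eqc.
have same : P = P' -> exists x y, [/\ x \in nd i j, y \in nd i' j' &
    x = y \/ linked (lsrc (h:=h) (W:=W)) (ltgt (W:=W) N ha) (lok (W:=W) N hb ha) x y].
  move=> PE; rewrite -PE in sP'; have [x /andP[c1 c2]] := common_corner iW jW iW' jW' sP sP'.
  by exists x, x; rewrite !inE c1 c2; split=> //; left.
have [PB PB'] := (sqr_box iW jW sP, sqr_box iW' jW' sP').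
have [[k [s [f c]]]|[n1 c]] := chartP i j; have [[k' [s' [f' c']]]|[n2 c']] := chartP i' j'; move: eqc; rewrite c c' => eqc.
- have a1 : 1 / 6 <= tq k (sgn s) P <= 1 / 2 by rewrite (foot_tq_ge f nh sP) (foot_tq f sP).
  have a1' : 1 / 6 <= tq k' (sgn s') P' <= 1 / 2 by rewrite (foot_tq_ge f' nh' sP') (foot_tq f' sP').
  have [kk] := psit_inj (ltn_ord k) (ltn_ord k') (sgnP s) (sgnP s') a1 a1' eqc.
  have {}kk : k = k' by exact: val_inj.
  subst k'; case=> [[_ PE]|[ss tE xE yE]]; first exact: same.
  have mlink x y : rim N hb ha k x y -> (x <= W)%N -> (y <= W)%N -> (mir N ha k x <= W)%N ->
     linked (lsrc (h:=h) (W:=W)) (ltgt (W:=W) N ha) (lok (W:=W) N hb ha) (pt x y) (pt (mir N ha k x) y).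
    move=> r xW yW mW; apply/existsP; exists (lR W k x y); rewrite /= !inordK ?ltnS // r /=.
    by rewrite !eqxx.
  have tE' : tq k (sgn s') P' = 1 / 6.
    have [_ _ _ st _] := tubept_inj (ltn_ord k) (ltn_ord k) (sg_norm (sgnP s)) (sg_norm (sgnP s'))
      (txi_bound (sgnP s) a1) (txi_bound (sgnP s') a1') (ty_bound a1) (ty_bound a1') (ts_bound a1) (ts_bound a1') eqc.
    lra.
  have n10 : (1 : R) <> -1 by lra.
  case: s s' ss f c f' c' tE tE' {a1 a1' eqc} => -[] //= ss f c f' c' tE tE'; rewrite /sgn in ss tE tE'; rewrite ?opprK in ss.
  - have [||x [y [r x1 y1 x2 y2]]] := rim_meet f' f sP' sP tE'; rewrite ?[P'.1 + _]addrC //.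
    exists (pt (mir N ha k x) y), (pt x y); rewrite !inE !corner_pt //; split=> //; right.
    have := mlink x y r; rewrite /linked => /(_ _ _ _) lk.
    have /existsP[l /andP[ok lE]] : [exists l, lok N hb ha l && (((lsrc l == pt x y) && (ltgt N ha l == pt (mir N ha k x) y)) || ((lsrc l == pt (mir N ha k x) y) && (ltgt N ha l == pt x y)))].
      by apply: lk; lia.
    by apply/existsP; exists l; rewrite ok orbC.
  - have [||x [y [r x1 y1 x2 y2]]] := rim_meet f f' sP sP' tE => //.
  exists (pt x y), (pt (mir N ha k x) y); rewrite !inE !corner_pt //; split=> //; right.
    by apply: mlink => //; lia.
  - by case: (n10 (esym ss)).
- have a1 : 1 / 6 <= tq k (sgn s) P <= 1 / 2 by rewrite (foot_tq_ge f nh sP) (foot_tq f sP).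
  have [PE _] := psit_psis (ltn_ord k) (sgnP s) a1 PB' eqc; exact: same.
- have a1' : 1 / 6 <= tq k' (sgn s') P' <= 1 / 2 by rewrite (foot_tq_ge f' nh' sP') (foot_tq f' sP').
  have [PE _] := psit_psis (ltn_ord k') (sgnP s') a1' PB (esym eqc); exact: same.
- have [PE|[b1 b2]] := psis_inj PB PB' eqc; first exact: same.
  have r0 : onring (pt 0 0) by rewrite /onring !pt1.
  exists (pt 0 0), (pt 0 0); rewrite !inE (touch_box iW jW sP b1) (touch_box iW' jW' sP' b2) r0 !orbT.
  by split=> //; left.
Qed.

Lemma sqr_corner i j x : corner i j x -> sqr i j (cx x.1, cx x.2).
Proof.
move=> /andP[h1 h2]; apply/sqrP; rewrite /= !cx_le; split; move: h1 h2; lia.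
Qed.

Lemma touch_pole i j : (i < W)%N -> (j < W)%N -> touch i j ->
  (chart i j @` sqr i j) (0, 0, - rad).
Proof.
move=> iW jW /existsP[x /andP[xc xr]]; have sx := sqr_corner xc.
exists (cx x.1, cx x.2) => //.
have bB := sqr_box iW jW sx.
have sB : supn (cx x.1, cx x.2) = box.
  apply/eqP; rewrite eq_le bB /= le_max !ler_normr /= -cxW !cx_le -[cx W](opprK) lerN2.
  have -> : - cx W = cx 0 by rewrite cxW cx0.
  by rewrite -cxW in bB; case/or4P: xr => /eqP->; rewrite ?cx_le ?leqnn ?cx0 ?cxW ?lerN2 ?lexx ?orbT.
have [[k [s [f c]]]|[_ ->]] := chartP i j; last exact: psis_pole.
have [? ?] := fo_bound k s; have [? ?] := fo0_bound.
by case/and4P: f xc xr; rewrite /corner /onring; lia.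
Qed.

(** A common border node leads to the south pole, any other common node to the point which it
    parametrises. *)
Lemma nd_meet i j i' j' x : (i < W)%N -> (j < W)%N -> ~~ hole i j ->
  (i' < W)%N -> (j' < W)%N -> ~~ hole i' j' -> x \in nd i j -> x \in nd i' j' ->
  (chart i j @` sqr i j) `&` (chart i' j' @` sqr i' j') !=set0.
Proof.
move=> iW jW nh iW' jW' nh'; rewrite !inE => xn xn'.
have [xr|nr] := boolP (onring x).
  have tt a b : corner a b x || touch a b && onring x -> touch a b.
    by case/orP => [c|/andP[]//]; apply/existsP; exists x; rewrite c.
  by exists (0, 0, - rad); split; apply: touch_pole => //; exact: tt.
rewrite (negbTE nr) !andbF !orbF in xn xn'.
have [s1 s2] := (sqr_corner xn, sqr_corner xn').
exists (chart i j (cx x.1, cx x.2)); split; first by exists (cx x.1, cx x.2).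
by exists (cx x.1, cx x.2) => //; exact/esym/chart_eq.
Qed.

End Mesh.

Lemma chart_small (R : realType) (h : nat) (d : R) : 0 < d ->
  \forall n \near \oo, forall i j P P', (i < wid h n)%N -> (j < wid h n)%N ->
    ~~ hole n.+1 (hb h n) (ha n (h := h)) i j -> sqr h n i j P -> sqr h n i j P' ->
    ball (chart h n i j P) d (chart h n i j P').
Proof.
move=> d0.
have k0 : compact (`[- box R h, box R h]%classic `*` `[- box R h, box R h]%classic).
  by apply: compact_setX; exact: segment_compact.
have box_mem P : supn P <= box R h ->
    (`[- box R h, box R h]%classic `*` `[- box R h, box R h]%classic) P.
  by rewrite /supn ge_max !ler_norml => /andP[p1 p2]; split; rewrite /= in_itv.
have box_le P : (`[- box R h, box R h]%classic `*` `[- box R h, box R h]%classic) P ->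
    supn P <= box R h.
  by case; rewrite /= !in_itv /= => p1 p2; rewrite /supn ge_max !ler_norml p1.
have s0 := @unif_small R _ (psis (R := R) h) _ d k0 (fun P KP => psis_cont (box_le P KP)) d0.
have s1 : \forall n \near \oo, forall ks : 'I_h * bool, forall P,
    1 / 6 <= tq ks.1 (sgn R ks.2) P <= 1 / 2 -> forall P', `|P.1 - P'.1| <= n.+1%:R^-1 ->
    `|P.2 - P'.2| <= n.+1%:R^-1 -> ball (psit h ks.1 (sgn R ks.2) P) d (psit h ks.1 (sgn R ks.2) P').
  apply: filter_forall => -[k s] /=.
  apply: (@unif_small R _ (psit h k (sgn R s)) [set P | 1 / 6 <= tq k (sgn R s) P <= 1 / 2] d) => //.
    pose c : R := mid R k + sgn R s.
    apply: (@subclosed_compact (R * R)%type _ (`[c - 1 / 2, c + 1 / 2]%classic `*` `[0 : R, 1 : R]%classic)).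
    - have cq P : {for P, continuous (@tq R k (sgn R s))}.
        by apply: cont_max; apply: cont_abs; apply: cont_sub; try exact: cont_cst; [exact: fst_cont | exact: snd_cont].
      have -> : [set P | 1 / 6 <= tq k (sgn R s) P <= 1 / 2] =
          (@tq R k (sgn R s)) @^-1` [set x | 1 / 6 <= x] `&` (@tq R k (sgn R s)) @^-1` [set x | x <= 1 / 2].
        by apply/seteqP; split=> P /=; [case/andP | case=> -> ->].
      by apply: closedI; apply: closed_comp => [P _|]; [exact: cq | exact: closed_ge | exact: cq | exact: closed_le].
    - by apply: compact_setX; exact: segment_compact.
    - move=> P /= /andP[_]; rewrite /tq ge_max !ler_norml -/c => /andP[/andP[a1 a2] /andP[a3 a4]].
      by split; rewrite /= in_itv /=; apply/andP; split; lra.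
  by move=> P /= ann; exact: psit_cont.
apply: filterS2 s0 s1 => n s0 s1 i j P P' iW jW nh sP sP'.
have sqr_near : `|P.1 - P'.1| <= n.+1%:R^-1 /\ `|P.2 - P'.2| <= n.+1%:R^-1.
  have := cx_step R h n i; have := cx_step R h n j.
  case/sqrP: sP => ? ? ? ?; case/sqrP: sP' => ? ? ? ?.
  by move: (n.+1%:R^-1) => w ? ?; rewrite !ler_norml; split; apply/andP; split; lra.
case: sqr_near => d1 d2.
have [[k [s [f ->]]]|[_ ->]] := @chartP R h n i j.
  by apply: (s1 (k, s)) => //=; rewrite (foot_tq_ge f nh sP) (foot_tq f sP).
by apply: s0 => //; apply: box_mem; exact: sqr_box sP.
Qed.

Theorem sphere_fine_cover (R : realType) (h : nat) (d : R) : 0 < d ->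
  fine_cover (@sphere_with_handles R h) h d.
Proof.
move=> d0; have [n _ /(_ n (leqnn n)) /= small] := @chart_small R h d d0.
have [f1 f2] := fo0_bound h n.
have N0 : (0 < n.+1)%N by [].
have b0 : (0 < hb h n)%N by rewrite /hb; lia.
have bW : (hb h n + n.+1 < wid h n)%N by rewrite /hb; lia.
have a0 (k : 'I_h) : (0 < ha n k)%N by rewrite /ha; lia.
have aW (k : 'I_h) : (ha n k + 7 * n.+1 < wid h n)%N.
  by have [_] := fo_bound n k true; rewrite foE /ha; lia.
have aS (k k' : 'I_h) : k != k' -> (ha n k + 12 * n.+1 <= ha n k')%N || (ha n k' + 12 * n.+1 <= ha n k)%N.
  rewrite -(inj_eq val_inj) /= /ha /fo /= !addn0 => kk.
  have [lt|lt] : (k.+1 <= k')%N \/ (k'.+1 <= k)%N by lia.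
    by apply/orP; left; nia.
  by apply/orP; right; nia.
have [cls clsP] := grid_classes N0 b0 bW a0 aW aS.
pose Q : finType := {q : node (wid h n) | [&& q.1 < wid h n, q.2 < wid h n & ~~ hole n.+1 (hb h n) (ha n (h := h)) q.1 q.2]%N}.
exists (node (wid h n)), (link h (wid h n)), (face h (wid h n)),
  ({ffun 'I_h -> bool} * {ffun 'I_h -> bool})%type, Q, (lH h (wid h n) 0 0),
  (lsrc (h:=h) (W:=wid h n)), (ltgt (W:=wid h n) n.+1 (ha n (h := h))),
  (fbd (W:=wid h n) n.+1 (hb h n) (ha n (h := h))), cls, (lok (W:=wid h n) n.+1 (hb h n) (ha n (h := h))),
  (fun q : Q => chart h n (val q).1 (val q).2 @` sqr h n (val q).1 (val q).2),
  (fun q : Q => nd h n (val q).1 (val q).2).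
split.
- split.
  + by rewrite card_prod card_ffun card_bool card_ord -expnD mul2n addnn.
  + exact: fbd_le2.
  + exact: fbd_cycle.
  + exact: clsP.
- split.
  + by case=> q /= /and3P[q1 q2 q3]; exact: chart_closed.
  + move=> x /(chart_cover n)[i [j [iW jW nh xc]]].
    have [e1 e2] := ptP (ltnW iW) (ltnW jW).
    have qP : [&& (pt (wid h n) i j).1 < wid h n, (pt (wid h n) i j).2 < wid h n &
        ~~ hole n.+1 (hb h n) (ha n (h := h)) (pt (wid h n) i j).1 (pt (wid h n) i j).2]%N.
      by rewrite e1 e2 iW jW.
    by exists (exist _ (pt (wid h n) i j) qP); rewrite [val _]/= e1 e2.
  + by case=> q /= /and3P[q1 q2 q3] x y [P sP <-] [P' sP' <-]; exact: small.
- split.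
  + case=> q /= /and3P[q1 q2 q3]; exists (pt (wid h n) q.1 q.2); rewrite inE.
    by rewrite corner_pt ?leqnn ?leqnSn.
  + case=> q /= /and3P[q1 q2 q3] [q' /= /and3P[q1' q2' q3']] [w [[P sP <-] [P' sP' eqP]]] x y xn yn.
    have [a [b [an bn ab]]] := chart_meet q1 q2 q3 q1' q2' q3' sP sP' (esym eqP).
    have c1 := nd_conn q1 q2 q3 (finset.subsetUl (nd h n q.1 q.2) (nd h n q'.1 q'.2)) xn an.
    have c2 := nd_conn q1' q2' q3' (finset.subsetUr (nd h n q.1 q.2) (nd h n q'.1 q'.2)) bn yn.
    apply: connect_trans c1 (connect_trans _ c2).
    case: ab => [->|ab]; first exact: connect0.
    by apply: connect1; apply/and3P; split=> //; rewrite inE ?an ?bn ?orbT.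
  + case=> q /= /and3P[q1 q2 q3] [q' /= /and3P[q1' q2' q3']] x xn xn'.
    exact: nd_meet xn xn'.
Qed.

Theorem embeds_edge_bound (R : realType) (n : nat) (G : sgraph n) (h : nat) :
  embeds_in R (@sphere_with_handles R h) G -> (#|edges G| <= 3 * n + 6 * h)%N.
Proof.
apply: fine_cover_edge_bound; first exact: (@norm_hausdorff R (R * R * R)%type).
exact: sphere_fine_cover.
Qed.

End EdgeBound.

(** * Arcs in the plane, on the upper hemisphere and along the tubes *)

Module SurfaceArcs.
Import Chains GridHomology FineCovers SolidHandles SphereChart EdgeBound.
Local Open Scope classical_set_scope.
Local Open Scope ring_scope.

Section Arcs.
Variable R : realType.

(** The parametrisation is continuous on all of [R], not just on the unit interval, so that it can
    be composed with [min] and [max] without subspace topologies. *)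
Definition is_arc (V : topologicalType) (A : set V) (p q : V) :=
  exists c : R -> V, [/\ continuous c, {in `[0, 1] &, injective c}, c @` `[0, 1] = A, c 0 = p & c 1 = q].

Lemma arc_rev (V : topologicalType) (A : set V) p q : is_arc A p q -> is_arc A q p.
Proof.
move=> [c [cc ci cA c0 c1]]; exists (fun t => c (1 - t)).
have fl : continuous (fun t : R => 1 - t).
  by move=> t; apply: (@cont_sub R R t (fun _ => 1) id); [exact: cont_cst | exact: cvg_id].
split.
- by move=> t; apply: (@continuous_comp _ _ _ (fun t : R => 1 - t) c); [exact: fl | exact: cc].
- move=> s t; rewrite !in_itv /= => /andP[s0 s1] /andP[t0 t1] /ci.
  have inI (r : R) : 0 <= r -> r <= 1 -> 1 - r \in `[0, 1].
    by move=> ? ?; rewrite in_itv /=; apply/andP; split; lra.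
  by move=> E; have := E (inI s s0 s1) (inI t t0 t1); lra.
- rewrite -cA; apply/seteqP; split=> _ [t tI <-]; rewrite /= in_itv /= in tI; case/andP: tI => t0 t1.
    by exists (1 - t) => //; rewrite /= in_itv /=; apply/andP; split; lra.
  exists (1 - t); first by rewrite /= in_itv /=; apply/andP; split; lra.
  by rewrite opprB addrC subrK.
- by rewrite subr0.
- by rewrite subrr.
Qed.

Lemma arc_image (V W : topologicalType) (f : V -> W) (A : set V) p q :
  continuous f -> {in A &, injective f} -> is_arc A p q -> is_arc (f @` A) (f p) (f q).
Proof.
move=> fc fi [c [cc ci cA c0 c1]]; exists (f \o c); split.
- by move=> t; apply: continuous_comp; [exact: cc | exact: fc].
- move=> s t sI tI /= /fi E; apply: ci => //; apply: E; rewrite inE -cA.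
    by exists s => //; rewrite inE in sI.
  by exists t => //; rewrite inE in tI.
- by rewrite -cA image_comp.
- by rewrite /= c0.
- by rewrite /= c1.
Qed.

Lemma arc_ends (V : topologicalType) (A : set V) p q : is_arc A p q -> A p /\ A q.
Proof.
by move=> [c [_ _ <- <- <-]]; split; [exists 0|exists 1] => //; rewrite /= in_itv /= lexx ler01.
Qed.

Lemma arc_cat (V : normedModType R) (A B : set V) p q r :
  is_arc A p q -> is_arc B q r -> A `&` B `<=` [set q] -> is_arc (A `|` B) p r.
Proof.
move=> [c [cc ci cA c0 c1]] [d [dc di dB d0 d1]] AB.
(* At every [t] one of the two values equals [q] and is cancelled, so the concatenation is
   continuous as a sum of continuous functions. *)
pose e t := c (Num.min (2 * t) 1) + d (Num.max (2 * t - 1) 0) - q.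
have e_lo t : 2 * t <= 1 -> e t = c (2 * t).
  by move=> t1; rewrite /e (min_idPl t1) (max_idPr _) ?subr_le0 // d0 addrK.
have e_hi t : 1 <= 2 * t -> e t = d (2 * t - 1).
  by move=> t1; rewrite /e (min_idPr t1) (max_idPl _) ?subr_ge0 // c1 addrC addKr.
have cA' t : 0 <= t <= 1 -> A (c t) by move=> tI; rewrite -cA; exists t => //; rewrite /= in_itv.
have dB' t : 0 <= t <= 1 -> B (d t) by move=> tI; rewrite -dB; exists t => //; rewrite /= in_itv.
have inI t : 0 <= t -> t <= 1 -> t \in `[0, 1] by move=> ? ?; rewrite in_itv /=; apply/andP.
have o01 : 0 <= (0 : R) <= 1 by rewrite lexx ler01.
have o11 : 0 <= (1 : R) <= 1 by rewrite lexx ler01.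
have mix s t : 0 <= s -> 2 * s <= 1 -> 1 <= 2 * t -> t <= 1 -> e s = e t -> s = t.
  move=> s0 s1 t0 t1; rewrite e_lo // e_hi // => E.
  have cq : c (2 * s) = q.
    by apply: AB; split; [apply: cA'; lra | rewrite E; apply: dB'; lra].
  have : 2 * s = 1 by apply: ci; rewrite ?cq ?c1 //; apply: inI; lra.
  have : 2 * t - 1 = 0 by apply: di; rewrite -?E ?cq ?d0 //; apply: inI; lra.
  lra.
exists e; split.
- have c2 : continuous (fun t : R => 2 * t).
    by move=> t; apply: (@cont_mul R R t (fun _ => 2) id); [exact: cont_cst | exact: cvg_id].
  move=> t; apply: cvgB; last exact: cvg_cst.
  apply: cvgD.
    apply: (@continuous_comp _ _ _ (fun t : R => Num.min (2 * t) 1) c); last exact: cc.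
    by apply: cont_min; [exact: c2 | exact: cont_cst].
  apply: (@continuous_comp _ _ _ (fun t : R => Num.max (2 * t - 1) 0) d); last exact: dc.
  by apply: cont_max; [apply: cont_sub; [exact: c2 | exact: cont_cst] | exact: cont_cst].
- move=> s t; rewrite !in_itv /= => /andP[s0 s1] /andP[t0 t1] E.
  have [ls|ls] := leP (2 * s) 1; have [lt|lt] := leP (2 * t) 1.
  + have : 2 * s = 2 * t by apply: ci; rewrite -?e_lo //; apply: inI; lra.
    lra.
  + by apply: mix => //; exact: ltW.
  + by apply/esym; apply: mix => //; exact: ltW.
  + have : 2 * s - 1 = 2 * t - 1 by apply: di; rewrite -?e_hi ?(ltW ls) ?(ltW lt) //; apply: inI; lra.
    lra.
- apply/seteqP; split=> [_ [t tI <-]|x []].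
  + rewrite /= in_itv /= in tI; case/andP: tI => t0 t1; have [l|l] := leP (2 * t) 1.
      by left; rewrite e_lo //; apply: cA'; lra.
    by right; rewrite e_hi ?(ltW l) //; apply: dB'; lra.
  + rewrite -cA => -[t tI <-]; rewrite /= in_itv /= in tI; case/andP: tI => t0 t1.
    exists (t / 2); first by rewrite /= in_itv /=; apply/andP; split; lra.
    by rewrite e_lo; [congr c; field | lra].
  + rewrite -dB => -[t tI <-]; rewrite /= in_itv /= in tI; case/andP: tI => t0 t1.
    exists ((t + 1) / 2); first by rewrite /= in_itv /=; apply/andP; split; lra.
    by rewrite e_hi; [congr d; field | lra].
- by rewrite e_lo ?mulr0 ?ler01 // c0.
- by rewrite e_hi ?mulr1 ?d1 //; [rewrite (_ : 2 - 1 = 1) // ; lra | lra].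
Qed.

Lemma arc_set (V : topologicalType) (A B : set V) p q : A = B -> is_arc A p q -> is_arc B p q.
Proof. by move->. Qed.

(** The segment from [(x0, u)] to [(x1, v)], with its equation cleared of denominators. *)
Definition fan (x0 x1 u v : R) : set (R * R) :=
  [set P | x0 <= P.1 <= x1 /\ P.2 * (x1 - x0) = u * (x1 - P.1) + v * (P.1 - x0)].
Definition hseg (a b y : R) : set (R * R) := [set P | a <= P.1 <= b /\ P.2 = y].
Definition vseg (x a b : R) : set (R * R) := [set P | P.1 = x /\ a <= P.2 <= b].

Lemma affine_cont (a b : R) : continuous (fun t : R => a + b * t).
Proof.
move=> t; apply: (@cont_add R R t (fun _ => a) (fun t => b * t)); first exact: cont_cst.
by apply: (@cont_mul R R t (fun _ => b) id); [exact: cont_cst | exact: cvg_id].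
Qed.

Lemma segment_arc (a b c d : R) (A : set (R * R)) : (b != 0) || (d != 0) ->
  (forall P, A P <-> exists t, [/\ 0 <= t, t <= 1, P.1 = a + b * t & P.2 = c + d * t]) ->
  is_arc A (a, c) (a + b, c + d).
Proof.
move=> nz AP; exists (fun t => (a + b * t, c + d * t)); split.
- have cp t : {for t, continuous (fun t => (a + b * t, c + d * t))}.
    by apply: cont_pair; exact: affine_cont.
  exact: cp.
- move=> s t _ _ [/addrI e1 /addrI e2]; case/orP: nz => nz; [exact: (mulfI nz) e1 | exact: (mulfI nz) e2].
- apply/seteqP; split=> [_ [t tI <-]|P /AP[t [t0 t1 e1 e2]]].
    by rewrite /= in_itv /= in tI; case/andP: tI => ? ?; apply/AP; exists t.
  by exists t; [rewrite /= in_itv /=; apply/andP | rewrite [P]surjective_pairing e1 e2].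
- by rewrite !mulr0 !addr0.
- by rewrite !mulr1.
Qed.

Lemma ratio01 (a b x : R) : a < b -> a <= x -> x <= b ->
  exists t, [/\ 0 <= t, t <= 1 & x = a + (b - a) * t].
Proof.
move=> ab ax xb; have d0 : 0 < b - a by rewrite subr_gt0.
exists ((x - a) / (b - a)); split.
- by rewrite divr_ge0 ?subr_ge0 // ltW.
- by rewrite ler_pdivrMr // mul1r lerD2r.
- by rewrite mulrC mulfVK ?gt_eqF // addrC subrK.
Qed.

Lemma hseg_arc a b y : a < b -> is_arc (hseg a b y) (a, y) (b, y).
Proof.
move=> ab; have := @segment_arc a (b - a) y 0 (hseg a b y).
rewrite (addrC a) subrK addr0; apply; first by rewrite gt_eqF ?subr_gt0.
move=> P; split=> [[/andP[p1 p2] p3]|[t [t0 t1 e1 e2]]].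
  by have [t [t0 t1 tE]] := ratio01 ab p1 p2; exists t; split=> //; rewrite mul0r addr0.
split; last by rewrite e2 mul0r addr0.
by rewrite e1; apply/andP; split; nra.
Qed.

Lemma vseg_arc x a b : a < b -> is_arc (vseg x a b) (x, a) (x, b).
Proof.
move=> ab; have := @segment_arc x 0 a (b - a) (vseg x a b).
rewrite (addrC a) subrK addr0; apply; first by rewrite (gt_eqF (_ : 0 < b - a)) ?orbT ?subr_gt0.
move=> P; split=> [[p3 /andP[p1 p2]]|[t [t0 t1 e1 e2]]].
  by have [t [t0 t1 tE]] := ratio01 ab p1 p2; exists t; split=> //; rewrite mul0r addr0.
split; first by rewrite e1 mul0r addr0.
by rewrite e2; apply/andP; split; nra.
Qed.

Lemma fan_arc x0 x1 u v : x0 < x1 -> is_arc (fan x0 x1 u v) (x0, u) (x1, v).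
Proof.
move=> ab; have d0 : x1 - x0 != 0 by rewrite gt_eqF ?subr_gt0.
have := @segment_arc x0 (x1 - x0) u (v - u) (fan x0 x1 u v).
rewrite (addrC x0) (addrC u) !subrK; apply; first by rewrite d0.
move=> P; split=> [[/andP[p1 p2] p3]|[t [t0 t1 e1 e2]]].
  have [t [t0 t1 tE]] := ratio01 ab p1 p2; exists t; split=> //.
  by apply: (mulIf d0); rewrite p3 tE; ring.
split; first by rewrite e1; apply/andP; split; nra.
by rewrite e1 e2; ring.
Qed.

End Arcs.

Section Lift.
Variables (R : realType) (h : nat).
Notation point := (R * R * R)%type.
Notation rad := (rad R h).
Notation mid := (mid R).
Notation S := (@sphere_with_handles R h).

Definition lift (P : R * R) : point := (P.1, P.2, foot_z h P.1 P.2).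

Lemma lift_cont : continuous lift.
Proof.
move=> P; apply: cont_triple; [exact: fst_cont | exact: snd_cont |].
apply: cont_sqrt; apply: cont_sub; last by apply: cont_sqr; exact: snd_cont.
by apply: cont_sub; [exact: cont_cst | apply: cont_sqr; exact: fst_cont].
Qed.

Lemma lift_inj : injective lift.
Proof. by move=> [x y] [x' y'] [/= -> ->]. Qed.

(** Abscissas at which no leg meets the upper hemisphere, whatever [y] is; the gap between the two
    feet of a handle is included. *)
Definition clear (x : R) := forall k, (k < h)%N -> `|x - mid k| < 1 / 2 \/ 3 / 2 < `|x - mid k|.

(** Around an interior point every ray begins inside the solid, so one escaping direction proves
    that a point is on the frontier. *)
Lemma surface_of (x y z dx dy dz : R) : solid h (x, y, z) ->
  (forall e : R, 0 < e -> e < 1 -> ~ solid h (x + dx * e, y + dy * e, z + dz * e)) -> S (x, y, z).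
Proof.
move=> sp out; apply/surfaceE; split=> // ip.
have cc (e : R) : {for e, continuous (fun e => (x + dx * e, y + dy * e, z + dz * e))}.
  by apply: cont_triple; exact: affine_cont.
have nr : \forall e \near (0 : R)^'+, interior (solid h) (x + dx * e, y + dy * e, z + dz * e).
  have i0 : nbhs (x + dx * 0, y + dy * 0, z + dz * 0) (interior (solid h)).
    by rewrite !mulr0 !addr0; apply: open_nbhs_nbhs; split => //; exact: open_interior.
  exact: (cvg_at_right_filter (cc 0) i0).
near (0 : R)^'+ => e.
apply: (out e).
- by near: e; exact: nbhs_right_gt.
- by near: e; apply: nbhs_right_lt.
- have : interior (solid h) (x + dx * e, y + dy * e, z + dz * e) by near: e.
  exact: interior_subset.
Unshelve. all: by end_near.
Qed.

Lemma not_solid (x y z : R) : rad ^+ 2 < x ^+ 2 + y ^+ 2 + z ^+ 2 ->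
  (forall k, (k < h)%N -> ~ @solid_handle R h k (x, y, z)) -> ~ solid h (x, y, z).
Proof. by move=> nb nh [|[k kh /(nh k kh)]] //; rewrite /solid_ball /= leNgt nb. Qed.

(** The escaping direction is horizontal, away from the slab [0 <= y <= 1] of the handles, or else
    upwards, where [clear] keeps the legs away and a rise of less than one does not reach the
    bridge. *)
Lemma lift_surface (x y : R) : x ^+ 2 + y ^+ 2 < rad ^+ 2 ->
  [\/ y <= 0, 1 <= y | clear x] -> S (lift (x, y)).
Proof.
move=> xy; rewrite /lift /=; set z := foot_z h x y.
have zE : x ^+ 2 + y ^+ 2 + z ^+ 2 = rad ^+ 2.
  by rewrite /z /foot_z sqr_sqrtr; [ring | lra].
have z0 : 0 < z by rewrite /z sqrtr_gt0; lra.
have sp : solid h (x, y, z) by left; rewrite /solid_ball /= -/rad zE.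
have zr : z <= rad by rewrite -(@ler_sqr R) ?nnegrE ?(ltW z0) // -zE; have := sqr_ge0 x; have := sqr_ge0 y; lra.
case=> c.
- apply: (@surface_of _ _ _ 0 (-1) 0) => // e e0 e1; apply: not_solid; first by nra.
  by move=> k kh /handleE[_ /andP[? _] _ _]; lra.
- apply: (@surface_of _ _ _ 0 1 0) => // e e0 e1; apply: not_solid; first by nra.
  by move=> k kh /handleE[_ /andP[_ ?] _ _]; lra.
- apply: (@surface_of _ _ _ 0 0 1) => // e e0 e1; apply: not_solid; first by nra.
  move=> k kh /handleE[]; rewrite mul0r addr0 => a _ _ b.
  case: (c k kh) => lt; first by case: b => b; [lra | move: zr b; rewrite radE /roof; lra].
  by lra.
Qed.

Lemma tube_surface k (sg xi y s : R) : (k < h)%N -> `|sg| = 1 -> 1 / 2 <= xi <= 3 / 2 ->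
  y = 0 \/ y = 1 -> 0 <= s <= 1 -> S (tubept h k sg xi y s).
Proof.
move=> kh sg1 x1 yb s1.
have y1 : 0 <= y <= 1 by case: yb => ->; apply/andP; split; lra.
have nb := tubept_ball kh sg1 x1 y1 s1; have xE := tubept_x h k y sg1 x1 s1.
have zb := tubept_z kh sg1 x1 y1 s1; have fz := foot_z_gt0 kh sg1 x1 y1.
have zE : 1 <= 2 * s -> (tubept h k sg xi y s).2 = roof R h + xi.
  by move=> le; rewrite /tubept /= (min_idPl le) mul1r addrC subrK.
have yE : (tubept h k sg xi y s).1.2 = y by [].
case: (tubept h k sg xi y s) nb xE zb zE yE => [[px py] pz] /= nb xE zb zE yE; subst py.
have /andP[x2 x3] := x1; have /andP[s2 s3] := s1; have /andP[z2 z3] := zb.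
have m0 : 0 <= Num.max 0 (2 * s - 1) by rewrite le_max lexx.
have m1 : Num.max 0 (2 * s - 1) <= 1 by rewrite ge_max ler01 /=; lra.
have sp : solid h (px, y, pz).
  right; exists k => //; apply/handleE; rewrite xE; split=> //.
  - by move: (Num.max _ _) m0 m1 => m m0 m1; nra.
  - by apply/andP; split; lra.
  - have [le|lt] := leP 1 (2 * s); first by right; rewrite zE //; lra.
    by left; rewrite (max_idPl _) ?subr_le0 ?(ltW lt) // subr0 mulr1.
case: yb => yE; rewrite yE in nb sp *.
- apply: (@surface_of _ _ _ 0 (-1) 0) => // e e0 e1; apply: not_solid; first by nra.
  by move=> k' kh' /handleE[_ /andP[? _] _ _]; lra.
- apply: (@surface_of _ _ _ 0 1 0) => // e e0 e1; apply: not_solid; first by nra.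
  by move=> k' kh' /handleE[_ /andP[_ ?] _ _]; lra.
Qed.

Lemma tubept1 k (sg xi y : R) : tubept h k sg xi y 1 = (mid k, y, roof R h + xi).
Proof.
rewrite /tubept mulr1 (_ : 2 - 1 = 1 :> R); last by lra.
by rewrite (max_idPr ler01) subrr !mulr0 addr0 (min_idPl _) ?ler1n // mul1r addrC subrK.
Qed.

Definition tubeset k (xi y : R) : set point :=
  [set p | exists sg s, [/\ sg = -1 \/ sg = 1, 0 <= s <= 1 & p = tubept h k sg xi y s]].

Lemma tube_arc k (xi y : R) : (k < h)%N -> 1 / 2 <= xi <= 3 / 2 -> 0 <= y <= 1 ->
  is_arc R (tubeset k xi y) (lift (mid k - xi, y)) (lift (mid k + xi, y)).
Proof.
move=> kh x1 y1.
have s01 (sg : R) : sg = -1 \/ sg = 1 -> `|sg| = 1 by case=> ->; rewrite ?normrN normr1.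
have half (sg : R) : sg = -1 \/ sg = 1 ->
    is_arc R [set p | exists s, 0 <= s <= 1 /\ p = tubept h k sg xi y s]
      (lift (mid k + sg * xi, y)) (mid k, y, roof R h + xi).
  move=> sgP; exists (fun s => tubept h k sg xi y s); split.
  - have c2 s : {for s, continuous (fun s : R => 2 * s)}.
      by apply: (@cont_mul R R s (fun _ => 2) id); [exact: cont_cst | exact: cvg_id].
    have cc (s : R) : {for s, continuous (tubept h k sg xi y)}.
      apply: cont_triple; [|exact: cont_cst|].
        apply: cont_add; first exact: cont_cst.
        apply: cont_mul; first exact: cont_cst.
        apply: cont_mul; first exact: cont_cst.
        apply: cont_sub; first exact: cont_cst.
        by apply: cont_max; [exact: cont_cst | apply: cont_sub => //; exact: cont_cst].
      apply: cont_add; first exact: cont_cst.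
      apply: cont_mul; last exact: cont_cst.
      by apply: cont_min => //; exact: cont_cst.
    exact: cc.
  - move=> s s'; rewrite !in_itv /= => sI sI' eqp.
    by have [] := tubept_inj kh kh (s01 _ sgP) (s01 _ sgP) x1 x1 y1 y1 sI sI' eqp.
  - apply/seteqP; split=> [_ [s sI <-]|_ [s [sI ->]]]; exists s; rewrite ?/= ?in_itv //= in sI *.
  - by rewrite tubept0.
  - exact: tubept1.
have e1 : (-1 : R) = -1 \/ (-1 : R) = 1 by left.
have e2 : (1 : R) = -1 \/ (1 : R) = 1 by right.
have a1 := half _ e1; have a2 := arc_rev (half _ e2).
rewrite mulN1r in a1; rewrite mul1r in a2.
have := arc_cat a1 a2 => /(_ _) ac.
apply: arc_set (ac _).
  apply/seteqP; split=> [p [[s [sI ->]]|[s [sI ->]]]|p [sg [s [[] -> sI ->]]]].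
  - by exists (-1), s.
  - by exists 1, s.
  - by left; exists s.
  - by right; exists s.
move=> p [[s [sI ->]] [s' [sI' eqp]]].
have [_ _ _ ss [|s1]] := tubept_inj kh kh (s01 _ e1) (s01 _ e2) x1 x1 y1 y1 sI sI' eqp; first by lra.
by rewrite /= s1 tubept1.
Qed.

Lemma tube_lift k (xi y : R) P : (k < h)%N -> 1 / 2 <= xi <= 3 / 2 -> 0 <= y <= 1 ->
  P.1 ^+ 2 + P.2 ^+ 2 < rad ^+ 2 -> tubeset k xi y (lift P) ->
  P = (mid k - xi, y) \/ P = (mid k + xi, y).
Proof.
move=> kh x1 y1 Pr [sg [s [sgP sI eqp]]].
have sg1 : `|sg| = 1 by case: sgP => ->; rewrite ?normrN normr1.
have s0 : s = 0.
  apply/eqP; rewrite eq_le; have /andP[-> _] := sI; rewrite andbT leNgt; apply/negP => s0.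
  have := tubept_norm kh sg1 x1 y1 s0; rewrite -eqp /lift /= /foot_z sqr_sqrtr; lra.
move: eqp; rewrite s0 tubept0 /lift; case: P Pr => a b /= Pr [-> -> _].
by case: sgP => ->; rewrite ?mulN1r ?mul1r; [left|right].
Qed.

Lemma tube_disj k (xi y xi' y' : R) p : (k < h)%N -> 1 / 2 <= xi <= 3 / 2 -> 0 <= y <= 1 ->
  1 / 2 <= xi' <= 3 / 2 -> 0 <= y' <= 1 -> tubeset k xi y p -> tubeset k xi' y' p -> xi = xi' /\ y = y'.
Proof.
move=> kh x1 y1 x1' y1' [sg [s [sgP sI ->]]] [sg' [s' [sgP' sI' eqp]]].
have s01 (r : R) : r = -1 \/ r = 1 -> `|r| = 1 by case=> ->; rewrite ?normrN normr1.
by have [] := tubept_inj kh kh (s01 _ sgP) (s01 _ sgP') x1 x1' y1 y1' sI sI' eqp.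
Qed.

Lemma tube_x k (xi y : R) p : (k < h)%N -> 1 / 2 <= xi <= 3 / 2 -> 0 <= y <= 1 ->
  tubeset k xi y p -> mid k - 3 / 2 <= p.1.1 <= mid k + 3 / 2.
Proof.
move=> kh x1 y1 [sg [s [sgP sI ->]]].
have sg1 : `|sg| = 1 by case: sgP => ->; rewrite ?normrN normr1.
have xE := tubept_x h k y sg1 x1 sI; have /andP[x2 x3] := x1; have /andP[s2 s3] := sI.
have : `|(tubept h k sg xi y s).1.1 - mid k| <= 3 / 2.
  have m0 : 0 <= Num.max 0 (2 * s - 1) by rewrite le_max lexx.
  by rewrite xE; move: (Num.max _ _) m0 => m m0; nra.
by rewrite ler_norml => /andP[? ?]; apply/andP; split; lra.
Qed.

Lemma tube_sub k (xi y : R) : (k < h)%N -> 1 / 2 <= xi <= 3 / 2 -> y = 0 \/ y = 1 ->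
  tubeset k xi y `<=` S.
Proof.
move=> kh x1 y1 _ [sg [s [sgP sI ->]]]; apply: tube_surface => //.
by case: sgP => ->; rewrite ?normrN normr1.
Qed.

End Lift.

End SurfaceArcs.

(** * Strands of darts crossing one handle *)

Module HandleSlab.
Import Chains GridHomology FineCovers SolidHandles SphereChart EdgeBound SurfaceArcs.
Local Open Scope classical_set_scope.
Local Open Scope ring_scope.

Ltac split_hyps := repeat match goal with
  | H : _ \/ _ |- _ => case: H => H
  | H : _ /\ _ |- _ => let a := fresh in let b := fresh in case: H => a b
  | H : is_true (_ && _) |- _ => let a := fresh in let b := fresh in case/andP: H => a b
  end.

Section Strands.
Variables (R : realType) (h : nat) (D : eqType) (n : nat) (vt : D -> 'I_n).
Hypothesis h4 : (4 <= h)%N.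
Notation point := (R * R * R)%type.
Notation rad := (rad R h).
Notation mid := (mid R).
Notation S := (@sphere_with_handles R h).
Notation lift := (@lift R h).
Notation clear := (@clear R h).
Notation is_arc := (is_arc R).

Definition vy (v : 'I_n) : R := v%:R / n%:R.
Definition vpos (v : 'I_n) : point := lift (-1, vy v).

(** The invariant of the sweep: all darts are drawn up to abscissa [x], disjoint except at the
    vertices on [x = -1]. The order of the heights [y d] is the current word. *)
Definition strands (x : R) (y : D -> R) (St : D -> set point) :=
  [/\ forall d, is_arc (St d) (vpos (vt d)) (lift (x, y d)),
      forall d p, St d p -> S p /\ -1 <= p.1.1 <= x,
      forall d p, St d p -> p.1.1 = -1 -> p = vpos (vt d),
      forall d p, St d p -> p.1.1 = x -> p = lift (x, y d) &
      forall d d' p, d != d' -> St d p -> St d' p -> p.1.1 = -1].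

Definition slab (x0 x1 : R) (y0 y1 : D -> R) (Sl : D -> set point) :=
  [/\ forall d, is_arc (Sl d) (lift (x0, y0 d)) (lift (x1, y1 d)),
      forall d p, Sl d p -> S p /\ x0 <= p.1.1 <= x1,
      forall d p, Sl d p -> p.1.1 = x0 -> p = lift (x0, y0 d),
      forall d p, Sl d p -> p.1.1 = x1 -> p = lift (x1, y1 d) &
      forall d d' p, d != d' -> Sl d p -> Sl d' p -> False].

Lemma strands_extend x0 x1 y0 y1 St Sl : -1 < x0 -> x0 < x1 ->
  strands x0 y0 St -> slab x0 x1 y0 y1 Sl -> strands x1 y1 (fun d => St d `|` Sl d).
Proof.
move=> n0 x01 [a1 a2 a3 a4 a5] [b1 b2 b3 b4 b5].
have meet d d' p : St d p -> Sl d' p -> d = d' /\ p = lift (x0, y0 d).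
  move=> Sp Sp'; have [_ /andP[_ l1]] := a2 _ _ Sp; have [_ /andP[l2 _]] := b2 _ _ Sp'.
  have px : p.1.1 = x0 by lra.
  have e1 := a4 _ _ Sp px; split=> //; apply/eqP; apply/negPn/negP => dd.
  have e2 := b3 _ _ Sp' px; have [d0 _] := arc_ends (b1 d).
  by apply: (b5 _ _ p dd) => //; rewrite e1.
split.
- by move=> d; apply: arc_cat (a1 d) (b1 d) _ => p [/meet h1 /h1[]].
- move=> d p [/a2[Sp /andP[l1 l2]]|/b2[Sp /andP[l1 l2]]]; split=> //; apply/andP; split; lra.
- move=> d p [|]; first exact: a3.
  by move=> /b2[_ /andP[l1 l2]] px; exfalso; lra.
- move=> d p [/a2[_ /andP[l1 l2]] px|]; [exfalso; lra | exact: b4].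
- move=> d d' p dd [s1|s1] [s2|s2].
  + exact: (a5 d d').
  + by have [e] := meet _ _ _ s1 s2; rewrite e eqxx in dd.
  + by have [e] := meet _ _ _ s2 s1; rewrite e eqxx in dd.
  + by case: (b5 _ _ _ dd s1 s2).
Qed.

Lemma h_ge4 : 4 <= h%:R :> R.
Proof. by rewrite ler_nat. Qed.

(** The drawing stays above the equatorial disc because [16 * h ^ 2 + 25 < (4 * h + 1) ^ 2] once
    [h > 3]; hence the assumption [4 <= h]. *)
Lemma rad_bound (x y : R) : -1 <= x -> x <= 4 * h%:R -> -4 <= y <= 5 -> x ^+ 2 + y ^+ 2 < rad ^+ 2.
Proof.
move=> x1 x2 /andP[y1 y2]; rewrite radE; have h1 := h_ge4.
have yy : y ^+ 2 <= 25 by nra.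
have xx : x ^+ 2 <= 16 * h%:R ^+ 2 by nra.
nra.
Qed.

Lemma fan_range (x0 x1 u v : R) P : x0 < x1 -> -4 <= u <= 5 -> -4 <= v <= 5 -> fan x0 x1 u v P ->
  -4 <= P.2 <= 5.
Proof.
move=> x01 /andP[u1 u2] /andP[v1 v2] [/andP[p1 p2] e].
have d0 : 0 < x1 - x0 by lra.
by apply/andP; split; rewrite -(ler_pM2r d0) e; nra.
Qed.

Lemma fan_left (x0 x1 u v : R) P : x0 < x1 -> fan x0 x1 u v P -> P.1 = x0 -> P = (x0, u).
Proof.
move=> x01 [_ e] px; have d0 : x1 - x0 != 0 by rewrite subr_eq0 gt_eqF.
rewrite [P]surjective_pairing px; congr (_, _); apply: (mulIf d0); rewrite e px; ring.
Qed.

Lemma fan_right (x0 x1 u v : R) P : x0 < x1 -> fan x0 x1 u v P -> P.1 = x1 -> P = (x1, v).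
Proof.
move=> x01 [_ e] px; have d0 : x1 - x0 != 0 by rewrite subr_eq0 gt_eqF.
rewrite [P]surjective_pairing px; congr (_, _); apply: (mulIf d0); rewrite e px; ring.
Qed.

(** Segments in the same order at both ends. A common left end is allowed, because the strands of
    one vertex start together. *)
Lemma fan_meet (x0 x1 u v u' v' : R) P : x0 < x1 -> u <= u' -> v < v' ->
  fan x0 x1 u v P -> fan x0 x1 u' v' P -> P.1 = x0 /\ u = u'.
Proof.
move=> x01 uu vv [/andP[p1 p2] e1] [_ e2].
have E : (u' - u) * (x1 - P.1) + (v' - v) * (P.1 - x0) = 0.
  have -> : (u' - u) * (x1 - P.1) + (v' - v) * (P.1 - x0) =
    (u' * (x1 - P.1) + v' * (P.1 - x0)) - (u * (x1 - P.1) + v * (P.1 - x0)) by ring.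
  by rewrite -e1 -e2 subrr.
have px : P.1 = x0 by nra.
split=> //; rewrite px subrr mulr0 addr0 in E.
by move/eqP: E; rewrite mulf_eq0 !subr_eq0 (gt_eqF x01) orbF => /eqP.
Qed.

Lemma lift_set (A : set (R * R)) p : (lift @` A) p -> A p.1 /\ p = lift p.1.
Proof. by case=> -[x y] Axy <-. Qed.

Lemma fan_slab x0 x1 (y0 y1 : D -> R) : x0 < x1 -> -1 <= x0 -> x1 <= 4 * h%:R ->
  (forall x, x0 <= x <= x1 -> clear x) ->
  (forall d, -4 <= y0 d <= 5) -> (forall d, -4 <= y1 d <= 5) ->
  (forall d d', d != d' -> (y0 d < y0 d' /\ y1 d < y1 d') \/ (y0 d' < y0 d /\ y1 d' < y1 d)) ->
  slab x0 x1 y0 y1 (fun d => lift @` fan x0 x1 (y0 d) (y1 d)).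
Proof.
move=> x01 l0 l1 cl b0 b1 ord; split.
- by move=> d; apply: arc_image; [exact: lift_cont | move=> ? ? _ _; exact: lift_inj | exact: fan_arc].
- move=> d p /lift_set[fp ->]; have [pp _] := fp; split=> //.
  have := fan_range x01 (b0 d) (b1 d) fp; have /andP[p1 p2] := pp.
  case: p.1 fp pp p1 p2 => x y /= fp pp p1 p2 yb.
  by apply: lift_surface; [apply: rad_bound => //; lra | constructor 3; exact: cl].
- by move=> d p /lift_set[fp {2}->] px; rewrite (fan_left x01 fp px).
- by move=> d p /lift_set[fp {2}->] px; rewrite (fan_right x01 fp px).
- move=> d d' p dd /lift_set[fp _] /lift_set[fp' _].
  by case: (ord d d' dd) => -[h1 h2]; [have [_] := fan_meet x01 (ltW h1) h2 fp fp' | have [_] := fan_meet x01 (ltW h1) h2 fp' fp]; lra.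
Qed.

Lemma clear_left (x : R) : x <= -1 / 4 -> clear x.
Proof.
move=> xl k kh; right; have /andP[m1 m2] := mid_bound R kh.
by rewrite ltr_normr; apply/orP; right; lra.
Qed.

Lemma clear_between j (x : R) : 4 * j%:R - 1 / 2 <= x -> x <= 4 * j%:R - 1 / 4 -> clear x.
Proof.
move=> x1 x2 k kh; right; rewrite ltr_normr /SolidHandles.mid; apply/orP.
have [lt|le] := ltnP k j.
  have : k%:R + 1 <= j%:R :> R by rewrite natr1 ler_nat.
  by left; lra.
have : j%:R <= k%:R :> R by rewrite ler_nat.
by right; lra.
Qed.

Lemma clear_gap k (x : R) : 4 * k%:R + 1 < x -> x < 4 * k%:R + 2 -> clear x.
Proof.
move=> x1 x2 k' kh; have [kk|kk] := eqVneq k' k.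
  by left; rewrite kk /SolidHandles.mid ltr_norml; apply/andP; split; lra.
right; rewrite ltr_normr /SolidHandles.mid; apply/orP; case: (ltngtP k' k) => lt; last by rewrite lt eqxx in kk.
  have : k'%:R + 1 <= k%:R :> R by rewrite natr1 ler_nat.
  by left; lra.
have : k%:R + 1 <= k'%:R :> R by rewrite natr1 ler_nat.
by right; lra.
Qed.

Lemma vy_bound v : 0 <= vy v <= 1.
Proof.
have n0 : 0 < n%:R :> R by rewrite ltr0n; case: (n) v => [[]|].
by rewrite divr_ge0 //= ler_pdivrMr // mul1r ler_nat ltnW // ltn_ord.
Qed.

Lemma vy_lt (v v' : 'I_n) : (v < v')%N -> vy v < vy v'.
Proof.
have n0 : 0 < n%:R :> R by rewrite ltr0n; case: (n) v => [[]|].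
by move=> lt; rewrite ltr_pM2r ?invr_gt0 // ltr_nat.
Qed.

Lemma strands_init (y : D -> R) : (forall d, -4 <= y d <= 5) ->
  (forall d d', d != d' -> y d < y d' /\ (vt d <= vt d')%N \/ y d' < y d /\ (vt d' <= vt d)%N) ->
  strands (-1 / 2) y (fun d => lift @` fan (-1) (-1 / 2) (vy (vt d)) (y d)).
Proof.
move=> yb ord; have h1 := h_ge4.
have x01 : -1 < -1 / 2 :> R by lra.
have vb d : -4 <= vy (vt d) <= 5 by have /andP[? ?] := vy_bound (vt d); apply/andP; split; lra.
have vle (v v' : 'I_n) : (v <= v')%N -> vy v <= vy v'.
  by rewrite leq_eqVlt => /orP[/eqP/val_inj->//|/vy_lt/ltW].
split.
- by move=> d; apply: arc_image; [exact: lift_cont | move=> ? ? _ _; exact: lift_inj | exact: fan_arc].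
- move=> d p /lift_set[fp ->]; have [pp _] := fp; split=> //.
  have := fan_range x01 (vb d) (yb d) fp; have /andP[p1 p2] := pp.
  case: p.1 fp pp p1 p2 => x z /= fp pp p1 p2 zb.
  by apply: lift_surface; [apply: rad_bound => //; lra | constructor 3; apply: clear_left; lra].
- by move=> d p /lift_set[fp {2}->] px; rewrite (fan_left x01 fp px).
- by move=> d p /lift_set[fp {2}->] px; rewrite (fan_right x01 fp px).
- move=> d d' p dd /lift_set[fp _] /lift_set[fp' _].
  by case: (ord d d' dd) => -[h2 h3]; [have [] := fan_meet x01 (vle _ _ h3) h2 fp fp' | have [] := fan_meet x01 (vle _ _ h3) h2 fp' fp].
Qed.

(* The three middle blocks of strands are reversed across handle k: the first
   one runs through the tube along its side y = 0, the second one along y = 1,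
   and the third one passes between the feet.  Here t is the rank of the strand
   scaled to the unit interval. *)
Inductive blk := bP | bX | bY | bZ | bQ.

Section Event.
Variable k : nat.
Hypothesis kh : (k < h)%N.
Notation c := (4 * k%:R : R).

(** Each block has a band of its own on either side. From [enter] to [leave] the bands of [bX] and
    [bZ] exchange their order around [bY]; inside a band the rank [t] keeps its order. *)
Definition enter (b : blk) (t : R) : R :=
  match b with bP => -3 + t | bX => -1 + t / 2 | bY => 2 + t / 2 | bZ => 3 + t / 2 | bQ => 4 + t end.
Definition leave (b : blk) (t : R) : R :=
  match b with bP => -3 + t | bX => 3 + t / 2 | bY => 2 + t / 2 | bZ => -2 + t / 2 | bQ => 4 + t end.

(** The feet are over [c <= x <= c + 1] and [c + 2 <= x <= c + 3]. A [bX] strand enters the tube at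
    [(c + 1 - t, 0)], comes out at [(c + 2 + t, 0)], turns back into the gap between the feet and
    climbs there, to the right of the [bZ] strands that descend through the same gap. A [bY] strand
    comes from above to the side [y = 1], crosses the tube and returns to its height. *)
Definition inpart (b : blk) (t : R) : set (R * R) :=
  match b with
  | bP | bQ => set0
  | bX => hseg (c - 1 / 4) (c + 1 - t) (-1 + t / 2) `|` vseg (c + 1 - t) (-1 + t / 2) 0
  | bY => hseg (c - 1 / 4) (c + t) (2 + t / 2) `|` vseg (c + t) 1 (2 + t / 2)
  | bZ => hseg (c - 1 / 4) (c + 9 / 8 + t / 4) (3 + t / 2) `|` vseg (c + 9 / 8 + t / 4) (-2 + t / 2) (3 + t / 2)
  end.
Definition outpart (b : blk) (t : R) : set (R * R) :=
  match b with
  | bP | bQ => hseg (c - 1 / 4) (c + 7 / 2) (enter b t)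
  | bX => vseg (c + 2 + t) (- 1 / 4 - t / 4) 0 `|` (hseg (c + 7 / 4 - t / 4) (c + 2 + t) (- 1 / 4 - t / 4)
      `|` (vseg (c + 7 / 4 - t / 4) (- 1 / 4 - t / 4) (3 + t / 2) `|` hseg (c + 7 / 4 - t / 4) (c + 7 / 2) (3 + t / 2)))
  | bY => vseg (c + 3 - t) 1 (2 + t / 2) `|` hseg (c + 3 - t) (c + 7 / 2) (2 + t / 2)
  | bZ => hseg (c + 9 / 8 + t / 4) (c + 7 / 2) (-2 + t / 2)
  end.
Definition plane b t : set (R * R) := inpart b t `|` outpart b t.
Definition tubeof (b : blk) (t : R) : set point :=
  match b with
  | bX => tubeset h k (1 / 2 + t) 0
  | bY => tubeset h k (3 / 2 - t) 1
  | _ => set0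
  end.

Ltac plane_cases := rewrite /plane /inpart /outpart /hseg /vseg /=; move: (4 * k%:R) => u.

Lemma plane_y b t x y : 0 < t < 1 -> plane b t (x, y) ->
  match b with bP => -3 < y < -2 | bQ => 4 < y < 5 | _ => -2 < y < 4 end.
Proof.
move=> /andP[t0 t1]; case: b; plane_cases => H; split_hyps; try done; by apply/andP; split; lra.
Qed.

Lemma plane_lt b t t' x y : 0 < t -> t < t' -> t' < 1 -> plane b t (x, y) -> plane b t' (x, y) -> False.
Proof. by move=> t0 tt t1; case: b; plane_cases => H H'; split_hyps; try done; lra. Qed.

Lemma plane_cross b t b' t' x y : 0 < t < 1 -> 0 < t' < 1 -> plane b t (x, y) -> plane b' t' (x, y) ->
  match b, b' with bX, bY | bX, bZ | bY, bZ => False | _, _ => True end.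
Proof.
move=> /andP[t0 t1] /andP[t0' t1'].
by case: b; case: b' => //; plane_cases => H H'; split_hyps; try done; lra.
Qed.

Lemma plane_disj b t b' t' P : 0 < t < 1 -> 0 < t' < 1 -> plane b t P -> plane b' t' P -> b = b' /\ t = t'.
Proof.
case: P => x y tI tI' pl pl'.
have bb : b = b'.
  have y1 := plane_y tI pl; have y2 := plane_y tI' pl'.
  have c1 := plane_cross tI tI' pl pl'; have c2 := plane_cross tI' tI pl' pl.
  by case: b b' pl pl' y1 y2 c1 c2 => [] [] // _ _ /andP[? ?] /andP[? ?] _ _; exfalso; lra.
subst b'; split=> //; have /andP[t0 t1] := tI; have /andP[t0' t1'] := tI'.
by apply/eqP; rewrite eq_le !leNgt; apply/andP; split; apply/negP => lt; [apply: (plane_lt t0' lt t1 pl' pl) | apply: (plane_lt t0 lt t1' pl pl')].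
Qed.

Lemma plane_surface b t P : 0 < t < 1 -> plane b t P ->
  [/\ S (lift P), c - 1 / 4 <= P.1 <= c + 7 / 2, P.1 = c - 1 / 4 -> P.2 = enter b t,
      P.1 = c + 7 / 2 -> P.2 = leave b t & P.1 ^+ 2 + P.2 ^+ 2 < rad ^+ 2].
Proof.
have kk : k%:R + 1 <= h%:R :> R by rewrite natr1 ler_nat.
have k0 : 0 <= k%:R :> R by [].
case: P => x y /andP[t0 t1] pl.
have xb : c - 1 / 4 <= x <= c + 7 / 2.
  by move: pl; clear -t0 t1; case: b; plane_cases => H; split_hyps; try done; lra.
have yb : -4 <= y <= 5.
  by move: pl; clear -t0 t1; case: b; plane_cases => H; split_hyps; try done; lra.
have yx : [\/ y <= 0, 1 <= y | c + 1 < x < c + 2].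
  have [y0|y0] := leP y 0; first by constructor 1.
  have [y1|y1] := leP 1 y; first by constructor 2.
  constructor 3; move: pl; clear -t0 t1 y0 y1; case: b; plane_cases => H; split_hyps; try done; lra.
have [eE eL] : (x = c - 1 / 4 -> y = enter b t) /\ (x = c + 7 / 2 -> y = leave b t).
  by move: pl; clear -t0 t1; case: b; plane_cases => H; split_hyps; try done; split=> ?; lra.
have rb : x ^+ 2 + y ^+ 2 < rad ^+ 2 by case/andP: xb => ? ?; apply: rad_bound => //; lra.
split=> //=; apply: lift_surface => //.
by case: yx => [?|?|/andP[? ?]]; [constructor 1 | constructor 2 | constructor 3; exact: (@clear_gap k)].
Qed.

Definition strip b t : set point := lift @` inpart b t `|` (tubeof b t `|` lift @` outpart b t).

Lemma lift_arc (A : set (R * R)) P Q : is_arc A P Q -> is_arc (lift @` A) (lift P) (lift Q).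
Proof. by apply: arc_image; [exact: lift_cont | move=> ? ? _ _; exact: lift_inj]. Qed.

Lemma midc : mid k = c + 3 / 2.
Proof. by []. Qed.

Lemma strip_arc b t : 0 < t < 1 ->
  is_arc (strip b t) (lift (c - 1 / 4, enter b t)) (lift (c + 7 / 2, leave b t)).
Proof.
move=> tI; have /andP[t0 t1] := tI.
have straight u : is_arc (lift @` (set0 : set (R * R)) `|` (set0 `|` lift @` hseg (c - 1 / 4) (c + 7 / 2) u))
    (lift (c - 1 / 4, u)) (lift (c + 7 / 2, u)).
  by rewrite image_set0 !set0U; apply/lift_arc/hseg_arc; lra.
(* For [bX] and [bY]: incoming part, tube and outgoing part meet only in the foot points [P] and
   [Q], so they can be concatenated. *)
have meet3 (b' : blk) (P Q : R * R) xi y : 1 / 2 <= xi <= 3 / 2 -> 0 <= y <= 1 -> P = (mid k - xi, y) ->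
    Q = (mid k + xi, y) -> tubeof b' t = tubeset h k xi y -> ~ inpart b' t Q -> ~ outpart b' t P ->
    (forall V, inpart b' t V -> outpart b' t V -> False) ->
    is_arc (inpart b' t) (c - 1 / 4, enter b' t) P -> is_arc (outpart b' t) Q (c + 7 / 2, leave b' t) ->
    is_arc (strip b' t) (lift (c - 1 / 4, enter b' t)) (lift (c + 7 / 2, leave b' t)).
  move=> x1 y1 PE QE tE nQ nP io a1 a2; have ta := tube_arc kh x1 y1; rewrite -PE -QE -tE in ta.
  have tl V : plane b' t V -> tubeof b' t (lift V) -> V = P \/ V = Q.
    move=> pV; have [_ _ _ _ rb] := plane_surface tI pV.
    by rewrite tE => /(tube_lift kh x1 y1 rb); rewrite -PE -QE.
  apply: arc_cat (lift_arc a1) _ _; first apply: arc_cat ta (lift_arc a2) _.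
    move=> p [tV [V oV VE]]; rewrite -VE in tV *.
    by case: (tl V _ tV) => [|VP|->//]; [right | case: nP; rewrite -VP].
  move=> p [[V iV <-] [tV|[V' oV' /lift_inj VE]]].
    by case: (tl V _ tV) => [|->//|VQ]; [left | case: nQ; rewrite -VQ].
  by case: (io V iV); rewrite -VE.
case: b => //=; try exact: straight.
- apply: (meet3 bX (c + 1 - t, 0) (c + 2 + t, 0) (1 / 2 + t) 0); rewrite ?midc ?lexx ?ler01 //.
  + by apply/andP; split; lra.
  + by congr (_, _); lra.
  + by congr (_, _); lra.
  + by rewrite /inpart /hseg /vseg /= => H; clear -t0 t1 H; split_hyps; lra.
  + by rewrite /outpart /hseg /vseg /= => H; clear -t0 t1 H; split_hyps; lra.
  + by case=> x y; rewrite /inpart /outpart /hseg /vseg /= => H H'; clear -t0 t1 H H'; split_hyps; lra.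
  + apply: arc_cat; [apply: hseg_arc; lra | apply: vseg_arc; lra |].
    by case=> x y []; rewrite /hseg /vseg /= => H H'; clear -t0 t1 H H'; split_hyps; congr (_, _); lra.
  + apply: (@arc_cat R _ _ _ _ (c + 2 + t, - 1 / 4 - t / 4)); first by apply: arc_rev; apply: vseg_arc; lra.
      apply: (@arc_cat R _ _ _ _ (c + 7 / 4 - t / 4, - 1 / 4 - t / 4)); first by apply: arc_rev; apply: hseg_arc; lra.
        apply: arc_cat; [apply: vseg_arc; lra | apply: hseg_arc; lra |].
        by case=> x y []; rewrite /hseg /vseg /= => H H'; clear -t0 t1 H H'; split_hyps; congr (_, _); lra.
      by case=> x y []; rewrite /hseg /vseg /= => H H'; clear -t0 t1 H H'; split_hyps; congr (_, _); lra.
    by case=> x y []; rewrite /hseg /vseg /= => H H'; clear -t0 t1 H H'; split_hyps; congr (_, _); lra.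
- apply: (meet3 bY (c + t, 1) (c + 3 - t, 1) (3 / 2 - t) 1); rewrite ?midc ?lexx ?ler01 //.
  + by apply/andP; split; lra.
  + by congr (_, _); lra.
  + by congr (_, _); lra.
  + by rewrite /inpart /hseg /vseg /= => H; clear -t0 t1 H; split_hyps; lra.
  + by rewrite /outpart /hseg /vseg /= => H; clear -t0 t1 H; split_hyps; lra.
  + by case=> x y; rewrite /inpart /outpart /hseg /vseg /= => H H'; clear -t0 t1 H H'; split_hyps; lra.
  + apply: arc_cat; [apply: hseg_arc; lra | apply: arc_rev; apply: vseg_arc; lra |].
    by case=> x y []; rewrite /hseg /vseg /= => H H'; clear -t0 t1 H H'; split_hyps; congr (_, _); lra.
  + apply: arc_cat; [apply: vseg_arc; lra | apply: hseg_arc; lra |].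
    by case=> x y []; rewrite /hseg /vseg /= => H H'; clear -t0 t1 H H'; split_hyps; congr (_, _); lra.
- rewrite /strip /tubeof set0U -image_setU; apply: lift_arc.
  apply: (@arc_cat R _ _ _ _ (c + 9 / 8 + t / 4, -2 + t / 2)); last 1 first.
  + by case=> x y []; rewrite /inpart /outpart /hseg /vseg /= => H H'; clear -t0 t1 H H'; split_hyps; congr (_, _); lra.
  + apply: arc_cat; [apply: hseg_arc; lra | apply: arc_rev; apply: vseg_arc; lra |].
    by case=> x y []; rewrite /hseg /vseg /= => H H'; clear -t0 t1 H H'; split_hyps; congr (_, _); lra.
  + by apply: hseg_arc; lra.
Qed.

Lemma tubeofP b t p : 0 < t < 1 -> tubeof b t p ->
  exists xi y, [/\ 1 / 2 <= xi <= 3 / 2, y = 0 \/ y = 1, tubeof b t = tubeset h k xi y,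
    plane b t (mid k - xi, y) & plane b t (mid k + xi, y)].
Proof.
move=> /andP[t0 t1]; case: b => //= _.
- exists (1 / 2 + t), 0; split=> //; [by apply/andP; split; lra | by left | |]; rewrite midc /plane /inpart /outpart /hseg /vseg /=.
  + by left; right; split; [lra | apply/andP; split; lra].
  + by right; left; split; [lra | apply/andP; split; lra].
- exists (3 / 2 - t), 1; split=> //; [by apply/andP; split; lra | by right | |]; rewrite midc /plane /inpart /outpart /hseg /vseg /=.
  + by left; right; split; [lra | apply/andP; split; lra].
  + by right; left; split; [lra | apply/andP; split; lra].
Qed.

Lemma event_slab (b : D -> blk) (t : D -> R) : (forall d, 0 < t d < 1) -> injective t ->
  slab (c - 1 / 4) (c + 7 / 2) (fun d => enter (b d) (t d)) (fun d => leave (b d) (t d))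
    (fun d => strip (b d) (t d)).
Proof.
move=> tI t_inj.
have stripP d p : strip (b d) (t d) p -> (plane (b d) (t d) p.1 /\ p = lift p.1) \/ tubeof (b d) (t d) p.
  rewrite /strip => -[/lift_set[ip pE]|[tp|/lift_set[ip pE]]]; last 2 first.
  - by right.
  - by left; split=> //; right.
  - by left; split=> //; left.
have tube_in d p : tubeof (b d) (t d) p -> S p /\ c <= p.1.1 <= c + 3.
  move=> tp; have [xi [y [x1 y1 tE _ _]]] := tubeofP (tI d) tp; rewrite tE in tp.
  have y2 : 0 <= y <= 1 by case: y1 => ->; apply/andP; split; lra.
  split; first exact: (tube_sub kh x1 y1 tp).
  by have := tube_x kh x1 y2 tp; rewrite midc => /andP[? ?]; apply/andP; split; lra.
split.
- by move=> d; exact: strip_arc.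
- move=> d p /stripP[[pp ->]|/tube_in[Sp /andP[? ?]]]; last by split=> //; apply/andP; split; lra.
  by have [] := plane_surface (tI d) pp.
- move=> d p /stripP[[pp pE]|/tube_in[_ /andP[? ?]]] px; last by exfalso; lra.
  have [_ _ e _ _] := plane_surface (tI d) pp; rewrite pE; congr (SurfaceArcs.lift _ _).
  by rewrite [p.1]surjective_pairing px e.
- move=> d p /stripP[[pp pE]|/tube_in[_ /andP[? ?]]] px; last by exfalso; lra.
  have [_ _ _ e _] := plane_surface (tI d) pp; rewrite pE; congr (SurfaceArcs.lift _ _).
  by rewrite [p.1]surjective_pairing px e.
- move=> d d' p dd.
  have pt d1 d2 : d1 != d2 -> plane (b d1) (t d1) p.1 /\ p = lift p.1 -> tubeof (b d2) (t d2) p -> False.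
    move=> d12 [pp pE] tp; have [xi [y [x1 y1 tE i1 i2]]] := tubeofP (tI d2) tp.
    have y2 : 0 <= y <= 1 by case: y1 => ->; apply/andP; split; lra.
    have [_ _ _ _ rb] := plane_surface (tI d1) pp.
    rewrite tE pE in tp; have [e|e] := tube_lift kh x1 y2 rb tp; rewrite e in pp.
      by have [_ /t_inj/eqP] := plane_disj (tI d1) (tI d2) pp i1; rewrite (negbTE d12).
    by have [_ /t_inj/eqP] := plane_disj (tI d1) (tI d2) pp i2; rewrite (negbTE d12).
  move=> /stripP[s1|s1] /stripP[s2|s2].
  + by have [_ /t_inj/eqP] := plane_disj (tI d) (tI d') s1.1 s2.1; rewrite (negbTE dd).
  + exact: (pt d d').
  + by apply: (pt d' d) => //; rewrite eq_sym.
  (* Tubes with a common point have the same [xi] and [y], hence a common foot, which would belong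
     to the plane parts of both strands. *)
  + have [xi [y [x1 y1 tE i1 i2]]] := tubeofP (tI d) s1.
    have [xi' [y' [x1' y1' tE' i1' i2']]] := tubeofP (tI d') s2.
    have y2 : 0 <= y <= 1 by case: y1 => ->; apply/andP; split; lra.
    have y2' : 0 <= y' <= 1 by case: y1' => ->; apply/andP; split; lra.
    rewrite tE in s1; rewrite tE' in s2.
    have [xx yy] := tube_disj kh x1 y2 x1' y2' s1 s2; rewrite -xx -yy in i1'.
    by have [_ /t_inj/eqP] := plane_disj (tI d) (tI d') i1 i1'; rewrite (negbTE dd).
Qed.

End Event.

End Strands.

End HandleSlab.

(** * Chord words and the kernel of their interlace matrix *)

Module DartWords.
Import Chains.
Local Open Scope ring_scope.

Section ChordWords.
Variable E : finType.
Notation dart := (E * bool)%type.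
Notation word := (seq dart).

Definition opp (p : dart) : dart := (p.1, ~~ p.2).

(* One handle lets three consecutive blocks of strands be reversed. *)
Definition step (w w' : word) := exists P X Y Z Q,
  w = P ++ X ++ Y ++ Z ++ Q /\ w' = P ++ Z ++ Y ++ X ++ Q.

Fixpoint reach k (w w' : word) : Prop :=
  if k is k'.+1 then exists2 w1, step w w1 & reach k' w1 w' else w = w'.

Definition crossing (w : word) := exists P a X b Y Z Q,
  w = P ++ a :: X ++ b :: Y ++ opp a :: Z ++ opp b :: Q.

Definition par (z : {ffun E -> bool}) (s : word) : bool := \sum_(q <- s) z q.1.
(** In [pi z w p + pi z w (opp p)] only the darts between [p] and its opposite remain, with one end
    of the chord of [p]; a chord with both ends in between cancels. So the equation in [ker] says
    that an even number of chords of [z] cross the chord of [p]. *)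
Definition pi (z : {ffun E -> bool}) (w : word) (p : dart) : bool := par z (take (index p w) w).

(* The kernel of the interlace matrix over the field with two elements. *)
Definition ker (w : word) : {set {ffun E -> bool}} :=
  [set z | [forall p, pi z w p + pi z w (opp p) == z p.1]].

Lemma oppK : involutive opp.
Proof. by case=> e b; rewrite /opp negbK. Qed.

Lemma opp_neq p : opp p != p.
Proof. by case: p => e [] /=; rewrite xpair_eqE eqxx. Qed.

Lemma dartP (p q : dart) : p.1 = q.1 -> p = q \/ p = opp q.
Proof. by case: p q => [e b] [e' b'] /= ->; case: b b' => [] [] /=; by [left | right]. Qed.

Lemma par_cat z s t : par z (s ++ t) = par z s + par z t.
Proof. exact: big_cat. Qed.

Lemma par_cons z p s : par z (p :: s) = z p.1 + par z s.
Proof. exact: big_cons. Qed.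

Lemma pi_split z w p u v : uniq w -> w = u ++ p :: v -> pi z w p = par z u.
Proof.
move=> uw wE; move: uw; rewrite /pi wE cat_uniq /= => /and3P[_ /norP[pu _] _].
by rewrite index_cat (negbTE pu) /= eqxx addn0 take_size_cat.
Qed.

Lemma eq_par (z f : {ffun E -> bool}) s : {in s, forall q, f q.1 = z q.1} -> par f s = par z s.
Proof. by move=> e; rewrite /par !big_seq; apply: eq_bigr => q /e. Qed.

Section Pivot.
Variables (P X Y Z Q : word) (a b : dart).
Let w := P ++ a :: X ++ b :: Y ++ opp a :: Z ++ opp b :: Q.
Let w' := P ++ a :: opp a :: Z ++ Y ++ X ++ b :: opp b :: Q.
(** The cuts are made just after [a] and [b] and just before their opposites, so the reversal brings
    the two ends of either chord together. *)
Lemma pivot_step : step w w'.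
Proof.
exists (rcons P a), (rcons X b), Y, (opp a :: Z), (opp b :: Q).
by rewrite !cat_rcons.
Qed.

Lemma pivot_perm : perm_eq w w'.
Proof.
have [P' [X' [Y' [Z' [Q' [-> ->]]]]]] := pivot_step.
by apply/permP => f; rewrite !count_cat; lia.
Qed.

Lemma pivot_perm4 : perm_eq w ([:: a; opp a; b; opp b] ++ P ++ X ++ Y ++ Z ++ Q).
Proof. by apply/permP => f; rewrite /w; do 5 rewrite ?count_cat /=; lia. Qed.

Hypothesis uw : uniq w.

Let uw' : uniq w'.
Proof. by rewrite -(perm_uniq pivot_perm). Qed.

Lemma pivot_clean q : q \in P ++ X ++ Y ++ Z ++ Q -> q.1 != a.1 /\ q.1 != b.1.
Proof.
move=> qw; move: uw; rewrite (perm_uniq pivot_perm4) cat_uniq => /and3P[_ /hasPn nq _].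
have := nq q qw; rewrite !inE !negb_or => /and4P[n1 n2 n3 n4].
split; apply/eqP => /dartP[] e; move: n1 n2 n3 n4; by rewrite e eqxx.
Qed.

Section Vector.
Variables (z f : {ffun E -> bool}).
Hypothesis zk : z \in ker w.
Hypothesis fz : forall e, e != a.1 -> e != b.1 -> f e = z e.

Lemma pivot_par s : {subset s <= P ++ X ++ Y ++ Z ++ Q} -> par f s = par z s.
Proof. by move=> ss; apply: eq_par => q /ss /pivot_clean[]; exact: fz. Qed.

Lemma pivot_a : par z X + z b.1 + par z Y = 0.
Proof.
move: zk; rewrite inE => /forallP /(_ a) /eqP.
rewrite (pi_split z uw (erefl _)).
rewrite (@pi_split z w (opp a) (P ++ a :: X ++ b :: Y) (Z ++ opp b :: Q)) //; last by rewrite /w; do 6 rewrite -?catA /=.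
rewrite !(par_cat, par_cons).
by case: (par z P) (z a.1) (par z X) (z b.1) (par z Y) => [] [] [] [] [].
Qed.

Lemma pivot_b : par z Y + z a.1 + par z Z = 0.
Proof.
move: zk; rewrite inE => /forallP /(_ b) /eqP.
rewrite (@pi_split z w b (P ++ a :: X) (Y ++ opp a :: Z ++ opp b :: Q)) //; last by rewrite /w; do 6 rewrite -?catA /=.
rewrite (@pi_split z w (opp b) (P ++ a :: X ++ b :: Y ++ opp a :: Z) Q) //; last by rewrite /w; do 6 rewrite -?catA /=.
rewrite !(par_cat, par_cons) /=.
by case: (par z P) (z a.1) (par z X) (z b.1) (par z Y) (par z Z) => [] [] [] [] [] [].
Qed.

(** Moving blocks changes the parity in front of a dart by parities of whole blocks; the kernel
    equations at [a] and [b] are exactly what makes these changes vanish. *)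
Lemma pivot_pi p : p \in P ++ X ++ Y ++ Z ++ Q -> pi f w' p = pi z w p.
Proof.
have sub s t u : P ++ X ++ Y ++ Z ++ Q = s ++ t ++ u -> par f t = par z t.
  by move=> e; apply: pivot_par => q qt; rewrite e !mem_cat qt orbT.
have pa := pivot_a; have pb := pivot_b.
have fP : par f P = par z P by apply: (sub [::] P (X ++ Y ++ Z ++ Q)).
have fX : par f X = par z X by apply: (sub P X (Y ++ Z ++ Q)).
have fY : par f Y = par z Y by apply: (sub (P ++ X) Y (Z ++ Q)); rewrite -!catA.
have fZ : par f Z = par z Z by apply: (sub (P ++ X ++ Y) Z Q); rewrite -!catA.
rewrite !mem_cat => /or4P[pp|pp|pp|/orP[pp|pp]].
- have [s1 [s2 PE]] : exists s1 s2, P = s1 ++ p :: s2 by case/splitPr: pp => s1 s2; exists s1, s2.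
  rewrite (@pi_split z w p s1 (s2 ++ a :: X ++ b :: Y ++ opp a :: Z ++ opp b :: Q)) //; last by rewrite /w PE; do 6 rewrite -?catA /=.
  rewrite (@pi_split f w' p s1 (s2 ++ a :: opp a :: Z ++ Y ++ X ++ b :: opp b :: Q)) //; last by rewrite /w' PE; do 6 rewrite -?catA /=.
  by apply: (sub [::] s1 ((p :: s2) ++ X ++ Y ++ Z ++ Q)); rewrite PE -!catA.
- have [s1 [s2 XE]] : exists s1 s2, X = s1 ++ p :: s2 by case/splitPr: pp => s1 s2; exists s1, s2.
  rewrite (@pi_split z w p (P ++ a :: s1) (s2 ++ b :: Y ++ opp a :: Z ++ opp b :: Q)) //; last by rewrite /w XE; do 6 rewrite -?catA /=.
  rewrite (@pi_split f w' p (P ++ a :: opp a :: Z ++ Y ++ s1) (s2 ++ b :: opp b :: Q)) //; last by rewrite /w' XE; do 6 rewrite -?catA /=.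
  have fs : par f s1 = par z s1 by apply: (sub P s1 ((p :: s2) ++ Y ++ Z ++ Q)); rewrite XE -!catA.
  rewrite !(par_cat, par_cons) /= fP fY fZ fs; move: pb.
  by case: (par z P) (z a.1) (f a.1) (par z s1) (par z Y) (par z Z) => [] [] [] [] [] [].
- have [s1 [s2 YE]] : exists s1 s2, Y = s1 ++ p :: s2 by case/splitPr: pp => s1 s2; exists s1, s2.
  rewrite (@pi_split z w p (P ++ a :: X ++ b :: s1) (s2 ++ opp a :: Z ++ opp b :: Q)) //; last by rewrite /w YE; do 6 rewrite -?catA /=.
  rewrite (@pi_split f w' p (P ++ a :: opp a :: Z ++ s1) (s2 ++ X ++ b :: opp b :: Q)) //; last by rewrite /w' YE; do 6 rewrite -?catA /=.
  have fs : par f s1 = par z s1 by apply: (sub (P ++ X) s1 ((p :: s2) ++ Z ++ Q)); rewrite YE -!catA.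
  rewrite !(par_cat, par_cons) /= fP fZ fs; move: pa pb.
  by case: (par z P) (z a.1) (f a.1) (z b.1) (par z s1) (par z X) (par z Y) (par z Z) => [] [] [] [] [] [] [] [].
- have [s1 [s2 ZE]] : exists s1 s2, Z = s1 ++ p :: s2 by case/splitPr: pp => s1 s2; exists s1, s2.
  rewrite (@pi_split z w p (P ++ a :: X ++ b :: Y ++ opp a :: s1) (s2 ++ opp b :: Q)) //; last by rewrite /w ZE; do 6 rewrite -?catA /=.
  rewrite (@pi_split f w' p (P ++ a :: opp a :: s1) (s2 ++ Y ++ X ++ b :: opp b :: Q)) //; last by rewrite /w' ZE; do 6 rewrite -?catA /=.
  have fs : par f s1 = par z s1 by apply: (sub (P ++ X ++ Y) s1 ((p :: s2) ++ Q)); rewrite ZE -!catA.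
  rewrite !(par_cat, par_cons) /= fP fs; move: pa pb.
  by case: (par z P) (z a.1) (f a.1) (z b.1) (par z s1) (par z X) (par z Y) (par z Z) => [] [] [] [] [] [] [] [].
- have [s1 [s2 QE]] : exists s1 s2, Q = s1 ++ p :: s2 by case/splitPr: pp => s1 s2; exists s1, s2.
  rewrite (@pi_split z w p (P ++ a :: X ++ b :: Y ++ opp a :: Z ++ opp b :: s1) s2) //; last by rewrite /w QE; do 6 rewrite -?catA /=.
  rewrite (@pi_split f w' p (P ++ a :: opp a :: Z ++ Y ++ X ++ b :: opp b :: s1) s2) //; last by rewrite /w' QE; do 6 rewrite -?catA /=.
  have fs : par f s1 = par z s1 by apply: (sub (P ++ X ++ Y ++ Z) s1 (p :: s2)); rewrite QE -!catA.
  rewrite !(par_cat, par_cons) /= fP fX fY fZ fs.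
  by case: (par z P) (z a.1) (f a.1) (z b.1) (f b.1) (par z s1) (par z X) (par z Y) (par z Z) => [] [] [] [] [] [] [] [] [].
Qed.

Hypothesis full : forall p, p \in w.

Lemma pivot_ker : f \in ker w'.
Proof.
rewrite inE; apply/forallP => p; apply/eqP.
have adja : pi f w' a + pi f w' (opp a) = f a.1.
  rewrite (pi_split f uw' (erefl _)).
  rewrite (@pi_split f w' (opp a) (P ++ [:: a]) (Z ++ Y ++ X ++ b :: opp b :: Q)) //; last by rewrite /w' -catA.
  rewrite par_cat par_cons /par big_nil; by case: (\sum_(q <- P) _) (f a.1) => [] [].
have adjb : pi f w' b + pi f w' (opp b) = f b.1.
  rewrite (@pi_split f w' b (P ++ a :: opp a :: Z ++ Y ++ X) (opp b :: Q)) //; last by rewrite /w'; do 6 rewrite -?catA /=.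
  rewrite (@pi_split f w' (opp b) ((P ++ a :: opp a :: Z ++ Y ++ X) ++ [:: b]) Q) //; last by rewrite /w'; do 6 rewrite -?catA /=.
  rewrite [par f (_ ++ [:: b])]par_cat par_cons /par big_nil; by case: (\sum_(q <- _) _) (f b.1) => [] [].
have [pa|na] := eqVneq p.1 a.1.
  by case/dartP: pa => ->; rewrite ?oppK ?[RHS]/= // addrC.
have [pb|nb] := eqVneq p.1 b.1.
  by case/dartP: pb => ->; rewrite ?oppK ?[RHS]/= // addrC.
have pin q : q.1 != a.1 -> q.1 != b.1 -> q \in P ++ X ++ Y ++ Z ++ Q.
  move=> qa qb; have := full q; rewrite /w !(mem_cat, inE).
  have -> : (q == a) = false by apply/eqP => e; rewrite e eqxx in qa.
  have -> : (q == b) = false by apply/eqP => e; rewrite e eqxx in qb.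
  have -> : (q == opp a) = false by apply/eqP => e; rewrite e eqxx in qa.
  have -> : (q == opp b) = false by apply/eqP => e; rewrite e eqxx in qb.
  by rewrite !orFb.
rewrite !pivot_pi ?pin // fz //.
by move: zk; rewrite inE => /forallP /(_ p) /eqP.
Qed.

End Vector.

(** In the old word the values of a kernel vector on the two crossing chords are determined by the
    others; in the new word these chords are isolated and the values are free. The kernel grows
    fourfold: the rank drops by two. *)
Lemma pivot_card : (forall p, p \in w) -> (4 * #|ker w| <= #|ker w'|)%N.
Proof.
move=> full.
have ab : a.1 != b.1.
  move: uw; rewrite (perm_uniq pivot_perm4) cat_uniq /= !inE !negb_or => /andP[/and4P[_ /andP[n1 _] _ _] _].
  move: uw; rewrite (perm_uniq pivot_perm4) cat_uniq /= !inE !negb_or => /andP[/andP[/and3P[_ n2 _] _] _].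
  by apply/eqP => /esym/dartP[e|e]; [rewrite e eqxx in n2 | rewrite e eqxx in n1].
pose g (x : {ffun E -> bool} * (bool * bool)) : {ffun E -> bool} :=
  [ffun e => if e == a.1 then x.2.1 else if e == b.1 then x.2.2 else x.1 e].
have gz x e : e != a.1 -> e != b.1 -> g x e = x.1 e by move=> /negbTE ea /negbTE eb; rewrite ffunE ea eb.
have ga x : g x a.1 = x.2.1 by rewrite ffunE eqxx.
have gb x : g x b.1 = x.2.2 by rewrite ffunE eq_sym (negbTE ab) eqxx.
have -> : (4 * #|ker w| = #|finset.setX (ker w) [set: bool * bool]|)%N.
  by rewrite finset.cardsX finset.cardsT card_prod card_bool mulnC.
rewrite -(@card_in_imset _ _ g); last first.
  move=> [z [al be]] [z' [al' be']]; rewrite !finset.in_setX /= => /andP[zk _] /andP[zk' _] gg.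
  have e1 : al = al' by have := ga (z, (al, be)); rewrite gg ga.
  have e2 : be = be' by have := gb (z, (al, be)); rewrite gg gb.
  rewrite e1 e2; congr (_, _); apply/ffunP => e.
  have off e' : e' != a.1 -> e' != b.1 -> z e' = z' e'.
    by move=> ea eb; have := gz (z, (al, be)) _ ea eb; rewrite gg gz.
  have offp s : {subset s <= P ++ X ++ Y ++ Z ++ Q} -> par z s = par z' s.
    by move=> ss; apply: eq_par => q /ss /pivot_clean[]; exact: off.
  have pX : par z X = par z' X by apply: offp => q qX; rewrite !mem_cat qX orbT.
  have pY : par z Y = par z' Y by apply: offp => q qX; rewrite !mem_cat qX !orbT.
  have pZ : par z Z = par z' Z by apply: offp => q qX; rewrite !mem_cat qX !orbT.
  have [->|ea] := eqVneq e a.1.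
    move: (pivot_b zk) (pivot_b zk'); rewrite pY pZ.
    by case: (z a.1) (z' a.1) (par z' Y) (par z' Z) => [] [] [] [].
  have [->|eb] := eqVneq e b.1; last exact: off.
  move: (pivot_a zk) (pivot_a zk'); rewrite pX pY.
  by case: (z b.1) (z' b.1) (par z' X) (par z' Y) => [] [] [] [].
apply: subset_leq_card; apply/fintype.subsetP => _ /imsetP[x xk ->].
case: x xk => z [al be]; rewrite finset.in_setX /= => /andP[zk _]; exact: (pivot_ker zk (gz (z, (al, be))) full).
Qed.

End Pivot.

(** The hypothesis bounds the rank by [s], and each crossing pays for its handle with two units of
    rank. *)
Theorem reduce_crossings s (w : word) : uniq w -> (forall p, p \in w) ->
  (2 ^ #|E| <= #|ker w| * 2 ^ s)%N ->
  exists k w', [/\ (2 * k <= s)%N, reach k w w' & ~ crossing w'].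
Proof.
have [r] := ubnP s; elim: r s w => // r IHr s w sr uw fw ks.
have [|ncr] := pselect (crossing w); last by exists 0%N, w.
move=> [P [a [X [b [Y [Z [Q wE]]]]]]]; subst w.
have pc := pivot_card uw fw; set w' := P ++ a :: opp a :: _ in pc.
(* A word with a crossing has rank at least two, since the larger kernel of the new word still has
   at most [2 ^ #|E|] elements. *)
have s2 : (2 <= s)%N.
  have k0 : (0 < #|ker w'|)%N.
    by rewrite card_gt0; apply/set0Pn; exists 0; rewrite inE; apply/forallP => p;
      rewrite /pi /par !big1 ?ffunE // => q _; rewrite ffunE.
  have k1 : (#|ker w'| <= 2 ^ #|E|)%N by rewrite -card_bool -card_ffun; exact: max_card.
  have k2 := leq_trans pc (leq_trans k1 ks).
  have k3 : (0 < #|ker (P ++ a :: X ++ b :: Y ++ opp a :: Z ++ opp b :: Q)|)%N.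
    by rewrite card_gt0; apply/set0Pn; exists 0; rewrite inE; apply/forallP => p;
      rewrite /pi /par !big1 ?ffunE // => q _; rewrite ffunE.
  by move: k2; rewrite mulnC leq_pmul2l // -[4%N]/(2 ^ 2)%N leq_exp2l.
have uw' : uniq w' by rewrite -(perm_uniq (pivot_perm P X Y Z Q a b)).
have fw' p : p \in w' by rewrite -(perm_mem (pivot_perm P X Y Z Q a b)).
have [||k [w'' [k2 rk nc]]] := IHr (s - 2)%N w' _ uw' fw'; first by lia.
  apply: leq_trans ks _; rewrite -{1}(subnK s2) expnD mulnCA mulnC.
  by rewrite leq_mul2r mulnC pc orbT.
exists k.+1, w''; split; [lia | | by []].
by exists w' => //; exact: pivot_step.
Qed.

End ChordWords.

End DartWords.

(** * Drawing a graph from its dart word *)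

Module WordEmbedding.
Import Chains GridHomology FineCovers SolidHandles SphereChart EdgeBound SurfaceArcs HandleSlab DartWords.
Local Open Scope classical_set_scope.
Local Open Scope ring_scope.

Lemma split_after (T : eqType) (w : seq T) a : uniq w -> a \in w ->
  exists P V, [/\ w = P ++ a :: V, uniq V &
    forall c, c \in w -> (index a w < index c w)%N -> c \in V /\ index c w = (size P + (index c V).+1)%N].
Proof.
move=> uw aw; have [P [V wE]] : exists P V, w = P ++ a :: V by case/splitPr: aw => P V; exists P, V.
exists P, V; move: uw; rewrite wE cat_uniq /= => /and4P[uP /norP[aP hP] aV uV]; split=> // c.
rewrite !index_cat (negbTE aP) /= eqxx addn0 mem_cat inE.
case: ifP => [cP _|/negbT cP] /=; first by rewrite ltnNge ltnW // index_mem.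
case: eqVneq => [_|_] /=; first by rewrite addn0 ltnn.
by move=> cV _.
Qed.

Lemma crossing_of_index (E : finType) (w : seq (E * bool)) (a b : E * bool) : uniq w ->
  a \in w -> b \in w -> opp a \in w -> opp b \in w ->
  (index a w < index b w)%N -> (index b w < index (opp a) w)%N ->
  (index (opp a) w < index (opp b) w)%N -> crossing w.
Proof.
move=> uw aw bw aw' bw' i1 i2 i3.
have [P [V [wE uV sV]]] := split_after uw aw.
have [bV eb] := sV _ bw i1; have [aV' ea'] := sV _ aw' (ltn_trans i1 i2).
have [bV' eb'] := sV _ bw' (ltn_trans i1 (ltn_trans i2 i3)).
have [X [V1 [VE uV1 sV1]]] := split_after uV bV.
have i2' : (index b V < index (opp a) V)%N by move: i2; rewrite eb ea' ltn_add2l.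
have i3' : (index (opp a) V < index (opp b) V)%N by move: i3; rewrite ea' eb' ltn_add2l.
have [aV1 ea1] := sV1 _ aV' i2'; have [bV1 eb1] := sV1 _ bV' (ltn_trans i2' i3').
have [Y [V2 [V1E uV2 sV2]]] := split_after uV1 aV1.
have i3'' : (index (opp a) V1 < index (opp b) V1)%N by move: i3'; rewrite ea1 eb1 ltn_add2l.
have [bV2 _] := sV2 _ bV1 i3''.
have [Z [Q [V2E _ _]]] := split_after uV2 bV2.
by exists P, a, X, b, Y, Z, Q; rewrite wE VE V1E V2E.
Qed.

(** A handle is left idle by the step in which all blocks but the first are empty. *)
Lemma reach_pad (E : finType) i k (w w' : seq (E * bool)) : reach k w w' -> reach (k + i) w w'.
Proof.
elim: k w => [|k IHk] w /=; last by case=> w1 s r; exists w1 => //; exact: IHk.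
move=> <-; elim: i => //= i IHi; exists w => //.
by exists w, [::], [::], [::], [::]; rewrite !cats0.
Qed.

Lemma pairwise_index (T : eqType) (r : rel T) w d d' : pairwise r w -> d' \in w ->
  (index d w < index d' w)%N -> r d d'.
Proof.
move=> /(pairwiseP d) pr d'w lt.
have i2 : (index d' w < size w)%N by rewrite index_mem.
have i1 := ltn_trans lt i2.
by have := pr _ _ i1 i2 lt; rewrite !nth_index // -index_mem.
Qed.

Lemma pairwise_total (T : eqType) (r : rel T) w d d' : pairwise r w -> d \in w -> d' \in w ->
  d != d' -> r d d' \/ r d' d.
Proof.
move=> pr dw d'w dd; case: (ltngtP (index d w) (index d' w)) => lt.
- by left; exact: pairwise_index lt.
- by right; exact: pairwise_index lt.
- by move/eqP: dd; case; rewrite -(nth_index d dw) lt nth_index.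
Qed.

Lemma enter_leave_bound (R : realType) b (t : R) : 0 < t < 1 ->
  -4 <= enter b t <= 5 /\ -4 <= leave b t <= 5.
Proof. by move=> /andP[t0 t1]; case: b => /=; split; lra. Qed.

Lemma enter_leave_homo (R : realType) b :
  {homo @enter R b : u v / u < v} /\ {homo @leave R b : u v / u < v}.
Proof. by case: b; split=> u v uv /=; lra. Qed.

Lemma enter_cross (R : realType) b b' (u v : R) : 0 < u < 1 -> 0 < v < 1 ->
  match b, b' with
  | bP, (bX | bY | bZ | bQ) | bX, (bY | bZ | bQ) | bY, (bZ | bQ) | bZ, bQ => enter b u < enter b' v
  | _, _ => True
  end.
Proof. by move=> /andP[u0 u1] /andP[v0 v1]; case: b; case: b' => //=; lra. Qed.

Lemma leave_cross (R : realType) b b' (u v : R) : 0 < u < 1 -> 0 < v < 1 ->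
  match b, b' with
  | bP, (bX | bY | bZ | bQ) | bZ, (bX | bY | bQ) | bY, (bX | bQ) | bX, bQ => leave b u < leave b' v
  | _, _ => True
  end.
Proof. by move=> /andP[u0 u1] /andP[v0 v1]; case: b; case: b' => //=; lra. Qed.

Section WordEmbedding.
Variables (R : realType) (E : finType) (n h : nat) (vt : E * bool -> 'I_n).
Hypothesis h4 : (4 <= h)%N.
Notation D := (E * bool)%type.
Notation point := (R * R * R)%type.
Notation S := (@sphere_with_handles R h).
Notation lift := (@lift R h).
Notation strands := (@strands R h _ n vt).
Notation vpos := (@vpos R h n).

Definition ordered (y : D -> R) (w : seq D) :=
  (forall d, -4 <= y d <= 5) /\ pairwise (fun d d' => y d < y d') w.

Definition rk (w : seq D) (d : D) : R := (index d w).+1%:R / (size w).+1%:R.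

Lemma rkP (w : seq D) d : d \in w -> 0 < rk w d < 1.
Proof.
move=> dw; rewrite /rk divr_gt0 //= ltr_pdivrMr // mul1r ltr_nat ltnS.
by rewrite index_mem.
Qed.

Lemma rk_lt (w : seq D) d d' : (rk w d < rk w d') = (index d w < index d' w)%N.
Proof. by rewrite ltr_pM2r ?invr_gt0 // ltr_nat. Qed.

Lemma rk_inj (w : seq D) : uniq w -> (forall d, d \in w) -> injective (rk w).
Proof.
move=> uw fw d d' e; have s0 : (size w).+1%:R^-1 != 0 :> R by rewrite invr_eq0 pnatr_eq0.
have /eqP := mulIf s0 e; rewrite eqr_nat => /eqP[ie].
by rewrite -(nth_index d (fw d)) ie nth_index.
Qed.

Lemma rk_pairwise (w : seq D) : uniq w -> pairwise (fun d d' => rk w d < rk w d') w.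
Proof.
move=> uw; case: w uw => // d0 w uw; apply/(pairwiseP d0) => i j; rewrite !inE => il jl ij.
by rewrite rk_lt !index_uniq.
Qed.

Definition block_of (P X Y Z : seq D) (d : D) : blk :=
  if d \in P then bP else if d \in X then bX else if d \in Y then bY else if d \in Z then bZ else bQ.

Lemma block_ofE (P X Y Z Q : seq D) : uniq (P ++ X ++ Y ++ Z ++ Q) ->
  [/\ {in P, forall d, block_of P X Y Z d = bP}, {in X, forall d, block_of P X Y Z d = bX},
      {in Y, forall d, block_of P X Y Z d = bY}, {in Z, forall d, block_of P X Y Z d = bZ} &
      {in Q, forall d, block_of P X Y Z d = bQ}].
Proof.
rewrite !cat_uniq !has_cat !negb_or => /and3P[_ /and4P[PX PY PZ PQ]] /and3P[_ /and3P[XY XZ XQ]].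
move=> /and3P[_ /andP[YZ YQ]] /and3P[_ ZQ _].
have no (s1 s2 : seq D) d : ~~ has (mem s1) s2 -> d \in s2 -> (d \in s1) = false.
  by move=> /hasPn hs /hs /negbTE.
rewrite /block_of; split=> d ds.
- by rewrite ds.
- by rewrite (no P X d PX ds) ds.
- by rewrite (no P Y d PY ds) (no X Y d XY ds) ds.
- by rewrite (no P Z d PZ ds) (no X Z d XZ ds) (no Y Z d YZ ds) ds.
- by rewrite (no P Q d PQ ds) (no X Q d XQ ds) (no Y Q d YQ ds) (no Z Q d ZQ ds).
Qed.

Lemma block_cross (g : blk -> R -> R) (b : D -> blk) (t : D -> R) b1 b2 (s1 s2 : seq D) :
  (forall d, 0 < t d < 1) -> {in s1, forall d, b d = b1} -> {in s2, forall d, b d = b2} ->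
  (forall u v, 0 < u < 1 -> 0 < v < 1 -> g b1 u < g b2 v) ->
  allrel (fun d d' => g (b d) (t d) < g (b d') (t d')) s1 s2.
Proof. by move=> tI h1 h2 gg; apply/allrelP => x y xs ys; rewrite h1 // h2 //; exact: gg. Qed.

Lemma block_inner (g : blk -> R -> R) (b : D -> blk) (t : D -> R) b1 (s : seq D) :
  {in s, forall d, b d = b1} -> {homo g b1 : u v / u < v} ->
  pairwise (fun d d' => t d < t d') s -> pairwise (fun d d' => g (b d) (t d) < g (b d') (t d')) s.
Proof.
move=> h1 gg; apply: (sub_in_pairwise (P := mem s)); last by apply/allP.
by move=> x y xs ys xy; rewrite h1 // h1 //; exact: gg.
Qed.

(** Each handle takes four units of abscissa: a quarter of a unit to spread the strands into the
    bands of their blocks, the rest to pass the handle. *)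
Lemma step_strands j (w w' : seq D) y St : (j < h)%N -> uniq w -> (forall d, d \in w) ->
  strands (4 * j%:R - 1 / 2) y St -> ordered y w -> step w w' ->
  exists y' St', strands (4 * j.+1%:R - 1 / 2) y' St' /\ ordered y' w'.
Proof.
move=> jh uw fw st [yb yo] [P [X [Y [Z [Q [wE wE']]]]]].
have jj : j%:R + 1 <= h%:R :> R by rewrite natr1 ler_nat.
have j0 : 0 <= j%:R :> R by [].
have n1 : -1 < 4 * j%:R - 1 / 2 :> R by lra.
have n2 : -1 < 4 * j%:R - 1 / 4 :> R by lra.
have x12 : 4 * j%:R - 1 / 4 < 4 * j%:R + 7 / 2 :> R by lra.
pose b := block_of P X Y Z; pose t := rk w.
have tI d : 0 < t d < 1 by exact: rkP.
have t_inj : injective t by exact: rk_inj.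
have [hP hX hY hZ hQ] : [/\ {in P, forall d, b d = bP}, {in X, forall d, b d = bX},
      {in Y, forall d, b d = bY}, {in Z, forall d, b d = bZ} & {in Q, forall d, b d = bQ}].
  by apply: block_ofE; rewrite -wE.
have bound d : -4 <= enter (b d) (t d) <= 5 /\ -4 <= leave (b d) (t d) <= 5.
  exact: enter_leave_bound.
have [pP pX pY pZ pQ] : [/\ pairwise (fun d d' => t d < t d') P, pairwise (fun d d' => t d < t d') X,
    pairwise (fun d d' => t d < t d') Y, pairwise (fun d d' => t d < t d') Z & pairwise (fun d d' => t d < t d') Q].
  have := rk_pairwise uw; rewrite {3}wE !pairwise_cat => /and3P[_ -> /and3P[_ -> /and3P[_ -> /and3P[_ -> ->]]]].
  by [].
have mono g : g = @enter R \/ g = @leave R -> forall b1, {homo g b1 : u v / u < v}.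
  by move=> [] -> b1; case: (enter_leave_homo R b1).
have ent : pairwise (fun d d' => enter (b d) (t d) < enter (b d') (t d')) w.
  have m := mono _ (or_introl erefl).
  rewrite {1}wE !pairwise_cat !allrel_catr.
  rewrite (block_inner hP (m _) pP) (block_inner hX (m _) pX) (block_inner hY (m _) pY).
  rewrite (block_inner hZ (m _) pZ) (block_inner hQ (m _) pQ) !andbT.
  rewrite (block_cross tI hP hX) ?(block_cross tI hP hY) ?(block_cross tI hP hZ) ?(block_cross tI hP hQ) //;
   rewrite ?(block_cross tI hX hY) ?(block_cross tI hX hZ) ?(block_cross tI hX hQ) //;
   rewrite ?(block_cross tI hY hZ) ?(block_cross tI hY hQ) ?(block_cross tI hZ hQ) //;
   by move=> u v uI vI; match goal with |- is_true (enter ?b1 _ < enter ?b2 _) =>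
     exact: (@enter_cross R b1 b2 u v uI vI) end.
have lea : pairwise (fun d d' => leave (b d) (t d) < leave (b d') (t d')) w'.
  have m := mono _ (or_intror erefl).
  rewrite wE' !pairwise_cat !allrel_catr.
  rewrite (block_inner hP (m _) pP) (block_inner hX (m _) pX) (block_inner hY (m _) pY).
  rewrite (block_inner hZ (m _) pZ) (block_inner hQ (m _) pQ) !andbT.
  rewrite (block_cross tI hP hX) ?(block_cross tI hP hY) ?(block_cross tI hP hZ) ?(block_cross tI hP hQ) //;
   rewrite ?(block_cross tI hZ hY) ?(block_cross tI hZ hX) ?(block_cross tI hZ hQ) //;
   rewrite ?(block_cross tI hY hX) ?(block_cross tI hY hQ) ?(block_cross tI hX hQ) //;
   by move=> u v uI vI; match goal with |- is_true (leave ?b1 _ < leave ?b2 _) =>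
     exact: (@leave_cross R b1 b2 u v uI vI) end.
have fs := @fan_slab R h D h4 (4 * j%:R - 1 / 2) (4 * j%:R - 1 / 4) y (fun d => enter (b d) (t d)).
have x01 : 4 * j%:R - 1 / 2 < 4 * j%:R - 1 / 4 :> R by lra.
have {}fs := fs x01 ltac:(lra) ltac:(lra) _ yb (fun d => (bound d).1) _.
have {}fs := fs ltac:(by move=> x /andP[? ?]; apply: (@clear_between R h j)).
have both : pairwise (fun d d' => (y d < y d') && (enter (b d) (t d) < enter (b d') (t d'))) w.
  by have := pairwise_relI (fun d d' => y d < y d') (fun d d' => enter (b d) (t d) < enter (b d') (t d')) w; rewrite yo ent.
have {}fs := fs ltac:(by move=> d d' dd; case: (pairwise_total both (fw d) (fw d') dd) => /andP[? ?]; [left | right]).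
have st1 := strands_extend n1 x01 st fs.
have es := event_slab h4 jh b tI t_inj.
have xj : 4 * j%:R + 7 / 2 = 4 * j.+1%:R - 1 / 2 :> R by rewrite -natr1; lra.
have st2 := strands_extend n2 x12 st1 es; rewrite xj in st2.
exists (fun d => leave (b d) (t d)); eexists; split; first exact: st2.
by split=> // d; have [] := bound d.
Qed.

Lemma reach_strands k j (w w' : seq D) y St : (j + k <= h)%N -> uniq w -> (forall d, d \in w) ->
  strands (4 * j%:R - 1 / 2) y St -> ordered y w -> reach k w w' ->
  exists y' St', [/\ strands (4 * (j + k)%:R - 1 / 2) y' St', ordered y' w', uniq w' & forall d, d \in w'].
Proof.
elim: k j w y St => [|k IHk] j w y St jk uw fw st yo /=.
  by move=> <-; rewrite addn0; exists y, St.
move=> [w1 sw rw]; have jh : (j < h)%N by lia.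
have [y1 [St1 [st1 yo1]]] := step_strands jh uw fw st yo sw.
have pw : perm_eq w w1.
  by case: sw => P [X [Y [Z [Q [-> ->]]]]]; apply/permP => f; rewrite !count_cat; lia.
have [|||y' [St' [s1 s2 s3 s4]]] := IHk j.+1 w1 y1 St1 _ _ _ st1 yo1 rw => //.
- by lia.
- by rewrite -(perm_uniq pw).
- by move=> d; rewrite -(perm_mem pw).
by exists y', St'; rewrite addnS -addSn.
Qed.

(** A bracket whose depth is proportional to its height, so that nested brackets are disjoint.
    Heights are at most [9], and the factor [1 / 32] keeps the depth below half a unit, over the
    disc. *)
Definition cap (x lo hi : R) : set (R * R) :=
  hseg x (x + (hi - lo) / 32) lo `|` (vseg (x + (hi - lo) / 32) lo hi `|` hseg x (x + (hi - lo) / 32) hi).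

Lemma cap_arc x lo hi : lo < hi -> is_arc R (cap x lo hi) (x, lo) (x, hi).
Proof.
move=> lh; apply: (@arc_cat R _ _ _ _ (x + (hi - lo) / 32, lo)); first by apply: hseg_arc; lra.
  apply: (@arc_cat R _ _ _ _ (x + (hi - lo) / 32, hi)); [by apply: vseg_arc; lra | by apply/arc_rev/hseg_arc; lra |].
  by case=> a b []; rewrite /hseg /vseg /= => H H'; split_hyps; congr (_, _); lra.
by case=> a b []; rewrite /hseg /vseg /= => H H'; split_hyps; congr (_, _); lra.
Qed.

Lemma cap_range x lo hi P : lo < hi -> cap x lo hi P ->
  [/\ x <= P.1 <= x + (hi - lo) / 32, lo <= P.2 <= hi & P.1 = x -> P.2 = lo \/ P.2 = hi].
Proof.
move=> lh; case: P => a b; rewrite /cap /hseg /vseg /= => H; split_hyps; split; try (by apply/andP; split; lra).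
- by left; lra.
- by move=> ?; exfalso; lra.
- by right; lra.
Qed.

Lemma cap_disj x lo hi lo' hi' P : lo < hi -> lo' < hi' -> lo < lo' -> hi != lo' ->
  (lo' < hi -> hi' < hi) -> cap x lo hi P -> cap x lo' hi' P -> False.
Proof.
move=> lh lh' ll hl nest c1 c2; have [_ /andP[y1 y2] _] := cap_range lh c1.
have [_ /andP[y1' y2'] _] := cap_range lh' c2.
have {}hl : lo' < hi by rewrite lt_neqAle eq_sym hl; lra.
have hh := nest hl; case: P c1 c2 {y1 y2 y1' y2' nest} => a b.
by rewrite /cap /hseg /vseg /= => H H'; split_hyps; lra.
Qed.

(** Behind the last handle no chords cross, so the two strands of every edge can be joined by caps
    that are nested or apart. *)
Theorem word_embeds (G : sgraph n) (w0 w : seq D) : uniq w0 -> (forall d, d \in w0) ->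
  pairwise (fun d d' => (vt d <= vt d')%N) w0 -> reach h w0 w -> ~ crossing w ->
  edges G = [set [set vt (e, false); vt (e, true)]%SET | e : E]%SET ->
  injective (fun e : E => [set vt (e, false); vt (e, true)]%SET) ->
  (forall e, vt (e, false) != vt (e, true)) ->
  embeds_in R S G.
Proof.
move=> uw0 fw0 vo rw ncr GE vinj vne.
have h1 : 4 <= h%:R :> R by rewrite ler_nat.
have y0b d : -4 <= rk w0 d <= 5 by have /andP[? ?] := rkP (fw0 d); apply/andP; split; lra.
have both : pairwise (fun d d' => (rk w0 d < rk w0 d') && (vt d <= vt d')%N) w0.
  by have := pairwise_relI (fun d d' => rk w0 d < rk w0 d') (fun d d' => (vt d <= vt d')%N) w0; rewrite rk_pairwise // vo.
have st0 := @strands_init R h _ n vt h4 (rk w0) y0b.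
have {}st0 := st0 (fun d d' dd => match pairwise_total both (fw0 d) (fw0 d') dd with
  | or_introl H => or_introl (andP H) | or_intror H => or_intror (andP H) end).
have x0 : -1 / 2 = 4 * 0%:R - 1 / 2 :> R by lra.
rewrite x0 in st0.
have [y [St [st [yb yo] uw fw]]] := @reach_strands h 0 w0 w (rk w0) _ (leqnn h) uw0 fw0 st0 (conj y0b (rk_pairwise uw0)) rw.
rewrite add0n in st; set xh : R := 4 * h%:R - 1 / 2 in st.
have [a1 a2 a3 a4 a5] := st.
have y_index d d' : y d < y d' -> (index d w < index d' w)%N.
  move=> lt; have dd : d != d' by apply/eqP => e; rewrite e ltxx in lt.
  case: (ltngtP (index d w) (index d' w)) => // [lt'|ie].
    by have := pairwise_index yo (fw d) lt'; rewrite ltNge (ltW lt).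
  by move/eqP: dd; case; rewrite -(nth_index d (fw d)) ie nth_index.
have y_inj : injective y.
  move=> d d' e; apply/eqP/negPn/negP => dd.
  by case: (pairwise_total yo (fw d) (fw d') dd); rewrite e ltxx.
pose lowd e : D := (e, y (e, true) < y (e, false)).
have low e : y (lowd e) < y (opp (lowd e)).
  rewrite /lowd /opp /=; case lt: (y (e, true) < y (e, false)) => //=.
  by rewrite lt_neqAle leNgt lt andbT; apply/eqP => /y_inj.
have vneq d : vt d != vt (opp d).
  by case: d => e [] /=; rewrite /opp /= ?vne // eq_sym vne.
pose capset e : set point := lift @` cap xh (y (lowd e)) (y (opp (lowd e))).
pose C e : set point := St (lowd e) `|` (capset e `|` St (opp (lowd e))).
have xh0 : -1 < xh by rewrite /xh; lra.
have cap_in e p : capset e p -> [/\ S p, xh <= p.1.1, p.1.1 = xh -> p = lift (xh, y (lowd e)) \/ p = lift (xh, y (opp (lowd e)))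
    & cap xh (y (lowd e)) (y (opp (lowd e))) p.1].
  move=> /lift_set[cp pE]; have [/andP[x1 x2] /andP[z1 z2] ends] := cap_range (low e) cp.
  have /andP[b1 b2] := yb (lowd e); have /andP[b3 b4] := yb (opp (lowd e)).
  split=> //.
  - rewrite pE; case: (p.1) x1 x2 z1 z2 {cp pE ends} => u v /= x1 x2 z1 z2; apply: lift_surface.
      by apply: (rad_bound h4); rewrite /xh in x1 x2 *; [lra | lra | apply/andP; split; lra].
    constructor 3 => k kh; right; have /andP[m1 m2] := mid_bound R kh.
    by rewrite ltr_normr; apply/orP; left; rewrite /xh in x1; lra.
  - move=> px; rewrite pE; have [e1|e1] := ends px; [left | right]; congr (SurfaceArcs.lift _ _);
    by rewrite [p.1]surjective_pairing px e1.
have st_cap d e p : St d p -> capset e p -> d.1 = e /\ p = lift (xh, y d).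
  move=> sp /cap_in[_ x1 ends _]; have [_ /andP[_ x2]] := a2 _ _ sp.
  have px : p.1.1 = xh by lra.
  have pE := a4 _ _ sp px; split=> //.
  by have [] := ends px; rewrite pE => /lift_inj[/y_inj->].
have vpos_inj v v' : vpos v = vpos v' -> v = v'.
  move=> /lift_inj[e]; apply/val_inj; case: (ltngtP v v') => // lt.
    by have := @vy_lt R n _ _ lt; rewrite e ltxx.
  by have := @vy_lt R n _ _ lt; rewrite e ltxx.
have C_arc e : is_arc R (C e) (vpos (vt (lowd e))) (vpos (vt (opp (lowd e)))).
  apply: (arc_cat (a1 (lowd e))).
    apply: (arc_cat (q := lift (xh, y (opp (lowd e))))); [exact: (lift_arc h (cap_arc xh (low e))) | exact: arc_rev (a1 _) |].
    by move=> p [cp sp]; have [_ ->] := st_cap _ _ _ sp cp.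
  move=> p [sp [cp|sp']]; first by have [_ ->] := st_cap _ _ _ sp cp.
  have ne : lowd e != opp (lowd e) by rewrite eq_sym opp_neq.
  have px := a5 _ _ _ ne sp sp'.
  have := a3 _ _ sp px; rewrite (a3 _ _ sp' px) => /vpos_inj/eqP.
  by rewrite eq_sym (negbTE (vneq _)).
have C_S e p : C e p -> S p.
  by case=> [/a2[]//|[/cap_in[]//|/a2[]//]].
have C_left e p : C e p -> p.1.1 = -1 -> p = vpos (vt (lowd e)) \/ p = vpos (vt (opp (lowd e))).
  move=> [sp|[/cap_in[_ x1 _ _]|sp]] px; [by left; exact: a3 | by move: x1; rewrite px leNgt xh0 | by right; exact: a3].
have C_disj e f p : e != f -> C e p -> C f p -> p.1.1 = -1.
  move=> ef.
  have ss d d' : d.1 = e -> d'.1 = f -> St d p -> St d' p -> p.1.1 = -1.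
    by move=> de df; apply: a5; apply/eqP => dd; rewrite -de -df dd eqxx in ef.
  have cc e1 f1 : e1 != f1 -> y (lowd e1) < y (lowd f1) -> capset e1 p -> capset f1 p -> False.
    move=> ef1 ylt /cap_in[_ _ _ c1] /cap_in[_ _ _ c2]; apply: (cap_disj (low e1) (low f1) ylt _ _ c1 c2).
      by apply/eqP => /y_inj[e1f1]; rewrite e1f1 eqxx in ef1.
    move=> lt1; rewrite ltNge le_eqVlt; apply/negP => /orP[/eqP/y_inj[e1f1]|lt2]; first by rewrite e1f1 eqxx in ef1.
    by apply: ncr; apply: (@crossing_of_index E w (lowd e1) (lowd f1)) => //; exact: y_index.
  move=> [s1|[c1|s1]] [s2|[c2|s2]].
  - exact: ss s1 s2.
  - by have [e1 _] := st_cap _ _ _ s1 c2; rewrite -e1 eqxx in ef.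
  - exact: ss s1 s2.
  - by have [e1 _] := st_cap _ _ _ s2 c1; rewrite -e1 eqxx in ef.
  - exfalso; case: (ltgtP (y (lowd e)) (y (lowd f))) => [lt|lt|/y_inj[e1 _]].
    + exact: (cc e f).
    + by apply: (cc f e) => //; rewrite eq_sym.
    + by rewrite e1 eqxx in ef.
  - by have [e1 _] := st_cap _ _ _ s2 c1; rewrite -e1 eqxx in ef.
  - exact: ss s1 s2.
  - by have [e1 _] := st_cap _ _ _ s1 c2; rewrite -e1 eqxx in ef.
  - exact: ss s1 s2.
have [cf cfP] := choice C_arc.
pose es (e : E) := [set vt (e, false); vt (e, true)]%SET.
(* Curves are indexed by sets of vertices; the constant one is a default for sets that are not
   edges. *)
exists vpos, (fun s => if [pick e | es e == s] is Some e then cf e else fun=> 0).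
have pickE e : [pick e' | es e' == es e] = Some e.
  by case: pickP => [e' /eqP/vinj->//|/(_ e)]; rewrite eqxx.
have inI01 (t : R) : t \in `]0, 1[ -> [/\ t \in `[0, 1], t != 0 & t != 1].
  by rewrite !in_itv /= => /andP[t0 t1]; rewrite !ltW // gt_eqF // lt_eqF.
have I0 : (0 : R) \in `[0, 1] by rewrite in_itv /= lexx ler01.
have I1 : (1 : R) \in `[0, 1] by rewrite in_itv /= lexx ler01.
have interior_pt e t : t \in `]0, 1[ -> (cf e t).1.1 <> -1.
  move=> /inI01[tI t0 t1] px; have [_ ci cC c0 c1] := cfP e.
  have Ct : C e (cf e t) by rewrite -cC; exists t.
  case: (C_left _ _ Ct px) => E1.
    by move/eqP: t0; case; apply: ci => //; rewrite c0.
  by move/eqP: t1; case; apply: ci => //; rewrite c1.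
have vS v : S (vpos v).
  clear -h4 h1; have /andP[v0 v1] := @vy_bound R n v.
  apply: lift_surface; first by apply: (rad_bound h4) => //; [lra | apply/andP; split; lra].
  by constructor 3; apply: clear_left; lra.
split=> //.
- move=> s; rewrite GE => /imsetP[e _ ->]; rewrite -/(es e) pickE.
  have [cc ci cC c0 c1] := cfP e; split=> //.
  + exact: continuous_subspaceT.
  + by rewrite cC => p; exact: C_S.
  + rewrite c0 c1; apply/seteqP; split=> [p [->|->]|p [v /=]].
    * by exists (vt (lowd e)) => //=; rewrite /es /lowd !inE; case: (_ < _); rewrite eqxx ?orbT.
    * by exists (vt (opp (lowd e))) => //=; rewrite /es /lowd /opp !inE; case: (_ < _); rewrite /= eqxx ?orbT.
    * rewrite /es /lowd /opp !inE /=; case: (y (e, true) < y (e, false)) => /orP[/eqP-> <-|/eqP-> <-] /=; by [left | right].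
  + by move=> t i tI E1; apply: (interior_pt e t tI); rewrite E1.
- move=> s s'; rewrite GE => /imsetP[e _ ->] /imsetP[f _ ->] ne u v uI vI; rewrite -/(es e) -/(es f) !pickE => eqp.
  have ef : e != f by apply/eqP => ef; rewrite ef in ne.
  have [_ _ cC _ _] := cfP e; have [_ _ cC' _ _] := cfP f.
  apply: (interior_pt e u uI); apply: (C_disj e f) => //.
    by rewrite -cC; exists u => //; have [] := inI01 _ uI.
  by rewrite eqp -cC'; exists v => //; have [] := inI01 _ vI.
Qed.

End WordEmbedding.

End WordEmbedding.

(** * Rotations with many triangular faces *)

Module RotationSystem.
Import Chains DartWords.
Local Open Scope ring_scope.

Section KeyWord.
Variables (E : finType) (key : E * bool -> nat).
Hypothesis key_inj : injective key.
Notation dart := (E * bool)%type.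

Definition kword : seq dart := sort (relpre key leq) (enum {: dart}).

Lemma kword_perm : perm_eq kword (enum {: dart}).
Proof. by rewrite perm_sort. Qed.

Lemma kword_uniq : uniq kword.
Proof. by rewrite (perm_uniq kword_perm) enum_uniq. Qed.

Lemma kword_mem p : p \in kword.
Proof. by rewrite (perm_mem kword_perm) mem_enum. Qed.

Lemma kword_sorted : sorted (relpre key leq) kword.
Proof. by apply: sort_sorted => x y; exact: leq_total. Qed.

Lemma kword_pairwise : pairwise (relpre key leq) kword.
Proof.
rewrite -sorted_pairwise; first exact: kword_sorted.
by move=> x y z; exact: leq_trans.
Qed.

Lemma pi_kword z p : pi z kword p = \sum_(q : dart | (key q < key p)%N) z q.1.
Proof.
rewrite /pi /par; have [P [V wE]] : exists P V, kword = P ++ p :: V.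
  by case/splitPr: (kword_mem p) => P V; exists P, V.
have := kword_uniq; rewrite wE cat_uniq /= => /and4P[uP /norP[pP hP] pV uV].
rewrite index_cat (negbTE pP) /= eqxx addn0 take_size_cat //.
have := kword_pairwise; rewrite wE pairwise_cat /= => /and4P[/allrelP PV _ /allP pVle _].
rewrite -[RHS]big_filter; apply: perm_big; apply: uniq_perm => //.
  by rewrite filter_uniq // index_enum_uniq.
move=> q; rewrite mem_filter mem_index_enum andbT.
have := kword_mem q; rewrite wE mem_cat inE => /or3P[qP|/eqP->|qV].
- rewrite qP ltn_neqAle; have /= -> := PV q p qP (mem_head _ _); rewrite andbT; symmetry.
  by apply/eqP => /key_inj qp; rewrite -qp qP in pP.
- by rewrite (negbTE pP) ltnn.
- rewrite ltnNge; have /= -> := pVle _ qV; apply/negbTE/negP => qP.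
  by move/hasPn: hP => /(_ q qV); rewrite /= qP.
Qed.

Definition delta (e : E) : {ffun E -> bool} := [ffun e' => e' == e].

Lemma pi_delta d p : pi (delta d.1) kword p = ((key d < key p)%N : bool) + (key (opp d) < key p)%N.
Proof.
rewrite pi_kword big_mkcond /= (bigD1 d) //= (bigD1 (opp d)) ?opp_neq //= !ffunE !eqxx.
rewrite big1 ?addr0; first by case: ifP; case: ifP.
move=> q /andP[qd qo]; rewrite ffunE; case: eqP => [/dartP[e|e]|_]; last by case: ifP.
  by rewrite e eqxx in qd.
by rewrite e eqxx in qo.
Qed.

Lemma piD (z1 z2 : {ffun E -> bool}) w p : pi (z1 + z2) w p = pi z1 w p + pi z2 w p.
Proof. by rewrite /pi /par -big_split /=; apply: eq_bigr => q _; rewrite ffunE. Qed.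

Lemma kerD w (z1 z2 : {ffun E -> bool}) : z1 \in ker w -> z2 \in ker w -> z1 + z2 \in ker w.
Proof.
rewrite !inE => /forallP h1 /forallP h2; apply/forallP => p; rewrite !piD !ffunE addrACA.
by rewrite (eqP (h1 p)) (eqP (h2 p)).
Qed.

(** The only dart above one of two consecutive keys and not above the other is [d']. *)
Lemma key_next d d' p : (key d).+1 = key d' -> ((key d < key p)%N : bool) + (key d' < key p)%N = (p == d').
Proof.
move=> kk; rewrite -(inj_eq key_inj) -kk.
by case: (ltngtP (key d).+1 (key p)) => lt; rewrite ?lt ?ltnn //; case: ltngtP => //; lia.
Qed.

(* A triangle whose three corners consist of consecutive darts, traversed
   coherently, is a face of the rotation system. *)
Lemma triangle_ker d0 d1 d2 : d0.1 != d1.1 -> d1.1 != d2.1 -> d2.1 != d0.1 ->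
  (key (opp d2)).+1 = key d0 -> (key (opp d0)).+1 = key d1 -> (key (opp d1)).+1 = key d2 ->
  delta d0.1 + delta d1.1 + delta d2.1 \in ker kword.
Proof.
move=> n01 n12 n20 k0 k1 k2; rewrite inE; apply/forallP => p; apply/eqP.
have piE q : pi (delta d0.1 + delta d1.1 + delta d2.1) kword q = (q == d0) + (q == d1) + (q == d2).
  rewrite !piD !pi_delta -(key_next q k0) -(key_next q k1) -(key_next q k2).
  by case: (_ < _)%N (_ < _)%N (_ < _)%N (_ < _)%N (_ < _)%N (_ < _)%N => [] [] [] [] [] [].
rewrite !piE !ffunE.
have oE d : (opp p == d) = (p == opp d) by rewrite -(inj_eq (inv_inj (@oppK E))) oppK.
have dE d : (p == d) + (opp p == d) = (p.1 == d.1) :> bool.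
  rewrite oE; case: (eqVneq p.1 d.1) => [/dartP[->|->]|ne].
  - by rewrite eqxx eq_sym (negbTE (opp_neq d)).
  - by rewrite eqxx (negbTE (opp_neq d)).
  - by rewrite !(introF eqP) //; move=> e; rewrite e eqxx in ne.
rewrite -!dE; move: (p == d0) (p == d1) (p == d2) (opp p == d0) (opp p == d1) (opp p == d2).
by do 6 case.
Qed.

Definition reduced (S : {set E}) (f : {ffun E -> bool}) :=
  exists2 g : {set E}, g \subset S & f + [ffun e => e \in g] \in ker kword.

Lemma reducedD S f1 f2 : reduced S f1 -> reduced S f2 -> reduced S (f1 + f2).
Proof.
move=> [g1 s1 k1] [g2 s2 k2].
exists ((g1 :\: g2) :|: (g2 :\: g1))%SET.
  apply/fintype.subsetP => e; rewrite !inE => /orP[/andP[_]|/andP[_]]; first exact: (fintype.subsetP s1).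
  exact: (fintype.subsetP s2).
rewrite (_ : _ + _ = f1 + [ffun e => e \in g1] + (f2 + [ffun e => e \in g2])); first exact: kerD.
apply/ffunP => e; rewrite !ffunE !inE.
by case: (f1 e) (f2 e) (e \in g1) (e \in g2) => [] [] [] [].
Qed.

Lemma reduced_ker S f : f \in ker kword -> reduced S f.
Proof.
move=> fk; exists finset.set0; first exact: finset.sub0set.
by rewrite (_ : _ + _ = f) //; apply/ffunP => e; rewrite !ffunE inE addr0.
Qed.

Lemma reduced_mem (S : {set E}) e : e \in S -> reduced S (delta e).
Proof.
move=> eS; exists [set e]%SET; first by rewrite finset.sub1set.
rewrite (_ : _ + _ = 0); last first.
  by apply/ffunP => e'; rewrite !ffunE inE; exact: bool_addxx.
rewrite inE; apply/forallP => p; rewrite /pi /par.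
by rewrite !big1 ?ffunE // => q _; rewrite ffunE.
Qed.

Lemma reduced_third S f1 f2 f3 : f1 + f2 + f3 \in ker kword -> reduced S f2 -> reduced S f3 ->
  reduced S f1.
Proof.
move=> /(reduced_ker S) r r2 r3; rewrite (_ : f1 = f1 + f2 + f3 + f2 + f3); first exact: reducedD (reducedD r r2) r3.
by apply/ffunP => e; rewrite !ffunE; case: (f1 e) (f2 e) (f3 e) => [] [] [].
Qed.

(** Kernel vectors and vectors supported on [S] together span everything, so the rank is at most
    [#|S|]. *)
Lemma ker_card (S : {set E}) : (forall e, reduced S (delta e)) ->
  (2 ^ #|E| <= #|ker kword| * 2 ^ #|S|)%N.
Proof.
move=> rS.
have r0 : reduced S 0.
  apply: reduced_ker; rewrite inE; apply/forallP => p; rewrite /pi /par.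
  by rewrite !big1 ?ffunE // => q _; rewrite ffunE.
have all f : reduced S f.
  have -> : f = \sum_(e | f e) delta e.
    apply/ffunP => e; rewrite sum_ffunE big_mkcond /= (bigD1 e) //= big1 => [|e' ne].
      by rewrite addr0; case: ifP => fe; rewrite ?ffunE ?eqxx ?fe.
    by case: ifP => // _; rewrite ffunE eq_sym (negbTE ne).
  by elim/big_rec: _ => // e x _ rx; exact: reducedD.
pose F (x : {ffun E -> bool} * {set E}) : {ffun E -> bool} := x.1 + [ffun e => e \in x.2].
rewrite -card_powerset -finset.cardsX -card_bool -card_ffun.
apply: leq_trans (leq_imset_card F _); apply: subset_leq_card; apply/fintype.subsetP => f _.
have [g gS fk] := all f; apply/imsetP; exists (f + [ffun e => e \in g], g).
  by rewrite finset.in_setX fk powersetE.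
by apply/ffunP => e; rewrite !ffunE /=; case: (f e) (e \in g) => [] [].
Qed.

End KeyWord.

Section Rotation.
Variables (E L : finType) (n m' : nat) (vt : E * bool -> 'I_n).
Notation m := m'.+2.
Notation dart := (E * bool)%type.
Notation I := (L * ('I_3 * ('I_m * 'I_m)))%type.
(** [L] indexes edge-disjoint complete tripartite graphs: [emb l p u] is point [u] of part [p], and
    [dt (l, (p, (u, x)))] is the dart that leaves it towards point [x] of part [p + 1]. *)
Variables (emb : L -> 'I_3 -> 'I_m -> 'I_n) (dt : I -> dart).
Hypothesis emb_inj : forall l p u p' u', emb l p u = emb l p' u' -> p = p' /\ u = u'.
Hypothesis dt_vt : forall l p u x, vt (dt (l, (p, (u, x)))) = emb l p u.
Hypothesis dt_opp : forall l p u x, vt (opp (dt (l, (p, (u, x))))) = emb l (p + 1) x.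
Hypothesis dt_inj : forall i j, (dt i).1 = (dt j).1 -> i = j.

Definition locate_edge (e : E) : option I := [pick i | (dt i).1 == e].
Definition corner_pos (u x : 'I_m) : nat := nat_of_ord (- x - u)%R.
(** At point [u] of part [p] the darts of a copy alternate: towards [x] in part [p + 1] at the odd
    place [2 * x + 1], towards [w] in part [p - 1] at the even place [2 * (- u - w)], the residue
    being taken modulo [m] before doubling. Neighbouring darts then belong to triangles whose three
    points add up to [0] or to [-1]. Edges in no copy come after all copies. *)
Definition slot (d : dart) : nat :=
  if locate_edge d.1 is Some (l, (p, (u, x))) then
    (enum_rank l * m.*2 + (if d == dt (l, (p, (u, x))) then (x : nat).*2.+1 else (corner_pos u x).*2))%N
  else (#|L| * m.*2 + enum_rank d)%N.
Definition big := (#|L| * m.*2 + #|{: dart}|)%N.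
(** The vertex is the leading digit in base [big], so the word is grouped by vertex. *)
Definition dkey (d : dart) : nat := (vt d * big + slot d)%N.

Lemma locate_dt i : locate_edge (dt i).1 = Some i.
Proof.
by rewrite /locate_edge; case: pickP => [j /eqP/dt_inj->//|/(_ i)]; rewrite eqxx.
Qed.

Lemma slot_dt l p u x : slot (dt (l, (p, (u, x)))) = (enum_rank l * m.*2 + (x : nat).*2.+1)%N.
Proof. by rewrite /slot locate_dt eqxx. Qed.

Lemma slot_opp l p u x :
  slot (opp (dt (l, (p, (u, x))))) = (enum_rank l * m.*2 + (corner_pos u x).*2)%N.
Proof. by rewrite /slot [(opp _).1]/= locate_dt (negbTE (opp_neq _)). Qed.

Lemma dkey_dt l p u x : dkey (dt (l, (p, (u, x)))) =
  (emb l p u * big + (enum_rank l * m.*2 + (x : nat).*2.+1))%N.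
Proof. by rewrite /dkey slot_dt dt_vt. Qed.

Lemma dkey_opp l p u x : dkey (opp (dt (l, (p, (u, x))))) =
  (emb l (p + 1)%R x * big + (enum_rank l * m.*2 + (corner_pos u x).*2))%N.
Proof. by rewrite /dkey slot_opp dt_opp. Qed.

Lemma slot_lt d : (slot d < big)%N.
Proof.
rewrite /slot /big; case: (locate_edge _) => [[l [p [u x]]]|]; last by rewrite ltn_add2l.
have lr : (enum_rank l < #|L|)%N by exact: ltn_ord.
have pl : ((if d == dt (l, (p, (u, x))) then (x : nat).*2.+1 else (corner_pos u x).*2) < m.*2)%N.
  by have := ltn_ord x; have := ltn_ord (- x - u)%R; rewrite /corner_pos; case: ifP => _; lia.
apply: ltn_addr; apply: (@leq_trans ((enum_rank l).+1 * m.*2)); first by rewrite mulSn addnC ltn_add2r.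
by rewrite leq_mul2r lr orbT.
Qed.

Lemma divmod_uniq (B a r a' r' : nat) : (r < B)%N -> (r' < B)%N -> (a * B + r = a' * B + r')%N -> a = a' /\ r = r'.
Proof.
move=> rB rB' e; have B0 : (0 < B)%N by apply: leq_ltn_trans rB.
have := congr1 (divn^~ B) e; have := congr1 (modn^~ B) e.
by rewrite /= !modnMDl !modn_small // !divnMDl // !divn_small // !addn0.
Qed.

Lemma dartE d : (exists l p u x, d = dt (l, (p, (u, x)))) \/
  (exists l p u x, d = opp (dt (l, (p, (u, x))))) \/ locate_edge d.1 = None.
Proof.
rewrite /locate_edge; case: pickP => [[l [p [u x]]] /eqP/esym/dartP[] e|_]; last by right; right.
  by left; exists l, p, u, x.
by right; left; exists l, p, u, x.
Qed.

Lemma dkey_inj : injective dkey.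
Proof.
move=> d d' /(divmod_uniq (slot_lt d) (slot_lt d'))[/val_inj vv ss].
have small (l : L) (c : nat) (y : nat) : (c < m.*2)%N -> (enum_rank l * m.*2 + c = #|L| * m.*2 + y)%N -> False.
  move=> cm e; have lr : ((enum_rank l).+1 <= #|L|)%N by exact: ltn_ord.
  have := leq_mul2r m.*2 (enum_rank l).+1 #|L|; rewrite lr orbT mulSn; lia.
have xl (x : 'I_m) : ((x : nat).*2.+1 < m.*2)%N by have := ltn_ord x; lia.
have cl u x : ((corner_pos u x).*2 < m.*2)%N by have := ltn_ord (- x - u)%R; rewrite /corner_pos; lia.
have noneE e : locate_edge e.1 = None -> slot e = (#|L| * m.*2 + enum_rank e)%N by rewrite /slot => ->.
case: (dartE d) => [[l [p [u [x dE]]]]|[[l [p [u [x dE]]]]|dN]];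
case: (dartE d') => [[l' [p' [u' [x' dE']]]]|[[l' [p' [u' [x' dE']]]]|dN']].
- move: ss vv; rewrite dE dE' !slot_dt !dt_vt => /(divmod_uniq (xl x) (xl x'))[/val_inj/enum_rank_inj ll].
  by move=> [/double_inj/val_inj xx]; rewrite ll xx => /emb_inj[-> ->].
- move: ss vv; rewrite dE dE' slot_dt slot_opp => /(divmod_uniq (xl x) (cl u' x'))[_ e].
  by have := congr1 odd e; rewrite /= !odd_double.
- by move: ss; rewrite dE slot_dt (noneE _ dN') => /(small _ _ _ (xl x)).
- move: ss vv; rewrite dE dE' slot_dt slot_opp => /(divmod_uniq (cl u x) (xl x'))[_ e].
  by have := congr1 odd e; rewrite /= !odd_double.
- move: ss vv; rewrite dE dE' !slot_opp !dt_opp => /(divmod_uniq (cl u x) (cl u' x'))[/val_inj/enum_rank_inj ll].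
  move=> /double_inj/val_inj cc; rewrite ll => /emb_inj[/addIr-> xx].
  by move: cc; rewrite xx => /addrI/oppr_inj->.
- by move: ss; rewrite dE slot_opp (noneE _ dN') => /(small _ _ _ (cl u x)).
- by move: ss; rewrite dE' slot_dt (noneE _ dN) => /esym/(small _ _ _ (xl x')).
- by move: ss; rewrite dE' slot_opp (noneE _ dN) => /esym/(small _ _ _ (cl u' x')).
- by move: ss; rewrite !noneE // => /addnI/val_inj/enum_rank_inj.
Qed.

Lemma dkey_vt d d' : (dkey d <= dkey d')%N -> (vt d <= vt d')%N.
Proof.
rewrite /dkey => le; rewrite leqNgt; apply/negP => lt.
have := slot_lt d'; have : ((vt d').+1 * big <= vt d * big)%N by rewrite leq_mul2r lt orbT.
by rewrite mulSn; lia.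
Qed.

(* Around (p, u), the neighbour (p + 1, x) follows (p - 1, w) when u + w + x = 0. *)
Lemma face_plus l (p q : 'I_3) (u x w : 'I_m) : q + 1 = p -> u + w + x = 0 ->
  (dkey (opp (dt (l, (q, (w, u)))))).+1 = dkey (dt (l, (p, (u, x)))).
Proof.
move=> <- e; rewrite dkey_dt dkey_opp -!addnS; congr (_ * _ + (_ * _ + _.*2.+1))%N.
rewrite /corner_pos; congr nat_of_ord; have : x = (u + w + x) - u - w by ring.
by rewrite e => ->; ring.
Qed.

Lemma val_succ (x : 'I_m) : (x : nat) != m'.+1 -> (x + 1 : 'I_m) = x.+1 :> nat.
Proof. by move=> xm /=; rewrite modn_small; have := ltn_ord x; rewrite ?modn_small //; lia. Qed.

Lemma ord_max_opp1 : (ord_max : 'I_m) = -1.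
Proof.
apply/eqP; rewrite -addr_eq0; apply/eqP/val_inj => /=.
by rewrite (modn_small (isT : (1 < m)%N)) addn1 modnn.
Qed.

(** The rotation at a vertex is cut open to a linear order, so within a copy no even place follows
    the last odd one; this excludes [x = m - 1]. *)
Lemma face_minus l (p q : 'I_3) (u x w : 'I_m) : q + 1 = p -> u + w + x = -1 -> (x : nat) != m'.+1 ->
  (dkey (dt (l, (p, (u, x))))).+1 = dkey (opp (dt (l, (q, (w, u))))).
Proof.
move=> <- e xm; rewrite dkey_dt dkey_opp -!addnS; congr (_ * _ + (_ * _ + _))%N.
rewrite -doubleS -val_succ // /corner_pos; congr ((nat_of_ord _).*2).
have : x = (u + w + x) - u - w by ring.
by rewrite e => ->; ring.
Qed.

Definition uncovered : {set E} := [set e | locate_edge e == None].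

(** Of the [3 * m ^ 2] edges in a copy, [S] keeps the [m ^ 2] edges [e0] between two of the parts
    and three families of [m] edges at which the chain of triangles starts or breaks. All others are
    congruent modulo the kernel to vectors on [S]. *)
Theorem rotation_kernel : exists w : seq dart,
  [/\ uniq w, forall d, d \in w, pairwise (fun d d' => (vt d <= vt d')%N) w &
      (2 ^ #|E| <= #|ker w| * 2 ^ (#|L| * (m ^ 2 + 3 * m) + #|uncovered|))%N].
Proof.
exists (kword dkey); split.
- exact: kword_uniq.
- exact: kword_mem.
- by apply: sub_pairwise (kword_pairwise dkey) => d d'; exact: dkey_vt.
pose e0 (l : L) i j := (dt (l, (0, (i, j)))).1.
pose e1 (l : L) j k := (dt (l, (1, (j, k)))).1.
pose e2 (l : L) k i := (dt (l, (1 + 1, (k, i)))).1.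
pose S : {set E} := (uncovered :|: ([set e0 x.1 x.2.1 x.2.2 | x : L * ('I_m * 'I_m)] :|:
  ([set e2 x.1 x.2 0 | x : L * 'I_m] :|: ([set e2 x.1 x.2 (1 - x.2) | x : L * 'I_m] :|:
   [set e2 x.1 ord_max x.2 | x : L * 'I_m]))))%SET.
have S_card : (#|S| <= #|L| * (m ^ 2 + 3 * m) + #|uncovered|)%N.
  apply: leq_trans (leq_card_setU _ _) _; rewrite addnC leq_add2r.
  apply: leq_trans (leq_card_setU _ _) _.
  have c1 : (#|[set e0 x.1 x.2.1 x.2.2 | x : L * ('I_m * 'I_m)]%SET| <= #|L| * m ^ 2)%N.
    by apply: leq_trans (leq_imset_card _ _) _; rewrite !card_prod !card_ord.
  have c2 (f : L * 'I_m -> E) : (#|[set f x | x : L * 'I_m]%SET| <= #|L| * m)%N.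
    by apply: leq_trans (leq_imset_card _ _) _; rewrite card_prod card_ord.
  apply: leq_trans (leq_add c1 (leq_trans (leq_card_setU _ _) (leq_add (c2 _) (leq_trans (leq_card_setU _ _) (leq_add (c2 _) (c2 _)))))) _.
  by rewrite mulnDr; lia.
suff rS : forall e, reduced dkey S (delta e).
  by apply: leq_trans (ker_card rS) _; rewrite leq_mul2l leq_exp2l // S_card orbT.
have ne (l : L) (p p' : 'I_3) u x u' x' : p != p' -> (dt (l, (p, (u, x)))).1 != (dt (l, (p', (u', x')))).1.
  by move=> pp; apply/eqP => /dt_inj[e]; rewrite e eqxx in pp.
have three : (1 + 1 + 1 : 'I_3) = 0 by exact: val_inj.
have tplus l i j k : i + j + k = 0 -> delta (e2 l k i) + delta (e0 l i j) + delta (e1 l j k) \in ker (kword dkey).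
  move=> e; apply: (triangle_ker dkey_inj (d0 := dt (l, (1 + 1, (k, i)))) (d1 := dt (l, (0, (i, j)))) (d2 := dt (l, (1, (j, k))))); try exact: ne.
  - by apply: face_plus => //; rewrite -e; ring.
  - by apply: face_plus => //; rewrite -e; ring.
  - by apply: face_plus; rewrite ?add0r // -e; ring.
have tminus l (i j k : 'I_m) : i + j + k = -1 -> (i : nat) != m'.+1 -> (j : nat) != m'.+1 -> (k : nat) != m'.+1 ->
    delta (e2 l k i) + delta (e1 l j k) + delta (e0 l i j) \in ker (kword dkey).
  move=> e im jm km; apply: (triangle_ker dkey_inj (d0 := opp (dt (l, (1 + 1, (k, i))))) (d1 := opp (dt (l, (1, (j, k))))) (d2 := opp (dt (l, (0, (i, j)))))); try exact: ne.
  - by rewrite oppK; apply: face_minus => //; rewrite -e; ring.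
  - by rewrite oppK; apply: face_minus => //; rewrite -e; ring.
  - by rewrite oppK; apply: face_minus; rewrite ?add0r // -e; ring.
have r0 l i j : reduced dkey S (delta (e0 l i j)).
  by apply: reduced_mem; rewrite !inE; apply/orP; right; apply/orP; left; apply/imsetP; exists (l, (i, j)).
have r2 l k i : reduced dkey S (delta (e2 l k i)).
  have [->|km] := eqVneq k ord_max.
    by apply: reduced_mem; rewrite !inE; do 4 (apply/orP; right); apply/imsetP; exists (l, i).
  case: i; elim=> [|i IHi] im.
    rewrite (_ : Ordinal im = 0); last exact: val_inj.
    by apply: reduced_mem; rewrite !inE; do 2 (apply/orP; right); apply/orP; left; apply/imsetP; exists (l, k).
  have im' : (i < m)%N by apply: ltn_trans im.
  have iE : Ordinal im = Ordinal im' + 1.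
    by apply: val_inj; apply/esym; apply: (@val_succ (Ordinal im')) => /=; lia.
  have [ik|ik] := eqVneq (Ordinal im') (- k).
    rewrite iE ik addrC; apply: reduced_mem; rewrite !inE; do 3 (apply/orP; right); apply/orP; left.
    by apply/imsetP; exists (l, k).
  (* From [e2 l k i'] to [e2 l k (i' + 1)] by two triangles that share [e1 l j k]: [(i', j, k)] of
     sum [-1] and [(i' + 1, j, k)] of sum [0]. The first one is missing for [k = -1] and for
     [j = -1], that is [i' = - k]; these cases are families of [S]. *)
  pose i' := Ordinal im'; pose j := - 1 - i' - k.
  have t1 : i' + j + k = -1 by rewrite /j; ring.
  have t2 : (i' + 1) + j + k = 0 by rewrite /j; ring.
  have jm : (j : nat) != m'.+1.
    apply: contra ik => /eqP jE; have : j = -1.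
      by rewrite -ord_max_opp1; exact: val_inj.
    move=> jE'; apply/eqP; rewrite -/i' (_ : i' = -1 - k - j); last by rewrite /j; ring.
    by rewrite jE'; ring.
  have km' : (k : nat) != m'.+1 by apply: contra km => /eqP kE; apply/eqP/val_inj.
  have im1 : (i' : nat) != m'.+1 by rewrite /=; lia.
  have rb : reduced dkey S (delta (e1 l j k)).
    apply: (reduced_third (f2 := delta (e2 l k i')) (f3 := delta (e0 l i' j))); [|exact: IHi|exact: r0].
    by rewrite [X in X + _]addrC; exact: tminus.
  rewrite iE; apply: reduced_third (tplus l _ j k t2) _ _; [exact: r0 | exact: rb].
have r1 l j k : reduced dkey S (delta (e1 l j k)).
  have t : (- j - k) + j + k = 0 by ring.
  apply: (reduced_third (f2 := delta (e2 l k (- j - k))) (f3 := delta (e0 l (- j - k) j))); [|exact: r2|exact: r0].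
  by rewrite -addrA addrC; exact: tplus.
move=> e; case eN: (locate_edge e) => [[l [p [u x]]]|]; last first.
  by apply: reduced_mem; rewrite !inE eN.
have -> : e = (dt (l, (p, (u, x)))).1.
  by move: eN; rewrite /locate_edge; case: pickP => // i /eqP <- [->].
have : [|| p == 0, p == 1 | p == 1 + 1] by case: p {eN} => -[|[|[]]].
case/or3P => /eqP->; [exact: r0 | exact: r1 | exact: r2].
Qed.

End Rotation.

End RotationSystem.

(** * Random packing of tripartite graphs by blocks *)

Module TripartitePacking.
Local Open Scope ring_scope.

Section Expectation.
Variable R : realFieldType.

Definition Ex (A : finType) (F : {ffun A -> bool} -> R) : R := (\sum_H F H) / 2 ^+ #|A|.

Lemma two_neq0 k : 2 ^+ k != 0 :> R.
Proof. by rewrite expf_neq0 // pnatr_eq0. Qed.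

Lemma Ex_ext (A : finType) (F G : {ffun A -> bool} -> R) : F =1 G -> Ex F = Ex G.
Proof. by move=> e; rewrite /Ex; under eq_bigr do rewrite e. Qed.

Lemma ExB (A : finType) (F G : {ffun A -> bool} -> R) : Ex (fun H => F H - G H) = Ex F - Ex G.
Proof. by rewrite /Ex sumrB mulrBl. Qed.

Lemma Ex_sum (A I : finType) (P : pred I) (F : I -> {ffun A -> bool} -> R) :
  Ex (fun H => \sum_(i | P i) F i H) = \sum_(i | P i) Ex (F i).
Proof. by rewrite /Ex exchange_big mulr_suml. Qed.

Lemma Ex_cst (A : finType) (c : R) : Ex (fun _ : {ffun A -> bool} => c) = c.
Proof. by rewrite /Ex sumr_const card_ffun card_bool -[c *+ _]mulr_natr natrX mulfK ?two_neq0. Qed.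

Lemma Ex_le (A : finType) (F G : {ffun A -> bool} -> R) : (forall H, F H <= G H) -> Ex F <= Ex G.
Proof. by move=> le; rewrite /Ex ler_pM2r ?invr_gt0 ?exprn_gt0 //; apply: ler_sum. Qed.

Definition pull (A B : finType) (f : A -> B) (H : {ffun B -> bool}) : {ffun A -> bool} :=
  [ffun a => H (f a)].

(** Fair bits restricted to some of the coordinates are fair bits: the fibres of [pull f] are
    translates of each other. *)
Lemma Ex_pull (A B : finType) (f : A -> B) (F : {ffun A -> bool} -> R) : injective f ->
  Ex (fun H => F (pull f H)) = Ex F.
Proof.
move=> fi; pose c := #|[set H : {ffun B -> bool} | pull f H == 0]|.
have fib G : #|[set H | pull f H == G]| = c.
  pose ext : {ffun B -> bool} := [ffun b => [exists a, (f a == b) && G a]].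
  have extE a : ext (f a) = G a.
    rewrite ffunE; apply/existsP/idP => [[a' /andP[/eqP/fi-> //]]|Ga].
    by exists a; rewrite eqxx.
  have pD H : pull f (H + ext) = pull f H + G.
    by apply/ffunP => a; rewrite !ffunE -[[exists _, _]]/(_) -extE ffunE.
  have xx (A' : finType) (H : {ffun A' -> bool}) : H + H = 0.
    by apply/ffunP => a; rewrite !ffunE; case: (H a).
  rewrite /c -(card_imset _ (addIr ext)); apply: eq_card => H; rewrite !inE.
  apply/imsetP/idP => [[H' + ->]|/eqP HG].
    by rewrite inE => /eqP HG; rewrite pD HG xx.
  exists (H + ext); last by rewrite -addrA xx addr0.
  by rewrite inE pD HG add0r.
have sumE : \sum_(H : {ffun B -> bool}) F (pull f H) = (\sum_G F G) * c%:R.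
  rewrite (partition_big (pull f) xpredT) //= mulr_suml; apply: eq_bigr => G _.
  rewrite (eq_bigr (fun=> F G)); last by move=> H /eqP->.
  rewrite sumr_const -[F G *+ _]mulr_natr; congr (_ * _%:R); rewrite -(fib G).
  by apply: eq_card => H; rewrite !inE.
have cE : 2 ^+ #|B| = 2 ^+ #|A| * c%:R :> R.
  have : (\sum_(H : {ffun B -> bool}) 1%N = \sum_(G : {ffun A -> bool}) c)%N.
    rewrite (partition_big (pull f) xpredT) //=; apply: eq_bigr => G _.
    by rewrite sum1_card -(fib G); apply: eq_card => H; rewrite !inE.
  rewrite sum1_card sum_nat_const !card_ffun card_bool => e.
  by rewrite -!natrX -natrM e.
have c0 : c%:R != 0 :> R by apply/eqP => e; move: cE; rewrite e mulr0 => /eqP; rewrite (negbTE (two_neq0 _)).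
by rewrite /Ex sumE cE invfM mulrA mulrAC mulfK // mulrAC.
Qed.

Lemma Ex_prod (C J : finType) (F : C -> {ffun J -> bool} -> R) :
  Ex (fun H : {ffun C * J -> bool} => \prod_c F c (pull (pair c) H)) = \prod_c Ex (F c).
Proof.
rewrite /Ex big_split /= prodr_const card_prod; congr (_ * _); last first.
  by rewrite exprVn -exprM mulnC.
rewrite bigA_distr_bigA /=.
pose h (g : {ffun C -> {ffun J -> bool}}) : {ffun C * J -> bool} := [ffun x => g x.1 x.2].
pose h' (H : {ffun C * J -> bool}) : {ffun C -> {ffun J -> bool}} := [ffun c => pull (pair c) H].
have hK : cancel h h' by move=> g; apply/ffunP => c; apply/ffunP => j; rewrite !ffunE.
have hK' : cancel h' h by move=> H; apply/ffunP => -[c j]; rewrite !ffunE.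
rewrite (reindex h) /=; last by exists h' => x _; [exact: hK | exact: hK'].
apply: eq_bigr => g _; apply: eq_bigr => c _; congr (F c _).
by apply/ffunP => j; rewrite !ffunE.
Qed.

Lemma Ex_indep (C J B : finType) (f : C -> J -> B) (F : C -> {ffun J -> bool} -> R) :
  (forall c j c' j', f c j = f c' j' -> c = c' /\ j = j') ->
  Ex (fun H => \prod_c F c (pull (f c) H)) = \prod_c Ex (F c).
Proof.
move=> fi; rewrite -Ex_prod -(@Ex_pull _ _ (fun x => f x.1 x.2)).
  apply: Ex_ext => H; apply: eq_bigr => c _; congr (F c _).
  by apply/ffunP => j; rewrite !ffunE.
by move=> [c j] [c' j'] /= /fi[-> ->].
Qed.

Lemma Ex_bit (B : finType) (e : B) : Ex (fun H => (H e)%:R) = 1 / 2.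
Proof.
rewrite /Ex; pose d : {ffun B -> bool} := [ffun b => b == e].
have two : (\sum_(H : {ffun B -> bool}) (H e)%:R) + (\sum_(H : {ffun B -> bool}) (H e)%:R) = 2 ^+ #|B| :> R.
  rewrite {2}(reindex (fun H : {ffun B -> bool} => H + d)) /=; last first.
    by exists (fun H : {ffun B -> bool} => H - d) => H _; rewrite ?addrK ?subrK.
  rewrite -big_split /= (eq_bigr (fun=> 1)); last first.
    by move=> H _; rewrite !ffunE eqxx; case: (H e); rewrite /= ?addr0 ?add0r.
  by rewrite sumr_const card_ffun card_bool -natrX.
have T0 := two_neq0 #|B|; move: two T0; move: (\sum_H _) (2 ^+ _) => S T <- T0.
have S0 : S != 0 by apply: contraNneq T0 => ->; rewrite addr0.
by apply: (mulIf T0); rewrite mulfVK //; lra.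
Qed.

End Expectation.

Section Tri.
Variable Y : zmodType.

(** Triples of fixed sum form a design: two entries determine the third, so an edge between two
    parts lies in exactly one triple. Copies and new blocks are both indexed in this way. *)
Definition tri (s : Y) (i : 'I_3) (y y' : Y) : {ffun 'I_3 -> Y} :=
  [ffun k => if k == i then y else if k == i + 1 then y' else s - (y + y')].
Definition tsum (g : {ffun 'I_3 -> Y}) : Y := g 0 + g 1 + g (1 + 1).

Lemma ord3_cases (i : 'I_3) : [\/ i = 0, i = 1 | i = 1 + 1].
Proof. by case: i => -[|[|[|]]] //= h; [constructor 1|constructor 2|constructor 3]; exact: val_inj. Qed.

Lemma ord3_succ (i : 'I_3) : (i + 1 == i) = false.
Proof. by case: (ord3_cases i) => ->. Qed.

Lemma tri_fst s i y y' : tri s i y y' i = y.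
Proof. by rewrite ffunE eqxx. Qed.

Lemma tri_snd s i y y' : tri s i y y' (i + 1) = y'.
Proof. by rewrite ffunE ord3_succ eqxx. Qed.

Lemma tri_thd s i y y' : tri s i y y' (i + 1 + 1) = s - (y + y').
Proof. by rewrite ffunE; case: (ord3_cases i) => ->. Qed.

Lemma tsum_tri s i y y' : tsum (tri s i y y') = s.
Proof.
rewrite /tsum !ffunE; case: (ord3_cases i) => -> /=.
- by rewrite addrC subrK.
- by rewrite -addrA subrK.
- by rewrite addrAC [y' + y]addrC addrC subrK.
Qed.

Lemma tri_id g i : tri (tsum g) i (g i) (g (i + 1)) = g.
Proof.
apply/ffunP => k; rewrite ffunE; case: eqP => [->//|/eqP ki]; case: eqP => [->//|/eqP ki'].
have kE : k = i + 1 + 1.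
  by move: ki ki'; case: (ord3_cases k) => ->; case: (ord3_cases i) => -> //= _ _; exact: val_inj.
rewrite {}kE /tsum; case: (ord3_cases i) => ->.
- by rewrite (_ : 0 + 1 = 1 :> 'I_3) ?add0r // addrC addrA addNr add0r.
- rewrite (_ : 1 + 1 + 1 = 0 :> 'I_3); last exact: val_inj.
  by rewrite -(addrA (g 0)) addrK.
- rewrite (_ : 1 + 1 + 1 = 0 :> 'I_3) ?add0r; last exact: val_inj.
  by rewrite [g 0 + g 1]addrC -(addrA (g 1)) [g 0 + g (1 + 1)]addrC addrK.
Qed.

End Tri.

HB.instance Definition _ (U V : finZmodType) := GRing.Zmodule.on (U * V)%type.

Section Packing.
Variables (R : realFieldType) (m' : nat).
Notation m := m'.+1.
Notation bits X := ('I_3 * (X * X))%type.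
Notation C := ('I_3 * ('I_m * 'I_m))%type.

(** An element [(i, (x, x'))] of [bits X] is a possible edge from [x] in part [i] to [x'] in part
    [i + 1] of the complete tripartite graph with three parts [X]. A block is the subgraph on [m]
    points of each part. *)
Definition bedge (X : Type) (f : 'I_3 -> 'I_m -> X) (c : C) : bits X :=
  (c.1, (f c.1 c.2.1, f (c.1 + 1) c.2.2)).

(** All edges of an assigned block are present and assigned to it, so the blocks in use are
    edge-disjoint. The probability of being present and unassigned equals [p] for every edge; an
    exact value is what the next round can multiply. *)
Definition packing (X : finType) (p : R) := exists (B : finType) (be : B -> 'I_3 -> 'I_m -> X)
  (cov : {ffun bits X -> bool} -> bits X -> option B),
  [/\ forall b i, injective (be b i),
      forall H e b, cov H e = Some b -> exists c, e = bedge (be b) c,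
      forall H e b, cov H e = Some b -> forall c, H (bedge (be b) c) /\ cov H (bedge (be b) c) = Some b &
      forall e, Ex (fun H => (H e && (cov H e == None))%:R) = p].

Lemma packing0 (X : finType) : packing X (1 / 2).
Proof.
exists void, (fun b : void => match b return 'I_3 -> 'I_m -> X with end), (fun _ _ => None).
by split=> // e; rewrite -(Ex_bit R e); apply: Ex_ext => H; rewrite andbT.
Qed.

Section Step.
Variables (X : finZmodType) (B : finType) (be : B -> 'I_3 -> 'I_m -> X).
Variables (cov : {ffun bits X -> bool} -> bits X -> option B) (p : R).
Hypothesis be_inj : forall b i, injective (be b i).
Hypothesis cov_in : forall H e b, cov H e = Some b -> exists c, e = bedge (be b) c.
Hypothesis cov_all : forall H e b, cov H e = Some b ->
  forall c, H (bedge (be b) c) /\ cov H (bedge (be b) c) = Some b.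
Hypothesis cov_ex : forall e, Ex (fun H => (H e && (cov H e == None))%:R) = p.
Notation Y := ('I_m * 'I_2)%type.
Notation X' := (X * Y)%type.
Notation copy := ({ffun 'I_3 -> 'I_m * 'I_2})%type.
Notation line := ({ffun 'I_3 -> X * 'I_2})%type.

(** A [g] of sum zero embeds a copy of the old graph into the new one, with second coordinate [g i]
    on part [i]. Each new edge lies in exactly one such copy, given by [gam]. *)
Definition lift (g : copy) (e : bits X) : bits X' := (e.1, ((e.2.1, g e.1), (e.2.2, g (e.1 + 1)))).
Definition loc (e : bits X') : bits X := (e.1, (e.2.1.1, e.2.2.1)).
Definition gam (e : bits X') : copy := tri 0 e.1 e.2.1.2 e.2.2.2.
(** The only new block through [e]: its points vary in the ['I_m] coordinate, and a line of sum
    [(0, 1)] fixes the rest. The component [1], against [0] for the copies, makes blocks transversal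
    to copies. *)
Definition fb (e : bits X') : line :=
  tri (0, 1) e.1 (e.2.1.1, e.2.1.2.2) (e.2.2.1, e.2.2.2.2).
Definition fbe (f : line) (i : 'I_3) (u : 'I_m) : X' := ((f i).1, (u, (f i).2)).
Definition alive (H : {ffun bits X -> bool}) e := H e && (cov H e == None).
Definition alive1 (H : {ffun bits X' -> bool}) e := alive (pull (lift (gam e)) H) (loc e).
Definition fire (H : {ffun bits X' -> bool}) f := [forall c, alive1 H (bedge (fbe f) c)].
Definition be' (b : copy * B + line) (i : 'I_3) (u : 'I_m) : X' :=
  match b with inl gb => (be gb.2 i u, gb.1 i) | inr f => fbe f i u end.
(** An edge covered within its copy stays covered; the new block is used when all its [3 * m ^ 2]
    edges are present and uncovered. *)
Definition cov' (H : {ffun bits X' -> bool}) (e : bits X') : option (copy * B + line) :=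
  if cov (pull (lift (gam e)) H) (loc e) is Some b then Some (inl (gam e, b))
  else if fire H (fb e) then Some (inr (fb e)) else None.

Lemma lift_loc e : lift (gam e) (loc e) = e.
Proof. by case: e => i [[x y] [x' y']]; rewrite /lift /gam /= tri_fst tri_snd. Qed.

Lemma gam_lift g e : tsum g = 0 -> gam (lift g e) = g.
Proof. by move=> gs; rewrite /gam /lift /= -{3}(tri_id g e.1) gs. Qed.

Lemma loc_lift g e : loc (lift g e) = e.
Proof. by case: e => i [x x']. Qed.

Lemma fb_mem e : e = bedge (fbe (fb e)) (e.1, (e.2.1.2.1, e.2.2.2.1)).
Proof. by case: e => i [[x [u v]] [x' [u' v']]]; rewrite /bedge /fbe /fb /= tri_fst tri_snd. Qed.

Lemma fb_edge f c : tsum f = (0, 1) -> fb (bedge (fbe f) c) = f.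
Proof.
move=> fs; rewrite /fb /bedge /fbe /= -[RHS](tri_id f c.1) fs.
by case: (f c.1) (f (c.1 + 1)) => ? ? [].
Qed.

Lemma alive1E H e : alive1 H e = H e && (cov (pull (lift (gam e)) H) (loc e) == None).
Proof. by rewrite /alive1 /alive ffunE lift_loc. Qed.

(* Distinct edges of a new block lie in distinct copies, hence are alive
   independently of each other. *)
Lemma gam_inj f c c' : tsum f = (0, 1) -> gam (bedge (fbe f) c) = gam (bedge (fbe f) c') -> c = c'.
Proof.
move=> fs; case: c c' => i [u v] [i' [u' v']]; rewrite /gam /bedge /fbe /= => gg.
have third j (a b : 'I_m) : (tri 0 j (a, (f j).2) (b, (f (j + 1)).2) (j + 1 + 1)).2 <> (f (j + 1 + 1)).2.
  rewrite tri_thd -{3}(tri_id f j) fs tri_thd /=.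
  by move/addIr/eqP.
have [ii|ii] := eqVneq i i'.
  subst i'; have := congr1 (fun g : copy => g i) gg; rewrite !tri_fst => -[->].
  by have := congr1 (fun g : copy => g (i + 1)) gg; rewrite !tri_snd => -[->].
case: (third i u v); rewrite gg.
have [e|e] : i + 1 + 1 = i' \/ i + 1 + 1 = i' + 1.
  by move: ii; case: (ord3_cases i) => ->; case: (ord3_cases i') => -> //= _; first [by left; exact: val_inj | by right; exact: val_inj].
  by rewrite e tri_fst.
by rewrite e tri_snd.
Qed.

Lemma step_in H e b : cov' H e = Some b -> exists c, e = bedge (be' b) c.
Proof.
rewrite /cov'; case cE: (cov _ _) => [b'|].
  move=> [<-]; have [c ec] := cov_in cE; exists c.
  by rewrite -[LHS]lift_loc ec.
case: ifP => // _ [<-]; exists (e.1, (e.2.1.2.1, e.2.2.2.1)); exact: fb_mem.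
Qed.

Lemma step_all H e b : cov' H e = Some b ->
  forall c, H (bedge (be' b) c) /\ cov' H (bedge (be' b) c) = Some b.
Proof.
rewrite {1}/cov'; case cE: (cov _ _) => [b'|].
  move=> [<-] c; have [h1 h2] := cov_all cE c.
  have eE : bedge (be' (inl (gam e, b'))) c = lift (gam e) (bedge (be b') c) by [].
  rewrite eE; split; first by move: h1; rewrite ffunE.
  by rewrite /cov' gam_lift ?tsum_tri // loc_lift h2.
case: ifP => // fi [<-] c; have fs : tsum (fb e) = (0, 1) by exact: tsum_tri.
have := forallP fi c; rewrite alive1E => /andP[h1 /eqP h2]; split=> //.
by rewrite /cov' -/(bedge (fbe (fb e)) c) h2 fb_edge // fi.
Qed.

(** The block through [e] fires only if [e] was alive, so the indicator is a difference. The edges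
    of the block lie in distinct copies, so the subtracted expectation is a product of [3 * m ^ 2]
    factors [p]. *)
Lemma step_ex e : Ex (fun H => (H e && (cov' H e == None))%:R) = p - p ^+ (3 * m ^ 2).
Proof.
have fs : tsum (fb e) = (0, 1) by exact: tsum_tri.
have E (H : {ffun bits X' -> bool}) : (H e && (cov' H e == None))%:R = (alive1 H e)%:R - \prod_c (alive1 H (bedge (fbe (fb e)) c))%:R :> R.
  have fireE : \prod_c (alive1 H (bedge (fbe (fb e)) c))%:R = (fire H (fb e))%:R :> R.
    rewrite /fire; case: forallP => [h|h].
      by rewrite big1 // => c _; rewrite h.
    have /forallPn[c /negbTE nc] : ~~ [forall c, alive1 H (bedge (fbe (fb e)) c)] by apply/negP => /forallP.
    by rewrite (bigD1 c) //= nc mul0r.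
  have fa : fire H (fb e) -> alive1 H e.
    by move=> /forallP /(_ (e.1, (e.2.1.2.1, e.2.2.2.1))); rewrite -fb_mem.
  rewrite fireE /cov' alive1E; move: fa; rewrite alive1E.
  case: (cov _ _) => [b|] /=; first by rewrite andbF; case: (fire _ _) => [/(_ isT)//|_]; rewrite subrr.
  by rewrite andbT; case: (fire _ _) => [/(_ isT)->|_] /=; rewrite ?subrr ?andbT ?subr0.
rewrite (Ex_ext E) ExB; congr (_ - _).
  rewrite /alive1 (@Ex_pull R _ _ (lift (gam e)) (fun H => (alive H (loc e))%:R)); first exact: cov_ex.
  by move=> x y xy; rewrite -(loc_lift (gam e) x) xy loc_lift.
rewrite (@Ex_indep R C _ _ (fun c => lift (gam (bedge (fbe (fb e)) c)))
   (fun c H => (alive H (loc (bedge (fbe (fb e)) c)))%:R)).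
  rewrite (eq_bigr (fun=> p)); last by move=> c _; exact: cov_ex.
  by rewrite prodr_const !card_prod !card_ord.
move=> c j c' j' eq; have cc : c = c'.
  apply: (gam_inj fs); have := congr1 gam eq; rewrite !gam_lift //; exact: tsum_tri.
by split=> //; rewrite -cc in eq; rewrite -(loc_lift (gam (bedge (fbe (fb e)) c)) j) eq loc_lift.
Qed.

Lemma packing_step : packing X' (p - p ^+ (3 * m ^ 2)).
Proof.
exists (copy * B + line)%type, be', cov'; split.
- by move=> [[g b]|f] i u u' /= []; [move=> /be_inj | move=> ->].
- exact: step_in.
- exact: step_all.
- exact: step_ex.
Qed.

End Step.

Theorem packing_small (archi : forall x : R, exists k : nat, x < k%:R) (d : R) : 0 < d ->
  exists (X : finType) (p : R), [/\ (0 < #|X|)%N, packing X p & p <= d].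
Proof.
move=> d0; pose fix q (r : nat) : R := if r is r'.+1 then q r' - q r' ^+ (3 * m ^ 2) else 1 / 2.
have qb r : 0 <= q r <= 1.
  elim: r => [|r /andP[q0 q1]] /=; first by apply/andP; split; lra.
  have e0 : 0 <= q r ^+ (3 * m ^ 2) by exact: exprn_ge0.
  have e1 : q r ^+ (3 * m ^ 2) <= q r by apply: ler_iXnr => //; rewrite muln_gt0 expn_gt0.
  by apply/andP; split; lra.
have ex r : exists X : finZmodType, packing X (q r).
  elim: r => [|r [X [B [be [cov [h1 h2 h3 h4]]]]]]; first by exists 'I_1; exact: packing0.
  by exists ((X * ('I_m * 'I_2))%type : finZmodType); exact: (packing_step h1 h2 h3 h4).
have [r qr] : exists r, q r <= d.
  have dN : 0 < d ^+ (3 * m ^ 2) by exact: exprn_gt0.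
  have [k kd] := archi (1 / d ^+ (3 * m ^ 2)).
  (* As long as [q r] exceeds [d], a round lowers it by at least [d ^+ (3 * m ^ 2)]. *)
  have alt r : (exists r', q r' <= d) \/ q r <= 1 / 2 - r%:R * d ^+ (3 * m ^ 2).
    elim: r => [|r [|le]]; [by right; rewrite mul0r subr0 | by left |].
    have [qd|qd] := leP (q r) d; first by left; exists r.
    have qE : q r.+1 = q r - q r ^+ (3 * m ^ 2) by [].
    right; rewrite qE -[r.+1%:R]natr1 mulrDl mul1r.
    have : d ^+ (3 * m ^ 2) <= q r ^+ (3 * m ^ 2) by apply: lerXn2r; rewrite ?nnegrE ?(ltW d0) ?(ltW qd) //; case/andP: (qb r).
    lra.
  case: (alt k) => // le; have /andP[q0 _] := qb k.
  by move: kd; rewrite ltr_pdivrMr //; lra.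
have [X pX] := ex r; exists X, (q r); split=> //.
by apply/card_gt0P; exists (0 : X).
Qed.

End Packing.

End TripartitePacking.

(** * Transferring the packing to graphs on [n] vertices *)

Module LineCovering.
Import Chains WordEmbedding DartWords RotationSystem TripartitePacking.
Local Open Scope ring_scope.

Section PairGraphs.
Variable n : nat.

Definition upair : finType := {e : 'I_n * 'I_n | (e.1 < e.2)%N}.
Definition pset (e : upair) : {set 'I_n} := [set (val e).1; (val e).2]%SET.

Lemma pset_card e : #|pset e| == 2.
Proof. by rewrite cards2; case: e => -[u v] /= uv; rewrite -(inj_eq val_inj) neq_ltn uv. Qed.

Lemma pset_inj : injective pset.
Proof.
move=> [[u v] /= uv] [[u' v'] /= uv'] e; apply: val_inj => /=.
have : u \in [set u'; v']%SET by rewrite -[[set u'; v']%SET]/(pset (exist _ (u', v') uv')) -e /pset /= !inE eqxx.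
have : v \in [set u'; v']%SET by rewrite -[[set u'; v']%SET]/(pset (exist _ (u', v') uv')) -e /pset /= !inE eqxx orbT.
rewrite !inE => /orP[/eqP vE|/eqP vE] /orP[/eqP uE|/eqP uE]; subst u v => //; exfalso; lia.
Qed.

Lemma psetP (s : {set 'I_n}) : #|s| == 2 -> exists e, s = pset e.
Proof.
move=> /cards2P[u [v [uv ->]]]; case: (ltngtP u v) => lt.
- by exists (exist _ (u, v) lt).
- by exists (exist _ (v, u) lt); rewrite /pset /= finset.setUC.
- by move/val_inj: lt => e; rewrite e eqxx in uv.
Qed.

Definition graph_edges (H : {ffun upair -> bool}) : {set {set 'I_n}} := [set pset e | e in [set e | H e]]%SET.

Lemma graph_edges_card H : [forall s in graph_edges H, #|s| == 2].
Proof. by apply/forall_inP => s /imsetP[e _ ->]; exact: pset_card. Qed.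

Definition graph (H : {ffun upair -> bool}) : sgraph n := exist _ (graph_edges H) (graph_edges_card H).

Definition graph_bits (G : sgraph n) : {ffun upair -> bool} := [ffun e => pset e \in edges G].

Lemma graphK : cancel graph graph_bits.
Proof.
move=> H; apply/ffunP => e; rewrite ffunE /edges /= /graph_edges.
by apply/imsetP/idP => [[e' + /pset_inj->]|He]; [rewrite inE | exists e; rewrite ?inE].
Qed.

Lemma graph_bitsK : cancel graph_bits graph.
Proof.
move=> G; apply: val_inj => /=; apply/setP => s; apply/imsetP/idP => [[e + ->]|sG].
  by rewrite inE ffunE.
have := valP G => /forall_inP /(_ s sG) /psetP[e sE].
by exists e => //; rewrite inE ffunE -sE.
Qed.

Lemma edges_graph_card H : #|edges (graph H)| = #|[set e | H e]|.
Proof. by rewrite /edges /= /graph_edges card_imset //; exact: pset_inj. Qed.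

End PairGraphs.

Section Covering.
Variables (R : realType) (n m'' : nat).
Notation m := m''.+2.
Notation bits X := ('I_3 * (X * X))%type.
Notation C := ('I_3 * ('I_m * 'I_m))%type.
Variables (X B : finType) (be : B -> 'I_3 -> 'I_m -> X).
Variable (cov : {ffun bits X -> bool} -> bits X -> option B).
Hypothesis be_inj : forall b i, injective (be b i).
Hypothesis cov_in : forall H e b, cov H e = Some b -> exists c, e = bedge (be b) c.
Hypothesis cov_all : forall H e b, cov H e = Some b ->
  forall c, H (bedge (be b) c) /\ cov H (bedge (be b) c) = Some b.
Notation c := #|X|.
Notation q := (n %/ c)%N.
Notation types := {ffun 'I_3 -> 'I_q}.

Lemma enc_lt (t : 'I_q) (x : X) : (t * c + enum_rank x < n)%N.
Proof.
have t1 := ltn_ord t; have x1 := ltn_ord (enum_rank x).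
apply: (@leq_trans (t.+1 * c)); first by rewrite mulSn addnC ltn_add2r.
by apply: leq_trans (leq_divM n c); rewrite leq_mul2r t1 orbT.
Qed.
Definition enc t x : 'I_n := Ordinal (enc_lt t x).

Lemma enc_inj t x t' x' : enc t x = enc t' x' -> t = t' /\ x = x'.
Proof.
move=> /(congr1 val) /= /(divmod_uniq (ltn_ord _) (ltn_ord _))[/val_inj-> /val_inj/enum_rank_inj->].
by [].
Qed.

Lemma enc_mono (t t' : 'I_q) x x' : (t < t')%N -> (enc t x < enc t' x')%N.
Proof.
move=> tt /=; have x1 := ltn_ord (enum_rank x).
apply: (@leq_trans (t.+1 * c)); first by rewrite mulSn addnC ltn_add2r.
by apply: leq_trans (leq_addr _ _); rewrite leq_mul2r tt orbT.
Qed.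

(** Up to a remainder the vertices are cut into [q] groups of size [#|X|]. Among triples of groups
    with sum divisible by [q], two groups determine the third, so different lines share no edge. The
    increasing order counts each triple once. *)
Definition isline (g : types) : bool :=
  [&& g 0%R < g 1%R, g 1%R < g (1 + 1)%R & q %| g 0%R + g 1%R + g (1 + 1)%R]%N.
Definition lineT : finType := {g : types | isline g}.

Lemma line_neq g i j : isline g -> g i = g j -> i = j.
Proof.
move=> /and3P[l1 l2 _]; case: (ord3_cases i) => ->; case: (ord3_cases j) => -> // e; exfalso;
move: (congr1 (@nat_of_ord _) e) l1 l2 => {e}; move: (nat_of_ord (g 0)) (nat_of_ord (g 1)) (nat_of_ord (g (1 + 1))) => a b d; lia.
Qed.

Lemma line_sum g i j k : isline g -> uniq [:: i; j; k] -> (q %| g i + g j + g k)%N.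
Proof.
move=> /and3P[_ _ d]; case: (ord3_cases i) => ->; case: (ord3_cases j) => ->; case: (ord3_cases k) => -> //= _;
move: d; move: (nat_of_ord (g 0)) (nat_of_ord (g 1)) (nat_of_ord (g (1 + 1))) => a b d;

match goal with |- is_true (_ %| ?x)%N -> is_true (_ %| ?y)%N => by rewrite (_ : y = x); last by clear; lia end.
Qed.

Lemma ord3_third (i j : 'I_3) : i != j -> exists k, uniq [:: i; j; k].
Proof.
by case: (ord3_cases i) => ->; case: (ord3_cases j) => -> // _; [exists (1 + 1) | exists 1 | exists (1 + 1) | exists 0 | exists 1 | exists 0].
Qed.

Lemma line_uniq g g' i j i' j' : isline g -> isline g' -> i != j -> g i = g' i' -> g j = g' j' ->
  [/\ g = g', i = i' & j = j'].
Proof.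
move=> lg lg' ij ei ej; have ij' : i' != j'.
  by apply: contra ij => /eqP e; apply/eqP/(line_neq lg); rewrite ei ej e.
have [k uk] := ord3_third ij; have [k' uk'] := ord3_third ij'.
have ek : g k = g' k'.
  have := line_sum lg uk; have := line_sum lg' uk'; rewrite -ei -ej => /eqP d' /eqP d.
  apply: val_inj; rewrite /= -(modn_small (ltn_ord (g k))) -(modn_small (ltn_ord (g' k'))).
  by apply/eqP; rewrite -(eqn_modDl (g i + g j)) d d'.
have [ii jj kk] : [/\ i = i', j = j' & k = k'].
  have /and3P[l1 l2 _] := lg; have /and3P[l1' l2' _] := lg'.
  have {}ei := congr1 val ei; have {}ej := congr1 val ej; have {}ek := congr1 val ek.
  move: uk uk' ei ej ek; rewrite /=.
  case: (ord3_cases i) => ->; case: (ord3_cases j) => ->; case: (ord3_cases k) => -> //= _;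
  case: (ord3_cases i') => ->; case: (ord3_cases j') => ->; case: (ord3_cases k') => -> //= _; first [by [] |
    move=> e1 e2 e3; exfalso; move: l1 l2 l1' l2'; rewrite ?e1 ?e2 ?e3; move: (nat_of_ord (g' 0)) (nat_of_ord (g' 1)) (nat_of_ord (g' (1 + 1))) => a b d; clear; lia].
subst i' j' k'; split=> //; apply/ffunP => l.
by move: uk; rewrite /= !inE negb_or; case: (ord3_cases i) ei => -> ei; case: (ord3_cases j) ej => -> ej; case: (ord3_cases k) ek => -> ek //=; case: (ord3_cases l) => ->.
Qed.

Definition evert (l : lineT) (j : bits X) : 'I_n * 'I_n :=
  (enc (val l j.1) j.2.1, enc (val l (j.1 + 1)) j.2.2).

Lemma le_ex (x : lineT * bits X) : exists e, pset e = [set (evert x.1 x.2).1; (evert x.1 x.2).2]%SET.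
Proof.
case: x => [[g lg] [i [x y]]] /=.
have gg : (g i < g (i + 1)%R)%N \/ (g (i + 1)%R < g i)%N.
  case: (ltngtP (g i) (g (i + 1))) => //; [by left | by right | move=> /val_inj/(line_neq lg)/esym/eqP].
  by rewrite ord3_succ.
by case: gg => gg; [exists (exist _ (_, _) (enc_mono x y gg)) | exists (exist _ (_, _) (enc_mono y x gg))]; rewrite /pset //= finset.setUC.
Qed.

Definition le (x : lineT * bits X) : upair n := projT1 (cid (le_ex x)).

Lemma leE x : pset (le x) = [set (evert x.1 x.2).1; (evert x.1 x.2).2]%SET.
Proof. exact: (projT2 (cid (le_ex x))). Qed.

Lemma le_inj : injective le.
Proof.
move=> x x' e; have := leE x; rewrite e leE.
case: x x' {e} => [[g lg] [i [x y]]] [[g' lg'] [i' [x' y']]] /=; rewrite /evert /=.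
set u := enc _ x; set v := enc _ y; set u' := enc _ x'; set v' := enc _ y' => e.
have uv : u != v by apply/eqP => /enc_inj[/(line_neq lg)/esym/eqP]; rewrite ord3_succ.
have ii : i != i + 1 by rewrite eq_sym ord3_succ.
have [uin vin] : u \in [set u'; v']%SET /\ v \in [set u'; v']%SET by rewrite e !inE !eqxx orbT.
move: uin vin; rewrite !inE => /orP[/eqP uE|/eqP uE] /orP[/eqP vE|/eqP vE].
- by rewrite uE vE eqxx in uv.
- have [eg ex] := enc_inj uE; have [eg' ex'] := enc_inj vE.
  have [gg i1 i2] := line_uniq lg lg' ii eg eg'; subst g' i' x' y'.
  by congr (_, _); exact: val_inj.
- have [eg ex] := enc_inj uE; have [eg' ex'] := enc_inj vE.
  have [gg i1 i2] := line_uniq lg lg' ii eg eg'.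
  by move: i2; rewrite i1; case: (ord3_cases i') => ->.
- by rewrite uE vE eqxx in uv.
Qed.

Definition gpick (e : upair n) : option (lineT * bits X) := [pick x | le x == e].

Lemma gpick_le x : gpick (le x) = Some x.
Proof. by rewrite /gpick; case: pickP => [y /eqP/le_inj->//|/(_ x)]; rewrite eqxx. Qed.

Lemma gpickP e x : gpick e = Some x -> le x = e.
Proof. by rewrite /gpick; case: pickP => // y /eqP <- [->]. Qed.

Definition lpull (l : lineT) (H : {ffun upair n -> bool}) : {ffun bits X -> bool} :=
  pull (fun j => le (l, j)) H.

Definition gcov (H : {ffun upair n -> bool}) (e : upair n) : option (lineT * B) :=
  if gpick e is Some x then
    (if cov (lpull x.1 H) x.2 is Some b then Some (x.1, b) else None) else None.

Definition nuncov (H : {ffun upair n -> bool}) := #|[set e | H e && (gcov H e == None)]%SET|.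

Lemma gcovP H e l b : gcov H e = Some (l, b) -> exists c, e = le (l, bedge (be b) c).
Proof.
rewrite /gcov; case gE: (gpick e) => [[l' j]|] //=; case cE: (cov _ _) => [b'|] // [<- <-].
by have [c' jE] := cov_in cE; exists c'; rewrite -jE (gpickP gE).
Qed.

Lemma gcov_all H e l b : gcov H e = Some (l, b) ->
  forall c, H (le (l, bedge (be b) c)) /\ gcov H (le (l, bedge (be b) c)) = Some (l, b).
Proof.
rewrite {1}/gcov; case gE: (gpick e) => [[l' j]|] //=; case cE: (cov _ _) => [b'|] // [<- <-] c.
have [h1 h2] := cov_all cE c; split; first by move: h1; rewrite ffunE.
by rewrite /gcov gpick_le /= h2.
Qed.

(** A block adds at most [m ^ 2 + 3 * m] to the rank for its [3 * m ^ 2] edges, an uncovered edge at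
    most one, and half the rank bounds the number of handles. The hypothesis is the resulting
    inequality multiplied by [3 * m]. *)
Theorem cover_embeds (H : {ffun upair n -> bool}) (h : nat) : (4 <= h)%N ->
  (3 * m * nuncov H + (m + 3) * #|[set e | H e]%SET| <= 6 * m * h)%N ->
  embeds_in R (@sphere_with_handles R h) (graph H).
Proof.
move=> h4 hh.
pose E : finType := {e : upair n | H e}.
pose vt (d : E * bool) : 'I_n := if d.2 then (val (val d.1)).2 else (val (val d.1)).1.
(* Restricted to blocks in use, so that all their edges are present in [H]. *)
pose L : finType := {lb : lineT * B | [exists e, gcov H e == Some lb]}.
have E_card : #|E| = #|[set e | H e]%SET| by rewrite card_sig cardsE.
have dt_ex (x : L * C) : exists d : E * bool,
    [/\ val d.1 = le ((val x.1).1, bedge (be (val x.1).2) x.2),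
        vt d = enc (val (val x.1).1 x.2.1) (be (val x.1).2 x.2.1 x.2.2.1) &
        vt (opp d) = enc (val (val x.1).1 (x.2.1 + 1)) (be (val x.1).2 (x.2.1 + 1) x.2.2.2)].
  case: x => [[[l b] /= ex] cc]; have /existsP[e /eqP ge] := ex.
  have [He _] := gcov_all ge cc; set ee := le _ in He *.
  have := leE (l, bedge (be b) cc); rewrite -/ee /evert /=; set u := enc _ _; set v := enc _ _ => eE.
  have uv : u != v.
    apply/eqP => /enc_inj[/(line_neq (valP l))/esym/eqP]; by rewrite ord3_succ.
  have : (val ee).1 \in [set u; v]%SET by rewrite -eE /pset !inE eqxx.
  have : (val ee).2 \in [set u; v]%SET by rewrite -eE /pset !inE eqxx orbT.
  have en : (val ee).1 != (val ee).2 by rewrite -(inj_eq val_inj) neq_ltn (valP ee).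
  rewrite !inE => /orP[/eqP e2|/eqP e2] /orP[/eqP e1|/eqP e1]; rewrite ?e1 ?e2 ?eqxx // in en.
  - by exists (exist _ ee He, true); rewrite /vt /opp /= e1 e2.
  - by exists (exist _ ee He, false); rewrite /vt /opp /= e1 e2.
have [dt dtP] := fin_all_exists dt_ex.
have dt_inj i j : (dt i).1 = (dt j).1 -> i = j.
  move=> e; have [i1 _ _] := dtP i; have [j1 _ _] := dtP j.
  have /le_inj : le ((val i.1).1, bedge (be (val i.1).2) i.2) = le ((val j.1).1, bedge (be (val j.1).2) j.2) by rewrite -i1 -j1 e.
  case: i j {e i1 j1} => [[[l b] ex] [i [u v]]] [[[l' b'] ex'] [i' [u' v']]] /= [ll ii uu vv].
  subst l' i'.
  have bb : b = b'.
    have /existsP[e /eqP ge] := ex; have /existsP[e' /eqP ge'] := ex'.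
    have [_ g1] := gcov_all ge (i, (u, v)); have [_ g2] := gcov_all ge' (i, (u', v')).
    have ee : le (l, bedge (be b) (i, (u, v))) = le (l, bedge (be b') (i, (u', v'))).
      by rewrite /bedge /= uu vv.
    by move: g1; rewrite ee g2 => -[].
  subst b'; move/be_inj: uu => ->; move/be_inj: vv => ->.
  by congr (_, _); exact: val_inj.
pose emb (l : L) i u := enc (val (val l).1 i) (be (val l).2 i u).
have emb_inj l p u p' u' : emb l p u = emb l p' u' -> p = p' /\ u = u'.
  by move=> /enc_inj[/(line_neq (valP (val l).1)) pp]; subst p' => /be_inj->.
have [w0 [uw fw pw kw]] := @rotation_kernel E L n m'' vt emb dt emb_inj
  (fun l p u x => let: And3 _ h _ := dtP (l, (p, (u, x))) in h)
  (fun l p u x => let: And3 _ _ h := dtP (l, (p, (u, x))) in h) dt_inj.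
have [k [w [ks rk nc]]] := reduce_crossings uw fw kw.
have L_card : (#|L| * (3 * m ^ 2) <= #|E|)%N.
  have := leq_card (fun x => (dt x).1) (fun i j => dt_inj i j).
  by rewrite !card_prod !card_ord.
have unc : (#|uncovered dt| <= nuncov H)%N.
  rewrite /nuncov -(card_imset _ val_inj); apply: subset_leq_card; apply/fintype.subsetP => _ /imsetP[e eu ->].
  rewrite inE (valP e) /=; apply/eqP; case ge: (gcov H (val e)) => [[l b]|] //.
  have [cc eE] := gcovP ge.
  have ex : [exists e, gcov H e == Some (l, b)] by apply/existsP; exists (val e); rewrite ge.
  have [d1 _ _] := dtP (exist _ (l, b) ex, cc).
  have de : (dt (exist _ (l, b) ex, cc)).1 = e by apply: val_inj; rewrite d1 -eE.
  by move: eu; rewrite inE -de (locate_dt dt_inj).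
have kh : (k <= h)%N.
  have : (3 * m * (2 * k) <= 3 * m * (2 * h))%N.
    apply: leq_trans (leq_mul (leqnn (3 * m)) ks) _.
    rewrite mulnDr (_ : 3 * m * (#|L| * (m ^ 2 + 3 * m)) = (m + 3) * (#|L| * (3 * m ^ 2)))%N; last by ring.
    apply: leq_trans (leq_add (leq_mul (leqnn _) L_card) (leq_mul (leqnn _) unc)) _.
    by rewrite E_card addnC; apply: leq_trans hh _; lia.
  by rewrite leq_pmul2l // leq_pmul2l.
have {}rk : reach h w0 w by rewrite -(subnKC kh); exact: reach_pad.
apply: (@word_embeds R E n h vt h4 (graph H) w0 w uw fw pw rk nc).
- rewrite /edges /= /graph_edges; apply/setP => s; apply/imsetP/imsetP => [[e]|[e _ ->]].
    by rewrite inE => He ->; exists (exist _ e He).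
  by exists (val e); rewrite ?inE ?(valP e).
- by move=> e e' /pset_inj/val_inj.
- by move=> e; rewrite /vt /= -(inj_eq val_inj) neq_ltn (valP (val e)).
Qed.

End Covering.

End LineCovering.

(** * Random graphs embed with high probability *)

Module RandomEmbedding.
Import Chains WordEmbedding DartWords RotationSystem TripartitePacking LineCovering.
Local Open Scope ring_scope.

Lemma upair_card n : #|upair n| = 'C(n, 2).
Proof.
rewrite -[in RHS](card_ord n) -card_draws -cardsT -(card_imset _ (@pset_inj n)).
apply: eq_card => s; rewrite inE; apply/imsetP/idP => [[e _ ->]|/psetP[e ->]]; last by exists e.
exact: pset_card.
Qed.

Lemma upair_card2 n : (2 * #|upair n| + n = n ^ 2)%N.
Proof.
rewrite upair_card bin2 mul2n halfK.
have -> : odd (n * n.-1) = false by case: n => // n; rewrite oddM /= andNb.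
by case: n => // n /=; rewrite subn0 -[in X in (_ + X)%N](muln1 n.+1) -mulnDr addn1.
Qed.

Lemma sum_indicator (T : finType) (P : pred T) : (\sum_e P e = #|[set e | P e]%SET|)%N.
Proof. by rewrite -sum1_card [RHS]big_mkcond; apply: eq_bigr => e _; rewrite inE; case: (P e). Qed.

Section Uncovered.
Variables (n : nat) (X : finType).
Hypothesis X_gt0 : (0 < #|X|)%N.
Notation c := #|X|.
Notation q := (n %/ c)%N.
Notation bits X := ('I_3 * (X * X))%type.

Lemma enc_ex (v : 'I_n) (lt : (v %/ c < q)%N) : exists x, v = enc (Ordinal lt) x :> 'I_n.
Proof.
exists (enum_val (Ordinal (ltn_pmod v X_gt0))); apply: val_inj.
by rewrite /= enum_valK /= -divn_eq.
Qed.

Definition triple (a b d : 'I_q) : {ffun 'I_3 -> 'I_q} :=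
  [ffun i : 'I_3 => if i == 0 then a else if i == 1 then b else d].

Lemma line_hit (e : upair n) (t t' t'' : 'I_q) x y :
  (val e).1 = enc t x -> (val e).2 = enc t' y -> (t < t')%N -> t'' != t -> t'' != t' ->
  (q %| t + t' + t'')%N -> exists z : lineT n X * bits X, le z = e.
Proof.
move=> e1 e2 tt n1 n2 dv.
have fin (g : {ffun 'I_3 -> 'I_q}) (lg : isline g) i a b :
    [set enc (g i) a; enc (g (i + 1)) b]%SET = [set enc t x; enc t' y]%SET -> exists z : lineT n X * bits X, le z = e.
  move=> eE; exists (exist _ g lg, (i, (a, b))); apply: pset_inj.
  by rewrite leE /pset e1 e2 -eE.
have [lt|lt|/val_inj lt] := ltngtP (t'' : nat) t; last by rewrite lt eqxx in n1.
  have lg : isline (triple t'' t t') by rewrite /isline !ffunE /= lt tt; move: dv; rewrite [in X in X -> _]addnC addnA.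
  by apply: (fin _ lg 1 x y); rewrite !ffunE.
have [lt'|lt'|/val_inj lt'] := ltngtP (t'' : nat) t'; last by rewrite lt' eqxx in n2.
  have lg : isline (triple t t'' t') by rewrite /isline !ffunE /= lt lt'; move: dv; rewrite [in X in X -> _]addnAC.
  by apply: (fin _ lg (1 + 1) y x); rewrite !ffunE /= finset.setUC.
have lg : isline (triple t t' t'') by rewrite /isline !ffunE /= tt lt'.
by apply: (fin _ lg 0 x y); rewrite !ffunE.
Qed.

(** The second groups that may lie on no line with [t]: [q] stands for the remainder, [t] for an
    edge inside a group, and the other four make the third group, [q - t - t'] or [2 * q - t - t'],
    coincide with [t] or with [t']. *)
Definition cands (t : nat) : seq nat :=
  [:: q; t; q - t.*2; q.*2 - t.*2; (q - t)./2; (q.*2 - t)./2]%N.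

Lemma gpick_none (e : upair n) : gpick X e = None -> ((val e).2 %/ c)%N \in cands ((val e).1 %/ c)%N.
Proof.
move=> ge; apply: contraT => nin.
have [z ze] : exists z : lineT n X * bits X, le z = e; last first.
  by move: ge; rewrite -ze gpick_le.
move: nin; rewrite !inE !negb_or => /and5P[n1 n2 n3 n4 /andP[n5 n6]].
have tq : ((val e).2 %/ c < q)%N.
  by rewrite ltn_neqAle n1 /= leq_div2r // ltnW.
have tt : ((val e).1 %/ c < (val e).2 %/ c)%N.
  by rewrite ltn_neqAle eq_sym n2 /= leq_div2r // ltnW // (valP e).
have tq1 : ((val e).1 %/ c < q)%N by exact: ltn_trans tq.
have [x xE] := enc_ex tq1; have [y yE] := enc_ex tq.
have q0 : (0 < q)%N by apply: leq_ltn_trans (tq).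
have [s [sq sd]] : exists s, (s < q)%N /\ ((val e).1 %/ c + (val e).2 %/ c + s = q \/ (val e).1 %/ c + (val e).2 %/ c + s = q.*2)%N.
  move: (tt) (tq); move: ((val e).1 %/ c)%N ((val e).2 %/ c)%N q; clear => t t' Q l l'.
  have [l2|l2] := ltnP Q (t + t'); first by exists (Q.*2 - (t + t'))%N; lia.
  by exists (Q - (t + t'))%N; lia.
apply: (@line_hit e (Ordinal tq1) (Ordinal tq) (Ordinal sq) x y) => //=.
- by rewrite -(inj_eq val_inj) /=; apply/eqP => sE; move: sd n3 n4; rewrite sE; move: ((val e).1 %/ c)%N ((val e).2 %/ c)%N q; clear => t t' Q; lia.
- by rewrite -(inj_eq val_inj) /=; apply/eqP => sE; move: sd n5 n6; rewrite sE; move: ((val e).1 %/ c)%N ((val e).2 %/ c)%N q; clear => t t' Q; lia.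
- by case: sd => ->; rewrite ?dvdnn // -mul2n dvdn_mull.
Qed.

(** An edge on no line is determined by its first end, the place of the second group among six
    candidates, and the residue of the second end. *)
Lemma gpick_none_card : (#|[set e : upair n | gpick X e == None]%SET| <= n * 6 * c)%N.
Proof.
pose f (e : upair n) : 'I_n * 'I_6 * 'I_c :=
  ((val e).1, inord (index ((val e).2 %/ c)%N (cands ((val e).1 %/ c))), Ordinal (ltn_pmod (val e).2 X_gt0)).
rewrite -(card_in_imset (f := f)).
  by apply: leq_trans (max_card _) _; rewrite !card_prod !card_ord.
move=> e e'; rewrite !inE => /eqP/gpick_none ge /eqP/gpick_none ge' fe.
have e1 : (val e).1 = (val e').1 := congr1 (fun z => z.1.1) fe.
have e2 : inord (index ((val e).2 %/ c)%N (cands ((val e).1 %/ c))) =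
  inord (index ((val e').2 %/ c)%N (cands ((val e').1 %/ c))) :> 'I_6 := congr1 (fun z => z.1.2) fe.
have e3 : ((val e).2 %% c = (val e').2 %% c)%N := congr1 (fun z => val z.2) fe.
apply: val_inj; rewrite [val e]surjective_pairing [val e']surjective_pairing e1; congr (_, _).
apply: val_inj; rewrite /= (divn_eq (val e).2 c) (divn_eq (val e').2 c) e3; congr (_ * _ + _)%N.
have i1 : (index ((val e).2 %/ c) (cands ((val e).1 %/ c)) < 6)%N.
  by rewrite -[6%N]/(size (cands ((val e).1 %/ c))) index_mem.
have i2 : (index ((val e').2 %/ c) (cands ((val e').1 %/ c)) < 6)%N.
  by rewrite -[6%N]/(size (cands ((val e').1 %/ c))) index_mem.
have := congr1 (@nat_of_ord _) e2; rewrite (inordK i1) (inordK i2) => ie.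
by rewrite -(nth_index 0%N ge) -(nth_index 0%N ge') ie e1.
Qed.

Variables (R : realFieldType) (B : finType) (d : R).
Variable (cov : {ffun bits X -> bool} -> bits X -> option B).
Hypothesis d_ge0 : 0 <= d.
Hypothesis cov_ex : forall e, Ex (fun H => (H e && (cov H e == None))%:R) <= d.

(** Linearity of expectation: an edge on a line behaves as in the packing, and the few others are
    counted in full. *)
Lemma nuncov_ex : Ex (fun H : {ffun upair n -> bool} => (nuncov cov H)%:R) <= n%:R ^+ 2 * d + (6 * c * n)%:R.
Proof.
have -> : Ex (fun H : {ffun upair n -> bool} => (nuncov cov H)%:R) =
    \sum_e Ex (fun H : {ffun upair n -> bool} => (H e && (gcov cov H e == None))%:R : R).
  rewrite -Ex_sum; apply: Ex_ext => H; rewrite /nuncov -sum1_card natr_sum big_mkcond /=.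
  by apply: eq_bigr => e _; rewrite inE; case: (_ && _).
have one e : Ex (fun H : {ffun upair n -> bool} => (H e && (gcov cov H e == None))%:R) <= d + (gpick X e == None)%:R.
  case gE: (gpick X e) => [[l j]|].
    rewrite addr0; apply: le_trans (cov_ex j).
    rewrite -(@Ex_pull R _ _ (fun j => le (l, j)) _); last by move=> i i' /le_inj[].
    apply: Ex_le => H; rewrite ffunE (gpickP gE) /gcov gE /= /lpull.
    by case: (cov _ _).
  apply: (@le_trans _ _ 1); last by rewrite eqxx lerDr.
  by rewrite -[leRHS](@Ex_cst R (upair n)); apply: Ex_le => H; rewrite lern1 leq_b1.
apply: le_trans (ler_sum _ (fun e _ => one e)) _.
rewrite big_split /= sumr_const; apply: lerD.
  rewrite -[d *+ _]mulr_natl ler_wpM2r // -natrX ler_nat.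
  by rewrite -(upair_card2 n) mul2n -addnn -addnA leq_addr.
rewrite -natr_sum ler_nat; apply: leq_trans (_ : n * 6 * c <= _)%N; last by rewrite -mulnA mulnC.
by rewrite sum_indicator; exact: gpick_none_card.
Qed.

End Uncovered.

Section Chebyshev.
Variables (R : realFieldType) (A : finType).

Definition flip (e : A) (H : {ffun A -> bool}) : {ffun A -> bool} := [ffun a => (a == e) (+) H a].

Lemma flipK e : involutive (flip e).
Proof. by move=> H; apply/ffunP => a; rewrite !ffunE addKb. Qed.

Lemma Ex_flip e (F : {ffun A -> bool} -> R) : Ex (fun H => F (flip e H)) = Ex F.
Proof. by rewrite /Ex [in RHS](reindex_inj (inv_inj (flipK e))). Qed.

Lemma Ex_scale (a : R) (F : {ffun A -> bool} -> R) : Ex (fun H => a * F H) = a * Ex F.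
Proof. by rewrite /Ex -mulr_sumr mulrA. Qed.

Definition sgnb (b : bool) : R := if b then 1 else -1.

Lemma Ex_sign e f : Ex (fun H : {ffun A -> bool} => sgnb (H e) * sgnb (H f)) = (e == f)%:R.
Proof.
have [<-|ef] := eqVneq e f.
  by rewrite -[RHS](@Ex_cst R A); apply: Ex_ext => H; rewrite /sgnb; case: (H e) => /=; lra.
have fl : Ex (fun H : {ffun A -> bool} => sgnb (H e) * sgnb (H f)) = - Ex (fun H : {ffun A -> bool} => sgnb (H e) * sgnb (H f)).
  rewrite -mulN1r -Ex_scale -[LHS](Ex_flip e); apply: Ex_ext => H.
  by rewrite !ffunE eqxx eq_sym (negbTE ef) /sgnb; case: (H e); case: (H f) => /=; lra.
by rewrite /=; lra.
Qed.

(** The variance of the edge count, written with signs; flipping one bit shows that the mixed terms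
    vanish. *)
Lemma Ex_sign_sum : Ex (fun H : {ffun A -> bool} => (\sum_e sgnb (H e)) ^+ 2) = #|A|%:R.
Proof.
transitivity (\sum_e \sum_f Ex (fun H : {ffun A -> bool} => sgnb (H e) * sgnb (H f))).
  rewrite (eq_bigr (fun e => Ex (fun H : {ffun A -> bool} => \sum_f sgnb (H e) * sgnb (H f)))); last by move=> e _; rewrite Ex_sum.
  rewrite -Ex_sum; apply: Ex_ext => H; rewrite expr2 mulr_suml; apply: eq_bigr => e _.
  by rewrite mulr_sumr.
under eq_bigr do under eq_bigr do rewrite Ex_sign.
rewrite (eq_bigr (fun=> 1)); first by rewrite sumr_const.
by move=> e _; rewrite (bigD1 e) //= eqxx big1 ?addr0 // => f; rewrite eq_sym => /negbTE->.
Qed.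

Lemma sign_sum (H : {ffun A -> bool}) : \sum_e sgnb (H e) = 2 * #|[set e | H e]|%:R - #|A|%:R.
Proof.
rewrite -[X in _ - X](sumr_const) -sum1_card natr_sum mulr_sumr [in X in X - _]big_mkcond /= -sumrB.
by apply: eq_bigr => e _; rewrite inE /sgnb; case: (H e); lra.
Qed.

Lemma Ex_markov (F : {ffun A -> bool} -> R) (a : R) : 0 < a -> (forall H, 0 <= F H) ->
  Ex (fun H => (a < F H)%R%:R) <= Ex F / a.
Proof.
move=> a0 F0; rewrite ler_pdivlMr // mulrC -Ex_scale; apply: Ex_le => H.
by case: ltP => aF; rewrite ?mulr1 ?mulr0 //; exact: ltW.
Qed.

End Chebyshev.

Section WhpEmbedding.
Variable R : realType.

Lemma nat_above (x : R) : exists k : nat, x < k%:R.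
Proof.
exists (Num.truncn `|x|).+1; apply: le_lt_trans (ler_norm x) _.
by have /andP[] := truncn_itv (normr_ge0 x).
Qed.

(** Here [M] is the block size, [K] the number of pairs, [N] is [n ^ 2]. With
    [E <= (1 / 4 + d / 2) * N] the left side is at most [(1 / 4 + 17 * d / 4) * M * N], and
    [d <= eps / 20] keeps this below [(1 + eps) * M * N / 4]. *)
Lemma handle_budget (d eps M K N U E h : R) : 0 < d -> d <= 1 -> d <= eps / 20 -> 0 < M -> 3 <= d * M ->
  0 <= E -> 2 * K <= N -> U <= d * N -> 2 * E - K <= d * N -> (1 + eps) * (N / 24) <= h -> 0 <= N ->
  3 * M * U + (M + 3) * E <= 6 * M * h.
Proof.
move=> d0 d1 de M0 dM E0 KN UN EN hN N0.
have a1 : M * U <= M * (d * N) by rewrite ler_pM2l.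
have a2 : M * ((1 + eps) * (N / 24)) <= M * h by rewrite ler_pM2l.
have a3 : (M + 3) * E <= (M + d * M) * ((1 / 4 + d / 2) * N).
  by apply: ler_pM => //; lra.
have a4 : d * d * (M * N) <= d * (M * N) by rewrite ler_wpM2r ?ler_piMr // ?mulr_ge0 // ltW.
have a5 : d * (M * N) <= eps / 20 * (M * N) by rewrite ler_wpM2r // mulr_ge0 // ltW.
nra.
Qed.

(** Markov's bound for the uncovered edges: the packing accounts for [eta / 3], the edges on no line
    for another third once [n] is large. The last third is left to Chebyshev's bound on the number
    of edges. *)
Lemma whp_budget (d eta c n : R) : 0 < d -> 0 < eta -> 0 < n -> 18 * c / (d * eta) <= n ->
  (n ^+ 2 * (d * eta / 3) + 6 * c * n) / (d * n ^+ 2) <= 2 * eta / 3.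
Proof.
move=> d0 e0 n0; rewrite ler_pdivrMr ?mulr_gt0 // => le.
rewrite ler_pdivrMr ?mulr_gt0 ?exprn_gt0 //.
have : n * (18 * c) <= n * (n * (d * eta)) by rewrite ler_pM2l.
by rewrite expr2; lra.
Qed.

Lemma whp_budget2 (d eta K n : R) : 0 < d -> 0 < eta -> 1 <= n -> K <= n ^+ 2 -> 3 / (d ^+ 2 * eta) <= n ->
  K / (d * n ^+ 2) ^+ 2 <= eta / 3.
Proof.
move=> d0 e0 n1 Kn; rewrite ler_pdivrMr ?mulr_gt0 ?exprn_gt0 // => le.
have n0 : 0 < n by exact: lt_le_trans n1.
rewrite ler_pdivrMr ?exprn_gt0 ?mulr_gt0 ?exprn_gt0 //; apply: le_trans Kn _.
rewrite (_ : eta / 3 * (d * n ^+ 2) ^+ 2 = (n ^+ 2 * (d ^+ 2 * eta)) / 3 * n ^+ 2); last by ring.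
rewrite ler_peMl ?exprn_ge0 ?(ltW n0) //.
have : n * (d ^+ 2 * eta) <= n ^+ 2 * (d ^+ 2 * eta).
  by rewrite ler_pM2r ?mulr_gt0 ?exprn_gt0 // expr2 ler_peMl // ltW.
lra.
Qed.

(** The order of choices matters: [d] depends on [eps], the block size on [d], the packing and [X]
    on [d * eta], and [n] comes last. *)
Lemma whp_embeds (eps eta : R) : 0 < eps -> 0 < eta ->
  exists n0 : nat, forall n h : nat, (n0 <= n)%N -> (1 + eps) * (n%:R ^+ 2 / 24) <= h%:R ->
  Ex (fun H : {ffun upair n -> bool} =>
    (~~ `[< embeds_in R (@sphere_with_handles R h) (graph H) >])%:R) <= eta.
Proof.
move=> eps0 eta0.
have [d [d0 d1 de]] : exists d : R, [/\ 0 < d, d <= 1 & d <= eps / 20].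
  exists (Num.min 1 (eps / 20)); rewrite lt_min ltr01 divr_gt0 // ge_min lexx; split=> //.
  by rewrite ge_min lexx orbT.
have [m'' md] := nat_above (3 / d).
have m_big : 3 <= d * m''.+2%:R.
  have : 3 / d < m''.+2%:R by apply: lt_le_trans md _; rewrite ler_nat ltnW // ltnW.
  by rewrite ltr_pdivrMr // mulrC => /ltW.
have p0 : 0 < d * eta / 3 by rewrite divr_gt0 // mulr_gt0.
have [X [p [X0 [B [be [cov [be_inj cov_in cov_all cov_ex]]]] pd]]] := @packing_small R m''.+1 nat_above _ p0.
have [n1 hn1] := nat_above (18 * #|X|%:R / (d * eta)).
have [n2 hn2] := nat_above (3 / (d ^+ 2 * eta)).
exists (n1 + n2 + 10)%N => n h nn hh.
have n10 : 10 <= n%:R :> R by rewrite ler_nat; apply: leq_trans nn; rewrite leq_addl.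
have hn1' : 18 * #|X|%:R / (d * eta) <= n%:R.
  by apply/ltW/(lt_le_trans hn1); rewrite ler_nat; apply: leq_trans nn; rewrite -addnA leq_addr.
have hn2' : 3 / (d ^+ 2 * eta) <= n%:R.
  by apply/ltW/(lt_le_trans hn2); rewrite ler_nat; apply: leq_trans nn; rewrite addnAC leq_addl.
have n0 : 0 < n%:R :> R by apply: lt_le_trans n10.
have n20 : 0 < n%:R ^+ 2 :> R by exact: exprn_gt0.
have dn0 : 0 < d * n%:R ^+ 2 by exact: mulr_gt0.
(* Since [n >= 10], the bound on [h] exceeds [100 / 24 > 4]. *)
have h4 : (4 <= h)%N.
  rewrite -(ler_nat R); apply: le_trans hh; have : 10 ^+ 2 <= n%:R ^+ 2 :> R by apply: lerXn2r; rewrite ?nnegrE.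
  rewrite -natrX; move: (n%:R ^+ 2) eps0 => N; clear => ? ?; nra.
have K2 : 2 * #|upair n|%:R <= n%:R ^+ 2 :> R.
  by rewrite -natrX -(upair_card2 n) natrD natrM lerDl.
pose S (H : {ffun upair n -> bool}) : R := \sum_e sgnb R (H e).
pose b1 (H : {ffun upair n -> bool}) : bool := d * n%:R ^+ 2 < (nuncov cov H)%:R.
pose b2 H : bool := (d * n%:R ^+ 2) ^+ 2 < (S H) ^+ 2.
have key H : ~~ `[< embeds_in R (@sphere_with_handles R h) (graph H) >] -> b1 H || b2 H.
  apply: contraNT; rewrite negb_or -!leNgt => /andP[b1H b2H]; apply/asboolP.
  apply: (@cover_embeds R n m'' X B be cov be_inj cov_in cov_all H h h4).
  have SH : S H <= d * n%:R ^+ 2.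
    apply: le_trans (ler_norm _) _.
    by rewrite -(@ler_pXn2r _ 2) ?nnegrE ?normr_ge0 ?(ltW dn0) // real_normK // num_real.
  rewrite -(ler_nat R) natrD !natrM natrD; move: SH; rewrite /S sign_sum => SH.
  by apply: (handle_budget d0 d1 de _ m_big _ K2 b1H SH hh); rewrite // ltW.
have E1 : Ex (fun H => (b1 H)%:R) <= 2 * eta / 3.
  apply: le_trans (Ex_markov dn0 _) _ => //.
  apply: le_trans (whp_budget d0 eta0 n0 hn1').
  rewrite ler_pM2r ?invr_gt0 //.
  have := @nuncov_ex n X X0 R B (d * eta / 3) cov (ltW p0) (fun e => _).
  by rewrite !natrM; apply => e; rewrite cov_ex.
have E2 : Ex (fun H => (b2 H)%:R) <= eta / 3.
  apply: le_trans (Ex_markov _ _) _; [exact: exprn_gt0 | by move=> H; exact: sqr_ge0 |].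
  rewrite Ex_sign_sum; apply: whp_budget2 => //; first by apply: le_trans n10; rewrite ler1n.
  by apply: le_trans K2; rewrite ler_peMl // ler1n.
apply: (@le_trans _ _ (Ex (fun H => (b1 H)%:R + (b2 H)%:R))).
  apply: Ex_le => H; case: (boolP (~~ _)) => [/key/orP[->|->]|_]; rewrite ?lerDl ?lerDr ?addr_ge0 //.
have -> : Ex (fun H => (b1 H)%:R + (b2 H)%:R) = Ex (fun H => (b1 H)%:R) + Ex (fun H => (b2 H)%:R) :> R.
  by rewrite /Ex big_split /= mulrDl.
by move: E1 E2; move: (Ex _) (Ex _); clear => x y; lra.
Qed.

End WhpEmbedding.

End RandomEmbedding.

(** * Conditioning on the genus, and the two halves of the theorem *)

Import Chains EdgeBound WordEmbedding DartWords RotationSystem TripartitePacking LineCovering RandomEmbedding.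
Local Open Scope classical_set_scope.
Local Open Scope ring_scope.

(** The genus is the least number of handles that admits a drawing, so it exists and is at most [h]
    as soon as one drawing does; no drawing has to be moved to a larger surface. *)
Lemma genus_at_mostP (R : realType) n (G : sgraph n) m :
  genus_at_most R G m <-> exists2 h, (h <= m)%N & embeds_in R (@sphere_with_handles R h) G.
Proof.
split=> [[k [kG _] km]|[h hm hG]]; first by exists k.
have ex : exists h, `[< embeds_in R (@sphere_with_handles R h) G >] by exists h; apply/asboolP.
case: (ex_minnP ex) => k /asboolP kG kmin; exists k; last by apply: leq_trans hm; apply: kmin; exact/asboolP.
by split=> // h' h'G; apply: kmin; exact/asboolP.
Qed.

Section Models.
Variable R : realType.

Lemma prob_uniform (C : forall n, {set sgraph n}) n (P : {set sgraph n}) :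
  prob (uniform_on R C n) P = #|P :&: C n|%SET%:R / #|C n|%:R.
Proof.
rewrite /prob; under eq_bigr do rewrite ffunE.
have -> : (#|P :&: C n|%SET = \sum_(G in P) (G \in C n))%N.
  rewrite -sum1_card big_mkcond [RHS]big_mkcond /=.
  by apply: eq_bigr => G _; rewrite inE; case: (G \in P); case: (G \in C n).
by rewrite -mulr_suml -natr_sum.
Qed.

Lemma prob_Grand n (P : {set sgraph n}) : prob (Grand R n) P = #|P|%:R / #|sgraph n|%:R.
Proof. by rewrite prob_uniform finset.setIT finset.cardsT. Qed.

Lemma sgraph_card n : #|sgraph n| = (2 ^ #|upair n|)%N.
Proof.
by rewrite -(bij_eq_card (Bijective (@graphK n) (@graph_bitsK n))) card_ffun card_bool.
Qed.

Lemma sgraph_gt0 n : 0 < #|sgraph n|%:R :> R.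
Proof. by rewrite sgraph_card ltr0n expn_gt0. Qed.

Lemma prob_Ex n (P : {set sgraph n}) :
  prob (Grand R n) P = Ex (fun H : {ffun upair n -> bool} => (graph H \in P)%:R).
Proof.
rewrite prob_Grand sgraph_card /Ex natrX; congr (_ / _).
rewrite -sum1_card natr_sum big_mkcond /= (reindex (@graph n)) /=; last first.
  by apply: onW_bij; exact: Bijective (@graphK n) (@graph_bitsK n).
by apply: eq_bigr => H _; case: (_ \in P).
Qed.

Lemma prob_Grand_le1 n (P : {set sgraph n}) : prob (Grand R n) P <= 1.
Proof. by rewrite prob_Grand ler_pdivrMr ?sgraph_gt0 // mul1r ler_nat max_card. Qed.

(** Conditioning on [C n] moves a probability by at most that of the complement. If [C n] is empty
    the bound is [1], and the quotient by zero counts as [0]. *)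
Lemma prob_close (C : forall n, {set sgraph n}) n (P : {set sgraph n}) :
  `|prob (Grand R n) P - prob (uniform_on R C n) P| <= 1 - prob (Grand R n) (C n).
Proof.
rewrite !prob_Grand prob_uniform; set N : R := #|sgraph n|%:R.
have N0 : 0 < N := sgraph_gt0 n.
set b : R := #|P :&: C n|%SET%:R; set a : R := #|C n|%:R.
have ba : b <= a by rewrite ler_nat subset_leq_card // finset.subsetIr.
have b0 : 0 <= b by [].
have bp : b <= #|P|%:R by rewrite ler_nat subset_leq_card // finset.subsetIl.
have pN : #|P|%:R - b <= N - a.
  have : #|P :|: C n|%SET%:R + b = #|P|%:R + a by rewrite -!natrD cardsUI.
  have : #|P :|: C n|%SET%:R <= N by rewrite ler_nat max_card.
  by move: (#|_|%:R) (#|_|%:R) => x y; lra.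
set s := b / a.
have bs : b = s * a.
  have [a0|a0] := eqVneq a 0; last by rewrite /s divfK.
  by apply/eqP; rewrite a0 mulr0 eq_le b0 andbT -a0.
have a0 : 0 <= a by [].
have [s0 s1] : 0 <= s /\ s <= 1.
  split; first by rewrite divr_ge0.
  have [a00|a00] := eqVneq a 0; first by rewrite /s a00 invr0 mulr0.
  by rewrite ler_pdivrMr ?mul1r // lt_neqAle eq_sym a00.
have aN : a <= N by rewrite ler_nat max_card.
rewrite -(ler_pM2r N0) -[X in `|_| * X](gtr0_norm N0) -normrM !mulrBl mul1r !divfK ?gt_eqF //.
rewrite ler_norml; apply/andP; split.
- by have := ler_wpM2r (_ : 0 <= N - a) s1; rewrite subr_ge0 => /(_ aN); lra.
- by have : s * a <= s * N by [rewrite ler_wpM2l]; lra.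
Qed.

Lemma cvg_close (u v x : nat -> R) : (forall n, `|u n - v n| <= 1 - x n) ->
  x @ \oo --> (1 : R) -> u @ \oo --> (1 : R) -> v @ \oo --> (1 : R).
Proof.
move=> uv /cvgrPdist_le x1 /cvgrPdist_le u1; apply/cvgrPdist_le => e e0.
have e2 : 0 < e / 2 by rewrite divr_gt0.
near=> n; have xn : `|1 - x n| <= e / 2 by near: n; exact: x1.
have un : `|1 - u n| <= e / 2 by near: n; exact: u1.
rewrite (_ : 1 - v n = (1 - u n) + (u n - v n)); last by ring.
apply: le_trans (ler_normD _ _) _; have := uv n; have := ler_norm (1 - x n); lra.
Unshelve. all: by end_near. Qed.

Lemma contiguous_uniform (C : forall n, {set sgraph n}) : whp (Grand R) C -> contiguous (Grand R) (uniform_on R C).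
Proof.
move=> wC P; split; apply: (cvg_close _ wC) => n; first exact: prob_close.
by rewrite distrC; exact: prob_close.
Qed.

(** Under the uniform law on [C n] the event [C n] is certain, unless it is empty and all quotients
    are [0]. Contiguity applied to the trivial property rules this out for large [n]. *)
Lemma contiguous_whp (C : forall n, {set sgraph n}) : contiguous (Grand R) (uniform_on R C) -> whp (Grand R) C.
Proof.
move=> ct; apply/ct; have : whp (Grand R) (fun n => [set: sgraph n]%SET).
  rewrite /whp (_ : (fun n => _) = cst 1); first exact: cvg_cst.
  by apply/funext => n; rewrite prob_Grand finset.cardsT divff // gt_eqF // sgraph_gt0.
have h2 : 0 < 1 / 2 :> R by rewrite divr_gt0.
move/ct => /cvgrPdist_le /(_ _ h2) near1.
apply: cvg_near_cst; near=> n; have : `|1 - prob (uniform_on R C n) [set: sgraph n]%SET| <= 1 / 2 by near: n.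
rewrite !prob_uniform finset.setTI finset.setIid; have [->|a0] := eqVneq (#|C n|%:R : R) 0.
  by rewrite invr0 mulr0 subr0 normr1 => ?; lra.
by rewrite divff.
Unshelve. all: by end_near. Qed.

(** Complementation preserves the law, and a graph and its complement cannot both have fewer than
    half of all pairs. *)
Lemma few_edges_half n : Ex (fun H : {ffun upair n -> bool} => (2 * #|[set e | H e]%SET| < #|upair n|)%N%:R) <= 1 / 2 :> R.
Proof.
pose F (H : {ffun upair n -> bool}) : R := (2 * #|[set e | H e]%SET| < #|upair n|)%N%:R.
pose neg (H : {ffun upair n -> bool}) : {ffun upair n -> bool} := [ffun e => ~~ H e].
have negK : involutive neg by move=> H; apply/ffunP => e; rewrite !ffunE negbK.
have e1 : Ex (fun H => F (neg H)) = Ex F by rewrite /Ex [in RHS](reindex_inj (inv_inj negK)).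
have e2 : Ex (fun H => F H + F (neg H)) = Ex F + Ex (fun H => F (neg H)) by rewrite /Ex big_split /= mulrDl.
have : Ex (fun H => F H + F (neg H)) <= 1.
  rewrite -[leRHS](@Ex_cst R (upair n)); apply: Ex_le => H; rewrite /F.
  have : (#|[set e | H e]| + #|[set e | neg H e]| = #|upair n|)%SET%N.
    rewrite -(cardsC [set e | H e]%SET); congr (_ + _)%N; apply: eq_card => e.
    by rewrite !inE ffunE.
  move: #|_| #|_| #|_| => a b c abc; rewrite -natrD lern1.
  by move: abc; clear; lia.
by rewrite e2 e1 /F; move: (Ex _); clear => x; lra.
Qed.

End Models.

Theorem theorem6p3 (R : realType) (eps : R) (g : nat -> nat) (eps_gt0 : 0 < eps) :
  ((\forall n \near \oo, (1 + eps) * (n%:R ^+ 2 / 24) <= (g n)%:R) ->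
    contiguous (Grand R) (Srand R g)) /\
  ((\forall n \near \oo, (g n)%:R <= (1 - eps) * (n%:R ^+ 2 / 24)) ->
    ~ contiguous (Grand R) (Srand R g)).
Proof.
split=> [g_big|g_small].
  apply: contiguous_uniform; apply/cvgrPdist_le => eta eta0.
  have [n0 n0P] := whp_embeds eps_gt0 eta0.
  near=> n; rewrite ger0_norm ?subr_ge0 ?prob_Grand_le1 // prob_Ex.
  rewrite -{1}(@Ex_cst R (upair n) 1) -ExB; apply: le_trans (n0P n (g n) _ _).
  - apply: Ex_le => H; rewrite inE; case: (boolP (`[< embeds_in _ _ _ >])) => [/asboolP em|_] /=.
      by rewrite asboolT ?subrr //; apply/genus_at_mostP; exists (g n).
    by rewrite lerBlDr lerDl.
  - by near: n; exact: nbhs_infty_ge.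
  - by near: n.
(* At least half of all graphs fail, so a probability within [1 / 4] of [1] is already absurd. *)
move=> /contiguous_whp /cvgrPdist_le /(_ (1 / 4)).
have q4 : 0 < 1 / 4 :> R by rewrite divr_gt0.
move=> /(_ q4) near1.
(* Comparing [2 * (3 * n + (1 - eps) * n ^ 2 / 4)] with the [(n ^ 2 - n) / 2] pairs leaves
   [13 < eps * n]. *)
have [k kP] := nat_above (13 / eps).
have : \forall n \near \oo, False; last by case=> N _ /(_ N) /(_ (leqnn N)).
near=> n.
have kn : 13 < eps * n%:R.
  have : 13 / eps < n%:R by apply: lt_le_trans kP _; rewrite ler_nat; near: n; exact: nbhs_infty_ge.
  by rewrite ltr_pdivrMr // mulrC.
have gn : (g n)%:R <= (1 - eps) * (n%:R ^+ 2 / 24) by near: n.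
have : `|1 - prob (Grand R n) [set G : sgraph n | `[< genus_at_most R G (g n) >]]%SET| <= 1 / 4 by near: n.
have : prob (Grand R n) [set G : sgraph n | `[< genus_at_most R G (g n) >]]%SET <= 1 / 2.
  rewrite prob_Ex; apply: le_trans (few_edges_half R n); apply: Ex_le => H.
  rewrite inE; case: (boolP `[< genus_at_most _ _ _ >]) => //= /asboolP/genus_at_mostP[h hg /embeds_edge_bound].
  rewrite edges_graph_card => eb; rewrite ler1n lt0b.
  rewrite -(ltr_nat R) natrM; have K2 := congr1 (fun k => k%:R : R) (upair_card2 n).
  rewrite natrD natrM natrX in K2.
  have {}eb : #|[set e | H e]%SET|%:R <= 3 * n%:R + 6 * (g n)%:R :> R.
    rewrite -!natrM -natrD ler_nat; apply: leq_trans eb _.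
    by rewrite leq_add2l leq_mul2l hg.
  have n0 : 0 < n%:R :> R.
    rewrite lt0r ler0n andbT; apply/negP => /eqP n0; move: kn; rewrite n0 mulr0; clear; lra.
  have : n%:R * 13 < n%:R * (eps * n%:R) by rewrite ltr_pM2l.
  move: K2 eb gn; rewrite -[upair n]/(upair n : finType) expr2.
  by move: (#|_|%:R) (#|_|%:R) (n%:R) ((g n)%:R) => K E N G; clear; lra.
move: (prob _ _); clear => x x2; rewrite ler_norml => /andP[_]; lra.
Unshelve. all: by end_near. Qed.
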